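(* Let $L/K$ be a finite Galois extension of global fields. For any $\sigma\in\mathrm{Gal}(L/K)$ put $$M(\sigma):=\frac12\sum_{\rho\ne\mathbf 1}\chi_\rho(\sigma)\,\nu(\rho),\qquad m(\sigma):=\sum_{\rho\neq\mathbf 1}\chi_\rho(\sigma)\,m_\rho,$$ where $\rho$ runs through all nontrivial irreducible (complex) representations of $\mathrm{Gal}(L/K)$ and $\chi_\rho$ is the character of $\rho$. Then the following (i), (ii) and (iii) are equivalent: (i) DRH(A) holds for all nontrivial irreducible representations of $\mathrm{Gal}(L/K)$. (ii) For all $\sigma\in\mathrm{Gal}(L/K)$ it holds that $$\pi_{\frac12,K}(x)-\frac{[L:K]}{|c_\sigma|}\pi_{\frac12}(x;\sigma)=(M(\sigma)+m(\sigma))\log\log x+c+o(1)\qquad(x\to\infty)$$ for some constant $c$. (iii) For all pairs $\sigma,\tau\in\mathrm{Gal}(L/K)$ it holds that $$\frac{1}{|c_\tau|}\pi_{\frac12}(x;\tau)-\frac1{|c_\sigma|}\pi_{\frac12}(x;\sigma)=\frac{1}{[L:K]}\bigl(M(\sigma)-M(\tau)+m(\sigma)-m(\tau)\bigr)\log\log x+c+o(1)\qquad(x\to\infty)$$ for some constant $c$.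
   Context: A global field is a number field or an algebraic function field of one variable over a finite field. $\mathfrak p$ denotes a prime ideal (prime) of $K$ and $N(\mathfrak p)$ its norm (cardinality of the residue field). $S$ is the set of all primes of $K$. For $\sigma\in\mathrm{Gal}(L/K)$, $c_\sigma$ is the conjugacy class of $\sigma$, and $S_\sigma$ is the set of primes $\mathfrak p$ of $K$ not dividing the relative discriminant $D_{L/K}$ whose Frobenius element $\left(\frac{L/K}{\mathfrak p}\right)$ is conjugate to $\sigma$. For $x\in\mathbb R_{>0}$, $$\pi_{s,K}(x):=\sum_{\mathfrak p\in S,\ N(\mathfrak p)\le x}\frac1{N(\mathfrak p)^s},\qquad \pi_s(x;\sigma):=\sum_{\mathfrak p\in S_\sigma,\ N(\mathfrak p)\le x}\frac{1}{N(\mathfrak p)^s}.$$ For a nontrivial irreducible Artin representation $\rho:\mathrm{Gal}(K^{\mathrm{sep}}/K)\to\mathrm{Aut}_{\mathbb C}(V)$ (a representation of $\mathrm{Gal}(L/K)$ is regarded as one of $\mathrm{Gal}(K^{\mathrm{sep}}/K)$), the $L$-function is $$L_K(s,\rho)=\prod_{\mathfrak p}\det\left(1-\rho(\mathrm{Frob}_{\mathfrak p})N(\mathfrak p)^{-s}\,\middle|\,V^{I_{\mathfrak p}}\right)^{-1}\quad(\mathrm{Re}(s)>1),$$ continued meromorphically, where $\mathrm{Frob}_{\mathfrak p}$ is the Frobenius element and $I_{\mathfrak p}$ the inertia group. Put $m_\rho=\mathrm{ord}_{s=1/2}L_K(s,\rho)$ and $$\nu(\rho)=\mathrm{mult}(\mathbf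 1,\mathrm{sym}^2\rho)-\mathrm{mult}(\mathbf 1,\wedge^2\rho)\in\mathbb Z,$$ with $\mathrm{mult}(\mathbf 1,\sigma)$ the multiplicity of the trivial representation $\mathbf 1$ in $\sigma$. The statement DRH(A) for $\rho$ (the Deep Riemann Hypothesis (A)) is: the limit $$\lim_{x\to\infty}\left((\log x)^{m_\rho}\prod_{N(\mathfrak p)\le x}\det\left(1-\rho(\mathrm{Frob}_{\mathfrak p})N(\mathfrak p)^{-1/2}\,\middle|\,V^{I_{\mathfrak p}}\right)^{-1}\right)$$ exists and is nonzero. *)

(* Defs.v *)
From mathcomp Require Import all_boot all_order all_algebra all_fingroup all_field.
From mathcomp Require Import mxrepresentation.
From mathcomp Require Import finmap complex.
From mathcomp Require Import all_classical all_reals all_analysis.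

Set Implicit Arguments.
Unset Strict Implicit.
Unset Printing Implicit Defensive.

Import Order.TTheory GRing.Theory Num.Theory.
Import numFieldNormedType.Exports.

Local Open Scope classical_set_scope.
Local Open Scope complex_scope.
Local Open Scope ring_scope.

Definition number_field (K : fieldType) : Prop :=
  exists (N : fieldExtType rat) (f : {rmorphism N -> K}), bijective f.

(* {fraction {poly F}} is the rational function field F(t). *)
Definition function_field (K : fieldType) : Prop :=
  exists (F : finFieldType) (N : fieldExtType {fraction {poly F}})
    (f : {rmorphism N -> K}), bijective f.

Definition global_field (K : fieldType) : Prop :=
  number_field K \/ function_field K.

Section Primes.
Variable K : fieldType.
Implicit Types (O : set K) (x y t u : K).

(* The nonunits of O; 0 is listed apart because 0^-1 = 0 in MathComp. *)
Definition max_ideal O : set K := [set x | O x /\ (x = 0 \/ ~ O x^-1)].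

(* A prime of K is identified with its local ring: a discrete valuation ring
   with field of fractions K, the associated prime ideal being [max_ideal O].
   If K is a number field these rings are the localizations of the ring of
   integers at its nonzero prime ideals; if K is a function field they are the
   places of K. *)
Definition is_prime O : Prop :=
  [/\ O 1,
      forall x y, O x -> O y -> O (x - y),
      forall x y, O x -> O y -> O (x * y) &
      exists t, [/\ max_ideal O t, t != 0 &
        forall x, x != 0 ->
          exists (u : K) (n : int), [/\ u != 0, O u, O u^-1 & x = u * t ^ n]]].

Definition residue_classes O : set (set K) :=
  [set [set y | O y /\ max_ideal O (y - x)] | x in O].

(* Cardinality of the residue field. *)
Definition prime_norm O : nat := #|` fset_set (residue_classes O)|%fset.

Definition primes_le (R : realType) (x : R) : set (set K) :=
  [set p | is_prime p /\ (prime_norm p)%:R <= x].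

End Primes.
Arguments primes_le K {R} x.

Section Splitting.
Variables (K : fieldType) (L : splittingFieldType K).
Local Notation G := ('Gal({:L} / 1%AS))%g.
Implicit Types (p : set K) (P : set L) (sg : gal_of {:L}).

Definition lies_above P p : Prop :=
  is_prime P /\ (forall a : K, P a%:A <-> p a).

Definition decomposition P : {set gal_of {:L}} :=
  [set sg in G | `[< forall x : L, P x <-> P (sg x) >]]%SET.

Definition inertia P : {set gal_of {:L}} :=
  [set sg in decomposition P |
    `[< forall x : L, P x -> max_ideal P (sg x - x) >]]%SET.

Definition is_frobenius p P sg : Prop :=
  sg \in decomposition P /\
  forall x : L, P x -> max_ideal P (sg x - x ^+ prime_norm p).

(* Defaults of [xget] are never reached for a prime p of a global field. The
   choice of a prime above p is immaterial up to conjugacy, and that of a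
   Frobenius element is immaterial modulo the inertia group. *)
Definition prime_above p : set L := xget setT [set P | lies_above P p].

Definition Frob p : gal_of {:L} :=
  xget 1%g [set sg | is_frobenius p (prime_above p) sg].

Definition integral_at p (x : L) : Prop :=
  exists q : {poly K},
    [/\ q \is monic, forall i, p q`_i & root (map_poly (in_alg L) q) x].

(* galTrace is the trace of L/K, with values in the copy of K inside L. *)
Definition disc (e : 'I_(\dim {:L}) -> L) : L :=
  \det (\matrix_(i, j) galTrace 1%AS {:L}%AS (e i * e j)).

(* The localization at p of the relative discriminant is the ideal generated
   by the discriminants of the families of [L : K] elements of L that are
   integral over the local ring of p. *)
Definition divides_discriminant p : Prop :=
  forall (e : 'I_(\dim {:L}) -> L) (d : K),
    (forall i, integral_at p (e i)) -> disc e = d%:A -> max_ideal p d.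

Definition frob_primes sg : set (set K) :=
  [set p | [/\ is_prime p, ~ divides_discriminant p & Frob p \in (sg ^: G)%g]].

End Splitting.
Arguments prime_above {K} L p.
Arguments Frob {K} L p.

Definition prime_sum (R : realType) (K : fieldType) (s x : R) : R :=
  \sum_(p \in primes_le K x) ((prime_norm p)%:R `^ s)^-1.

Definition prime_sum_frob (R : realType) (K : fieldType)
    (L : splittingFieldType K) (s x : R) (sg : gal_of {:L}) : R :=
  \sum_(p \in primes_le K x `&` frob_primes sg) ((prime_norm p)%:R `^ s)^-1.

Section SquareRepr.
Variables (F : fieldType) (gT : finGroupType) (G : {group gT}) (n : nat).
Variable rG : mx_representation F G n.

(* The tensor square of the row-vector module 'rV_n, realized on 'M_n with
   u (x) v corresponding to u^T *m v. *)
Definition tensor_square_mx (g : gT) : 'M[F]_(n * n) :=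
  lin_mx (fun A : 'M[F]_n => (rG g)^T *m A *m rG g).

Lemma mul_tensor_square_mx (g : gT) (A : 'M[F]_n) :
  mxvec A *m tensor_square_mx g = mxvec ((rG g)^T *m A *m rG g).
Proof.
pose f := mulmxr (rG g) \o mulmx (rG g)^T : 'M[F]_n -> 'M[F]_n.
by rewrite -[RHS]/(mxvec (f A)) -[LHS]/(mxvec A *m lin_mx f) mul_vec_lin.
Qed.

Lemma tensor_square_mx_repr : mx_repr G tensor_square_mx.
Proof.
split=> [|x y Gx Gy]; apply/row_matrixP=> i; rewrite !rowE.
  rewrite mulmx1 -[delta_mx 0 i]vec_mxK mul_tensor_square_mx.
  by rewrite repr_mx1 trmx1 mul1mx mulmx1.
rewrite mulmxA -[delta_mx 0 i]vec_mxK !mul_tensor_square_mx.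
by rewrite repr_mxM // trmx_mul !mulmxA.
Qed.
Definition tensor_square := MxRepresentation tensor_square_mx_repr.

Definition swap_mx : 'M[F]_(n * n) := lin_mx (@trmx F n n).

Lemma swap_mx_stable (a : F) : mxmodule tensor_square (eigenspace swap_mx a).
Proof.
apply/mxmoduleP=> g Gg; apply/eigenspaceP.
have com : swap_mx *m tensor_square_mx g = tensor_square_mx g *m swap_mx.
  apply/row_matrixP=> i; rewrite !rowE !mulmxA -[delta_mx 0 i]vec_mxK.
  rewrite [in LHS]/swap_mx mul_vec_lin !mul_tensor_square_mx mul_vec_lin /=.
  by rewrite !trmx_mul trmxK mulmxA.
rewrite -mulmxA -com mulmxA.
by have /eigenspaceP-> := submx_refl (eigenspace swap_mx a); rewrite scalemxAl.
Qed.

(* Symmetric and antisymmetric tensors; used in characteristic 0 only. *)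
Definition sym2_repr := submod_repr (swap_mx_stable 1).
Definition alt2_repr := submod_repr (swap_mx_stable (-1)).

End SquareRepr.

(* Dimension of the isotypic component of the trivial representation. *)
Definition mult_trivial (F : fieldType) (gT : finGroupType) (G : {group gT})
  (n : nat) (rG : mx_representation F G n) : nat := \rank (rfix_mx rG G).

Definition nu (F : fieldType) (gT : finGroupType) (G : {group gT})
    (n : nat) (rG : mx_representation F G n) : int :=
  (mult_trivial (sym2_repr rG))%:Z - (mult_trivial (alt2_repr rG))%:Z.

Section Meromorphic.
Variable R : realType.
Local Notation C := ((R[i])^o).
Implicit Types (f g : C -> C) (z w : C).

Definition holomorphic_near g z : Prop := \forall w \near z, derivable g w 1.

Definition meromorphic f : Prop :=
  forall z, exists (m : int) g,
    holomorphic_near g z /\ \forall w \near z^', f w = (w - z) ^ m * g w.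

Definition has_order f z (m : int) : Prop :=
  exists g, [/\ holomorphic_near g z, g z != 0 &
    \forall w \near z^', f w = (w - z) ^ m * g w].

(* n^s, for a positive natural number n and a complex number s *)
Definition nat_cpow (n : nat) (s : C) : C :=
  let r := n%:R `^ complex.Re s in
  let theta := complex.Im s * ln n%:R in
  (r * cos theta) +i* (r * sin theta).

End Meromorphic.

Section Artin.
Variables (R : realType) (K : fieldType) (L : splittingFieldType K).
Local Notation G := ('Gal({:L} / 1%AS))%G.
Local Notation C := ((R[i])^o).

Section OneRepresentation.
Variables (n : nat) (rho : mx_representation R[i] G n).

(* The inertia group of the absolute Galois group acts on the space of rho
   through the inertia group of L/K. *)
Definition inertia_fixed (p : set K) : 'M[R[i]]_n :=
  rfix_mx rho (inertia (prime_above L p)).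

(* Matrix of the Frobenius at p acting on the inertia-fixed vectors. *)
Definition frob_mx (p : set K) : 'M[R[i]]_(\rank (inertia_fixed p)) :=
  in_submod (inertia_fixed p)
    (val_submod (1%:M : 'M[R[i]]_(\rank (inertia_fixed p))) *m rho (Frob L p)).

Definition euler_factor (p : set K) (s : C) : C :=
  (\det (1%:M - nat_cpow (prime_norm p) (- s) *: frob_mx p))^-1.

Definition euler_product (s : C) (x : R) : C :=
  \big[*%R/1]_(p \in primes_le K x) euler_factor p s.

(* f is the meromorphic continuation to the plane of L_K(s, rho). *)
Definition is_artin_L (f : C -> C) : Prop :=
  meromorphic f /\
  forall s : C, 1 < complex.Re s ->
    euler_product s x @[x --> +oo] --> f s.

Definition half : C := (2^-1 : R)%:C.

(* The integer ord_{s=1/2} L_K(s, rho); the default 0 would only be used in the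
   absence of a meromorphic continuation. *)
Definition central_order : int :=
  xget 0 [set m | exists2 f, is_artin_L f & has_order f half m].

Definition DRH_A : Prop :=
  exists2 l : C, l != 0 &
    ((ln x)%:C : C) ^ central_order * euler_product half x @[x --> +oo] --> l.

End OneRepresentation.

(* A complete set of representatives of the isomorphism classes of irreducible
   complex representations of Gal(L/K); [principal_comp] is the trivial one. *)
Definition irreps : irrType R[i] G := DecSocleType (regular_repr R[i] G).

Definition irr_char (i : irreps) (sg : gal_of {:L}) : C := \tr (irr_repr i sg).

Definition M_sum (sg : gal_of {:L}) : C :=
  2^-1 * \sum_(i : irreps | i != principal_comp irreps)
           irr_char i sg * (nu (irr_repr i))%:~R.

Definition m_sum (sg : gal_of {:L}) : C :=
  \sum_(i : irreps | i != principal_comp irreps)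
    irr_char i sg * (central_order (irr_repr i))%:~R.

End Artin.

(* f x = g x + c + o(1) as x tends to +oo, for some constant c *)
Definition eq_const_o1 (R : realType) (f g : R -> (R[i])^o) : Prop :=
  exists c : (R[i])^o, f x - (g x + c) @[x --> +oo] --> (0 : (R[i])^o).

(* Main.v *)
(** The logarithm of the Euler product at 1/2 is T + Q/2 up to convergence, with
T and Q the sums of chi(Frob) N^(-1/2) and chi(Frob^2) N^(-1); Q grows like
nu loglog by Mertens. To recover T, Frobenius must be equidistributed on the
primes of norm N up to o(sqrt N): Stepanov's method for function fields. *)
Require Import Defs.
From HB Require Import structures.
From mathcomp Require Import all_boot all_order all_algebra all_fingroup all_field.
From mathcomp Require Import mxrepresentation.
From mathcomp Require Import finmap complex.
From mathcomp Require Import all_classical all_reals all_analysis.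
From mathcomp Require Import pgroup cyclic abelian zify ring lra.

Set Implicit Arguments.
Unset Strict Implicit.
Unset Printing Implicit Defensive.

Import Order.TTheory GRing.Theory Num.Theory.
Import numFieldNormedType.Exports.

Local Open Scope complex_scope.
Local Open Scope ring_scope.

(** Convergence of the exponentials determines a logarithm only modulo 2 pi i, so DRH(A) yields
    directly only that the real parts of its increments tend to 0. Over a number field boundedly
    many primes share a norm and the increments are small anyway. Over a function field about q^n /
    n primes have norm q^n, and a constant field extension inside L would destroy equidistribution
    among them. The real parts say that the classes of s and of its inverse together receive the
    expected number of primes. At exponents n divisible by the degree r of a large constant field
    the main terms for s and its inverse agree, and this excludes constant extensions; Stepanov's
    upper bound then holds with the expected main term for every class and every n, and the paired
    estimate turns it into an equality. Only now do the increments tend to 0 and a branch of the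
    logarithm converge. The term Q needs no L-values at s = 1: the bound N^(1/4) for T, obtained on
    the way, makes the sums of the nontrivial characters at s = 1 converge by Abel summation. The
    arithmetic of K and the Mertens estimate rest on counts of lattice points, uniformly over Z and
    F[t]. *)

Local Notation tf := (@FracField.tofrac {poly _}).

(** * Indices of additive subgroups and cardinalities, by systems of representatives *)

Section Index.
Variable V : comPzRingType.
Implicit Types (O I J : set V) (x y : V).

Definition subg I : Prop := I 0 /\ forall x y, I x -> I y -> I (x - y).
Lemma subgN I x : subg I -> I x -> I (- x).
Proof. by case=> I0 IB Ix; rewrite -sub0r; apply: IB. Qed.
Lemma subgD I x y : subg I -> I x -> I y -> I (x + y).
Proof. by move=> sI Ix Iy; rewrite -[y]opprK; apply: sI.2 => //; apply: subgN. Qed.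
Lemma subgC I x y : subg I -> I (x - y) -> I (y - x).
Proof. by move=> sI /(subgN sI); rewrite opprB. Qed.
Lemma subg_trans I x y z : subg I -> I (x - y) -> I (y - z) -> I (x - z).
Proof. by move=> sI h1 h2; rewrite -(subrKA y) ; apply: subgD. Qed.

(** O need not be a group: with I reduced to 0 and O a ball, an index is a cardinality, so the same
    lemmas serve for residue rings and for lattice points. *)
Definition transversal (T : finType) O I (r : T -> V) : Prop :=
  [/\ forall t, O (r t), forall t s, I (r t - r s) -> t = s
  & forall x, O x -> exists t, I (x - r t)].

Definition hasidx O I (n : nat) : Prop := exists r : 'I_n -> V, transversal O I r.

Lemma transversal_idx (T : finType) O I (r : T -> V) :
  transversal O I r -> hasidx O I #|T|.
Proof.
move=> [rO rI rs]; exists (fun i => r (enum_val i)); split=> [t|t s|x Ox] //.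
  by move=> /rI /enum_val_inj.
by have [t It] := rs x Ox; exists (enum_rank t); rewrite enum_rankK.
Qed.

Lemma idx_ge (T : finType) O I n (u : T -> V) : subg I -> hasidx O I n ->
  (forall t, O (u t)) -> (forall t s, I (u t - u s) -> t = s) -> (#|T| <= n)%N.
Proof.
move=> sI [r [rO rI rs]] uO uI.
have [f fP] := choice (fun t => rs _ (uO t)).
have /leq_card : injective f; last by rewrite card_ord.
move=> t s fts; apply: uI; apply: (subg_trans sI (fP t)).
by rewrite fts; apply: subgC.
Qed.

Lemma idx_uniq O I m n : subg I -> hasidx O I m -> hasidx O I n -> m = n.
Proof.
move=> sI hm hn; apply/eqP; rewrite eqn_leq.
have [r [rO rI _]] := hm; have [s [sO sI' _]] := hn.
by have := idx_ge sI hn rO rI; have := idx_ge sI hm sO sI'; rewrite !card_ord => -> ->.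
Qed.

(** A longest family of pairwise incongruent elements is a transversal, since an element missed by
    it could be added. *)
Lemma idx_bound O I B : subg I ->
  (forall n (r : 'I_n -> V), (forall t, O (r t)) ->
  (forall t s, I (r t - r s) -> t = s) -> (n <= B)%N) ->
  exists2 n, (n <= B)%N & hasidx O I n.
Proof.
move=> sI hB.
pose Q n := `[< exists r : 'I_n -> V,
  (forall t, O (r t)) /\ (forall t s, I (r t - r s) -> t = s) >].
have Q0 : exists n, Q n.
  by exists 0%N; apply/asboolP; exists (fun _ => 0); split=> -[].
have QB n : Q n -> (n <= B)%N by move=> /asboolP[r [rO rI]]; apply: (hB n r).
case: (ex_maxnP Q0 QB) => n /asboolP[r [rO rI]] nmax; exists n.
  exact: (hB n r).
exists r; split=> // x Ox; apply: contrapT => nx.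
suff /nmax : Q n.+1 by rewrite ltnn.
apply/asboolP; exists (fun i => if unlift ord0 i is Some j then r j else x); split=> [t|t s].
  by case: unliftP => [j _|_].
case: (unliftP ord0 t) => [j|] ->; case: (unliftP ord0 s) => [k|] -> //.
- by move=> /rI->.
- by move=> /(subgC sI) h; case: nx; exists j.
by move=> h; case: nx; exists k.
Qed.

Lemma idx_le (T : finType) O I (g : V -> T) : subg I ->
  (forall x y, O x -> O y -> g x = g y -> I (x - y)) ->
  exists2 n, (n <= #|T|)%N & hasidx O I n.
Proof.
move=> sI gI; apply: idx_bound => // n r rO rI.
have /leq_card : injective (g \o r); last by rewrite card_ord.
by move=> t s /= /(gI _ _ (rO t) (rO s))/rI.
Qed.

Lemma idxM O I J m n : subg O -> subg I -> subg J ->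
  (forall x, J x -> I x) -> (forall x, I x -> O x) ->
  hasidx O I m -> hasidx I J n -> hasidx O J (m * n).
Proof.
move=> sO sI sJ JI IO [r [rO rI rs]] [u [uI uJ us]].
suff /transversal_idx : transversal O J (fun t : 'I_m * 'I_n => r t.1 + u t.2).
  by rewrite card_prod !card_ord.
split=> [[i j]|[i j] [k l] /= h|x Ox] /=.
- by apply: subgD => //; apply: IO.
- have ik : i = k.
  apply: rI; have -> : r i - r k = r i + u j - (r k + u l) - (u j - u l) by ring.
  by apply: (sI.2); [apply: JI | apply: (sI.2)].
  by subst k; congr (_, _); apply: uJ; move: h; congr J; ring.
have [i Ii] := rs x Ox; have [j Jj] := us _ Ii.
by exists (i, j); move: Jj => /=; congr J; ring.
Qed.

(** The index m bounds incongruent families at both intermediate stages; the product formula then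
    follows from [idxM] and uniqueness. *)
Lemma idx_sub O I J m : subg O -> subg I -> subg J ->
  (forall x, J x -> I x) -> (forall x, I x -> O x) ->
  hasidx O J m -> exists n k, [/\ hasidx O I n, hasidx I J k & m = (n * k)%N].
Proof.
move=> sO sI sJ JI IO hm.
have [n _ hn] : exists2 n, (n <= m)%N & hasidx O I n.
  apply: idx_bound => // n r rO rI; rewrite -(card_ord n); apply: idx_ge hm rO _ => //.
  by move=> t s /JI/rI.
have [k _ hk] : exists2 n, (n <= m)%N & hasidx I J n.
  apply: idx_bound => // k r rO rI; rewrite -(card_ord k).
  by apply: idx_ge hm _ rI => // t; apply: IO.
by exists n, k; split=> //; apply: idx_uniq hm (idxM sO sI sJ JI IO hn hk).
Qed.

Lemma idx_gt0 O I n : O 0 -> hasidx O I n -> (0 < n)%N.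
Proof. by move=> O0 [r [_ _ rs]]; case: n r rs => // r /(_ _ O0)[[]]. Qed.

End Index.

Lemma idx_scale (K : fieldType) (O I : set K) (y : K) n : y != 0 ->
  hasidx O I n -> hasidx [set x | O (x / y)] [set x | I (x / y)] n.
Proof.
move=> y0 [r [rO rI rs]]; exists (fun i => r i * y); split=> /= [t|t s|x /rs[t It]].
- by rewrite mulfK.
- by rewrite -mulrBl mulfK //; apply: rI.
by exists t; rewrite mulrBl mulfK.
Qed.

(** * The norm of a prime as an index *)

Section PrimeNorm.
Variable K : fieldType.
Implicit Types p : set K.
Local Open Scope classical_set_scope.

(** [fset_set] of an infinite set is empty and gives norm 0, so positivity of n is what certifies
    that the residue classes are finite. *)
Lemma prime_norm_idx p n : subg (max_ideal p) -> (0 < n)%N ->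
  hasidx p (max_ideal p) n <-> prime_norm p = n.
Proof.
move=> sm n0; pose c x := [set y | p y /\ max_ideal p (y - x)].
have mp x : max_ideal p x -> p x by case.
have cE x y : p x -> c x = c y -> max_ideal p (x - y).
  move=> px cxy; suff : c y x by case.
  by rewrite -cxy; split=> //; rewrite subrr; exact: sm.1.
have cI x y : max_ideal p (x - y) -> c x = c y.
  move=> xy; apply/seteqP; split=> z [pz h]; split=> //.
  exact: subg_trans h xy.
  exact: subg_trans h (subgC sm xy).
have idxc m (r : 'I_m -> K) : transversal p (max_ideal p) r ->
  prime_norm p = m.
  move=> [rO rI rs]; rewrite /prime_norm.
  have -> : residue_classes p = [set` [fset c (r i) | i : 'I_m]%fset].
  apply/seteqP; split=> [_ [x px <-]|z /= /imfsetP[i _ ->]].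
  by have [i Ii] := rs x px; apply/imfsetP; exists i => //; apply: cI.
  by exists (r i).
  rewrite set_fsetK card_imfset /=; first by rewrite size_enum_ord.
  by move=> i j /cE h; apply: rI; apply: h.
split=> [[r]|pn]; first exact: idxc.
have fin : finite_set (residue_classes p).
  apply: contrapT => inf; move: n0; rewrite -pn /prime_norm.
  by rewrite /fset_set; case: pselect => // _; rewrite cardfs0.
pose X := fset_set (residue_classes p).
have XP (z : X) : exists x, p x /\ c x = val z.
  by have := valP z; rewrite in_fset_set // inE => -[x px <-]; exists x.
have [r rP] := choice XP.
have /transversal_idx : transversal p (max_ideal p) r.
  split=> [z|z w h|x px]; first by case: (rP z).
  by apply: val_inj; rewrite -(rP z).2 -(rP w).2; apply: cI.
  have cX : c x \in X by rewrite in_fset_set // inE; exists x.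
  by exists [` cX]%fset; apply: cE px _; rewrite (rP _).2.
by rewrite -cardfE -/(prime_norm p) pn.
Qed.

End PrimeNorm.

(** * The discrete valuation attached to a prime *)

Section ValuationDef.
Variables (K : fieldType) (P : set K).
Local Open Scope classical_set_scope.
Definition uniformizer t := [/\ max_ideal P t, t != 0 & forall x, x != 0 ->
  exists (u : K) (n : int), [/\ u != 0, P u, P u^-1 & x = u * t ^ n]].
Definition unif : K := xget 0 [set t | uniformizer t].
(** The condition v(x) >= n, phrased by division so that it makes sense, and holds, at x = 0. *)
Definition vge (n : int) : set K := [set x | P (x / unif ^ n)].
(** At x = 0 the default value 0 is reached; the valuation is only meaningful at nonzero
    arguments. *)
Definition vl (x : K) : int := xget 0 [set n | vge n x /\ ~ vge (n + 1) x].
End ValuationDef.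

Section Valuation.
Variables (K : fieldType) (P : set K).
Local Notation unif := (unif P).
Local Notation vge := (vge P).
Local Notation vl := (vl P).
Hypothesis hP : is_prime P.

Let t := unif.
Let t_unif : uniformizer P t.
Proof. by apply: (xgetPex 0 (P := uniformizer P)); case: hP. Qed.
Let tmax : max_ideal P t. Proof. by case: t_unif. Qed.
Lemma unif_neq0 : unif != 0. Proof. by case: t_unif. Qed.
Let tE x : x != 0 -> exists (u : K) (n : int), [/\ u != 0, P u, P u^-1 & x = u * t ^ n].
Proof. by case: t_unif => ? ? h; apply: h. Qed.
Let t0 := unif_neq0.
Lemma prime1 : P 1. Proof. by case: hP. Qed.
Let hP1 := prime1.
Lemma primeB x y : P x -> P y -> P (x - y). Proof. by case: hP => ? h *; apply: h. Qed.
Lemma primeM x y : P x -> P y -> P (x * y). Proof. by case: hP => ? ? h *; apply: h. Qed.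
Lemma prime0 : P 0. Proof. by rewrite -(subrr 1); apply: primeB. Qed.
Lemma primeN x : P x -> P (- x).
Proof. by move=> Px; rewrite -sub0r; apply: primeB => //; apply: prime0. Qed.
Lemma primeD x y : P x -> P y -> P (x + y).
Proof. by move=> Px Py; rewrite -[y]opprK; apply: primeB => //; apply: primeN. Qed.
Lemma primeX x k : P x -> P (x ^+ k).
Proof. by move=> Px; elim: k => [|k IH]; rewrite ?expr0 // exprS; apply: primeM. Qed.
Lemma prime_sub : subg P. Proof. by split; [apply: prime0 | apply: primeB]. Qed.
Lemma vge0 x : vge 0 x <-> P x. Proof. by rewrite /vge /= expr0z divr1. Qed.
Let tP (k : nat) : P (t ^+ k). Proof. by apply: primeX; case: tmax. Qed.

Lemma vge_le m n x : m <= n -> vge n x -> vge m x.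
Proof.
rewrite /vge /= -subr_ge0 => mn Px.
have -> : x / unif ^ m = x / unif ^ n * t ^ (n - m).
  by rewrite expfzDr // -mulrA mulKf ?expfz_neq0 // invr_expz.
by move: mn; case: (n - m) => // k _; apply: primeM => //; exact: tP.
Qed.

Lemma vgeB n x y : vge n x -> vge n y -> vge n (x - y).
Proof. by rewrite /vge /= mulrBl; apply: primeB. Qed.
Lemma vge_sub n : subg (vge n).
Proof. by split; [rewrite /vge /= mul0r; apply: prime0 | apply: vgeB]. Qed.
Lemma vgeD n x y : vge n x -> vge n y -> vge n (x + y).
Proof. exact: (subgD (vge_sub n)). Qed.
Lemma vgeM m n x y : vge m x -> vge n y -> vge (m + n) (x * y).
Proof.
rewrite /vge /= => Px Py; rewrite expfzDr // invfM mulrACA; exact: primeM.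
Qed.

Lemma max_prime x : max_ideal P x -> P x. Proof. by case. Qed.

(* A unit times a negative power of the uniformizer is not in P, since t would be invertible. *)
Let neg_notin (u : K) (k : nat) : P u^-1 -> u != 0 -> ~ P (u * t ^- k.+1).
Proof.
move=> Pu u0 h; case: tmax => _ [/eqP|]; first by rewrite (negPf t0).
apply; have -> : t^-1 = u^-1 * (u * t ^- k.+1) * t ^+ k.
  by rewrite mulKf // exprS invfM mulfVK ?expf_neq0.
by apply: primeM => //; apply: primeM.
Qed.

Lemma vge1 x : vge 1 x <-> max_ideal P x.
Proof.
have [->|x0] := eqVneq x 0.
  split=> _; last exact: (vge_sub 1).1.
  by split; [apply: prime0 | left].
split=> [vx|[Px [/eqP|nPx]]]; last 1 first.
- have [u [n [u0 Pu Pu1 xE]]] := tE x0.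
  case: n xE => [[|n]|n] xE.
  + by case: nPx; rewrite xE expr0z mulr1.
  + rewrite /vge /= xE -/t expr1z; have -> : t ^ n.+1 = t ^+ n * t by rewrite -exprnP exprSr.
  by rewrite mulrA mulfK //; apply: primeM.
  + by move: Px; rewrite xE NegzE -exprnN => /(neg_notin Pu1 u0).
- by split; [apply/vge0; apply: vge_le vx|right=> Px; case: (neg_notin (k := 0) (u := 1) _ _)];
  rewrite ?invr1 ?oner_eq0 ?mul1r ?expr1 //;
  move: vx; rewrite /vge /= expr1z -/t => vx;
  have := primeM Px vx; rewrite mulKf.
by rewrite (negPf x0).
Qed.

Lemma max_sub : subg (max_ideal P).
Proof.
split=> [|x y]; first by apply/vge1; apply: (vge_sub 1).1.
by move=> /vge1 h1 /vge1 h2; apply/vge1; apply: vgeB.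
Qed.

Lemma maxM x y : P x -> max_ideal P y -> max_ideal P (x * y).
Proof. by move=> /vge0 h1 /vge1 h2; apply/vge1; rewrite -[1]add0r; apply: vgeM. Qed.
Lemma max_not1 : ~ max_ideal P 1.
Proof. by case=> _ [/eqP|]; rewrite ?oner_eq0 // invr1. Qed.

Lemma prime_tot x : x != 0 -> ~ P x -> max_ideal P x^-1.
Proof.
move=> x0 nPx; split; last by right; rewrite invrK.
have [u [n [u0 Pu Pu1 xE]]] := tE x0.
case: n xE nPx => n ->; first by case; apply: primeM => //; exact: tP.
by rewrite NegzE -exprnN => _; rewrite invfM invrK; apply: primeM.
Qed.

Lemma vlP x n : x != 0 -> vge n x <-> n <= vl x.
Proof.
move=> x0.
have : exists n, vge n x /\ ~ vge (n + 1) x.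
  have [u [m [u0 Pu Pu1 xE]]] := tE x0; exists m; rewrite /vge /= xE -/t mulfK ?expfz_neq0 //.
  split=> //; rewrite expfzDr // expr1z invfM mulrA mulfK ?expfz_neq0 //.
  by have := neg_notin (k := 0) Pu1 u0; rewrite expr1.
move=> h; have [] : vge (vl x) x /\ ~ vge (vl x + 1) x := xgetPex 0 h.
move=> h1 h2; split=> [hn|le]; last exact: vge_le h1.
rewrite leNgt; apply/negP => lt; apply: h2; apply: vge_le hn; lia.
Qed.

Lemma vl_eq x n : x != 0 -> vge n x -> ~ vge (n + 1) x -> vl x = n.
Proof. by move=> x0 /vlP h /vlP h'; have := h x0; have := h' x0; lia. Qed.
Lemma vl_prime x : x != 0 -> P x <-> 0 <= vl x.
Proof. by move=> x0; rewrite -vge0; apply: vlP. Qed.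
Lemma vl_max x : x != 0 -> max_ideal P x <-> 1 <= vl x.
Proof. by move=> x0; rewrite -vge1; apply: vlP. Qed.

(** Only the upper bound needs work: both cofactors are units, and if the product had a larger
    valuation, multiplying by their inverses would put the inverse of the uniformizer in P. *)
Lemma vlM x y : x != 0 -> y != 0 -> vl (x * y) = vl x + vl y.
Proof.
move=> x0 y0; apply: vl_eq; rewrite ?mulf_neq0 //.
  by apply: vgeM; apply/vlP.
have key z : z != 0 -> P (z / t ^ vl z) /\ ~ max_ideal P (z / t ^ vl z).
  move=> z0; split; first by apply/(vlP (vl z) z0).
  move=> /vge1; rewrite /vge /= -/t expr1z -mulrA -invfM mulrC.
  rewrite -[t ^ _ * t]/(t ^ _ * t ^ 1) -expfzDr // => h.
  have : vge (vl z + 1) z by rewrite /vge /= mulrC.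
  by move=> /vlP; rewrite z0 => /(_ isT); lia.
move=> h; have [Px nx] := key _ x0; have [Py ny] := key _ y0.
have inv z : z != 0 -> P z -> ~ max_ideal P z -> P z^-1.
  by move=> z0 Pz nz; apply: contrapT => nz'; apply: nz; split=> //; right.
have Pxi := inv _ _ Px nx; have Pyi := inv _ _ Py ny.
have tn k : t ^ k != 0 by rewrite expfz_neq0.
have {Pxi} := Pxi _; rewrite mulf_neq0 ?invr_eq0 // => /(_ isT) Pxi.
have {Pyi} := Pyi _; rewrite mulf_neq0 ?invr_eq0 // => /(_ isT) Pyi.
case: tmax => _ [/eqP|]; first by rewrite (negPf t0).
apply; move: h; rewrite /vge /= -/t => h.
have := primeM h (primeM Pxi Pyi); congr P.
rewrite !invf_div !expfzDr // expr1z.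
have gen (a b c u v : K) : [&& a != 0, b != 0, c != 0, u != 0 & v != 0] ->
  u * v / (a * b * c) * (a / u * (b / v)) = c^-1.
  by case/and5P=> *; field; apply/and5P.
by rewrite gen // !tn x0 y0 t0.
Qed.

Lemma vl1 : vl 1 = 0.
Proof. by have := vlM (oner_neq0 K) (oner_neq0 K); rewrite mulr1 => /esym/eqP; rewrite -subr_eq0 addrK => /eqP. Qed.

Lemma vlV x : x != 0 -> vl x^-1 = - vl x.
Proof.
by move=> x0; have := vlM x0 (_ : x^-1 != 0); rewrite invr_eq0 divff // vl1 => /(_ x0); lia.
Qed.

Lemma vlX x k : x != 0 -> vl (x ^+ k) = vl x * k%:Z.
Proof.
move=> x0; elim: k => [|k IH]; first by rewrite expr0 vl1 mulr0.
by rewrite exprS vlM ?expf_neq0 // IH; lia.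
Qed.

Lemma vl_ltD x y : x != 0 -> y != 0 -> vl x < vl y -> x + y != 0 /\ vl (x + y) = vl x.
Proof.
move=> x0 y0 lt.
have n1 : ~ vge (vl x + 1) (x + y).
  move=> h; have : vge (vl x + 1) x.
  by have := vgeB h (_ : vge (vl x + 1) y); rewrite addrK; apply; apply/vlP => //; lia.
  by move/vlP; rewrite x0 => /(_ isT); lia.
have xy0 : x + y != 0.
  by apply/eqP => h; apply: n1; rewrite h; apply: (vge_sub _).1.
split=> //; apply: vl_eq => //; apply: vgeD; apply/vlP => //; lia.
Qed.

(** Complete integral closedness of a valuation ring: a negative valuation would tend to minus
    infinity along the powers of x. *)
Lemma prime_boundedX x (c : int) : x != 0 -> (forall k, vge c (x ^+ k)) -> P x.
Proof.
move=> x0 h; apply/vl_prime => //; rewrite leNgt; apply/negP => lt.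
have := h (absz c).+1; move/vlP; rewrite expf_neq0 // => /(_ isT); rewrite vlX //; nia.
Qed.

Lemma vl_unif : vl unif = 1.
Proof.
apply: vl_eq => //; first by rewrite /vge /= expr1z divff.
rewrite /vge /= -/t expfzDr // expr1z invfM mulVKf //.
by have := neg_notin (k := 0) (u := 1); rewrite invr1 mul1r expr1; apply; rewrite ?oner_neq0.
Qed.

(** Consecutive powers of the maximal ideal have quotients isomorphic to the residue field, by
    multiplication with a power of the uniformizer. *)
Lemma idx_prime_pow N k : hasidx P (max_ideal P) N -> hasidx P (vge k%:Z) (N ^ k).
Proof.
move=> hN; elim: k => [|k IH].
  exists (fun _ => 0); split=> [_|i j _|x Px]; first exact: prime0.
  by rewrite (ord1 i) (ord1 j).
  by exists ord0; rewrite subr0; apply/vge0.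
rewrite expnSr; apply: (idxM prime_sub (vge_sub _) (vge_sub _) _ _ IH) => [x|x h|].
- by apply: vge_le; lia.
- by apply/vge0; apply: vge_le h.
have tk0 : t ^ k%:Z != 0 by rewrite expfz_neq0.
have := idx_scale tk0 hN; congr hasidx; apply/funext => x; apply/propext => /=.
rewrite -vge1 /vge /= -/t expr1z -mulrA -invfM.
by rewrite -[t ^ _ * t]/(t ^ _ * t ^ 1) -expfzDr // -PoszD addn1.
Qed.

End Valuation.

(** * Base rings with a size: the common axioms of Z in Q and of F[t] in F(t) *)

Record sized (R : realType) (F : fieldType) := Sized {
  sA : set F;
  sabs : F -> R;
  sA1 : sA 1;
  sAB : forall a b, sA a -> sA b -> sA (a - b);
  sAM : forall a b, sA a -> sA b -> sA (a * b);
  sabs0 : sabs 0 = 0;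
  sabs_gt0 : forall a, a != 0 -> 0 < sabs a;
  sabsM : forall a b, sabs (a * b) = sabs a * sabs b;
  sabsD : forall a b, sabs (a + b) <= sabs a + sabs b;
  sA_disc : forall a, sA a -> sabs a < 1 -> a = 0;
  sA_round : forall x, exists2 a, sA a & sabs (x - a) < 1;
  sA_frac : forall x, exists b, [/\ b != 0, sA b & sA (b * x)];
  sA_scale : exists2 C : R, 1 <= C & forall X : R, 1 <= X ->
  exists a, [/\ sA a, X <= sabs a & sabs a <= C * X];
  sA_count : exists c C : R, [/\ 0 < c, 0 < C & forall r, 1 <= r -> exists n,
  [/\ hasidx (fun a => sA a /\ sabs a < r) (fun a => a = 0) n,
  c * r <= n%:R & n%:R <= C * r]];
  (* The points of the unit-scale lattice sA in two concentric balls whose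
  radii differ by h; in the ultrametric case r1 = r = r2. *)
  sA_shell : exists2 C : R, 0 < C & forall r h : R, 1 <= h -> 4 * h <= r ->
  exists r1 r2 n1 n2, [/\
  forall x y z, sabs x < r1 -> sabs y < h -> sabs z < h -> sabs (x + y + z) < r,
  forall x y z, sabs x < r -> sabs y < h -> sabs z < h -> sabs (x + y + z) < r2,
  hasidx (fun a => sA a /\ sabs a < r1) (fun a => a = 0) n1,
  hasidx (fun a => sA a /\ sabs a < r2) (fun a => a = 0) n2
  & [/\ n2%:R <= n1%:R + C * h, n2%:R <= C * r & (n1 <= n2)%N]] }.

Section SizedTheory.
Variables (R : realType) (F : fieldType) (S : sized R F).
Local Notation A := (sA S).
Local Notation abs := (sabs S).
Lemma sA0 : A 0. Proof. by rewrite -(subrr 1); apply: sAB; apply: sA1. Qed.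
Lemma sAN a : A a -> A (- a).
Proof. by move=> Aa; rewrite -sub0r; apply: sAB => //; apply: sA0. Qed.
Lemma sAD a b : A a -> A b -> A (a + b).
Proof. by move=> Aa Ab; rewrite -[b]opprK; apply: sAB => //; apply: sAN. Qed.
Lemma sA_sum (I : finType) (f : I -> F) : (forall i, A (f i)) -> A (\sum_i f i).
Proof. by move=> h; elim/big_ind: _ => //; [apply: sA0 | apply: sAD]. Qed.
Lemma sabs_ge0 a : 0 <= abs a.
Proof. by have [->|/(sabs_gt0 S)/ltW//] := eqVneq a 0; rewrite sabs0. Qed.
Lemma sabs1 : abs 1 = 1.
Proof.
have := sabsM S 1 1; rewrite mulr1 => h; apply: (mulfI (lt0r_neq0 (sabs_gt0 S (oner_neq0 F)))).
by rewrite -h mulr1.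
Qed.
Lemma sabsN a : abs (- a) = abs a.
Proof.
have h : abs (-1) = 1.
  have : abs (-1) ^+ 2 = 1 by rewrite expr2 -sabsM mulrNN mulr1 sabs1.
  by move/eqP; rewrite sqrf_eq1 => /orP[/eqP//|/eqP h]; have := sabs_ge0 (-1); rewrite h; lra.
by rewrite -mulN1r sabsM h mul1r.
Qed.
Lemma sabsB a b : abs (a - b) <= abs a + abs b.
Proof. by rewrite -(sabsN b); apply: sabsD. Qed.
Lemma sabs_sum (I : finType) (f : I -> F) : abs (\sum_i f i) <= \sum_i abs (f i).
Proof.
elim/big_rec2: _ => [|i y x _ h]; first by rewrite sabs0.
by apply: le_trans (sabsD S _ _) _; rewrite lerD2l.
Qed.
Lemma sabsX a k : abs (a ^+ k) = abs a ^+ k.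
Proof. by elim: k => [|k IH]; rewrite ?expr0 ?sabs1 // !exprS sabsM IH. Qed.

Lemma sabsV a : abs a^-1 = (abs a)^-1.
Proof.
have [->|a0] := eqVneq a 0; first by rewrite invr0 sabs0 invr0.
have n0 := lt0r_neq0 (sabs_gt0 S a0).
by apply: (mulfI n0); rewrite -sabsM !divff // sabs1.
Qed.
(** [sA_scale] reaches the sizes above 1; inverses of elements of A reach the small ones. *)
Lemma sabs_scale : exists2 C : R, 1 <= C & forall X : R, 0 < X ->
  exists a, X <= abs a /\ abs a <= C * X.
Proof.
have [C C1 sc] := sA_scale S; exists C => // X X0; have C0 : 0 < C by lra.
have [X1|X1] := leP 1 X; first by have [a [_ h1 h2]] := sc X X1; exists a.
have [X2|X2] := leP 1 (C * X); first by exists 1; rewrite sabs1 ltW.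
have [|a [_ h1 h2]] := sc (C * X)^-1; first by rewrite invf_ge1 ?mulr_gt0 // ltW.
have i0 : 0 < (C * X)^-1 by rewrite invr_gt0 mulr_gt0.
exists a^-1; rewrite sabsV; split.
  rewrite -[X]invrK lef_pV2 ?posrE ?invr_gt0 //; last by lra.
  by apply: le_trans h2 _; rewrite invfM mulVKf ?lt0r_neq0.
by rewrite -[C * X]invrK lef_pV2 ?posrE ?invr_gt0 ?mulr_gt0 //; lra.
Qed.

End SizedTheory.

(** A basis [fw] of K over F with coordinate functions [fco]. The structure constants lie in A, so
    that the lattice spanned over A is closed under multiplication, though it need not contain 1. *)
Record finext (R : realType) (F : fieldType) (S : sized R F) (K : fieldType) := Finext {
  fj : {rmorphism F -> K};
  fd : nat;
  fw : 'I_fd -> K;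
  fco : K -> 'I_fd -> F;
  fcoK : forall x, x = \sum_i fj (fco x i) * fw i;
  fcoB : forall x y i, fco (x - y) i = fco x i - fco y i;
  fcoZ : forall a x i, fco (fj a * x) i = a * fco x i;
  fcow : forall i k, fco (fw i) k = (i == k)%:R;
  fmulA : forall i j k, sA S (fco (fw i * fw j) k) }.

Arguments fco {R F S K} f x i.
Arguments fw {R F S K} f i.
Arguments fcoK {R F S K} f x.
Arguments fcoB {R F S K} f x y i.
Arguments fcoZ {R F S K} f a x i.
Arguments fcow {R F S K} f i k.
Arguments fmulA {R F S K} f i j k.

(** * The lattice of a finite extension, its sup-norm boxes and the ring of integers *)

Section Lattice.
Variables (R : realType) (F : fieldType) (S : sized R F) (K : fieldType).
Variable X : finext S K.
Local Notation A := (sA S).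
Local Notation abs := (sabs S).
Local Notation d := (fd X).
Local Notation j := (fj X).
Local Notation co := (fco X).
Local Notation w := (fw X).
Implicit Types (x y z : K) (r e : R).

Lemma fco0 i : co 0 i = 0. Proof. by rewrite -(subrr 0) fcoB subrr. Qed.
Lemma fcoN x i : co (- x) i = - co x i. Proof. by rewrite -sub0r fcoB fco0 sub0r. Qed.
Lemma fcoD x y i : co (x + y) i = co x i + co y i.
Proof. by rewrite -[in LHS](opprK y) fcoB fcoN opprK. Qed.
Lemma fco_sum (I : finType) (f : I -> K) i : co (\sum_k f k) i = \sum_k co (f k) i.
Proof. by elim/big_rec2: _ => [|k a b _ <-]; rewrite ?fco0 ?fcoD. Qed.
Lemma fco_inj x y : (forall i, co x i = co y i) -> x = y.
Proof. by move=> h; rewrite (fcoK X x) (fcoK X y); apply: eq_bigr => i _; rewrite h. Qed.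
Lemma fco_comb (f : 'I_d -> F) i : co (\sum_k j (f k) * w k) i = f i.
Proof.
rewrite fco_sum (bigD1 i) //= fcoZ fcow eqxx mulr1 big1 ?addr0 // => k ki.
by rewrite fcoZ fcow (negPf ki) mulr0.
Qed.
Lemma fcoM x y k : co (x * y) k = \sum_i \sum_l co x i * co y l * co (w i * w l) k.
Proof.
rewrite {1}(fcoK X x) mulr_suml fco_sum; apply: eq_bigr => i _.
rewrite {1}(fcoK X y) mulr_sumr fco_sum; apply: eq_bigr => l _.
by rewrite mulrACA -rmorphM fcoZ.
Qed.
Lemma fd_gt0 : (0 < d)%N.
Proof.
rewrite lt0n; apply/eqP => d0; have := oner_neq0 K; rewrite (fcoK X 1) big1 ?eqxx // => i.
by case: i => i i_lt; exfalso; rewrite d0 in i_lt.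
Qed.

Definition lam : set K := fun x => forall i, A (co x i).
Definition box r : set K := fun x => forall i, abs (co x i) < r.
(** The complete integral closure of [lam]: the powers of x have a common denominator. With this
    form sums are handled by the binomial formula and integral equations are avoided. *)
Definition oint : set K := fun x => exists2 D : F, D != 0 & forall k, lam (j D * x ^+ k).

Lemma lam_sub : subg lam.
Proof.
by split=> [i|x y hx hy i]; rewrite ?fco0 ?fcoB; [apply: sA0 | apply: sAB].
Qed.
Lemma lamM x y : lam x -> lam y -> lam (x * y).
Proof.
move=> hx hy k; rewrite fcoM; apply: sA_sum => i; apply: sA_sum => l.
by apply: sAM (fmulA X _ _ _); apply: sAM.
Qed.
Lemma lamZ a x : A a -> lam x -> lam (j a * x).
Proof. by move=> Aa hx i; rewrite fcoZ; apply: sAM. Qed.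

Lemma lam_frac x : exists D, [/\ D != 0, A D & lam (j D * x)].
Proof.
have [b bP] := choice (fun i => sA_frac S (co x i)).
have AP (s : seq 'I_d) : A (\prod_(i <- s) b i).
  by elim/big_ind: _ => [||i _]; [apply: sA1 | apply: sAM | case: (bP i)].
exists (\prod_i b i); split=> // [|i].
  by apply/prodf_neq0 => i _; case: (bP i).
rewrite fcoZ (bigD1 i) //= mulrAC mulrC; apply: sAM.
  by rewrite -big_filter; apply: AP.
by case: (bP i).
Qed.

Lemma boxB r e x y : box r x -> box e y -> box (r + e) (x - y).
Proof. by move=> hx hy i; rewrite fcoB; apply: le_lt_trans (sabsB _ _ _) _; apply: ltrD. Qed.
Lemma boxN r x : box r x -> box r (- x).
Proof. by move=> hx i; rewrite fcoN sabsN. Qed.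
Lemma boxD r e x y : box r x -> box e y -> box (r + e) (x + y).
Proof. by move=> hx /boxN hy; rewrite -[y]opprK; apply: boxB. Qed.
Lemma box_le r e x : r <= e -> box r x -> box e x.
Proof. by move=> re h i; apply: lt_le_trans re. Qed.
Lemma boxZ r a x : a != 0 -> box r x <-> box (abs a * r) (j a * x).
Proof.
move=> a0; split=> h i; have := h i; rewrite fcoZ sabsM ltr_pM2l //; exact: sabs_gt0.
Qed.
Lemma box0 r : 0 < r -> box r 0.
Proof. by move=> r0 i; rewrite fco0 sabs0. Qed.
Lemma ex_box x : exists2 r, 1 <= r & box r x.
Proof.
exists (\sum_i abs (co x i) + 1); first by rewrite lerDr sumr_ge0 // => i _; apply: sabs_ge0.
move=> i; rewrite (bigD1 i) //= -addrA ltrDl ltr_wpDl // sumr_ge0 // => k _; exact: sabs_ge0.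
Qed.
Lemma box_lam x : lam x -> box 1 x -> x = 0.
Proof. by move=> Lx bx; apply: fco_inj => i; rewrite fco0; apply: sA_disc. Qed.
Definition bM : R := \sum_i \sum_l \sum_k abs (co (w i * w l) k) + 1.
Let sum0 (I : finType) (f : I -> R) : (forall i, 0 <= f i) -> 0 <= \sum_i f i.
Proof. by move=> h; apply: sumr_ge0. Qed.
Lemma bM_ge1 : 1 <= bM.
Proof. by rewrite lerDr; do 3!(apply: sum0 => ?); apply: sabs_ge0. Qed.
Lemma boxM r e x y : 0 < r -> 0 < e -> box r x -> box e y -> box (bM * (r * e)) (x * y).
Proof.
move=> r0 e0 hx hy k; rewrite fcoM; have re0 : 0 < r * e by apply: mulr_gt0.
apply: (@le_lt_trans _ _ ((bM - 1) * (r * e))); last by rewrite ltr_pM2r // gtrBl.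
rewrite /bM addrK; apply: le_trans (sabs_sum _ _) _; rewrite mulr_suml; apply: ler_sum => i _.
apply: le_trans (sabs_sum _ _) _; rewrite mulr_suml; apply: ler_sum => l _.
rewrite !sabsM mulrC; apply: ler_pM; rewrite ?mulr_ge0 ?sabs_ge0 //.
  by rewrite (bigD1 k) //= lerDl sumr_ge0 // => ? _; apply: sabs_ge0.
by apply: ler_pM; rewrite ?sabs_ge0 // ltW.
Qed.

Lemma lam_round x : exists2 y, lam y & box 1 (x - y).
Proof.
have [b bP] := choice (fun i => (let: ex_intro2 a h1 h2 := sA_round S (co x i) in ex_intro (fun a => A a /\ abs (co x i - a) < 1) a (conj h1 h2))).
exists (\sum_i j (b i) * w i) => i; rewrite ?fcoB fco_comb; by case: (bP i).
Qed.

Lemma oint_lam x : lam x -> oint x.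
Proof.
move=> Lx; have [D [D0 AD LD]] := lam_frac 1; exists D => // -[|k]; first by rewrite expr0.
elim: k => [|k IH]; first by rewrite expr1; apply: lamZ.
by rewrite exprSr mulrA; apply: lamM.
Qed.
Lemma oint1 : oint 1.
Proof. by have [D [D0 AD LD]] := lam_frac 1; exists D => // k; rewrite expr1n. Qed.
Lemma ointj a : A a -> oint (j a).
Proof.
move=> Aa; have [D [D0 AD LD]] := lam_frac 1; exists D => // k.
rewrite -rmorphXn -[_ ^+ k]mulr1 rmorphM mulrCA; elim: k => [|k IH].
  by rewrite expr0 rmorph1 mul1r.
by rewrite exprS rmorphM -mulrA; apply: lamZ.
Qed.
Lemma ointM x y : oint x -> oint y -> oint (x * y).
Proof.
move=> [D D0 hx] [E E0 hy]; exists (D * E) => [|k]; first by rewrite mulf_neq0.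
by rewrite exprMn rmorphM mulrACA; apply: lamM.
Qed.
Lemma ointN x : oint x -> oint (- x).
Proof.
move=> [D D0 hx]; exists D => // k; rewrite exprNn mulrCA.
rewrite -(rmorph_sign j); apply: lamZ => //.
by rewrite -signr_odd; case: odd; rewrite ?expr0 ?expr1; [apply: sAN|]; apply: sA1.
Qed.
Lemma ointD x y : oint x -> oint y -> oint (x + y).
Proof.
move=> [D D0 hx] [E E0 hy]; exists (D * E) => [|k]; first by rewrite mulf_neq0.
rewrite exprDn mulr_sumr; elim/big_ind: _ => [||i _]; first exact: lam_sub.1.
  by move=> u v; apply: subgD lam_sub.
rewrite mulrnAr rmorphM mulrACA; elim: ('C(_, _)) => [|n IH]; first exact: lam_sub.1.
by rewrite mulrS; apply: (subgD lam_sub) => //; apply: lamM.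
Qed.
Lemma oint_sub : subg oint.
Proof. by split=> [|x y hx /ointN]; [apply: oint_lam; apply: lam_sub.1 | apply: ointD]. Qed.
Lemma ointX x k : oint x -> oint (x ^+ k).
Proof. by move=> h; elim: k => [|k IH]; rewrite ?expr0 ?exprS; [apply: oint1 | apply: ointM]. Qed.

Lemma ex_small (a b : R) : 0 < a -> 0 < b -> exists k, a / 2 ^+ k < b.
Proof.
move=> a0 b0; exists (Num.bound (a / b)); rewrite ltr_pdivrMr ?exprn_gt0 // -ltr_pdivrMl //.
rewrite mulrC; apply: lt_le_trans (archi_boundP _) _; first by rewrite divr_ge0 ?ltW.
by rewrite -natrX ler_nat ltnW // ltn_expl.
Qed.

(* If x were small, the elements D x^k of lam would tend to 0. *)
Lemma oint_disc : exists2 e, 0 < e & forall x, oint x -> box e x -> x = 0.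
Proof.
have b1 := bM_ge1; have b0 : 0 < bM by lra.
exists (2 * bM)^-1 => [|x [D D0 Dx] bx]; first by rewrite invr_gt0 mulr_gt0.
have bX k : box ((2 * bM)^-1 / 2 ^+ k) (x ^+ k.+1).
  elim: k => [|k IH]; first by rewrite expr1 expr0 divr1.
  rewrite exprSr; have e0 : 0 < (2 * bM)^-1 by rewrite invr_gt0 mulr_gt0.
  have := boxM _ _ IH bx; rewrite divr_gt0 ?exprn_gt0 // e0 => /(_ isT isT).
  rewrite -[x ^+ k.+1 * x]exprSr; congr (box _ _).
  move: (2 ^+ k) (expf_neq0 k (lt0r_neq0 (ltr0Sn R 1))) (bM) (lt0r_neq0 b0) => p p0 m m0.
  by field; rewrite ?p0 ?m0.
have [k kP] := ex_small (a := abs D * (2 * bM)^-1) (b := 1) ltac:(by rewrite mulr_gt0 ?sabs_gt0 ?invr_gt0 ?mulr_gt0) ltr01.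
have /eqP : j D * x ^+ k.+1 = 0.
  apply: box_lam => //; apply: box_le (ltW kP) _; rewrite -mulrA.
  by apply: (proj1 (boxZ _ _ D0)); apply: bX.
by rewrite mulf_eq0 fmorph_eq0 (negPf D0) /= expf_eq0 => /eqP.
Qed.

Lemma packing : exists2 C : R, 0 < C & forall e r, 0 < e -> 0 < r ->
  exists (T : finType) (g : K -> T), #|T|%:R <= (C * (r / e + 1)) ^+ d /\
  forall x y, box r x -> box r y -> g x = g y -> box e (x - y).
Proof.
have [C1 C1_ge1 scale] := sabs_scale S; have [c [C2 [c0 C20 count]]] := sA_count S.
have C10 : 0 < C1 by lra.
exists (C2 * (2 * C1 + 1) + C2) => [|e r e0 r0]; first by rewrite addr_gt0 ?mulr_gt0 ?addr_gt0 ?mulr_gt0.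
have e20 : 0 < 2 / e by rewrite divr_gt0.
have [M [M1 M2]] := scale (2 / e) e20.
have M0 : M != 0 by apply/eqP => M0; move: M1; rewrite M0 sabs0; lra.
have aM0 : 0 < abs M := sabs_gt0 S M0.
have [|n [hn _ nle]] := count (abs M * r + 1); first by rewrite lerDr mulr_ge0 ?ltW.
have [u [uA uI us]] := hn.
have [rd rdP] := choice (fun x : F => (let: ex_intro2 a h1 h2 := sA_round S x in ex_intro (fun a => A a /\ abs (x - a) < 1) a (conj h1 h2))).
have rdB (y : F) : abs y < r -> A (rd (M * y)) /\ abs (rd (M * y)) < abs M * r + 1.
  move=> hy; have [h1 h2] := rdP (M * y); split=> //.
  have -> : rd (M * y) = M * y - (M * y - rd (M * y)) by ring.
  apply: le_lt_trans (sabsB _ _ _) _; apply: ltrD => //.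
  by rewrite sabsM ltr_pM2l.
have n0 : (0 < n)%N by apply: idx_gt0 hn; split; [apply: sA0 | rewrite sabs0 ltr_wpDl // mulr_ge0 ?ltW].
pose i0 := Ordinal n0.
have exf (y : F) : exists i, abs y < r -> rd (M * y) = u i.
  have [hy|hy] := boolP (abs y < r); last by exists i0.
  by have [i hi] := us _ (rdB _ hy); exists i => _; apply/eqP; rewrite -subr_eq0; apply/eqP.
have [f fP] := choice exf.
exists {ffun 'I_d -> 'I_n}, (fun x => [ffun i => f (co x i)]); split.
  rewrite card_ffun !card_ord natrX; apply: lerXn2r; rewrite ?nnegrE ?ler0n //.
  by rewrite mulr_ge0 ?addr_ge0 ?divr_ge0 ?mulr_ge0 ?ltW // ?addr_gt0 // ?mulr_gt0.
  apply: le_trans nle _; rewrite mulrDl -mulrA -mulrDr ler_pM2l //.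
  have re0 : 0 < r / e by rewrite divr_gt0.
  have h1 : abs M * r <= C1 * (2 * (r / e)).
  have -> : 2 * (r / e) = (2 / e) * r by rewrite mulrCA mulrC mulrAC.
  by rewrite mulrA ler_pM2r.
  by move: (r / e) (abs M * r) re0 h1 => t m t0 h1; nra.
move=> x y hx hy /ffunP fxy i; rewrite fcoB.
have := fxy i; rewrite !ffunE => fi.
have [_ h1] := rdP (M * co x i); have [_ h2] := rdP (M * co y i).
have : abs (M * (co x i - co y i)) < 2.
  have -> : M * (co x i - co y i) = (M * co x i - rd (M * co x i)) - (M * co y i - rd (M * co y i)).
  by rewrite (fP _ (hx i)) (fP _ (hy i)) fi; ring.
  by apply: le_lt_trans (sabsB _ _ _) _; lra.
rewrite sabsM -ltr_pdivlMl // => h; apply: lt_le_trans h _.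
rewrite mulrC ler_pdivrMr // -ler_pdivrMl // mulrC; lra.
Qed.

End Lattice.

(** * Counting integers and points of ideals in balls *)

Section LatticeCount.
Variables (R : realType) (F : fieldType) (S : sized R F) (K : fieldType).
Variable X : finext S K.
Local Notation A := (sA S).
Local Notation abs := (sabs S).
Local Notation d := (fd X).
Local Notation j := (fj X).
Local Notation co := (fco X).
Local Notation w := (fw X).
Local Notation lam := (lam X).
Local Notation box := (box X).
Local Notation O := (oint X).
Implicit Types (x y z : K) (r e : R) (I : set K).

Definition zeros : set K := fun x => x = 0.
Lemma zeros_sub : subg zeros.
Proof. by split=> // x y -> ->; rewrite subr0. Qed.
Definition lball I z (U : set K) : set K := fun x => I x /\ U (x - z).

(** By discreteness, distinct points of O cannot share a cell of [packing] whose diameter is below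
    the constant of [oint_disc]. *)
Lemma ball_finite : exists2 C : R, 1 <= C & forall r z, 1 <= r ->
  exists2 n, n%:R <= (C * r) ^+ d & hasidx (lball O z (box r)) zeros n.
Proof.
have [e e0 he] := oint_disc X; have [C C0 pack] := packing X.
have ei0 : 0 < e^-1 by rewrite invr_gt0.
exists (C * (e^-1 + 1) + 1) => [|r z r1]; first by rewrite lerDr mulr_ge0 ?addr_ge0 ?ltW.
have r0 : 0 < r by lra.
have [T [g [Tle hg]]] := pack e r e0 r0.
have [||n nle hn] := idx_le (T := T) (O := lball O z (box r)) (I := zeros) (g := fun x => g (x - z)).
- exact: zeros_sub.
- move=> x y [Ox bx] [Oy b_y] /hg -/(_ bx b_y); rewrite (_ : x - z - (y - z) = x - y); last by ring.
  by apply: he; apply: (oint_sub X).2.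
exists n => //; apply: (@le_trans _ _ #|T|%:R); first by rewrite ler_nat.
apply: le_trans Tle _; apply: lerXn2r; rewrite ?nnegrE.
- by rewrite mulr_ge0 ?addr_ge0 ?mulr_ge0 ?ltW.
- by rewrite mulr_ge0 ?addr_ge0 ?mulr_ge0 ?addr_ge0 ?ltW.
have h1 : C * 1 <= C * r by rewrite ler_pM2l.
rewrite !mulrDl !mulrDr mul1r mulrDl; have : C * (r / e) = C * e^-1 * r by ring.
by move=> ->; lra.
Qed.

Lemma ball_finite_sub U r z : 1 <= r -> (forall x, U x -> box r x) ->
  exists n, hasidx (lball O z U) zeros n.
Proof.
move=> r1 Ur; have [C C1 fin] := ball_finite; have [n _ hn] := fin r z r1.
have [|k _ hk] := @idx_bound _ (lball O z U) zeros n zeros_sub; last by exists k.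
move=> k u uB uI; rewrite -(card_ord k); apply: (idx_ge (u := u) zeros_sub hn) => // i.
by have [Ou hu] := uB i; split=> //; apply: Ur.
Qed.

Lemma lam_ball r n : hasidx (fun a => A a /\ abs a < r) (fun a => a = 0) n ->
  hasidx (lball lam 0 (box r)) zeros (n ^ d).
Proof.
move=> [u [uA uI us]].
have -> : (n ^ d)%N = #|{ffun 'I_d -> 'I_n}| by rewrite card_ffun !card_ord.
apply: (transversal_idx (r := fun f : {ffun 'I_d -> 'I_n} => \sum_i j (u (f i)) * w i)).
split=> [f|f g /= h|x [Lx]].
- by split=> [i|i]; rewrite ?subr0 fco_comb; case: (uA (f i)).
- apply/ffunP => i; apply: uI; have := congr1 (fun x => co x i) h.
  by rewrite /= fcoB !fco_comb fco0.
rewrite subr0 => bx.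
have [f fP] := choice (fun i => us (co x i) (conj (Lx i) (bx i))).
exists [ffun i => f i]; apply: (@fco_inj _ _ _ _ X) => i; rewrite fcoB fco_comb ffunE fco0.
exact: fP.
Qed.

(** The lattice points of the ball of radius r / 2 about 0 are translated by a lattice point near
    the centre; r >= 2 leaves room for this rounding. *)
Lemma ball_many : exists2 c : R, 0 < c & forall r z, 2 <= r ->
  exists n (u : 'I_n -> K), [/\ forall i, lball O z (box r) (u i), injective u & (c * r) ^+ d <= n%:R].
Proof.
have [c [C [c0 C0 count]]] := sA_count S.
exists (c / 2) => [|r z r2]; first by rewrite divr_gt0.
have [|n [hn cn _]] := count (r / 2); first by rewrite ler_pdivlMr // mul1r.
have [v [vA vI _]] := lam_ball hn.
have [y Ly byz] := lam_round X z.
exists (n ^ d)%N, (fun i => v i + y); split=> [i|i k /addIr h|].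
- have [Lv bv] := vA i; split; first by apply: oint_lam; apply: subgD (lam_sub X) _ _.
  have -> : v i + y - z = (v i - 0) - (z - y) by ring.
  by apply: box_le (boxB bv byz); lra.
- by apply: vI; rewrite h /zeros subrr.
rewrite natrX; apply: lerXn2r; rewrite ?nnegrE ?mulr_ge0 ?ler0n //; lra.
Qed.

(** r bounds the covering radius of I in the sup norm of the coordinates. *)
Definition cov I r : Prop := forall z, exists2 y, I y & box r (z - y).
Lemma cov_lam : cov lam 1. Proof. exact: lam_round. Qed.

(* Choose representatives of O / I within h of the vector joining the centres;
  then O meets a ball in n translates of the trace of I on slightly smaller
  or larger balls. *)
Lemma ball_index_ge I n h (U1 U : set K) z z1 m M : subg I -> (forall x, I x -> O x) ->
  hasidx O I n -> cov I h ->
  (forall x y, U1 x -> box h y -> U (x + y)) ->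
  hasidx (lball I z1 U1) zeros m -> hasidx (lball O z U) zeros M -> (n * m <= M)%N.
Proof.
move=> sI IO [u [uO uI us]] hc hr [v [vB vI vs]] hM.
have exf i : exists fi, I (u i - fi) /\ box h (fi - (z - z1)).
  have [y Iy hy] := hc (u i - (z - z1)); exists (u i - y); split.
  by rewrite (_ : u i - (u i - y) = y) //; ring.
  by rewrite (_ : u i - y - (z - z1) = u i - (z - z1) - y) //; ring.
have {exf}[f fP] := choice exf.
have fO i : O (f i).
  rewrite (_ : f i = u i - (u i - f i)); last by ring.
  by apply: (oint_sub X).2 => //; apply: IO; case: (fP i).
rewrite -(card_ord n) -(card_ord m) -card_prod.
apply: (idx_ge (u := fun t => f t.1 + v t.2) zeros_sub hM) => [[i k]|[i k] [a b]] /=.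
  have [Iv bv] := vB k; split; first by apply: subgD (oint_sub X) _ _ => //; apply: IO.
  rewrite (_ : f i + v k - z = v k - z1 + (f i - (z - z1))); last by ring.
  by apply: hr => //; case: (fP i).
rewrite /zeros => h0.
have ia : i = a.
  apply: uI; have [h1 _] := fP i; have [h2 _] := fP a.
  have -> : u i - u a = (u i - f i) - (u a - f a) + (v b - v k).
  by apply/eqP; rewrite -subr_eq0 -[X in _ == X]h0; apply/eqP; ring.
  by apply: subgD => //; apply: sI.2 => //; [case: (vB b)|case: (vB k)].
subst a; congr (_, _); apply: vI; rewrite /zeros -[RHS]h0; ring.
Qed.

Lemma ball_index_le I n h (U U2 : set K) z z2 m M : subg I -> (forall x, I x -> O x) ->
  hasidx O I n -> cov I h ->
  (forall x y, U x -> box h y -> U2 (x + y)) ->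
  hasidx (lball I z2 U2) zeros m -> hasidx (lball O z U) zeros M -> (M <= n * m)%N.
Proof.
move=> sI IO [u [uO uI us]] hc hr hm [v [vB vI vs]].
have exf i : exists fi, I (u i - fi) /\ box h (fi - (z - z2)).
  have [y Iy hy] := hc (u i - (z - z2)); exists (u i - y); split.
  by rewrite (_ : u i - (u i - y) = y) //; ring.
  by rewrite (_ : u i - y - (z - z2) = u i - (z - z2) - y) //; ring.
have {exf}[f fP] := choice exf.
have [g gP] := choice (fun k => us (v k) (vB k).1).
have [w' [w'B w'I w's]] := hm.
have key k : lball I z2 U2 (v k - f (g k)).
  have [h1 h2] := fP (g k); split.
  by rewrite (_ : _ - _ = v k - u (g k) + (u (g k) - f (g k))); [apply: subgD | ring].
  rewrite (_ : _ - _ = v k - z + - (f (g k) - (z - z2))); last by ring.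
  by apply: hr; [case: (vB k) | apply: boxN].
have [l lP] := choice (fun k => w's _ (key k)).
have /leq_card : injective (fun k => (g k, l k)); last by rewrite card_prod !card_ord.
move=> a b [gab lab]; apply: vI; have h1 := lP a; have := lP b.
by rewrite -lab -gab => h2; rewrite /zeros -(subrr 0) -{1}h1 -{1}h2; ring.
Qed.

Definition scaled y I : set K := fun x => I (x / y).
Lemma scaled_sub y I : subg I -> subg (scaled y I).
Proof. by case=> I0 IB; split=> [|x z]; rewrite /scaled ?mul0r // mulrBl; apply: IB. Qed.
Lemma scaledO y x : O y -> y != 0 -> scaled y O x -> O x.
Proof. by move=> Oy y0 h; rewrite -(divfK y0 x); apply: ointM. Qed.

Lemma cov_scaled I r e y : 0 < r -> 0 < e -> y != 0 -> cov I r -> box e y ->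
  cov (scaled y I) (bM X * (e * r)).
Proof.
move=> r0 e0 y0 hc hy z; have [x Ix bx] := hc (z / y); exists (y * x).
  by rewrite /scaled mulrC mulKf.
rewrite (_ : z - y * x = y * (z / y - x)); last by rewrite mulrBr mulrCA divff ?mulr1.
exact: boxM.
Qed.

Lemma cov_O : cov O 1.
Proof. by move=> z; have [y Ly] := lam_round X z; exists y => //; apply: oint_lam. Qed.

(** Every class of O modulo I meets the ball of radius r, whose points in O are counted by
    [ball_finite]. *)
Lemma idx_cov : exists2 C : R, 1 <= C & forall I r, 1 <= r -> subg I ->
  (forall x, I x -> O x) -> cov I r -> exists2 n, n%:R <= (C * r) ^+ d & hasidx O I n.
Proof.
have [C C1 fin] := ball_finite; exists C => // I r r1 sI IO hc.
have [n nle hn] := fin r 0 r1; have [u [uB uI us]] := hn.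
have n0 : (0 < n)%N.
  by apply: idx_gt0 hn; split; [apply: (oint_sub X).1 | rewrite subr0; apply: box0; lra].
have exg x : exists i, O x -> I (x - u i).
  have [Ox|nO] := pselect (O x); last by exists (Ordinal n0).
  have [y Iy hy] := hc x.
  have [|i hi] := us (x - y).
  by split; [apply: (oint_sub X).2 => //; apply: IO | rewrite subr0].
  exists i => _; rewrite (_ : x - u i = x - y - u i + y); last by ring.
  by rewrite hi add0r.
have {exg}[g gP] := choice exg.
have [|k kle hk] := idx_le (T := 'I_n) (O := O) (I := I) (g := g) sI.
- move=> x y Ox Oy gxy; rewrite (_ : x - y = x - u (g x) - (y - u (g y))).
  by apply: sI.2; apply: gP.
  by rewrite gxy; ring.
exists k => //; apply: le_trans nle; rewrite card_ord in kle; by rewrite ler_nat.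
Qed.

Lemma idx_scaledO : exists2 C : R, 1 <= C & forall y r, O y -> y != 0 -> 1 <= r -> box r y ->
  exists2 n, n%:R <= (C * r) ^+ d & hasidx O (scaled y O) n.
Proof.
have [C C1 h] := idx_cov; have b1 := bM_ge1 X.
exists (C * bM X) => [|y r Oy y0 r1 hy]; first by rewrite -[1]mulr1; apply: ler_pM; lra.
have [||||n nle hn] := h (scaled y O) (bM X * (r * 1)).
- by rewrite mulr1 -[1]mulr1; apply: ler_pM; lra.
- exact: scaled_sub (oint_sub X).
- by move=> x; apply: scaledO.
- by apply: cov_scaled => //; try exact: cov_O; lra.
by exists n => //; rewrite -mulrA; rewrite mulr1 in nle.
Qed.

Definition oideal I : Prop := [/\ subg I, forall x, I x -> O x & forall a x, O a -> I x -> I (a * x)].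

(** Minkowski's argument by pigeonhole: a ball of radius about n^(1/d) holds more than n points of
    O, so two of them are congruent modulo I. *)
Lemma ideal_small : exists2 C : R, 1 <= C & forall I n r, subg I -> hasidx O I n ->
  1 <= r -> n%:R <= r ^+ d -> exists y, [/\ I y, y != 0 & box (C * r) y].
Proof.
have [c c0 many] := ball_many.
have ci0 : 0 < c^-1 by rewrite invr_gt0.
exists (2 * (2 * c^-1 + 2)) => [|I n r sI hn r1 nr]; first by lra.
have [|m [u [uB uI mge]]] := many ((2 * c^-1 + 2) * r) 0; first by nra.
have lt : (n < m)%N.
  rewrite -(ltr_nat R); apply: le_lt_trans nr _; apply: lt_le_trans mge.
  rewrite ltr_pXn2r ?fd_gt0 // ?nnegrE; [|by lra|by rewrite !mulr_ge0 ?addr_ge0 ?mulr_ge0 ?ltW //; lra].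
  by rewrite mulrA mulrDr mulrCA divff ?lt0r_neq0 //; nra.
have [v [vO vI vs]] := hn.
have [g gP] := choice (fun k => vs (u k) (uB k).1).
have : ~~ injectiveb g.
  by apply: contraL lt => /injectiveP/leq_card; rewrite !card_ord -leqNgt.
move=> /injectivePn[a [b ab gab]]; exists (u a - u b); split.
- by apply: (subg_trans sI (gP a)); rewrite gab; apply: subgC.
- by rewrite subr_eq0; apply: contra ab => /eqP/uI ->.
have [_ ba] := uB a; have [_ bb] := uB b; rewrite !subr0 in ba bb.
by apply: box_le (boxB ba bb); lra.
Qed.

(* For y close to the constant a, multiplication by y expands by about |a|. *)
Lemma idx_scaled_ge : exists c e : R, [/\ 0 < c, 0 < e, e < 1 & forall a y r n, A a -> O y ->
  e^-1 <= r -> r <= abs a -> box (e * r) (y - j a) -> y != 0 /\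
  (hasidx O (scaled y O) n -> (c * r) ^+ d <= n%:R)].
Proof.
have [e0 e0_gt0 disc] := oint_disc X; have b1 := bM_ge1 X.
have b0 : 0 < bM X by lra.
have [c c0 many] := ball_many.
pose e := Num.min (2 * bM X)^-1 (Num.min (e0 / 3) (1/2)) / 4.
have e_gt0 : 0 < e.
  by rewrite divr_gt0 // !lt_min invr_gt0 mulr_gt0 //= !divr_gt0.
have e4 : Num.min (2 * bM X)^-1 (Num.min (e0 / 3) (1/2)) = 4 * e by rewrite /e; field.
have le1 : 4 * e <= (2 * bM X)^-1 by rewrite -e4 ge_min lexx.
have le2 : 4 * e <= e0 / 3 by rewrite -e4 !ge_min lexx orbT.
have le3 : 4 * e <= 1/2 by rewrite -e4 !ge_min lexx !orbT.
clearbody e; exists (c * (2 * e)), e; split=> // [||a y r n Aa Oy r1 ra hy]; [by rewrite mulr_gt0 // mulr_gt0|lra|].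
have ri0 : 0 < e^-1 by rewrite invr_gt0.
have r0 : 0 < r by lra.
have er1 : 1 <= e * r by rewrite -ler_pdivrMl // mulr1.
have a0 : a != 0 by apply/eqP => a0; move: ra; rewrite a0 sabs0; lra.
have aa0 := sabs_gt0 S a0.
have ebm : e * bM X <= 1 / 8.
  by move: le1; rewrite -(ler_pM2r b0) invfM mulfVK ?lt0r_neq0 //; lra.
have key x : box (4 * e * r) (y * x) -> box e0 x.
  move=> hx; have [s s1 hs] := ex_box X x.
  (* Each use of a x = y x - (y - a) x halves the bound on x up to a term 4 e, so the bound falls to
     about 8 e, which is below [e0]. *)
  have step t : 0 < t -> box t x -> box (4 * e + t / 2) x.
  move=> t0 ht; apply/(boxZ X _ _ a0).
  rewrite (_ : j a * x = y * x - (y - j a) * x); last by ring.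
  have := boxB hx (boxM _ _ hy ht); rewrite mulr_gt0 // t0 => /(_ isT isT).
  apply: box_le; rewrite mulrDr; apply: lerD; first by rewrite mulrC ler_pM2r //; lra.
  have -> : bM X * (e * r * t) = (e * bM X) * (r * t) by ring.
  have rt0 : 0 < r * t by rewrite mulr_gt0.
  have : r * t <= abs a * t by rewrite ler_pM2r.
  nra.
  have it k : box (8 * e + s / 2 ^+ k) x.
  elim: k => [|k IH]; first by rewrite expr0 divr1; apply: box_le hs; lra.
  have s2 : 0 < s / 2 ^+ k by rewrite divr_gt0 ?exprn_gt0 //; lra.
  have s3 : 0 < 8 * e + s / 2 ^+ k by lra.
  have := step _ s3 IH; apply: box_le.
  by rewrite exprSr invfM; lra.
  have [s0 e30] : 0 < s /\ 0 < 3 * e by split; lra.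
  have [k hk] := ex_small s0 e30.
  by apply: box_le (it k); lra.
have y0 : y != 0.
  apply/eqP => y0; have /eqP : (1 : K) = 0; last by rewrite oner_eq0.
  by apply: disc (oint1 X) _; apply: key; rewrite y0 mul0r; apply: box0; nra.
split=> // hn.
have [|m [u [uB uI mge]]] := many (2 * (e * r)) 0; first by lra.
have: (m <= n)%N.
  rewrite -(card_ord m); apply: (idx_ge (u := u) _ hn).
  - exact: scaled_sub (oint_sub X).
  - by move=> i; case: (uB i).
  move=> i k h; apply: uI; apply/eqP; rewrite -subr_eq0; apply/eqP.
  have /eqP : (u i - u k) / y = 0.
  apply: disc => //; apply: key; rewrite [y * _]mulrC divfK //.
  have [_ h1] := uB i; have [_ h2] := uB k; rewrite !subr0 in h1 h2.
  by apply: box_le (boxB h1 h2); lra.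
  by rewrite mulf_eq0 invr_eq0 (negPf y0) orbF => /eqP.
rewrite -(ler_nat R); apply: le_trans.
by rewrite (_ : _ * r = c * (2 * (e * r))) //; ring.
Qed.

(* n w and W lie between the same two multiples of d-th powers of counts in sA. *)
Lemma count_ideal (B : R) : exists2 C : R, 0 < C & forall (r h : R) n I z m M,
  1 <= r -> 1 <= h -> h <= B * r -> subg I -> (forall x, I x -> O x) ->
  hasidx O I n -> cov I h -> hasidx (lball I z (box r)) zeros m ->
  hasidx (lball O z (box r)) zeros M ->
  `|(n * m)%:R - M%:R| <= C * (r ^+ d.-1 * h).
Proof.
have [C1 C1_gt0 shell] := sA_shell S; have [C2 C21 fin] := ball_finite.
have [_ _ /(_ lam 1 (lexx _) (lam_sub X) (@oint_lam _ _ _ _ X) cov_lam)[q _ hq]] := idx_cov.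
have dE : d = d.-1.+1 by rewrite prednK ?fd_gt0.
pose Bp := `|B|; pose D1 := (C2 * (1 + Bp)) ^+ d.
have Bp0 : 0 <= Bp by apply: normr_ge0.
have D10 : 0 < D1 by rewrite exprn_gt0 // mulr_gt0 //; lra.
pose D2 := q%:R * (d%:R * (C1 ^+ d.-1 * C1)).
have D20 : 0 <= D2 by rewrite !mulr_ge0 ?ler0n ?exprn_ge0 ?ltW.
exists (4 * D1 + D2) => [|r h n I z m M r1 h1 hB sI IO hn hc hm hM]; first by lra.
have r0 : 0 < r by lra.
have rd0 : 0 <= r ^+ d.-1 by rewrite exprn_ge0 // ltW.
(* If h is comparable with r, each of the two counts is O(r ^ d) and is already absorbed by the
   error term; h <= B r serves here. *)
have [h4|h4] := leP (4 * h) r; last first.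
  have D1r (k : nat) : k%:R <= (C2 * (r + h)) ^+ d -> k%:R <= 4 * D1 * (r ^+ d.-1 * h).
  move=> hk; apply: le_trans hk _; have -> : 4 * D1 * (r ^+ d.-1 * h) = D1 * (r ^+ d.-1 * (4 * h)) by ring.
  apply: (@le_trans _ _ (D1 * r ^+ d)); last first.
  rewrite ler_pM2l // {1}dE exprSr; apply: ler_wpM2l => //; exact: ltW.
  rewrite /D1 -exprMn; apply: lerXn2r; rewrite ?nnegrE.
  - by rewrite mulr_ge0 //; lra.
  - by rewrite !mulr_ge0 //; lra.
  rewrite -mulrA; apply: ler_wpM2l; first by lra.
  rewrite mulrDl mul1r lerD2l; apply: le_trans hB _; rewrite ler_pM2r //; exact: ler_norm.
  have hnm : (n * m)%:R <= 4 * D1 * (r ^+ d.-1 * h).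
  have [|p hp hfin] := fin (r + h) z; first by lra.
  apply: D1r; apply: le_trans hp; rewrite ler_nat.
  by apply: (ball_index_ge sI IO hn hc _ hm hfin) => x y; apply: boxD.
  have hM' : M%:R <= 4 * D1 * (r ^+ d.-1 * h).
  have [|p hp hfin] := fin r z; first by lra.
  rewrite (idx_uniq zeros_sub hM hfin); apply: D1r; apply: le_trans hp _.
  apply: lerXn2r; rewrite ?nnegrE ?mulr_ge0 //; try lra.
  by apply: ler_wpM2l; lra.
  have h0 : 0 <= h by lra.
  have : 0 <= D2 * (r ^+ d.-1 * h) by apply: mulr_ge0 => //; apply: mulr_ge0.
  rewrite mulrDl ler_norml; have := ler0n R M; have := ler0n R (n * m); lra.
have [r1' [r2' [n1 [n2 [s1 s2 hn1 hn2 [n12 n2C n12']]]]]] := shell r h h1 h4.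
have L1 := lam_ball hn1; have L2 := lam_ball hn2.
have box1h : forall x, box 1 x -> box h x by move=> x; apply: box_le.
pose U1 := fun x => exists x1 x2, [/\ box r1' x1, box h x2 & x = x1 + x2].
pose U2 := fun x => exists x1 x2, [/\ box r x1, box h x2 & x = x1 + x2].
have z0 : abs 0 < h by rewrite sabs0; lra.
have [|p1 hp1] := @ball_finite_sub U1 r z r1.
  by move=> x [x1 [x2 [b1 b2 ->]]] i; rewrite fcoD -[_ + _]addr0; apply: s1.
have [||p2 hp2] := @ball_finite_sub U2 (r + h) z; first by lra.
  by move=> x [x1 [x2 [b1 b2 ->]]]; apply: boxD.
have lamO := @oint_lam _ _ _ _ X; have sl := lam_sub X.
have lo1 : (q * n1 ^ d <= n * m)%N.
  apply: (@leq_trans p1).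
  by apply: (ball_index_ge sl lamO hq cov_lam _ L1 hp1) => x y hx /box1h hy; exists x, y.
  apply: (ball_index_le sI IO hn hc _ hm hp1) => x y [x1 [x2 [b1 b2 ->]]] hy i.
  by rewrite !fcoD; apply: s1.
have up1 : (n * m <= q * n2 ^ d)%N.
  apply: (@leq_trans p2).
  by apply: (ball_index_ge sI IO hn hc _ hm hp2) => x y hx hy; exists x, y.
  apply: (ball_index_le sl lamO hq cov_lam _ L2 hp2) => x y [x1 [x2 [b1 b2 ->]]] /box1h hy i.
  by rewrite !fcoD; apply: s2.
have lo2 : (q * n1 ^ d <= M)%N.
  apply: (ball_index_ge sl lamO hq cov_lam _ L1 hM) => x y hx /box1h hy i.
  by rewrite fcoD -[_ + _]addr0; apply: s1.
have up2 : (M <= q * n2 ^ d)%N.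
  apply: (ball_index_le sl lamO hq cov_lam _ L2 hM) => x y hx /box1h hy i.
  by rewrite fcoD -[_ + _]addr0; apply: s2.
(* A difference of d-th powers: the factor n2 - n1 is O(h) by the shell axiom, and each of the d
   other terms is O(r ^ d.-1). *)
have main : (q * n2 ^ d)%:R - (q * n1 ^ d)%:R <= D2 * (r ^+ d.-1 * h).
  rewrite !natrM !natrX -mulrBr /D2 -mulrA; apply: ler_wpM2l; first exact: ler0n.
  have hsum : \sum_(i < d) n2%:R ^+ (d.-1 - i) * n1%:R ^+ i <= d%:R * (C1 * r) ^+ d.-1 :> R.
  have -> : d%:R * (C1 * r) ^+ d.-1 = \sum_(i < d) (C1 * r) ^+ d.-1.
  by rewrite sumr_const card_ord mulr_natl.
  apply: ler_sum => i _; have di : (i <= d.-1)%N by rewrite -ltnS -dE.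
  apply: (@le_trans _ _ (n2%:R ^+ (d.-1 - i) * n2%:R ^+ i)).
  by apply: ler_wpM2l; rewrite ?exprn_ge0 // lerXn2r ?nnegrE // ler_nat.
  by rewrite -exprD subnK //; apply: lerXn2r; rewrite ?nnegrE // mulr_ge0 // ltW.
  have sum0 : 0 <= \sum_(i < d) n2%:R ^+ (d.-1 - i) * n1%:R ^+ i :> R.
  by apply: sumr_ge0 => i _; rewrite mulr_ge0 ?exprn_ge0.
  have h0 : 0 <= h by lra.
  have n21 : n2%:R - n1%:R <= C1 * h by lra.
  rewrite subrXX; apply: (@le_trans _ _ ((C1 * h) * (d%:R * (C1 * r) ^+ d.-1))).
  by apply: ler_pM => //; rewrite subr_ge0 ler_nat.
  by rewrite exprMn le_eqVlt; apply/orP; left; apply/eqP; ring.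
have := ler0n R M; have h0 : 0 <= h by lra.
have D10' := ltW D10; have : 0 <= 4 * D1 * (r ^+ d.-1 * h) by apply: mulr_ge0; apply: mulr_ge0.
move: lo1 up1 lo2 up2; rewrite -!(ler_nat R) => lo1 up1 lo2 up2.
by rewrite mulrDl ler_norml; lra.
Qed.

End LatticeCount.

(** * Dedekind theory of the ring of integers: maximal ideals correspond to primes *)

Section Dedekind.
Variables (R : realType) (F : fieldType) (S : sized R F) (K : fieldType).
Variable X : finext S K.
Local Notation A := (sA S).
Local Notation abs := (sabs S).
Local Notation j := (fj X).
Local Notation lam := (lam X).
Local Notation box := (box X).
Local Notation O := (oint X).
Local Notation oideal := (oideal X).
Implicit Types (x y z s : K) (P Q M I : set K).

(** The primes lying over primes of A; over F[t] this leaves out the places at infinity. *)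
Definition above P : Prop := is_prime P /\ forall a, A a -> P (j a).
Definition ctr P : set K := fun x => O x /\ max_ideal P x.
Lemma oint_frac x : exists D, [/\ D != 0, A D & O (j D * x)].
Proof. by have [D [D0 AD LD]] := lam_frac X x; exists D; split=> //; apply: oint_lam. Qed.
Lemma j_neq0 (D : F) : D != 0 -> j D != 0. Proof. by rewrite fmorph_eq0. Qed.

(** O is a finite union of classes modulo [lam], so the product of the denominators of
    representatives serves for all of O. *)
Lemma oint_lam_den : exists D, [/\ D != 0, A D & forall x, O x -> lam (j D * x)].
Proof.
have [C C1 /(_ lam 1 (lexx _) (lam_sub X) (@oint_lam _ _ _ _ X) (@cov_lam _ _ _ _ X))] := idx_cov X.
case=> n _ [u [uO uI us]].
have [b bP] := choice (fun i => lam_frac X (u i)).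
have AP (s : seq 'I_n) : A (\prod_(i <- s) b i).
  by elim/big_ind: _ => [||i _]; [apply: sA1 | apply: sAM | case: (bP i)].
exists (\prod_i b i); split=> // [|x /us[i Li]]; first by apply/prodf_neq0 => i _; case: (bP i).
have Ab : A (\prod_(k | k != i) b k) by rewrite -big_filter; apply: AP.
rewrite -(subrK (u i) x) mulrDr; apply: (subgD (lam_sub X)); first exact: lamZ.
have -> : j (\prod_k b k) * u i = j (\prod_(k | k != i) b k) * (j (b i) * u i).
  by rewrite (bigD1 i) //= rmorphM mulrA [_ * j (b i)]mulrC.
by apply: lamZ => //; case: (bP i).
Qed.

(** The common denominator of O turns almost integrality over O into almost integrality over
    [lam]. *)
Lemma oint_closed c y : c != 0 -> (forall k, O (c * y ^+ k)) -> O y.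
Proof.
move=> c0 h; have [b [b0 Ab Ob]] := oint_frac c^-1.
have [D [D0 AD OD]] := oint_lam_den.
exists (D * b) => [|k]; first by rewrite mulf_neq0.
rewrite rmorphM -mulrA; apply: OD.
by rewrite (_ : _ * _ = (j b * c^-1) * (c * y ^+ k)); [apply: ointM | rewrite mulrA mulfVK].
Qed.

(** Elements with coordinates in A have valuations bounded below by those of the basis, so the
    powers of x have bounded denominators at P. *)
Lemma aboveO P x : above P -> O x -> P x.
Proof.
move=> [hP AP] [D D0 hD].
have [->|x0] := eqVneq x 0; first exact: prime0.
have lamP : exists c : int, forall y, lam y -> vge P c y.
  have [c cP] : exists c : int, forall i, vge P c (fw X i).
  suff [c hc] : exists c : int, forall i, i \in enum 'I_(fd X) -> vge P c (fw X i).
  by exists c => i; apply: hc; rewrite mem_enum.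
  elim: (enum _) => [|i s [c hc]]; first by exists 0.
  have [w0|w0] := eqVneq (fw X i) 0.
  by exists c => k; rewrite inE => /orP[/eqP->|/hc//]; rewrite w0; apply: (vge_sub hP c).1.
  exists (Order.min c (vl P (fw X i))) => k; rewrite inE => /orP[/eqP->|/hc].
  by apply/(vlP hP) => //; rewrite ge_min lexx orbT.
  by apply: (vge_le hP); rewrite ge_min lexx.
  exists c => y Ly; rewrite (fcoK X y); elim/big_ind: _ => [||i _].
  - exact: (vge_sub hP c).1.
  - by move=> u v; apply: vgeD.
  rewrite -[c]add0r; apply: vgeM => //; apply/vge0; exact: AP.
have [c hc] := lamP.
apply: (prime_boundedX hP (c := c - vl P (j D)) x0) => k.
apply/(vlP hP); first by rewrite expf_neq0.
have Dx0 : j D * x ^+ k != 0 by rewrite mulf_neq0 ?expf_neq0 ?j_neq0.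
have /(vlP hP) := hc _ (hD k); rewrite Dx0 => /(_ isT); rewrite (vlM hP) ?expf_neq0 ?j_neq0 //; lia.
Qed.

(** Maximality is expressed by inverses modulo M, so that no quotient ring has to be formed. The
    nonzero element makes all indices finite. *)
Definition maxO M : Prop := [/\ oideal M, ~ M 1, exists2 x, M x & x != 0 &
  forall x, O x -> ~ M x -> exists2 y, O y & M (1 - x * y)].

Lemma oideal_fin I x : oideal I -> I x -> x != 0 -> exists n, hasidx O I n.
Proof.
move=> [sI IO IM] Ix x0; have [C C1 idx] := idx_scaledO X; have [r r1 br] := ex_box X x.
have [n _ hn] := idx x r (IO _ Ix) x0 r1 br.
have sO := scaled_sub x (oint_sub X).
have [|m [k [hm _ _]]] := idx_sub (oint_sub X) sI sO _ IO hn; last by exists m.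
by move=> y Oy; rewrite -(divfK x0 y); apply: IM.
Qed.

(* Two powers of x are congruent; this replaces all chain conditions below. *)
Lemma pow_cong I x y : oideal I -> I y -> y != 0 -> O x ->
  exists i k, I (x ^+ i * (1 - x ^+ k.+1)).
Proof.
move=> hI Iy y0 Ox; have [n [u [uO uI us]]] := oideal_fin hI Iy y0.
have [sI _ _] := hI.
have [g gP] := choice (fun i => us (x ^+ i) (ointX i Ox)).
have : ~~ injectiveb (fun i : 'I_n.+1 => g i).
  by apply/negP => /injectiveP/leq_card; rewrite !card_ord ltnn.
move=> /injectivePn[a [b ab gab]].
wlog lt : a b ab gab / (a < b)%N.
  move=> H; move: (ab); rewrite neq_ltn => /orP[|]; first exact: H.
  by apply: H; rewrite 1?eq_sym.
exists a, (b - a).-1; rewrite prednK ?subn_gt0 // mulrBr mulr1 -exprD subnKC 1?ltnW //.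
by apply: (subg_trans sI (gP a)); rewrite gab; apply: subgC.
Qed.

Lemma prime_inv P x : is_prime P -> P x -> ~ max_ideal P x -> P x^-1.
Proof. by move=> hP Px nx; apply: contrapT => n; apply: nx; split=> //; right. Qed.

Lemma max_mul P x y : is_prime P -> P x -> ~ max_ideal P x -> max_ideal P (x * y) -> max_ideal P y.
Proof.
move=> hP Px nx h; have x0 : x != 0 by apply/eqP => x0; apply: nx; split=> //; left.
by rewrite -(mulKf x0 y); apply: maxM => //; apply: prime_inv.
Qed.

(** Two powers of x are congruent modulo the ideal; cancelling x ^ i, a unit at P, leaves 1 - x ^
    k.+1 in it, and x ^ k is the required inverse. *)
Lemma ctr_maxO P : above P -> maxO (ctr P).
Proof.
move=> aP; have [hP AP] := aP; have OP x := @aboveO P x aP.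
have hI : oideal (ctr P).
  split=> [|x []//|a x Oa [Ox mx]].
  by split=> [|x y [Ox mx] [Oy my]]; split; [exact: (oint_sub X).1|exact: (max_sub hP).1|
  exact: (oint_sub X).2|exact: (max_sub hP).2].
  by split; [apply: ointM | apply: maxM => //; apply: OP].
have [t ht t0] : exists2 x, ctr P x & x != 0.
  have [D [D0 AD OD]] := oint_frac (unif P).
  exists (j D * unif P); last by rewrite mulf_neq0 ?j_neq0 ?unif_neq0.
  split=> //; apply: maxM => //; first exact: AP.
  by apply/(vl_max hP); rewrite ?unif_neq0 // vl_unif.
split=> // [[_ /max_not1]//||x Ox nx]; first by exists t.
have [i [k]] := pow_cong hI ht t0 Ox.
have nx' : ~ max_ideal P x by move=> h; apply: nx.
have nxi : ~ max_ideal P (x ^+ i).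
  elim: i => [|i IH]; first by rewrite expr0; apply: max_not1.
  by rewrite exprS => /(max_mul hP (OP _ Ox) nx').
case=> _ /(max_mul hP (primeX hP i (OP _ Ox)) nxi) h; exists (x ^+ k); first exact: ointX.
by rewrite -exprS; split=> //; apply: (oint_sub X).2 (oint1 X) _; apply: ointX.
Qed.

Definition loc M : set K := fun x => exists s, [/\ O s, ~ M s & O (s * x)].

Section Localization.
Variable M : set K.
Hypothesis hM : maxO M.

Let hI : oideal M. Proof. by case: hM. Qed.
Let sM : subg M. Proof. by case: hI. Qed.
Let MO x : M x -> O x. Proof. by case: hI => _ h _; apply: h. Qed.
Let MM a x : O a -> M x -> M (a * x). Proof. by case: hI => _ _ h; apply: h. Qed.
Let nM1 : ~ M 1. Proof. by case: hM. Qed.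
Let M_prime x y : O x -> O y -> M (x * y) -> ~ M x -> M y.
Proof.
move=> Ox Oy Mxy nx; case: hM => _ _ _ /(_ x Ox nx)[z Oz Mz].
rewrite (_ : y = y * (1 - x * z) + z * (x * y)); last by ring.
by apply: subgD => //; apply: MM.
Qed.
Let nM s : ~ M s -> s != 0. Proof. by move=> h; apply/eqP => s0; apply: h; rewrite s0; apply: sM.1. Qed.
Let n1B x : M x -> ~ M (1 - x).
Proof. by move=> Mx h; apply: nM1; rewrite -(subrK x 1); apply: subgD. Qed.
Lemma loc_O x : O x -> loc M x. Proof. by exists 1; rewrite mul1r; split=> //; apply: oint1. Qed.
Lemma locB x y : loc M x -> loc M y -> loc M (x - y).
Proof.
move=> [s [Os ns hs]] [t [Ot nt ht]]; exists (s * t); split; first exact: ointM.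
  by move=> /(M_prime Os Ot)/(_ ns).
rewrite (_ : _ * _ = t * (s * x) - s * (t * y)); last by ring.
by apply: (oint_sub X).2; apply: ointM.
Qed.
Lemma locM x y : loc M x -> loc M y -> loc M (x * y).
Proof.
move=> [s [Os ns hs]] [t [Ot nt ht]]; exists (s * t); split; first exact: ointM.
  by move=> /(M_prime Os Ot)/(_ ns).
by rewrite mulrACA; apply: ointM.
Qed.
Lemma loc_inv s : O s -> ~ M s -> loc M s^-1.
Proof. by move=> Os ns; exists s; split=> //; rewrite divff ?nM //; apply: oint1. Qed.
Lemma loc_maxM m x : M m -> loc M x -> m * x != 1.
Proof.
move=> Mm [s [Os ns hs]]; apply/eqP => h; apply: ns.
by rewrite -[s]mulr1 -h mulrCA mulrC; apply: MM.
Qed.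

(* Some y outside O with y M in O: a socle element of the M-part of O / a O. *)
Lemma loc_socle : exists y, ~ O y /\ forall m, M m -> O (m * y).
Proof.
case: hM => _ _ [a Ma a0] _; have Oa := MO Ma.
pose ann b : set K := fun s => O s /\ O (s * b / a).
have annI b : O b -> oideal (ann b).
  move=> Ob; split=> [|x []//|c x Oc [Ox hx]].
  split=> [|x y [Ox hx] [Oy hy]]; first by split; rewrite ?mul0r; apply: (oint_sub X).1.
  by split; [|rewrite !mulrBl]; apply: (oint_sub X).2.
  split; first exact: ointM.
  by rewrite (_ : _ / a = c * (x * b / a)); [apply: ointM | ring].
have ann_a b : O b -> ann b a by move=> Ob; split=> //; rewrite mulrAC divff // mul1r.
(* Least index means largest annihilator. By [annS], any c killed by all that kills b, with
   annihilator still inside M, has the same annihilator as b. *)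
pose T n := `[< exists b, [/\ O b, (forall s, ann b s -> M s) & hasidx O (ann b) n] >].
have Tex : exists n, T n.
  have [n hn] := oideal_fin (annI 1 (oint1 X)) (ann_a 1 (oint1 X)) a0.
  exists n; apply/asboolP; exists 1; split=> // [|s]; first exact: oint1.
  by rewrite /ann mulr1 => -[Os hs]; rewrite -(divfK a0 s); apply: MM.
case: (ex_minnP Tex) => n /asboolP[b [Ob bM hb]] nmin.
have annS c s : O c -> (forall s, ann b s -> ann c s) -> (forall s, ann c s -> M s) -> ann c s -> ann b s.
  move=> Oc sub cM hs; apply: contrapT => nbs.
  have [m hm] := oideal_fin (annI c Oc) (ann_a c Oc) a0.
  have [sb _ _] := annI b Ob; have [sc cO _] := annI c Oc.
  have [m' [k [hm' hk nE]]] := idx_sub (oint_sub X) sc sb sub cO hb.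
  have mm' := idx_uniq sc hm hm'; subst m'.
  have nm : (n <= m)%N by apply: nmin; apply/asboolP; exists c.
  have m0 := idx_gt0 (oint_sub X).1 hm.
  have k2 : (2 <= k)%N.
  rewrite -(card_ord 2); apply: (idx_ge (u := fun i : 'I_2 => if i == ord0 then 0 else s) sb hk).
  by move=> i; case: ifP => _; [apply: sc.1 | apply: hs].
  move=> i l; have [->|i0] := eqVneq i ord0; have [->|l0] := eqVneq l ord0 => // h.
  - by case: nbs; rewrite -[s]opprK -[- s]sub0r; apply: subgN.
  - by case: nbs; rewrite -[s]subr0.
  apply: val_inj; case: i l i0 l0 {h} => [[|[|i]] //= i2] [[|[|l]] //= l2] //.
  by move: nm; rewrite nE; nia.
exists (b / a); split=> [Oba|m Mm].
  by apply: nM1; apply: bM; split; [apply: oint1 | rewrite mul1r].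
suff [] : ann b m by rewrite mulrA.
have Om := MO Mm.
have [i [k hik]] := pow_cong (annI b Ob) (ann_a b Ob) a0 Om.
have ex : exists k, ~ (forall s, ann (m ^+ k * b) s -> M s).
  exists i => H; have /n1B : M (m ^+ k.+1) by rewrite exprSr; apply: MM => //; apply: ointX.
  apply; apply: H; split; first by apply: (oint_sub X).2 (oint1 X) (ointX _ _).
  by case: hik => _; congr (O _); ring.
(* At the last exponent k' for which the annihilator of m ^ k' b stays inside M, some u outside M
   gives u m killing m ^ k' b. [annS] brings this back to b, and a second use, through u b, removes
   u. *)
have [k' hk' kmin] : exists2 k, ~ (forall s, ann (m ^+ k.+1 * b) s -> M s) &
  forall s, ann (m ^+ k * b) s -> M s.
  case: ex => l; elim: l => [|l IH hl]; first by rewrite expr0 mul1r.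
  have [h|h] := pselect (forall s, ann (m ^+ l * b) s -> M s); last exact: IH.
  by exists l.
have [u [[Ou hu] nu]] : exists u, ann (m ^+ k'.+1 * b) u /\ ~ M u.
  by apply: contrapT => h; apply: hk' => s hs; apply: contrapT => ns; apply: h; exists s.
have Oc : O (m ^+ k' * b) by apply: ointM => //; apply: ointX.
have hum : ann b (u * m).
  apply: (annS (m ^+ k' * b)) => // [s [Os hs]|].
  split=> //; rewrite (_ : _ / a = m ^+ k' * (s * b / a)); last by ring.
  by apply: ointM => //; apply: ointX.
  split; first exact: ointM.
  by move: hu; rewrite exprS; congr (O _); ring.
apply: (annS (u * b)) => // [|s [Os hs]|s [Os hs]|]; first exact: ointM.
- split=> //; rewrite (_ : _ / a = u * (s * b / a)); last by ring.
  exact: ointM.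
- apply: (M_prime Ou Os) nu; apply: bM; split; first exact: ointM.
  by move: hs; congr (O _); ring.
split=> //; case: hum => _; congr (O _); ring.
Qed.

(** If p y stayed in M for all p in M, then a y ^ k would be integral for all k and y would lie in
    O. Hence some p y is a unit at M, and this p generates the maximal ideal. *)
Lemma loc_unif : exists p, [/\ M p, p != 0 & forall m, M m -> loc M (m / p)].
Proof.
have [y [nOy My]] := loc_socle; case: (hM) => _ _ [a Ma a0] _.
have [p Mp npy] : exists2 p, M p & ~ M (p * y).
  apply: contrapT => h; apply: nOy; apply: (oint_closed a0) => k; apply: MO.
  elim: k => [|k IH]; first by rewrite expr0 mulr1.
  by rewrite exprSr mulrA; apply: contrapT => n; apply: h; exists (a * y ^+ k).
have py0 := nM npy; move: (py0); rewrite mulf_eq0 negb_or => /andP[p0 y0].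
exists p; split=> // m Mm; exists (p * y); split=> //; first exact: My.
by rewrite (_ : _ * _ = m * y); [apply: My | field].
Qed.

Lemma loc_max x : max_ideal (loc M) x -> O x -> M x.
Proof.
move=> [_ h] Ox; apply: contrapT => nx; case: h => [x0|]; first by move: (nM nx); rewrite x0 eqxx.
by apply; apply: loc_inv.
Qed.
Lemma max_loc x : M x -> max_ideal (loc M) x.
Proof.
move=> Mx; split; first exact/loc_O/MO.
have [->|x0] := eqVneq x 0; [by left|right=> h].
by have := loc_maxM Mx h; rewrite divff // eqxx.
Qed.

(** For x in O the exponent of p is bounded because [pow_cong] makes x divide a power of p locally
    at M; what remains at the largest exponent is a unit. *)
Lemma loc_prime : is_prime (loc M).
Proof.
have [p [Mp p0 hp]] := loc_unif.
split; [exact/loc_O/oint1 | exact: locB | exact: locM |].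
exists p; split=> //; first exact: max_loc.
have unit x : loc M x -> ~ loc M (x / p) -> loc M x^-1.
  move=> [s [Os ns hs]] nx; have x0 : x != 0.
  by apply/eqP => x0; apply: nx; rewrite x0 mul0r; apply/loc_O; exact: (oint_sub X).1.
  have nsx : ~ M (s * x).
  move=> /hp; rewrite -mulrA => h; apply: nx; rewrite -(mulKf (nM ns) (x / p)).
  by apply: locM => //; apply: loc_inv.
  rewrite -(mulKf (nM ns) x) invfM invrK; apply: locM; first exact: loc_O.
  exact: loc_inv.
have key x : O x -> x != 0 -> exists u (n : nat), [/\ u != 0, loc M u, loc M u^-1 & x = u * p ^+ n].
  move=> Ox x0.
  have xI : oideal (scaled x O).
  split=> [|y|c y Oc]; first exact: scaled_sub (oint_sub X).
  by apply: scaledO.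
  by rewrite /scaled -mulrA; apply: ointM.
  have xx : scaled x O x by rewrite /scaled divff //; apply: oint1.
  have [i [k hik]] := pow_cong xI xx x0 (MO Mp).
  have hi : loc M (p ^+ i / x).
  have npk : ~ M (1 - p ^+ k.+1) by apply: n1B; rewrite exprSr; apply: MM => //; apply/ointX/MO.
  exists (1 - p ^+ k.+1); split=> //; first by apply: (oint_sub X).2 (oint1 X) _; apply/ointX/MO.
  by move: hik; rewrite /scaled mulrCA mulrA.
  have bnd l : loc M (x / p ^+ l) -> (l <= i)%N.
  move=> hl; rewrite leqNgt; apply/negP => lt.
  have : loc M (p ^+ (l - i).-1 * (x / p ^+ l * (p ^+ i / x))).
  by apply: locM; [apply/loc_O/ointX/MO | apply: locM].
  move/(loc_maxM Mp); rewrite mulrA -exprS prednK ?subn_gt0 //.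
  rewrite mulrCA mulrA [_ / x]mulrC; apply/negP; rewrite negbK; apply/eqP.
  have -> : p ^+ l = p ^+ (l - i) * p ^+ i by rewrite -exprD subnK // ltnW.
  by field; rewrite x0 !expf_neq0.
  have Q0 : exists l, `[< loc M (x / p ^+ l) >] by exists 0%N; apply/asboolP; rewrite expr0 divr1; apply: loc_O.
  have Qb l : `[< loc M (x / p ^+ l) >] -> (l <= i)%N by move/asboolP/bnd.
  case: (ex_maxnP Q0 Qb) => l /asboolP hl lmax.
  exists (x / p ^+ l), l; split=> //; first by rewrite mulf_neq0 ?invr_eq0 ?expf_neq0.
  apply: unit => // h; suff : (l.+1 <= l)%N by rewrite ltnn.
  by apply: lmax; apply/asboolP; rewrite exprSr invfM mulrA.
  by rewrite divfK ?expf_neq0.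
move=> x x0; have [D [D0 AD OD]] := oint_frac x.
have D0' := j_neq0 D0.
have [u [n [u0 hu hu1 uE]]] := key _ OD (mulf_neq0 D0' x0).
have [v [m [v0 hv hv1 vE]]] := key _ (ointj X AD) D0'.
exists (u / v), (n%:Z - m%:Z); split; rewrite ?mulf_neq0 ?invr_eq0 ?invf_div //; try exact: locM.
rewrite expfzDr // -exprnP -exprnN -(mulKf D0' x) uE vE.
by field; rewrite v0 expf_neq0.
Qed.

Lemma loc_above : above (loc M).
Proof. by split=> [|a Aa]; [apply: loc_prime | apply/loc_O/ointj]. Qed.

End Localization.

(** Recovering the valuation ring from its ideal in O reduces the comparison of primes to that of
    ideals. An x in P outside the localization would have its inverse in the maximal ideal there,
    and so a unit s of P would be in the maximal ideal of P. *)
Lemma loc_ctr P x : above P -> loc (ctr P) x <-> P x.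
Proof.
move=> aP; have hM := ctr_maxO aP; have [hP AP] := aP; split.
  move=> [s [Os ns /(aboveO aP) h]].
  have s0 : s != 0 by apply/eqP => s0; apply: ns; rewrite s0; split; [exact: (oint_sub X).1 | exact: (max_sub hP).1].
  rewrite -(mulKf s0 x); apply: primeM => //; apply: prime_inv => //; first exact: aboveO.
  by move=> h'; apply: ns.
move=> Px; apply: contrapT => nx; have hL := loc_prime hM.
have x0 : x != 0 by apply/eqP => x0; apply: nx; rewrite x0; apply/(loc_O hM); exact: (oint_sub X).1.
have [s [Os ns hs]] := max_prime (prime_tot hL x0 nx).
have [_ mP] : ctr P (s * x^-1).
  apply: (loc_max hM) => //; apply: (maxM hL); first exact: loc_O.
  exact: prime_tot.
by apply: ns; split=> //; rewrite -(divfK x0 s) mulrC; apply: maxM.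
Qed.

Lemma above_eq P Q : above P -> above Q -> (forall x, ctr P x -> ctr Q x) -> P = Q.
Proof.
move=> aP aQ h; suff e : ctr P = ctr Q.
  by apply/funext => x; apply/propext; rewrite -(loc_ctr x aP) e loc_ctr.
apply/funext => x; apply/propext; split=> [|Qx]; first exact: h.
apply: contrapT => nPx; have [_ _ _ /(_ x)] := ctr_maxO aP; case: (Qx) => Ox _ /(_ Ox nPx)[y Oy /h Q1].
have [[sQ _ QM] nQ1 _ _] := ctr_maxO aQ; apply: nQ1.
by rewrite -(subrK (x * y) 1); apply: subgD => //; rewrite mulrC; apply: QM.
Qed.

Lemma comax P Q : above P -> above Q -> P <> Q -> exists x, [/\ O x, max_ideal P x & max_ideal Q (1 - x)].
Proof.
move=> aP aQ nPQ; have [x [Px nQx]] : exists x, ctr P x /\ ~ ctr Q x.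
  apply: contrapT => h; apply: nPQ; apply: above_eq => // x Px; apply: contrapT => nQ.
  by apply: h; exists x.
have [_ _ _ /(_ x)] := ctr_maxO aQ; case: (Px) => Ox mx /(_ Ox nQx)[y Oy [_ Q1]].
exists (x * y); split=> //; first exact: ointM.
by rewrite mulrC; apply: maxM => //; [case: aP | apply: aboveO aP _].
Qed.

(** The denominators of x form an ideal; if it were proper, localizing at a maximal ideal above it
    would give a prime that does not contain x. *)
Lemma oint_inter x : (forall P, above P -> P x) -> O x.
Proof.
move=> h; apply: contrapT => nOx.
pose I : set K := fun s => O s /\ O (s * x).
have hI : oideal I.
  split=> [|y []//|a y Oa [Oy hy]].
  split=> [|y z [Oy hy] [Oz hz]]; first by split; rewrite ?mul0r; apply: (oint_sub X).1.
  by split; rewrite ?mulrBl; apply: (oint_sub X).2.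
  by split; rewrite -?mulrA; apply: ointM.
have nI1 : ~ I 1 by case; rewrite mul1r.
have [D [D0 AD OD]] := oint_frac x.
have ID : I (j D) by split=> //; apply: ointj.
have Dn0 := j_neq0 D0.
(* Enlarge I to a proper ideal of minimal index. *)
pose T n := `[< exists J, [/\ oideal J, forall s, I s -> J s, ~ J 1 & hasidx O J n] >].
have Tex : exists n, T n.
  by have [n hn] := oideal_fin hI ID Dn0; exists n; apply/asboolP; exists I.
case: (ex_minnP Tex) => n /asboolP[J [hJ IJ nJ1 hn]] nmin.
have [sJ JO JM] := hJ.
have mJ : maxO J.
  split=> //; first by exists (j D) => //; apply: IJ.
  move=> y Oy nJy.
  pose J' : set K := fun s => exists2 z, O z & J (s - y * z).
  have hJ' : oideal J'.
  split=> [|s [z Oz /JO h1]|a s Oa [z Oz h1]].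
  - split=> [|s t [z Oz h1] [z' Oz' h2]].
  by exists 0; [exact: (oint_sub X).1 | rewrite mulr0 subrr; exact: sJ.1].
  exists (z - z'); first exact: (oint_sub X).2.
  by rewrite (_ : _ - _ = s - y * z - (t - y * z')); [apply: sJ.2 | ring].
  - by rewrite -(subrK (y * z) s); apply: (subgD (oint_sub X)) => //; apply: ointM.
  exists (a * z); first exact: ointM.
  by rewrite (_ : _ - _ = a * (s - y * z)); [apply: JM | ring].
  have JJ' s : J s -> J' s by move=> Js; exists 0; [exact: (oint_sub X).1 | rewrite mulr0 subr0].
  have J'y : J' y by exists 1; [exact: oint1 | rewrite mulr1 subrr; exact: sJ.1].
  apply: contrapT => hno.
  have nJ'1 : ~ J' 1 by move=> [z Oz h1]; apply: hno; exists z.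
  have [sJ' J'O _] := hJ'.
  have [m [k [hm hk nE]]] := idx_sub (oint_sub X) sJ' sJ JJ' J'O hn.
  have nm : (n <= m)%N by apply: nmin; apply/asboolP; exists J'; split=> // s /IJ/JJ'.
  have m0 := idx_gt0 (oint_sub X).1 hm.
  have k2 : (2 <= k)%N.
  rewrite -(card_ord 2); apply: (idx_ge (u := fun i : 'I_2 => if i == ord0 then 0 else y) sJ hk).
  by move=> i; case: ifP => _; [apply: sJ'.1 | apply: J'y].
  move=> i l; have [->|i0] := eqVneq i ord0; have [->|l0] := eqVneq l ord0 => // h'.
  - by case: nJy; rewrite -[y]opprK -[- y]sub0r; apply: subgN.
  - by case: nJy; rewrite -[y]subr0.
  apply: val_inj; case: i l i0 l0 {h'} => [[|[|i]] //= i2] [[|[|l]] //= l2] //.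
  by move: nm; rewrite nE; nia.
have [s [Os ns hs]] := h _ (loc_above mJ).
by apply: ns; apply: IJ.
Qed.

End Dedekind.

(** * Chinese remainders and the factorization of indices *)

Section Norms.
Variables (R : realType) (F : fieldType) (S : sized R F) (K : fieldType).
Variable X : finext S K.
Local Notation A := (sA S).
Local Notation j := (fj X).
Local Notation O := (oint X).
Local Notation above := (above X).
Implicit Types (x y z s : K) (P Q M I : set K) (t : seq (set K)).

Lemma idx_inter P I n : subg I -> (forall x, O x -> P x) ->
  (forall x, P x -> exists2 o, O o & I (x - o)) ->
  hasidx P I n <-> hasidx O (fun x => O x /\ I x) n.
Proof.
move=> sI OP PO; split=> -[u [uO uI us]]; last first.
  exists u; split=> [i|i k h|x /PO[p Op Ip]]; first exact: OP.
  by apply: uI; split=> //; apply: (oint_sub X).2.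
  have [i [_ h]] := us p Op; exists i; exact: subg_trans sI Ip h.
have [f fP] := choice (fun i => (let: ex_intro2 a h1 h2 := PO _ (uO i) in ex_intro (fun o => O o /\ I (u i - o)) a (conj h1 h2))).
exists f; split=> [i|i k [_ h]|x Ox]; first by case: (fP i).
  apply: uI; apply: (subg_trans sI (fP i).2); apply: (subg_trans sI h).
  by apply: subgC => //; case: (fP k).
have [i h] := us x (OP x Ox); exists i; split.
  by apply: (oint_sub X).2 => //; case: (fP i).
by apply: (subg_trans sI h); case: (fP i).
Qed.

(** The approximation is x (1 - w ^ k), where w = 1 - s y lies in the maximal ideal and s is a
    denominator of x prime to P: the factor 1 - w ^ k is a multiple of s. *)
Lemma approx P x (k : nat) : above P -> P x -> exists2 o, O o & vge P k (x - o).
Proof.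
move=> aP; have [hP AP] := aP; move/(loc_ctr x aP) => [s [Os ns Osx]].
have [_ _ _ /(_ s Os ns)[y Oy [Ow mw]]] := ctr_maxO aP.
set w := 1 - s * y in Ow mw.
exists (x * (1 - w ^+ k)).
  have -> : x * (1 - w ^+ k) = (s * x) * y * \sum_(i < k) w ^+ i.
  rewrite -opprB subrX1 /w; move: (\sum_(_ < _) _) => sum; ring.
  apply: ointM; first exact: ointM.
  by elim/big_ind: _ => [|a b|i _]; [exact: (oint_sub X).1 | exact: (subgD (oint_sub X)) | apply: ointX].
rewrite (_ : x - _ = x * w ^+ k); last by ring.
have Px : P x by apply/(loc_ctr x aP); exists s.
rewrite -[k%:Z]add0r; apply: vgeM => //; first exact/vge0.
have wk : vge P 1 w by apply/(vge1 hP).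
elim: (k) => [|l IH]; first by rewrite expr0; apply/vge0; apply: prime1.
by rewrite exprS -[l.+1%:Z]/(1%:Z + l%:Z); apply: vgeM.
Qed.

Lemma norm_above P : above P -> hasidx P (max_ideal P) (prime_norm P) /\ (1 < prime_norm P)%N.
Proof.
move=> aP; have [hP AP] := aP; have [hI _ [x cx x0] _] := ctr_maxO aP.
have sm := max_sub hP.
have [n hn] := oideal_fin hI cx x0.
have {}hn : hasidx P (max_ideal P) n.
  apply/idx_inter => // [y|y Py]; first exact: aboveO.
  by have [p Op /(vge1 hP)] := approx 1 aP Py; exists p.
have n0 := idx_gt0 (prime0 hP) hn.
have nE : prime_norm P = n by apply/prime_norm_idx.
rewrite nE; split=> //.
rewrite -(card_ord 2); apply: (idx_ge (u := fun i : 'I_2 => i%:R) sm hn) => [i|i l h].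
  by case: i => [[|[|i]]] //= _; [apply: prime0|apply: prime1].
apply: val_inj; case: i l h => [[|[|i]] //= i2] [[|[|l]] //= l2] //= h; case: (max_not1 hP).
  by move: h; rewrite sub0r => /(subgN sm); rewrite opprK.
by rewrite subr0 in h.
Qed.

Lemma opow_idx P (k : nat) : above P -> hasidx O (fun x => O x /\ vge P k x) (prime_norm P ^ k).
Proof.
move=> aP; have [hP AP] := aP; have [hn _] := norm_above aP.
apply/(idx_inter (P := P)) => [|y|y Py|]; last exact: idx_prime_pow.
- exact: vge_sub.
- exact: aboveO.
by have [p] := approx k aP Py; exists p.
Qed.

Lemma maxX P x (k : nat) : is_prime P -> max_ideal P x -> vge P k (x ^+ k).
Proof.
move=> hP /(vge1 hP) mx; elim: k => [|l IH]; first by rewrite expr0; apply/vge0; apply: prime1.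
by rewrite exprS -[l.+1%:Z]/(1%:Z + l%:Z); apply: vgeM.
Qed.

(** Induction on t with exponent only 1 at P, multiplying by k-th powers of elements from [comax];
    replacing e by 1 - (1 - e) ^ k then raises the exponent at P and keeps divisibility at the
    others. *)
Lemma crt_elem P t (k : nat) : above P -> (forall Q, Q \in t -> above Q) -> P \notin t ->
  exists e, [/\ O e, vge P k (1 - e) & forall Q, Q \in t -> vge Q k e].
Proof.
move=> aP at_ Pt; have [hP AP] := aP.
suff [e [Oe me hQ]] : exists e, [/\ O e, max_ideal P (1 - e) & forall Q, Q \in t -> vge Q k e].
  exists (1 - (1 - e) ^+ k); split.
  - by apply: (oint_sub X).2 (oint1 X) _; apply: ointX; apply: (oint_sub X).2 (oint1 X) _.
  - by rewrite opprB addrCA subrr addr0; apply: maxX.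
  move=> Q Qt; have aQ := at_ Q Qt; have hv := hQ Q Qt; have [hQ' _] := aQ.
  rewrite (_ : _ - _ = (\sum_(i < k) (1 - e) ^+ i) * e); last first.
  by rewrite -opprB subrX1; move: (\sum_(_ < _) _) => sum; ring.
  rewrite -[k%:Z]add0r; apply: vgeM => //; apply/vge0; apply: aboveO aQ _.
  elim/big_ind: _ => [|a b|i _]; [exact: (oint_sub X).1 | exact: (subgD (oint_sub X)) |].
  by apply: ointX; apply: (oint_sub X).2 (oint1 X) _.
elim: t at_ Pt => [|Q t IH] at_ Pt.
  by exists 1; split=> //; [exact: oint1 | rewrite subrr; exact: (max_sub hP).1].
have [|| e [Oe me hQ]] := IH.
- by move=> Q' Q't; apply: at_; rewrite inE Q't orbT.
- by move: Pt; rewrite inE negb_or => /andP[].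
have aQ : above Q by apply: at_; rewrite inE eqxx.
have [hQ0 _] := aQ.
have [x [Ox mx m1x]] : exists x, [/\ O x, max_ideal Q x & max_ideal P (1 - x)].
  by apply: (comax aQ aP) => QP; move: Pt; rewrite inE QP eqxx.
exists (e * x ^+ k); split; first by apply: ointM => //; apply: ointX.
  rewrite (_ : 1 - _ = (1 - e) + e * (1 - x ^+ k)); last by ring.
  apply: (subgD (max_sub hP)) => //; apply: maxM => //; first exact: (aboveO aP).
  rewrite -opprB subrX1 -mulNr opprB mulrC; apply: maxM => //; apply: aboveO aP _.
  by elim/big_ind: _ => [|a b|i _]; [exact: (oint_sub X).1 | exact: (subgD (oint_sub X)) | exact: ointX].
move=> Q'; rewrite inE => /orP[/eqP->|Q't].
  rewrite -[k%:Z]add0r; apply: vgeM => //; first by apply/vge0; apply: (aboveO aQ).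
  exact: maxX.
have aQ' : above Q' by apply: at_; rewrite inE Q't orbT.
have [hQ' _] := aQ'; rewrite -[k%:Z]addr0; apply: vgeM => //; first exact: hQ.
by apply/vge0; apply: aboveO aQ' _; apply: ointX.
Qed.

Definition pideal t (v : set K -> nat) : set K :=
  fun x => O x /\ forall Q, Q \in t -> vge Q (v Q) x.

Lemma pideal_sub t v : (forall Q, Q \in t -> above Q) -> subg (pideal t v).
Proof.
move=> at_; split=> [|x y [Ox hx] [Oy hy]].
  by split=> [|Q /at_[hQ _]]; [exact: (oint_sub X).1 | exact: (vge_sub hQ _).1].
split=> [|Q Qt]; first exact: (oint_sub X).2.
by have [hQ _] := at_ Q Qt; apply: vgeB => //; [apply: hx | apply: hy].
Qed.

(** Multiplying representatives modulo a power of P by the e of [crt_elem] moves them into the ideal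
    of the other primes without changing their classes at P. *)
Lemma crt_idx t v : uniq t -> (forall Q, Q \in t -> above Q) ->
  hasidx O (pideal t v) (\prod_(Q <- t) prime_norm Q ^ v Q)%N.
Proof.
elim: t => [|P t IH] /= ut at_.
  rewrite big_nil; exists (fun _ => 0); split=> [_|i k _|x Ox]; first exact: (oint_sub X).1.
  by rewrite (ord1 i) (ord1 k).
  by exists ord0; rewrite subr0; split.
case/andP: ut => Pt ut; have aP : above P by apply: at_; rewrite inE eqxx.
have at' Q : Q \in t -> above Q by move=> Qt; apply: at_; rewrite inE Qt orbT.
have [hP _] := aP.
rewrite big_cons mulnC; apply: (idxM (oint_sub X) (pideal_sub v at') (pideal_sub v at_) _ _ (IH ut at')).
- by move=> x [Ox h]; split=> // Q Qt; apply: h; rewrite inE Qt orbT.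
- by move=> x [].
have [u [uO uI us]] := opow_idx (v P) aP.
pose k := (v P + \sum_(Q <- t) v Q)%N.
have [e [Oe he hQ]] := crt_elem k aP at' Pt.
have heP : vge P (v P) (1 - e) by apply: vge_le he => //; rewrite lez_nat leq_addr.
have heQ Q : Q \in t -> vge Q (v Q) e.
  move=> Qt; have [hQ' _] := at' Q Qt; apply: (vge_le hQ' _ (hQ Q Qt)).
  by rewrite lez_nat /k (big_rem Q) //= addnCA leq_addr.
have vge_mulO Q (m : nat) a b : above Q -> O a -> vge Q m b -> vge Q m (a * b).
  move=> aQ Oa hb; have [hQ' _] := aQ; rewrite -[m%:Z]add0r; apply: vgeM => //.
  by apply/vge0; apply: (aboveO aQ).
exists (fun i => u i * e); split=> [i|i l [_ h]|x [Ox hx]].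
- by split=> [|Q Qt]; [apply: ointM | apply: (vge_mulO _ _ _ _ (at' _ Qt) (uO i) (heQ _ Qt))].
- apply: uI; split; first exact: (oint_sub X).2.
  have -> : u i - u l = (u i * e - u l * e) + (u i - u l) * (1 - e) by ring.
  apply: vgeD => //; first by apply: h; rewrite inE eqxx.
  by apply: vge_mulO => //; apply: (oint_sub X).2.
have [i [Oi hi]] := us x Ox; exists i; split=> [|Q].
  by apply: (oint_sub X).2 => //; apply: ointM.
rewrite inE => /orP[/eqP->|Qt].
  have -> : x - u i * e = (x - u i) + u i * (1 - e) by ring.
  by apply: vgeD => //; apply: vge_mulO.
have [hQ' _] := at' Q Qt; apply: vgeB => //; first exact: hx.
exact: (vge_mulO _ _ _ _ (at' _ Qt) (uO i) (heQ _ Qt)).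
Qed.

Lemma vge_oint P y : above P -> y != 0 -> O y -> vl P y = `|vl P y|%N.
Proof.
move=> aP y0 Oy; have [hP _] := aP.
have := aboveO aP Oy; move/(vl_prime hP) => /(_ y0); lia.
Qed.

Lemma scaled_pideal y t : O y -> y != 0 -> (forall Q, Q \in t -> above Q) ->
  forall x, scaled y O x -> pideal t (fun Q => `|vl Q y|%N) x.
Proof.
move=> Oy y0 at_ x hx; have Ox := scaledO Oy y0 hx; split=> // Q /at_ aQ.
have [hQ _] := aQ; rewrite -(vge_oint aQ) // -(divfK y0 x) -[vl Q y]add0r.
by apply: vgeM => //; [apply/vge0; apply: (aboveO aQ) | apply/(vlP hQ)].
Qed.

Lemma prod_norm_le y t n : O y -> y != 0 -> uniq t ->
  (forall Q, Q \in t -> above Q /\ max_ideal Q y) -> hasidx O (scaled y O) n ->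
  (\prod_(Q <- t) prime_norm Q <= n)%N.
Proof.
move=> Oy y0 ut ht hn; have at_ Q : Q \in t -> above Q by case/ht.
have hc := crt_idx (fun=> 1%N) ut at_.
have [||||||m [k [hm hk nE]]] := @idx_sub _ O (pideal t (fun=> 1%N)) (scaled y O) n.
- exact: oint_sub.
- exact: pideal_sub.
- exact: scaled_sub (oint_sub X).
- move=> x hx; split=> [|Q /ht[aQ mQ]]; first exact: scaledO hx.
  have [hQ _] := aQ; apply/(vge1 hQ); rewrite -(divfK y0 x).
  by apply: maxM => //; apply: aboveO aQ _.
- by move=> x [].
- exact: hn.
have := idx_uniq (pideal_sub _ at_) hm hc; rewrite (eq_bigr _ (fun Q _ => expn1 _)) => <-.
rewrite nE leq_pmulr //; apply: idx_gt0 hk; exact: (pideal_sub _ at_).1.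
Qed.

(** The norms of the primes containing y multiply to at most the index of y O, and each norm is at
    least 2. *)
Lemma mem_finite y : O y -> y != 0 -> exists2 t, uniq t &
  forall Q, Q \in t <-> above Q /\ max_ideal Q y.
Proof.
move=> Oy y0; have [C C1 idx] := idx_scaledO X; have [r r1 br] := ex_box X y.
have [n _ hn] := idx y r Oy y0 r1 br.
pose T k := `[< exists t, [/\ uniq t, size t = k & forall Q, Q \in t -> above Q /\ max_ideal Q y] >].
have T0 : exists k, T k by exists 0%N; apply/asboolP; exists [::].
have Tb k : T k -> (k <= n)%N.
  move/asboolP=> [t [ut <- ht]]; apply: leq_trans (prod_norm_le Oy y0 ut ht hn); apply: ltnW.
  have {}ht Q : Q \in t -> (1 < prime_norm Q)%N by case/ht => /norm_above[].
  elim: t ht {ut} => [|Q t IH] ht; first by rewrite big_nil.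
  rewrite big_cons /=; have h1 := ht Q (mem_head _ _).
  have := IH (fun Q' h => ht Q' (mem_behead (s := Q :: t) h)); nia.
case: (ex_maxnP T0 Tb) => k /asboolP[t [ut tk ht]] kmax; exists t => // Q; split=> [|hQ]; first exact: ht.
apply: contrapT => /negP nQ; suff : (k.+1 <= k)%N by rewrite ltnn.
apply: kmax; apply/asboolP; exists (Q :: t); split=> //=; [by rewrite nQ | by rewrite tk |].
by move=> Q'; rewrite inE => /orP[/eqP->|/ht].
Qed.

(** By [oint_inter], divisibility by y is tested prime by prime, so y O is the ideal counted by
    [crt_idx]. *)
Lemma idx_scaled_prod y t : O y -> y != 0 -> uniq t -> (forall Q, Q \in t -> above Q) ->
  (forall Q, above Q -> max_ideal Q y -> Q \in t) ->
  hasidx O (scaled y O) (\prod_(Q <- t) prime_norm Q ^ `|vl Q y|)%N.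
Proof.
move=> Oy y0 ut at_ ht; have := crt_idx (fun Q => `|vl Q y|%N) ut at_.
congr hasidx; apply/funext => x; apply/propext; split; last exact: scaled_pideal.
move=> [Ox h]; apply: (oint_inter (X := X)) => P aP; have [hP _] := aP.
have [Pt|Pt] := boolP (P \in t).
  have := h P Pt; rewrite -(vge_oint aP) // => hv; apply/vge0.
  rewrite -(subrr (vl P y)) -(vlV hP) //; apply: vgeM => //.
  by apply/(vlP hP); rewrite ?invr_eq0.
apply: primeM => //; first exact: (aboveO aP).
apply: prime_inv => //; first exact: (aboveO aP).
by move=> /(ht P aP) h'; rewrite h' in Pt.
Qed.

End Norms.

(** * Chebyshev's bound and Mertens's first theorem from lattice points *)

Section Mertens.
Variables (R : realType) (F : fieldType) (S : sized R F) (K : fieldType).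
Variable X : finext S K.
Local Notation A := (sA S).
Local Notation abs := (sabs S).
Local Notation j := (fj X).
Local Notation d := (fd X).
Local Notation O := (oint X).
Local Notation box := (box X).
Local Notation above := (above X).
Local Notation zeros := (zeros (K := K)).
Implicit Types (x y z s : K) (P Q I : set K) (t : seq (set K)) (T : nat).

(** The input of Chebyshev's argument: a product of central binomial coefficients over Z, a product
    of polynomials X^(q^f) - X over F[t]. *)
Definition cheb_elem : Prop := exists2 B : R, 1 <= B & forall T, exists z : F,
  [/\ A z, z != 0, abs z <= B ^+ T &
  forall P, above P -> (prime_norm P <= T)%N -> max_ideal P (j z)].

Hypothesis cheb : cheb_elem.
Local Notation nm P := ((prime_norm P)%:R : R).

Lemma ps_ex T : exists t, uniq t /\ forall P, P \in t <-> above P /\ (prime_norm P <= T)%N.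
Proof.
have [B B1 /(_ T)[z [Az z0 _ hz]]] := cheb.
have [t ut ht] := mem_finite (ointj X Az) (j_neq0 X z0).
exists [seq P <- t | (prime_norm P <= T)%N]; split=> [|P]; first exact: filter_uniq.
rewrite mem_filter; split=> [/andP[h /ht[]//]|[aP h]].
by rewrite h; apply/ht; split=> //; apply: hz.
Qed.

Definition ps T := projT1 (cid (ps_ex T)).
Lemma ps_uniq T : uniq (ps T). Proof. by rewrite /ps; case: cid => t []. Qed.
Lemma psP P T : P \in ps T <-> above P /\ (prime_norm P <= T)%N.
Proof. by rewrite /ps; case: cid => t []. Qed.
Lemma nm_gt1 P T : P \in ps T -> 1 < nm P.
Proof. by move/psP => [/norm_above[_ h] _]; rewrite ltr1n. Qed.
Lemma ln_nm P T : P \in ps T -> 0 <= ln (nm P).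
Proof. by move/nm_gt1/ltW/ln_ge0. Qed.

Lemma sum_in t (f g : set K -> R) : (forall P, P \in t -> f P <= g P) ->
  \sum_(P <- t) f P <= \sum_(P <- t) g P.
Proof. by move=> h; rewrite !big_seq; apply: ler_sum. Qed.

Lemma sum_subset (U : eqType) (t1 t2 : seq U) (f : U -> R) : uniq t1 -> uniq t2 ->
  {subset t1 <= t2} -> (forall u, u \in t2 -> 0 <= f u) ->
  \sum_(u <- t1) f u <= \sum_(u <- t2) f u.
Proof.
move=> u1 u2 sub f0; rewrite [leRHS](bigID (mem t1)) /= -[X in _ <= X + _]big_filter.
have pe : perm_eq [seq i <- t2 | i \in t1] t1.
  apply: uniq_perm => //; first exact: filter_uniq.
  by move=> u; rewrite mem_filter andb_idr // => /sub.
rewrite (perm_big t1 pe) /= lerDl big_seq_cond; by apply: sumr_ge0 => u /andP[/f0].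
Qed.

Lemma ln_prodn t (f : set K -> nat) : (forall P, P \in t -> (0 < f P)%N) ->
  ln ((\prod_(P <- t) f P)%N%:R : R) = \sum_(P <- t) ln (f P)%:R.
Proof.
elim: t => [|P t IH] h; first by rewrite !big_nil ln1.
have h' Q : Q \in t -> (0 < f Q)%N by move=> Qt; apply: h; rewrite inE Qt orbT.
rewrite !big_cons natrM lnM ?IH // posrE ltr0n; first by apply: h; rewrite inE eqxx.
by rewrite big_seq; elim/big_ind: _ => // a b; rewrite muln_gt0 => -> ->.
Qed.

(** The product of the norms is at most the index of z O, which is bounded by the d-th power of a
    multiple of B ^ T. *)
Lemma theta_bound : exists2 C : R, 1 <= C & forall T,
  \sum_(P <- ps T) ln (nm P) <= C * T%:R.
Proof.
have [B B1 hB] := cheb; have [C C1 idx] := idx_scaledO X; have [r r1 br] := ex_box X 1.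
pose C' := d%:R * (ln (C * r) + ln B) + 1.
have B0 : 0 < B by lra.
have lB : 0 <= ln B by apply: ln_ge0.
have Cr1 : 1 <= C * r by rewrite -[1]mulr1; apply: ler_pM; lra.
have lC : 0 <= ln (C * r) by apply: ln_ge0.
exists C' => [|T]; first by rewrite /C' lerDr mulr_ge0 // addr_ge0.
have [->|T0] := posnP T.
  rewrite mulr0 big_seq big1 // => P /psP[/norm_above[_ h1] h2]; lia.
have [z [Az z0 hz zP]] := hB T.
have BT1 : 1 <= B ^+ T by apply: exprn_ege1.
have bz : box (B ^+ T * r) (j z).
  by rewrite -[j z]mulr1; apply: box_le (proj1 (boxZ X r 1 z0) br); rewrite ler_pM2r //; lra.
have [|n nle hn] := idx (j z) (B ^+ T * r) (ointj X Az) (j_neq0 X z0) _ bz.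
  by rewrite -[1]mulr1; apply: ler_pM; lra.
have hle := prod_norm_le (ointj X Az) (j_neq0 X z0) (ps_uniq T) _ hn.
have {}hle : (\prod_(Q <- ps T) prime_norm Q <= n)%N.
  by apply: hle => Q /psP[aQ QT]; split=> //; apply: zP.
have p0 Q : Q \in ps T -> (0 < prime_norm Q)%N by move/nm_gt1; rewrite ltr1n => /ltnW.
rewrite -ln_prodn //; have prod0 : (0 < \prod_(Q <- ps T) prime_norm Q)%N.
  by rewrite big_seq; elim/big_ind: _ => // a b; rewrite muln_gt0 => -> ->.
apply: (@le_trans _ _ (ln ((C * r * B ^+ T) ^+ d))).
  rewrite ler_ln ?posrE ?ltr0n ?exprn_gt0 // ?mulr_gt0 ?exprn_gt0 //; try lra.
  rewrite mulrAC -mulrA; apply: le_trans nle; by rewrite ler_nat.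
have CrB0 : 0 < C * r * B ^+ T by rewrite mulr_gt0 ?exprn_gt0 //; lra.
have -> : ln ((C * r * B ^+ T) ^+ d) = d%:R * (ln (C * r) + T%:R * ln B).
  by rewrite lnXn // lnM ?posrE ?exprn_gt0 // ?lnXn ?mulr_natl //; lra.
have T1 : 1 <= T%:R :> R by rewrite ler1n.
have : d%:R * ln (C * r) * 1 <= d%:R * ln (C * r) * T%:R by apply: ler_wpM2l => //; apply: mulr_ge0.
by rewrite /C'; move: (ln _) (ln _) (T%:R) (d%:R) T1 => l1 l2 T' d' T1; lra.
Qed.

(** Partial summation against [theta_bound], reduced to the dyadic blocks of norms. *)
Lemma dyadic : exists2 C : R, 0 < C & forall T (g : nat -> R),
  (forall n, 0 <= g n) -> (forall m n, (0 < m)%N -> (m <= n)%N -> g n <= g m) ->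
  \sum_(P <- ps T) ln (nm P) * g (prime_norm P) <=
  C * \sum_(i < (trunc_log 2 T).+1) 2 ^+ i * g (2 ^ i)%N.
Proof.
have [C C1 th] := theta_bound; exists (2 * C) => [|T g g0 gm]; first by lra.
set l := trunc_log 2 T.
pose tl P := trunc_log 2 (prime_norm P).
have lt_l P : P \in ps T -> (tl P < l.+1)%N by move/psP => [_ h]; rewrite ltnS; apply: leq_trunc_log.
apply: (@le_trans _ _ (\sum_(P <- ps T) \sum_(i < l.+1) (if tl P == i then ln (nm P) * g (2 ^ i)%N else 0))).
  apply: sum_in => P Pt; rewrite (bigD1 (Ordinal (lt_l P Pt))) //= eqxx.
  rewrite big1 ?addr0 => [|i]; last first.
  by rewrite -val_eqE /= eq_sym => /negPf ->.
  apply: ler_wpM2l; first exact: ln_nm Pt.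
  apply: gm; first by rewrite expn_gt0.
  by apply: trunc_logP => //; have := nm_gt1 Pt; rewrite ltr1n => /ltnW.
rewrite exchange_big /= mulr_sumr; apply: ler_sum => i _.
apply: (@le_trans _ _ ((\sum_(P <- ps (2 ^ i.+1)) ln (nm P)) * g (2 ^ i)%N)); last first.
  apply: le_trans (ler_wpM2r (g0 _) (th _)) _.
  by rewrite natrX exprS le_eqVlt; apply/orP; left; apply/eqP; ring.
rewrite -big_mkcond /= -mulr_suml; apply: ler_wpM2r => //.
rewrite -[leLHS]big_filter.
have uf : uniq [seq P <- ps T | tl P == i] by apply: filter_uniq; apply: ps_uniq.
have sub : {subset [seq P <- ps T | tl P == i] <= ps (2 ^ i.+1)}.
  move=> P; rewrite mem_filter => /andP[/eqP tlP /psP[aP PT]]; apply/psP; split=> //.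
  by rewrite ltnW // -tlP; apply: trunc_log_ltn.
by apply: sum_subset => //; [apply: ps_uniq | move=> P /ln_nm].
Qed.

(** n^(1/d), the order of the radius of a ball holding n integers, and of the covering radius of an
    ideal of index n. *)
Definition root (n : nat) : R := n%:R `^ (d%:R^-1).
Lemma root_ge0 n : 0 <= root n. Proof. exact: powR_ge0. Qed.
Lemma rootX n : root n ^+ d = n%:R.
Proof.
rewrite -powR_mulrn ?root_ge0 // -powRrM mulVf ?powRr1 //.
by rewrite pnatr_eq0 -lt0n fd_gt0.
Qed.
Lemma root_le m n : (m <= n)%N -> root m <= root n.
Proof. by move=> mn; apply: ge0_ler_powR; rewrite ?nnegrE ?invr_ge0 // ler_nat. Qed.
Lemma root1 : root 1 = 1. Proof. by rewrite /root powR1. Qed.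
Lemma root_ge1 n : (0 < n)%N -> 1 <= root n. Proof. by move=> n0; have := root_le n0; rewrite root1. Qed.
Lemma rootM m n : root (m * n) = root m * root n.
Proof. by rewrite /root natrM powRM. Qed.

Lemma sum_root : exists2 C : R, 0 < C & forall T, (0 < T)%N ->
  \sum_(P <- ps T) ln (nm P) * (root (prime_norm P) / nm P) <= C * root T.
Proof.
have [C C0 dy] := dyadic; pose q := root 2.
have q1 : 1 < q.
  rewrite ltNge; apply/negP => h; have := rootX 2; have := exprn_ile1 d (root_ge0 2) h.
  by move=> h1 h2; move: h1; rewrite h2 -[1]/(1%:R) ler_nat.
exists (C * (q / (q - 1))) => [|T T0]; first by rewrite mulr_gt0 ?divr_gt0 //; lra.
apply: le_trans (dy T (fun n => root n / n%:R) _ _) _ => [n|m n m0 mn|].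
- by rewrite divr_ge0 ?root_ge0.
- have rE (k : nat) : (0 < k)%N -> root k / k%:R = (k%:R `^ (1 - d%:R^-1))^-1.
  move=> k0; have k0' : (k%:R : R) != 0 by rewrite pnatr_eq0 -lt0n.
  have e : k%:R `^ (1 - d%:R^-1) * root k = k%:R.
  by rewrite /root -powRD ?subrK ?powRr1 //; apply/implyP.
  have k1 : k%:R `^ (1 - d%:R^-1) != 0 :> R by rewrite gt_eqF // powR_gt0 // ltr0n.
  by apply: (mulfI k1); rewrite mulrA e !divff.
  rewrite !rE ?(leq_trans m0) //; rewrite lef_pV2 ?posrE ?powR_gt0 ?ltr0n ?(leq_trans m0) //.
  apply: ge0_ler_powR; rewrite ?nnegrE ?ler_nat //.
  by rewrite subr_ge0 invf_le1 ?ltr0n ?fd_gt0 // ler1n fd_gt0.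
rewrite -mulrA ler_pM2l //.
have rX i : root (2 ^ i) = q ^+ i.
  by elim: i => [|i IH]; rewrite ?expn0 ?root1 // expnS rootM IH exprS.
have -> : \sum_(i < (trunc_log 2 T).+1) 2 ^+ i * (root (2 ^ i) / (2 ^ i)%:R) = \sum_(i < (trunc_log 2 T).+1) q ^+ i.
  apply: eq_bigr => i _; rewrite natrX mulrCA mulrV ?unitfE ?expf_neq0 // mulr1; exact: rX.
have q10 : 0 < q - 1 by lra.
rewrite mulrAC ler_pdivlMr // mulrC -subrX1; apply: (@le_trans _ _ (q ^+ (trunc_log 2 T).+1)); first lra.
rewrite exprS ler_pM2l //; last by lra.
by rewrite -rX; apply: root_le; apply: trunc_logP.
Qed.

Lemma sum_inv_sq : exists2 C : R, 0 < C & forall T,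
  \sum_(P <- ps T) ln (nm P) * (nm P ^+ 2)^-1 <= C.
Proof.
have [C C0 dy] := dyadic; exists (C * 2) => [|T]; first by rewrite mulr_gt0.
apply: le_trans (dy T (fun n => (n%:R ^+ 2)^-1) _ _) _ => [n|m n m0 mn|].
- by rewrite invr_ge0 exprn_ge0.
- rewrite lef_pV2 ?posrE ?exprn_gt0 ?ltr0n ?(leq_trans m0) //.
  by apply: lerXn2r; rewrite ?nnegrE // ler_nat.
rewrite ler_pM2l //; elim: (trunc_log 2 T) => [|l].
  by rewrite big_ord1 !expr0 expr1n invr1; lra.
suff H n : \sum_(i < n) 2 ^+ i * ((2 ^ i)%:R ^+ 2)^-1 = 2 - 2 / 2 ^+ n :> R.
  by move=> _; rewrite H lerBlDr lerDl divr_ge0 // exprn_ge0.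
elim: n => [|n IH]; first by rewrite big_ord0 expr0 divr1 subrr.
rewrite big_ord_recr /= IH natrX [2 ^+ n.+1]exprS; have p0 : (2 : R) ^+ n != 0 by [].
by field.
Qed.

Lemma oideal_pow P (k : nat) : above P -> oideal X (fun x => O x /\ vge P k x).
Proof.
move=> aP; have [hP _] := aP; split=> [|x []//|a x Oa [Ox h]].
  split=> [|x y [Ox hx] [Oy hy]]; first by split; [exact: (oint_sub X).1 | exact: (vge_sub hP _).1].
  by split; [exact: (oint_sub X).2 | exact: vgeB].
split; first exact: ointM.
by rewrite -[k%:Z]add0r; apply: vgeM => //; apply/vge0; apply: aboveO aP _.
Qed.

(** An ideal of index n contains a nonzero y of size about n^(1/d), and y O alone already has a
    covering radius of this order. *)
Lemma cov_ideal : exists2 C : R, 1 <= C & forall I n, oideal X I -> hasidx O I n ->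
  (0 < n)%N -> cov X I (C * root n).
Proof.
have [C C1 small] := ideal_small X; have b1 := bM_ge1 X.
exists (bM X * C) => [|I n [sI IO IM] hn n0]; first by rewrite -[1]mulr1; apply: ler_pM; lra.
have r1 := root_ge1 n0.
have [|y [Iy y0 hy]] := small I n (root n) sI hn r1; first by rewrite rootX.
have Cr0 : 0 < C * root n by rewrite mulr_gt0 //; lra.
have := cov_scaled ltr01 Cr0 y0 (@cov_O _ _ _ _ X) hy; rewrite mulr1 mulrA => h z.
have [x hx bx] := h z; exists x => //.
by rewrite -(divfK y0 x); apply: IM.
Qed.

(** The valuation is written as a sum of indicators of divisibility, so that summing over the y of a
    ball leads to counts of points in the ideals P ^ k. *)
Lemma ln_idx T y n : O y -> y != 0 -> hasidx O (scaled y O) n -> (n <= T)%N ->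
  ln (n%:R : R) = \sum_(P <- ps T) ln (nm P) * \sum_(k < T) (`[< vge P k.+1 y >])%:R /\
  forall P k, P \in ps T -> vge P k%:Z y -> (prime_norm P ^ k <= T)%N.
Proof.
move=> Oy y0 hn nT; have sO := scaled_sub y (oint_sub X).
have aP Q : Q \in ps T -> above Q by case/psP.
have all_in Q : above Q -> max_ideal Q y -> Q \in ps T.
  move=> aQ mQ; apply/psP; split=> //; apply: leq_trans nT.
  have := prod_norm_le (t := [:: Q]) Oy y0 isT _ hn; rewrite big_seq1; apply.
  by move=> Q'; rewrite inE => /eqP->.
have hp := idx_scaled_prod Oy y0 (ps_uniq T) aP all_in.
have nE := idx_uniq sO hn hp.
have pos Q : Q \in ps T -> (0 < prime_norm Q)%N by move/nm_gt1; rewrite ltr1n => /ltnW.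
have le_pow P : P \in ps T -> (prime_norm P ^ `|vl P y| <= T)%N.
  move=> PT; apply: leq_trans nT; rewrite nE (bigD1_seq P) ?ps_uniq //= leq_pmulr //.
  rewrite big_seq_cond; elim/big_ind: _ => // [a b'|Q /andP[/pos h _]]; first by rewrite muln_gt0 => -> ->.
  by rewrite expn_gt0 h.
have vE P k : P \in ps T -> vge P k%:Z y <-> (k <= `|vl P y|)%N.
  move=> /aP aP'; have [hP _] := aP'.
  by rewrite (vlP hP) // (vge_oint aP' y0 Oy) lez_nat.
split; last first.
  move=> P k PT /(vE _ _ PT) h; apply: leq_trans (le_pow P PT).
  by rewrite leq_pexp2l // pos.
rewrite nE ln_prodn; last by move=> Q /pos h; rewrite expn_gt0 h.
rewrite !big_seq; apply: eq_bigr => P PT.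
rewrite natrX lnXn ?ltr0n ?pos // -[ln _ *+ _]mulr_natr; congr (_ * _).
have vT : (`|vl P y| <= T)%N.
  by apply: leq_trans (le_pow P PT); apply/ltnW/ltn_expl; have := nm_gt1 PT; rewrite ltr1n.
rewrite -natr_sum; congr (_%:R).
rewrite (eq_bigr (fun k : 'I_T => (k < `|vl P y|)%N : nat)); last first.
  by move=> k _; congr nat_of_bool; apply/asboolP/idP => /(vE _ _ PT).
have H m l : (\sum_(k < m) (k < l)%N = minn m l)%N.
  elim: m => [|m IH]; first by rewrite big_ord0 min0n.
  by rewrite big_ord_recr /= IH; case: (ltnP m l) => h /=; lia.
by rewrite H; apply/esym/minn_idPr.
Qed.

Lemma geom_tail (n m : nat) : (1 < n)%N -> \sum_(k < m) ((n ^ k.+2)%:R : R)^-1 <= 2 * (n%:R ^+ 2)^-1.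
Proof.
move=> n1; have n0 : 0 < n%:R :> R by rewrite ltr0n ltnW.
have n2 : 0 < (n%:R ^+ 2)^-1 :> R by rewrite invr_gt0 exprn_gt0.
apply: (@le_trans _ _ (\sum_(k < m) (2^-1) ^+ k * (n%:R ^+ 2)^-1)).
  apply: ler_sum => k _; rewrite natrX -addn2 exprD invfM ler_pM2r // exprVn.
  rewrite lef_pV2 ?posrE ?exprn_gt0 //; apply: lerXn2r; rewrite ?nnegrE ?ler_nat //.
rewrite -mulr_suml ler_pM2r //.
have := subrX1 (2^-1 : R) m; have : 0 <= (2^-1 : R) ^+ m by rewrite exprn_ge0.
by move: (\sum_(_ < _) _) => s; lra.
Qed.

(* Average log |O / y O| over the y in a ball around a large constant, first
  from the size of y and then from the factorization of y. *)
Lemma mertens_scale : exists2 C : R, 0 < C & exists T0, forall T, (T0 <= T)%N ->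
  `|\sum_(P <- ps T) ln (nm P) / nm P - ln T%:R| <= C.
Proof.
have [C1 C11 fin] := ball_finite X; have [c2 c20 many] := ball_many X.
have [c3 [e [c30 e0 e1 low]]] := idx_scaled_ge X; have [C4 C41 up] := idx_scaledO X.
have [C5 C51 covI] := cov_ideal; have [Cs Cs1 scale] := sA_scale S.
have [r1 r11 hr1] := ex_box X 1.
have [C8 C80 sroot] := sum_root; have [C9 C90 ssq] := sum_inv_sq.
have [D DE] : exists D, D = C4 * (Cs * r1 + e) by exists (C4 * (Cs * r1 + e)).
have Csr : 1 <= Cs * r1 by rewrite -[1]mulr1; apply: ler_pM; lra.
have D1 : 1 <= D by rewrite DE; nra.
have [B BE] : exists B, B = C5 * D / e by exists (C5 * D / e).
have [C6 C60 cnt] := count_ideal X B.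
have B0 : 0 < B by rewrite BE divr_gt0 // mulr_gt0 //; lra.
have [C7 C7E] : exists C7, C7 = C1 ^+ d + C6 * B by exists (C1 ^+ d + C6 * B).
have C70 : 0 < C7 by rewrite C7E addr_gt0 ?exprn_gt0 ?mulr_gt0 //; lra.
pose L := - (d%:R * ln (c3 / D)).
have [C10 C10E] : exists c, c = C6 * C5 * C8 * (D / e) + C7 * 2 * C9.
  by exists (C6 * C5 * C8 * (D / e) + C7 * 2 * C9).
have C100 : 0 < C10.
  have [C50 D0] : 0 < C5 /\ 0 < D by split; lra.
  by rewrite C10E addr_gt0 // ?mulr_gt0 ?divr_gt0 ?invr_gt0.
exists (C10 / c2 ^+ d + `|L|).
  by apply: ltr_wpDr => //; rewrite divr_gt0 ?exprn_gt0.
pose M := D * (2 / e).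
exists (Num.bound (M ^+ d)).+1 => T TT0.
have M0 : 0 < M by rewrite mulr_gt0 ?divr_gt0 //; lra.
have T0 : (0 < T)%N by apply: leq_ltn_trans TT0.
have rootM : M <= root T.
  rewrite -(ler_pXn2r (n := d)) ?fd_gt0 ?nnegrE ?root_ge0 ?(ltW M0) // rootX.
  apply/ltW; apply: lt_le_trans (archi_boundP _) _; first by rewrite exprn_ge0 // ltW.
  by rewrite ler_nat; apply: ltnW.
have D0 : 0 < D by lra.
(* The constant a has size about x, and the ball about it has radius r = e x. The constant D is such
   that the elements of this ball have index at most (D x) ^ d = T. *)
have [x xE] : exists x : R, x = root T / D by exists (root T / D).
have [r rE] : exists r : R, r = e * x by exists (e * x).
have rootE : root T = D * x by rewrite xE mulrC divfK // gt_eqF.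
have rootE' : root T = (D / e) * r by rewrite rE mulrA divfK ?gt_eqF.
have x2 : 2 / e <= x by rewrite xE ler_pdivlMr // mulrC.
have r2 : 2 <= r by rewrite rE mulrC -ler_pdivrMr.
have x1 : 1 <= x by move: r2; rewrite rE; nra.
have ei : e^-1 <= x by apply: le_trans x2; rewrite ler_pMl ?invr_gt0 //; lra.
have [a [Aa xa ax]] := scale x x1.
have [|W Wle hW] := fin r (j a); first by lra.
have Wge : (c2 * r) ^+ d <= W%:R.
  have [m [u [uB uI mge]]] := many r (j a) r2; apply: le_trans mge _; rewrite ler_nat.
  rewrite -(card_ord m); apply: (idx_ge (u := u) (@zeros_sub K) hW) => // t s /eqP.
  by rewrite subr_eq0 => /eqP/uI.
have r0 : 0 < r by lra.
have W0 : 0 < W%:R :> R by apply: lt_le_trans Wge; rewrite exprn_gt0 // mulr_gt0.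
have [v [vB vI vs]] := hW.
have a0 : a != 0 by apply/eqP => a0; move: xa; rewrite a0 sabs0; lra.
have vO i : O (v i) by case: (vB i).
have bv i : box (e * x) (v i - j a) by rewrite -rE; case: (vB i).
have vlow i n := low a (v i) x n Aa (vO i) ei xa (bv i).
have v0 i : v i != 0 by case: (vlow i 0%N).
have idxv i : exists n, [/\ hasidx O (scaled (v i) O) n, (n <= T)%N & (c3 * x) ^+ d <= n%:R].
  have bv' : box ((Cs * r1 + e) * x) (v i).
  have -> : v i = j a * 1 + (v i - j a) by ring.
  have h1 := proj1 (boxZ X r1 1 a0) hr1.
  apply: box_le (boxD h1 (bv i)).
  by rewrite mulrDl lerD2r mulrAC ler_pM2r //; lra.
  have [|n nle hn] := up (v i) ((Cs * r1 + e) * x) (vO i) (v0 i) _ bv'.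
  by rewrite mulr_ege1 // ler_wpDr // ltW.
  exists n; split=> //; last by case: (vlow i n) => _; apply.
  by move: nle; rewrite mulrA -DE -rootE rootX ler_nat.
have [n nP] := choice idxv.
pose w P k := #|[pred i : 'I_W | `[< vge P k%:Z (v i) >]]|.
have hw P k : above P -> hasidx (lball (fun y => O y /\ vge P k%:Z y) (j a) (box r)) zeros (w P k).
  move=> aP; rewrite /w -card_sig.
  apply: (transversal_idx (r := fun s : {i : 'I_W | `[< vge P k%:Z (v i) >]} => v (val s))).
  split=> [s|s t /vI h|y [[Oy hy] by_]].
  - by have [h1 h2] := vB (val s); split=> //; split=> //; apply/asboolP; apply: (valP s).
  - exact: val_inj.
  have [i hi] := vs y (conj Oy by_).
  have yv : y = v i by apply/eqP; rewrite -subr_eq0; apply/eqP.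
  have hvi : `[< vge P k%:Z (v i) >] by apply/asboolP; rewrite -yv.
  by exists (exist _ i hvi).
have lnn : \sum_i ln (n i)%:R = \sum_(P <- ps T) ln (nm P) * \sum_(k < T) (w P k.+1)%:R.
  transitivity (\sum_(i < W) \sum_(P <- ps T) ln (nm P) * \sum_(k < T) (`[< vge P k.+1 (v i) >])%:R).
  by apply: eq_bigr => i _; have [h1 h2 _] := nP i; case: (ln_idx (vO i) (v0 i) h1 h2).
  rewrite exchange_big /=; apply: eq_bigr => P _; rewrite -mulr_sumr exchange_big /=.
  congr (_ * _); apply: eq_bigr => k _; rewrite -natr_sum; congr (_%:R).
  by rewrite /w -sum1_card [RHS]big_mkcond /=; apply: eq_bigr => i _; rewrite inE; case: asboolP.
have cntP P k : P \in ps T -> (prime_norm P ^ k <= T)%N ->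
  `|(prime_norm P ^ k * w P k)%:R - W%:R| <= C6 * (r ^+ d.-1 * (C5 * root (prime_norm P ^ k))).
  move=> PT kT; have aP : above P by case/psP: PT.
  have N0 : (0 < prime_norm P ^ k)%N by rewrite expn_gt0; have := nm_gt1 PT; rewrite ltr1n => /ltnW->.
  have hI := oideal_pow k aP; have [sI IO _] := hI; have hk := opow_idx k aP.
  apply: (cnt r _ _ _ _ _ _ _ _ _ sI IO hk (covI _ _ hI hk N0) (hw P k aP) hW); first by lra.
  by rewrite mulr_ege1 // root_ge1.
  rewrite (_ : B * r = C5 * root T); last by rewrite rootE' BE; ring.
  by rewrite ler_pM2l ?(lt_le_trans ltr01) //; apply: root_le.
have wle P k : P \in ps T -> (w P k)%:R <= C7 * r ^+ d * ((prime_norm P ^ k)%:R)^-1.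
  move=> PT; have N0 : (0 < prime_norm P ^ k)%N by rewrite expn_gt0; have := nm_gt1 PT; rewrite ltr1n => /ltnW->.
  have rd0 : 0 <= r ^+ d by rewrite exprn_ge0 // ltW.
  have [kT|kT] := leqP (prime_norm P ^ k) T; last first.
  rewrite (_ : w P k = 0)%N ?divr_ge0 ?mulr_ge0 //; first exact: ltW.
  apply: eq_card0 => i; rewrite !inE; apply/negP => /asboolP h.
  have [h1 h2 _] := nP i; have [_ /(_ P k PT h)] := ln_idx (vO i) (v0 i) h1 h2.
  by rewrite leqNgt kT.
  rewrite ler_pdivlMr ?ltr0n // -natrM mulnC.
  have := cntP P k PT kT; rewrite ler_distl => /andP[_] /le_trans; apply.
  have dE : d = d.-1.+1 by rewrite prednK ?fd_gt0.
  have h1 : C5 * root (prime_norm P ^ k) <= B * r.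
  rewrite (_ : B * r = C5 * root T); last by rewrite rootE' BE; ring.
  by rewrite ler_pM2l ?(lt_le_trans ltr01) //; apply: root_le.
  rewrite C7E mulrDl; apply: lerD; first by rewrite -exprMn.
  have e' : B * r ^+ d = r ^+ d.-1 * (B * r) by rewrite {1}dE exprSr; ring.
  by rewrite -mulrA e' !ler_pM2l ?exprn_gt0.
pose S1 := \sum_(P <- ps T) ln (nm P) / nm P.
(* For the exponent 1 the error of [count_ideal] is summed by [sum_root]; all higher exponents
   together give O(r ^ d) by [geom_tail] and [sum_inv_sq]. *)
have main1 : `|\sum_i ln (n i)%:R - W%:R * S1| <= C10 * r ^+ d.
  rewrite lnn /S1 mulr_sumr -sumrB.
  apply: (@le_trans _ _ (\sum_(P <- ps T) (C6 * C5 * r ^+ d.-1 * (ln (nm P) * (root (prime_norm P) / nm P))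
  + C7 * 2 * r ^+ d * (ln (nm P) * (nm P ^+ 2)^-1)))).
  apply: le_trans (ler_norm_sum _ _ _) _; apply: sum_in => P PT.
  have nP1 := nm_gt1 PT; have N0 := lt_trans ltr01 nP1.
  rewrite mulrCA -mulrBr normrM ger0_norm ?(ln_nm PT) //.
  have -> : C6 * C5 * r ^+ d.-1 * (ln (nm P) * (root (prime_norm P) / nm P))
  + C7 * 2 * r ^+ d * (ln (nm P) * (nm P ^+ 2)^-1) =
  ln (nm P) * (C6 * C5 * r ^+ d.-1 * (root (prime_norm P) / nm P) + C7 * 2 * r ^+ d * (nm P ^+ 2)^-1) by ring.
  apply: ler_wpM2l; first exact: ln_nm PT.
  have PT' : (prime_norm P ^ 1 <= T)%N by rewrite expn1; case/psP: PT.
  have c1 := cntP P 1%N PT PT'; rewrite expn1 in c1.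
  rewrite -(prednK T0) big_ord_recl addrAC; apply: le_trans (ler_normD _ _) _; apply: lerD.
  rewrite -(ler_pM2r N0) -[X in _ * X]ger0_norm ?(ltW N0) // -normrM mulrBl divfK ?gt_eqF //.
  rewrite -natrM mulnC; apply: le_trans c1 _.
  by rewrite le_eqVlt; apply/orP; left; apply/eqP; field; rewrite gt_eqF.
  rewrite ger0_norm ?sumr_ge0 //; apply: le_trans (ler_sum _ (fun k _ => wle P _ PT)) _.
  have -> : C7 * 2 * r ^+ d * (nm P ^+ 2)^-1 = C7 * r ^+ d * (2 * (nm P ^+ 2)^-1) by ring.
  rewrite -mulr_sumr; apply: ler_wpM2l.
  by rewrite mulr_ge0 ?exprn_ge0 // ltW.
  by apply: geom_tail; rewrite -(ltr_nat R).
  rewrite big_split /= -!mulr_sumr C10E mulrDl; apply: lerD; last first.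
  rewrite [leRHS]mulrAC; apply: ler_wpM2l; last exact: ssq.
  by rewrite !mulr_ge0 ?exprn_ge0 // ltW.
  have dE : d = d.-1.+1 by rewrite prednK ?fd_gt0.
  apply: (@le_trans _ _ (C6 * C5 * r ^+ d.-1 * (C8 * root T))).
  apply: ler_wpM2l; last exact: sroot.
  by rewrite !mulr_ge0 ?exprn_ge0 ?(ltW C60) ?(ltW r0) // (le_trans ler01).
  by rewrite rootE' [in leRHS]dE exprSr le_eqVlt; apply/orP; left; apply/eqP; ring.
(* Each index n i lies between (c3 x) ^ d, a fixed multiple of T, and T itself. *)
have main2 : `|\sum_i ln (n i)%:R - W%:R * ln T%:R| <= W%:R * `|L|.
  have -> : W%:R * ln T%:R = \sum_(i < W) ln T%:R :> R by rewrite sumr_const card_ord mulr_natl.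
  have -> : W%:R * `|L| = \sum_(i < W) `|L| :> R by rewrite sumr_const card_ord mulr_natl.
  rewrite -sumrB; apply: le_trans (ler_norm_sum _ _ _) _; apply: ler_sum => i _.
  have [h1 h2 h3] := nP i.
  have n0 : (0 < n i)%N := idx_gt0 (oint_sub X).1 h1.
  have T0' : 0 < T%:R :> R by rewrite ltr0n.
  have cx : 0 < c3 * x by rewrite mulr_gt0 //; lra.
  have hi : ln (n i)%:R <= ln T%:R :> R by rewrite ler_ln ?posrE ?ltr0n // ler_nat.
  have lo : ln T%:R - L <= ln (n i)%:R :> R.
  have -> : ln T%:R - L = ln ((c3 * x) ^+ d) :> R; last first.
  by rewrite ler_ln ?posrE ?ltr0n ?exprn_gt0.
  have -> : c3 * x = (c3 / D) * root T by rewrite xE; ring.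
  rewrite exprMn rootX lnM ?posrE ?exprn_gt0 ?divr_gt0 // lnXn ?divr_gt0 //.
  by rewrite /L opprK addrC mulr_natl.
  have := ler_norm L; have := ler_norm (- L); rewrite normrN ler_norml; lra.
have rW : r ^+ d <= W%:R / c2 ^+ d by rewrite ler_pdivlMr ?exprn_gt0 // mulrC -exprMn.
have : `|W%:R * S1 - W%:R * ln T%:R| <= W%:R * (C10 / c2 ^+ d + `|L|).
  have -> : W%:R * S1 - W%:R * ln T%:R = (\sum_i ln (n i)%:R - W%:R * ln T%:R) - (\sum_i ln (n i)%:R - W%:R * S1) by ring.
  apply: le_trans (ler_normB _ _) _; rewrite addrC mulrDr; apply: lerD => //.
  apply: le_trans main1 _; rewrite mulrCA ler_pM2l //.
by rewrite -mulrBr normrM ger0_norm ?(ltW W0) // ler_pM2l.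
Qed.

End Mertens.

(** * The residue field as a finite field *)

Section ResidueField.
Variables (K : fieldType) (P : set K) (N : nat) (r : 'I_N -> K).
Hypotheses (hP : is_prime P) (hr : transversal P (max_ideal P) r).

(** The carrier is the index set of the transversal; the [let]s make the type mention P and r, so
    that the field structure they define can be attached to it. *)
Definition resid : Type := let _ := hr in let _ := hP in 'I_N.
Let rP (i : resid) : P (r i). Proof. by case: hr => h _ _; apply: h. Qed.
Let rI (i k : resid) : max_ideal P (r i - r k) -> i = k.
Proof. by case: hr => _ h _; apply: h. Qed.
Let i0 : resid.
Proof. by have [_ _ h] := hr; have [i _] := cid (h 0 (prime0 hP)); exact: i. Defined.
Let sm := max_sub hP.
Definition rcl (x : K) : resid := xget i0 (fun i : resid => max_ideal P (x - r i)).
Lemma rclP x : P x -> max_ideal P (x - r (rcl x)).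
Proof. by have [_ _ h] := hr; move=> /h[i hi]; apply: (@xgetPex _ i0 (fun i : resid => max_ideal P (x - r i))); exists i. Qed.

Lemma rcl_eq x y : P x -> P y -> rcl x = rcl y <-> max_ideal P (x - y).
Proof.
move=> Px Py; split=> [e|h]; last apply: rI.
  by apply: (subg_trans sm (rclP Px)); rewrite e; apply/(subgC sm)/rclP.
apply: (subg_trans sm (subgC sm (rclP Px))); exact: subg_trans sm h (rclP Py).
Qed.

Lemma rclK (i : resid) : rcl (r i) = i. Proof. by apply: rI; apply/(subgC sm)/rclP. Qed.
Definition radd (i k : resid) := rcl (r i + r k).
Definition ropp (i : resid) := rcl (- r i).
Definition rmul (i k : resid) := rcl (r i * r k).
Definition rinv (i : resid) := if i == rcl 0 :> 'I_N then rcl 0 else rcl (r i)^-1.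

Lemma rcl_add x y : P x -> P y -> rcl (x + y) = radd (rcl x) (rcl y).
Proof.
move=> Px Py; apply/rcl_eq; [exact: primeD | exact: primeD |].
by rewrite opprD addrACA; apply: subgD => //; apply: rclP.
Qed.
Lemma rcl_mul x y : P x -> P y -> rcl (x * y) = rmul (rcl x) (rcl y).
Proof.
move=> Px Py; apply/rcl_eq; [exact: primeM | exact: primeM |].
have -> : x * y - r (rcl x) * r (rcl y) = y * (x - r (rcl x)) + r (rcl x) * (y - r (rcl y)) by ring.
by apply: subgD => //; apply: maxM => //; apply: rclP.
Qed.

Let P0 := prime0 hP. Let P1 := prime1 hP.
Let PD := primeD hP. Let PM := primeM hP. Let PN := primeN hP.

Lemma raddA : associative radd.
Proof.
move=> i k l; rewrite -(rclK i) -(rclK k) -(rclK l) -!rcl_add ?addrA //; exact: PD.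
Qed.
Lemma raddC : commutative radd. Proof. by move=> i k; rewrite /radd addrC. Qed.
Lemma radd0 : left_id (rcl 0) radd.
Proof. by move=> i; rewrite -{1}(rclK i) -rcl_add // add0r rclK. Qed.
Lemma raddN : left_inverse (rcl 0) ropp radd.
Proof. by move=> i; rewrite -{2}(rclK i) /ropp -rcl_add ?addNr //; apply: PN. Qed.
HB.instance Definition _ := Finite.copy resid 'I_N.
HB.instance Definition _ := GRing.isZmodule.Build resid raddA raddC radd0 raddN.

Lemma rmulA : associative rmul.
Proof.
move=> i k l; rewrite -(rclK i) -(rclK k) -(rclK l) -!rcl_mul ?mulrA //; exact: PM.
Qed.
Lemma rmulC : commutative rmul. Proof. by move=> i k; rewrite /rmul mulrC. Qed.
Lemma rmul1 : left_id (rcl 1) rmul.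
Proof. by move=> i; rewrite -{1}(rclK i) -rcl_mul // mul1r rclK. Qed.
Lemma rmulD : left_distributive rmul radd.
Proof.
move=> i k l; rewrite -(rclK i) -(rclK k) -(rclK l) -rcl_add // -!rcl_mul //; last exact: PD.
by rewrite mulrDl rcl_add //; apply: PM.
Qed.
Lemma r1_neq0 : rcl 1 != rcl 0 :> resid.
Proof. by apply/eqP => /rcl_eq -/(_ P1 P0); rewrite subr0; apply: max_not1. Qed.
HB.instance Definition _ := GRing.Zmodule_isComNzRing.Build resid rmulA rmulC rmul1 rmulD r1_neq0.

Lemma rmulV (i : resid) : i != 0 -> rmul (rinv i) i = 1.
Proof.
move=> i0'; have n0 : ~ max_ideal P (r i).
  by rewrite -[r i]subr0 => /rcl_eq -/(_ (rP i) P0); rewrite rclK => h; rewrite h eqxx in i0'.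
have r0 : r i != 0 by apply/eqP => h; apply: n0; rewrite h; exact: sm.1.
rewrite /rinv ifN // -{2}(rclK i) -rcl_mul ?mulVf //.
by apply: contrapT => n; apply: n0; split=> //; right.
Qed.
Lemma rinv0 : rinv 0 = 0. Proof. by rewrite /rinv eqxx. Qed.
HB.instance Definition _ := GRing.ComNzRing_isField.Build resid rmulV rinv0.

End ResidueField.

(* c is reduction modulo the maximal ideal of P, onto the residue field k. *)
Definition residue_map (K : fieldType) (P : set K) (k : finFieldType) (c : K -> k) : Prop :=
  [/\ c 1 = 1, forall x y, P x -> P y -> c (x + y) = c x + c y,
  forall x y, P x -> P y -> c (x * y) = c x * c y,
  forall a, exists2 x, P x & c x = a &
  forall x, P x -> c x = 0 <-> max_ideal P x].

Lemma residue_ex (K : fieldType) (P : set K) N : is_prime P -> hasidx P (max_ideal P) N ->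
  exists (k : finFieldType) (c : K -> k), residue_map P c /\ #|k| = N.
Proof.
move=> hP [r hr]; exists (resid hP hr), (rcl hP hr : K -> resid hP hr); split; last exact: card_ord.
split=> [//|x y Px Py|x y Px Py|a|x Px]; [exact: rcl_add | exact: rcl_mul | |].
  by have [h _ _] := hr; exists (r a); [exact: h | exact: rclK].
by rewrite -[0]/(rcl hP hr 0) (rcl_eq hP hr Px (prime0 hP)) subr0.
Qed.

Section ResidueTheory.
Variables (K : fieldType) (P : set K) (k : finFieldType) (c : K -> k).
Hypotheses (hP : is_prime P) (hc : residue_map P c).

Lemma res1 : c 1 = 1. Proof. by case: hc. Qed.
Lemma resD x y : P x -> P y -> c (x + y) = c x + c y. Proof. by case: hc => _ h _ _ _; apply: h. Qed.
Lemma resM x y : P x -> P y -> c (x * y) = c x * c y. Proof. by case: hc => _ _ h _ _; apply: h. Qed.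
Lemma res_surj a : exists2 x, P x & c x = a. Proof. by case: hc. Qed.
Lemma res_max x : P x -> c x = 0 <-> max_ideal P x. Proof. by case: hc => _ _ _ _ h; apply: h. Qed.
Lemma res0 : c 0 = 0. Proof. by apply/res_max; [exact: prime0 | exact: (max_sub hP).1]. Qed.
Lemma resN x : P x -> c (- x) = - c x.
Proof.
move=> Px; apply/eqP; rewrite -addr_eq0 -resD ?addNr ?res0 //; exact: primeN.
Qed.
Lemma resB x y : P x -> P y -> c (x - y) = c x - c y.
Proof. by move=> Px Py; rewrite resD ?resN //; apply: primeN. Qed.
Lemma res_eq x y : P x -> P y -> c x = c y <-> max_ideal P (x - y).
Proof.
move=> Px Py; rewrite -(res_max (primeB hP Px Py)) resB //.
by split=> [->|/eqP]; [rewrite subrr | rewrite subr_eq0 => /eqP].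
Qed.
Lemma resX x n : P x -> c (x ^+ n) = c x ^+ n.
Proof.
move=> Px; elim: n => [|n IH]; first by rewrite !expr0 res1.
by rewrite !exprS resM ?IH //; apply: primeX.
Qed.
Lemma res_sum (I : Type) (s : seq I) (f : I -> K) : (forall i, P (f i)) ->
  c (\sum_(i <- s) f i) = \sum_(i <- s) c (f i).
Proof.
move=> hf; elim: s => [|i s IH]; first by rewrite !big_nil res0.
rewrite !big_cons resD ?IH //; elim/big_ind: _ => //; [exact: prime0 | by move=> *; apply: primeD].
Qed.

Lemma fermat x : P x -> max_ideal P (x ^+ #|k| - x).
Proof.
by move=> Px; apply/res_eq; [exact: primeX | | rewrite resX // expf_card].
Qed.
End ResidueTheory.

(** k is a vector space over F: a family of greatest length with injective combinations also spans,
    hence is a basis. *)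
Lemma card_power (F : finFieldType) (k : finFieldType) (f : {rmorphism F -> k}) :
  exists2 m, (0 < m)%N & #|k| = (#|F| ^ m)%N.
Proof.
have F1 : (1 < #|F|)%N := finNzRing_gt1 F.
pose comb m (x : 'I_m -> k) (a : {ffun 'I_m -> F}) := \sum_i f (a i) * x i.
pose T m := `[< exists x : 'I_m -> k, injective (comb m x) >].
have T0 : exists m, T m.
  by exists 0%N; apply/asboolP; exists (fun _ => 0) => a b _; apply/ffunP => -[].
have Tb m : T m -> (m <= #|k|)%N.
  move=> /asboolP[x /leq_card]; rewrite card_ffun card_ord => h.
  by apply: leq_trans h; apply/ltnW/ltn_expl.
case: (ex_maxnP T0 Tb) => m /asboolP[x xI] mmax.
have surj y : exists a, comb m x a = y.
  apply: contrapT => ny; suff /mmax : T m.+1 by rewrite ltnn.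
  apply/asboolP; exists (fun i => if unlift ord0 i is Some l then x l else y) => a b.
  have bl (d : {ffun 'I_m.+1 -> F}) :
  \sum_(i < m) f (d (lift ord0 i)) * (if unlift ord0 (lift ord0 i) is Some l then x l else y) =
  \sum_(i < m) f (d (lift ord0 i)) * x i by apply: eq_bigr => i _; rewrite liftK.
  rewrite /comb !big_ord_recl unlift_none !bl => h.
  have h' : f (a ord0 - b ord0) * y = comb m x [ffun i => b (lift ord0 i) - a (lift ord0 i)].
  rewrite rmorphB mulrBl; apply/eqP; rewrite subr_eq addrC; apply/eqP.
  apply: (@addIr _ (\sum_(i < m) f (a (lift ord0 i)) * x i)).
  rewrite h -addrA; congr (_ + _); rewrite /comb -big_split; apply: eq_bigr => i _ /=.
  by rewrite ffunE rmorphB; ring.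
  have [ab|ab] := eqVneq (a ord0) (b ord0); last first.
  case: ny; exists [ffun i => (a ord0 - b ord0)^-1 * (b (lift ord0 i) - a (lift ord0 i))].
  have ab0 : f (a ord0 - b ord0) != 0 by rewrite fmorph_eq0 subr_eq0.
  apply: (mulfI ab0); rewrite h' /comb mulr_sumr; apply: eq_bigr => i _.
  by rewrite !ffunE rmorphM fmorphV mulrA mulVKf.
  have e : [ffun i => a (lift ord0 i)] = [ffun i => b (lift ord0 i)].
  apply: xI; move: h; rewrite /comb ab => /addrI h.
  rewrite (eq_bigr (fun i => f (a (lift ord0 i)) * x i)) => [|i _]; last by rewrite ffunE.
  by rewrite h; apply: eq_bigr => i _; rewrite ffunE.
  apply/ffunP => i; case: (unliftP ord0 i) => [l|] -> //.
  by have := congr1 (fun g : {ffun _ -> _} => g l) e; rewrite !ffunE.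
have [g gP] := choice surj.
exists m.
  rewrite lt0n; apply/eqP => m0; have [a ha] := surj 1.
  by have := oner_neq0 k; rewrite -ha /comb big1 ?eqxx // => -[i i_lt]; exfalso; rewrite m0 in i_lt.
apply/eqP; rewrite eqn_leq; apply/andP; split.
  have /leq_card : injective g by move=> y z h; rewrite -(gP y) h gP.
  by rewrite card_ffun card_ord.
by have := leq_card _ xI; rewrite card_ffun card_ord.
Qed.

(** * The base ring Z *)

Section SizedInt.
Variable R : realType.
Definition qint : set rat := fun x => x \is a Num.int.
Definition qabs (x : rat) : R := ratr `|x|.
Lemma qabs_nat (n : nat) : qabs n%:R = n%:R. Proof. by rewrite /qabs normr_nat ratr_nat. Qed.

Lemma qint_ball (r : R) : 0 < r -> exists m : nat, [/\ m%:R < r, r <= m.+1%:R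
  & hasidx (fun a => qint a /\ qabs a < r) (fun a => a = 0) m.*2.+1].
Proof.
move=> r0; have ex : exists m : nat, r <= m.+1%:R.
  by exists (Num.bound r); apply/ltW; apply: lt_le_trans (archi_boundP (ltW r0)) _; rewrite ler_nat.
case: (ex_minnP ex) => m rm mmin; exists m; have mr : m%:R < r.
  case: m rm mmin => // m rm mmin; rewrite ltNge; apply/negP => h.
  by have := mmin _ h; rewrite ltnn.
split=> //; exists (fun i => (Posz i - Posz m)%:~R); split=> [i|i l|x [/intrP[z ->] hz]].
- split; first exact: intr_int.
  apply: le_lt_trans mr; rewrite /qabs -intr_norm ratr_int -[m%:R]/(m%:Z%:~R : R) ler_int.
  by have := ltn_ord i; lia.
- by rewrite -rmorphB => /eqP; rewrite intr_eq0 => /eqP h; apply: val_inj => /=; lia.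
have zm : `|z| <= m.
  move: hz; rewrite /qabs -intr_norm ratr_int => /lt_le_trans /(_ rm).
  by rewrite -[m.+1%:R]/(m.+1%:Z%:~R : R) ltr_int; lia.
have lt : (absz (z + Posz m)%R < m.*2.+1)%N by lia.
exists (Ordinal lt); apply/eqP; rewrite -rmorphB intr_eq0 /=; lia.
Qed.

Lemma qint_round (x : rat) : exists2 a, qint a & qabs (x - a) < 1.
Proof.
exists (Num.floor x)%:~R; first exact: intr_int.
have -> : (1 : R) = ratr 1 by rewrite rmorph1.
rewrite /qabs ltr_rat ltr_norml.
by have := floor_le x; have := floorD1_gt x; rewrite intrD; lra.
Qed.

Lemma sized_int_ex : exists S : sized R rat, sA S = qint /\ sabs S = qabs.
Proof.
unshelve eexists (@Sized R rat qint qabs _ _ _ _ _ _ _ _ qint_round _ _ _ _); last by [].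
- exact: (intr_int _ 1).
- by move=> a b; apply: rpredB.
- by move=> a b; apply: rpredM.
- by rewrite /qabs normr0 rmorph0.
- by move=> a a0; rewrite /qabs ltr0q normr_gt0.
- by move=> a b; rewrite /qabs normrM rmorphM.
- by move=> a b; rewrite /qabs -rmorphD ler_rat ler_normD.
- move=> a /intrP[z ->]; rewrite /qabs -intr_norm ratr_int -[1]/(1%:Z%:~R : R) ltr_int => h.
  by have -> : z = 0 by lia.
- move=> x; exists (denq x)%:~R; split; [by rewrite intr_eq0 denq_neq0 | exact: intr_int |].
  by rewrite mulrC -numqE; apply: intr_int.
- exists 2 => [|X X1]; first by rewrite ler1n.
  have X0 : 0 <= X by lra.
  have /andP[h1 h2] := truncn_itv X0.
  exists (Num.truncn X).+1%:R; rewrite qabs_nat; split.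
  + by rewrite -[_%:R]/((Num.truncn X).+1%:Z%:~R); apply: intr_int.
  + exact: ltW.
  by rewrite -natr1; lra.
- exists 1, 3; split=> // r r1; have [m [h1 h2 h3]] := @qint_ball r ltac:(lra).
  exists m.*2.+1; split=> //; rewrite -addnn -addn1 !natrD; move: h2; rewrite -natr1; lra.
(* Radii differing from r by 2 h leave room for two displacements of size less than h. *)
exists 10 => // r h h1 h4; exists (r - 2 * h), (r + 2 * h).
have [m1 [a1 a2 a3]] := @qint_ball (r - 2 * h) ltac:(lra).
have [m2 [b1 b2 b3]] := @qint_ball (r + 2 * h) ltac:(lra).
have qD x y z : qabs (x + y + z) <= qabs x + qabs y + qabs z.
  rewrite /qabs -!rmorphD ler_rat; apply: le_trans (ler_normD _ _) _.
  by rewrite lerD2r ler_normD.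
exists m1.*2.+1, m2.*2.+1; split=> // [x y z h2 h3 h5|x y z h2 h3 h5|].
- by apply: le_lt_trans (qD x y z) _; lra.
- by apply: le_lt_trans (qD x y z) _; lra.
have m12 : (m1 < m2.+1)%N by rewrite -(ltr_nat R); apply: lt_trans a1 _; lra.
have e k : k.*2.+1%:R = 2 * k%:R + 1 :> R by rewrite -addn1 natrD -muln2 natrM mulrC.
move: a2 b2; rewrite !e -!natr1 => a2 b2.
by clear a3 b3 qD; split; [lra | lra | lia].
Qed.

End SizedInt.

(** * The base ring F[t] with the absolute value at infinity *)

Section SizedPoly.
Variables (R : realType) (F : finFieldType).
Local Notation F0 := {fraction {poly F}}.
Local Notation q := #|F|.

(** The quotient defining the field of fractions is opened here, to express a class by the numerator
    and denominator of a representative. *)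
Lemma frac_rep (x : F0) : exists u v : {poly F}, v != 0 /\ x = tf u / tf v.
Proof.
elim/quotW: x => /= y; exists (frac y).1, (frac y).2; have d0 := denom_ratioP y.
split=> //; have d0' : tf (frac y).2 != 0 by rewrite tofrac_eq0.
apply: (mulIf d0'); rewrite divfK // -{1}(FracField.Ratio_numden y).
change (FracField.mul (\pi_(FracField.type {poly F}) (Ratio (frac y).1 (frac y).2))%qT
  (tf (frac y).2) = tf (frac y).1).
rewrite !piE.
apply/eqmodP; rewrite /= FracField.equivfE /FracField.mulf.
rewrite !numden_Ratio ?mulf_neq0 ?oner_eq0 // !mulr1 //.
by rewrite mulrC.
Qed.

(** The absolute value of the place at infinity, q to the degree. *)
Definition psz (u : {poly F}) : R := if u == 0 then 0 else (q ^ (size u).-1)%:R.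
Let q1 : (1 < q)%N := finNzRing_gt1 F.
Let q0 : (0 < q)%N := ltnW q1.
Lemma psz_gt0 u : u != 0 -> 0 < psz u.
Proof. by rewrite /psz => /negPf->; rewrite ltr0n expn_gt0 q0. Qed.
Lemma psz_neq0 u : u != 0 -> psz u != 0. Proof. by move/psz_gt0; rewrite lt0r => /andP[]. Qed.
Lemma psz_ge0 u : 0 <= psz u. Proof. by rewrite /psz; case: eqP. Qed.
Lemma pszM u v : psz (u * v) = psz u * psz v.
Proof.
rewrite /psz mulf_eq0; case: eqVneq => [|u0]; first by rewrite mul0r.
case: eqVneq => [|v0] /=; first by rewrite mulr0.
by rewrite size_mul // -natrM -expnD; congr ((_ ^ _)%:R); move: u0 v0; rewrite -!size_poly_gt0; move: (size u) (size v) => m n; lia.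
Qed.
Lemma psz_lt u (n : nat) : (psz u < (q ^ n)%:R) = (size u <= n)%N.
Proof.
rewrite /psz; case: eqVneq => [->|u0]; first by rewrite size_poly0 ltr0n expn_gt0 q0.
by move: u0; rewrite -size_poly_gt0 ltr_nat ltn_exp2l //; move: (size u) => m; lia.
Qed.
Lemma psz_le u v : psz u <= psz v = (size u <= size v)%N.
Proof.
rewrite /psz; case: eqVneq => [->|u0]; first by rewrite size_poly0 psz_ge0.
case: eqVneq => [->|v0].
  by rewrite size_poly0 leqn0 size_poly_eq0 (negPf u0) leNgt ltr0n expn_gt0 q0.
by move: u0 v0; rewrite -!size_poly_gt0 ler_nat leq_exp2l //; move: (size u) (size v) => m n; lia.
Qed.
Lemma pszD u v : psz (u + v) <= Num.max (psz u) (psz v).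
Proof.
by rewrite le_max !psz_le; have := size_polyD u v; rewrite /maxn; case: ltnP => _ ->; rewrite ?orbT.
Qed.

(** A chosen fraction, not reduced; [fabsE] shows that the absolute value does not depend on the
    choice. *)
Definition fnum (x : F0) := projT1 (cid (frac_rep x)).
Definition fden (x : F0) := projT1 (cid (projT2 (cid (frac_rep x)))).
Lemma fdenP x : fden x != 0 /\ x = tf (fnum x) / tf (fden x).
Proof. exact: (projT2 (cid (projT2 (cid (frac_rep x))))). Qed.
Definition fabs (x : F0) : R := psz (fnum x) / psz (fden x).

Lemma fabsE u v : v != 0 -> fabs (tf u / tf v) = psz u / psz v.
Proof.
move=> v0; have [d0 e] := fdenP (tf u / tf v); rewrite /fabs.
move: (fnum _) (fden _) d0 e => n d d0 e.
have : tf (u * d) = tf (n * v).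
  have tv : tf v != 0 by rewrite tofrac_eq0.
  have td : tf d != 0 by rewrite tofrac_eq0.
  by rewrite !rmorphM /= -(divfK tv (tf u)) e mulrAC divfK // mulrAC.
move/eqP; rewrite tofrac_eq => /eqP /(congr1 psz); rewrite !pszM => h.
have pv := psz_neq0 v0; have pd := psz_neq0 d0.
by apply: (mulIf pd); apply: (mulIf pv); rewrite divfK // -h mulrAC divfK.
Qed.
Lemma fabs_poly u : fabs (tf u) = psz u.
Proof.
have := @fabsE u 1 (oner_neq0 _); rewrite rmorph1 divr1 => ->.
by rewrite {2}/psz oner_eq0 size_poly1 expn0 divr1.
Qed.
Lemma fabsM x y : fabs (x * y) = fabs x * fabs y.
Proof.
have [u [v [v0 ->]]] := frac_rep x; have [u' [v' [v0' ->]]] := frac_rep y.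
rewrite mulrACA -invfM -!rmorphM /= !fabsE ?mulf_neq0 // !pszM invfM; exact: mulrACA.
Qed.
Lemma fabs_max x y : fabs (x + y) <= Num.max (fabs x) (fabs y).
Proof.
have [u [v [v0 ->]]] := frac_rep x; have [u' [v' [v0' ->]]] := frac_rep y.
have tv : tf v != 0 by rewrite tofrac_eq0.
have tv' : tf v' != 0 by rewrite tofrac_eq0.
have -> : tf u / tf v + tf u' / tf v' = tf (u * v' + u' * v) / tf (v * v').
  have e1 := tofracD (u * v') (u' * v); have e2 := tofracM u v'; have e3 := tofracM u' v.
  have e4 := tofracM v v'; rewrite e1 e2 e3 e4.
  have h := addf_div (tf u : F0) (tf u' : F0) tv tv'; rewrite h.
  reflexivity.
have aux (a b c : {poly F}) : c != 0 -> tf a / tf b = tf (a * c) / tf (b * c).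
  move=> c0; have tc : tf c != 0 by rewrite tofrac_eq0.
  by rewrite !tofracM -mulf_div divff ?mulr1.
have vv : v' * v = v * v' := mulrC _ _.
rewrite (aux u v v' v0') (aux u' v' v v0) vv.
rewrite !fabsE ?mulf_neq0 //; have p0 := psz_gt0 (mulf_neq0 v0 v0').
have pi0 : 0 <= (psz (v * v'))^-1 by rewrite invr_ge0 ltW.
by rewrite -maxr_pMl //; apply: ler_wpM2r => //; apply: pszD.
Qed.

Definition fpoly : set F0 := fun x => exists u, x = tf u.

Lemma fpoly_ball (r : R) : 1 <= r -> exists n : nat, [/\ r <= (q ^ n)%:R, (q ^ n)%:R <= q%:R * r
  & hasidx (fun a => fpoly a /\ fabs a < r) (fun a => a = 0) (q ^ n)].
Proof.
move=> r1; have ex : exists n : nat, r <= (q ^ n)%:R.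
  exists (Num.bound r); apply/ltW; apply: lt_trans (archi_boundP _) _; first by lra.
  by rewrite ltr_nat ltn_expl.
case: (ex_minnP ex) => n rn nmin.
have lo k : (q ^ k)%:R < r <-> (k < n)%N.
  split=> h; last by rewrite ltNge; apply/negP => /nmin; rewrite leqNgt h.
  by rewrite -(ltn_exp2l _ _ q1) -(ltr_nat R); apply: lt_le_trans rn.
have ltE u : fabs (tf u) < r <-> (size u <= n)%N.
  rewrite fabs_poly -psz_lt; split=> h; first exact: lt_le_trans rn.
  move: h; rewrite /psz; case: eqP => [_ _|_]; first by lra.
  by rewrite ltr_nat ltn_exp2l // => /lo.
exists n; split=> //.
  case: n lo {rn nmin ltE} => [|n] lo; first by rewrite expn0 -[1%:R]mul1r; apply: ler_pM => //; rewrite ler1n.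
  by rewrite expnS natrM ler_pM2l ?ltr0n //; apply/ltW/lo.
have -> : (q ^ n)%N = #|{ffun 'I_n -> F}| by rewrite card_ffun card_ord.
apply: (transversal_idx (r := fun f : {ffun 'I_n -> F} => tf (\poly_(i < n) (oapp f 0 (insub i))))).
split=> [f|f g|_ [[u ->] /ltE hu]].
- by split; [eexists | apply/ltE; apply: size_poly].
- rewrite -rmorphB => /eqP; rewrite tofrac_eq0 subr_eq0 => /eqP/polyP h; apply/ffunP => i.
  by have := h i; rewrite !coef_poly ltn_ord !valK.
exists [ffun i : 'I_n => u`_i]; apply/eqP; rewrite -rmorphB tofrac_eq0 subr_eq0; apply/eqP/polyP => i.
rewrite coef_poly; case: ltnP => h; last by rewrite nth_default // (leq_trans hu).
by rewrite insubT /= ffunE.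
Qed.

Lemma sized_poly_ex : exists S : sized R F0, sA S = fpoly /\ sabs S = fabs.
Proof.
have mxD a b : Num.max a b <= a + b :> R -> True by [].
unshelve eexists (@Sized R F0 fpoly fabs _ _ _ _ _ _ _ _ _ _ _ _ _); last by [].
- by exists 1; rewrite rmorph1.
- by move=> _ _ [u ->] [v ->]; exists (u - v); rewrite rmorphB.
- by move=> _ _ [u ->] [v ->]; exists (u * v); rewrite rmorphM.
- by rewrite -(rmorph0 tf) fabs_poly /psz eqxx.
- move=> a a0; have [u [v [v0 aE]]] := frac_rep a; rewrite aE fabsE // divr_gt0 ?psz_gt0 //.
  by apply: contraNneq a0 => u0; rewrite aE u0 rmorph0 mul0r.
- exact: fabsM.
- move=> a b; apply: le_trans (fabs_max a b) _; rewrite ge_max.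
  have f0 x : 0 <= fabs x by rewrite divr_ge0 ?psz_ge0.
  by rewrite lerDl lerDr !f0.
- by move=> _ [u ->]; rewrite fabs_poly -[1]/((q ^ 0)%:R) psz_lt leqn0 size_poly_eq0 => /eqP->; rewrite rmorph0.
- move=> x; have [u [v [v0 ->]]] := frac_rep x; exists (tf (u %/ v)); first by eexists.
  have tv : tf v != 0 by rewrite tofrac_eq0.
  have -> : tf u / tf v - tf (u %/ v) = tf (u %% v) / tf v.
  by rewrite {1}(divp_eq u v) rmorphD rmorphM /= mulrDl mulfK // addrAC subrr add0r.
  rewrite fabsE // ltr_pdivrMr ?psz_gt0 // mul1r ltNge psz_le -ltnNge; exact: ltn_modpN0.
- move=> x; have [u [v [v0 ->]]] := frac_rep x; exists (tf v); split.
  + by rewrite tofrac_eq0.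
  + by eexists.
  by exists u; rewrite mulrC divfK // tofrac_eq0.
- exists q%:R => [|X X1]; first by rewrite ler1n.
  have [n [h1 h2 _]] := fpoly_ball X1; exists (tf 'X^n); rewrite fabs_poly; split=> //; first by eexists.
  by rewrite /psz -size_poly_eq0 size_polyXn.
  by rewrite /psz -size_poly_eq0 size_polyXn.
- exists 1, q%:R; split; rewrite ?ltr0n // => r r1.
  by have [n [h1 h2 h3]] := fpoly_ball r1; exists (q ^ n)%N; rewrite mul1r.
exists q%:R => [|r h h1 h4]; first by rewrite ltr0n.
have r1 : 1 <= r by lra.
have [n [_ h2 h3]] := fpoly_ball r1.
have um x y z : fabs x < r -> fabs y < h -> fabs z < h -> fabs (x + y + z) < r.
  move=> hx hy hz; apply: le_lt_trans (fabs_max _ _) _; rewrite gt_max; apply/andP; split; last by lra.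
  by apply: le_lt_trans (fabs_max _ _) _; rewrite gt_max hx /=; lra.
exists r, r, (q ^ n)%N, (q ^ n)%N; split=> //; split=> //.
by rewrite lerDl mulr_ge0 //; lra.
Qed.

End SizedPoly.

(** * Integral bases of finite extensions *)

Section FinextBuild.
Variables (R : realType) (F : fieldType) (S : sized R F) (K : fieldType).
Variables (j : {rmorphism F -> K}) (I : finType) (w : I -> K) (co : K -> I -> F).
Hypothesis coK : forall x, x = \sum_i j (co x i) * w i.
Hypothesis coB : forall x y i, co (x - y) i = co x i - co y i.
Hypothesis coZ : forall a x i, co (j a * x) i = a * co x i.
Hypothesis cow : forall i k, co (w i) k = (i == k)%:R.

(** The basis is multiplied by a common denominator D of its structure constants; the new structure
    constants are D times the old ones and lie in A. *)
Lemma finext_build : exists X : finext S K, fj X = j.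
Proof.
have [b bP] := choice (fun t : I * I * I => sA_frac S (co (w t.1.1 * w t.1.2) t.2)).
pose D := \prod_t b t.
have AP (s : seq (I * I * I)) : sA S (\prod_(t <- s) b t).
  by elim/big_ind: _ => [||t _]; [apply: sA1 | apply: sAM | case: (bP t)].
have D0 : D != 0 by apply/prodf_neq0 => t _; case: (bP t).
have hD t : sA S (D * co (w t.1.1 * w t.1.2) t.2).
  rewrite /D (bigD1 t) //= mulrAC mulrC; apply: sAM; first by rewrite -big_filter; apply: AP.
  by case: (bP t).
have jD0 : j D != 0 by rewrite fmorph_eq0.
unshelve eexists (@Finext R F S K j #|I| (fun i => j D * w (enum_val i))
  (fun x i => co x (enum_val i) / D) _ _ _ _ _); last by [].
- move=> x; rewrite {1}(coK x) (reindex (@enum_val I I)) /=; last first.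
  by apply: onW_bij; apply: enum_val_bij.
  by apply: eq_bigr => i _; rewrite mulrA -rmorphM divfK.
- by move=> x y i /=; rewrite coB mulrBl.
- by move=> a x i /=; rewrite coZ mulrA.
- move=> i k /=; rewrite coZ mulrAC divff // mul1r cow (inj_eq enum_val_inj) //.
move=> i k l /=; rewrite mulrACA -mulrA !coZ mulrCA mulrAC mulrA divff // mul1r.
by have := hD (enum_val i, enum_val k, enum_val l); rewrite /= mulrC.
Qed.
End FinextBuild.

Lemma finext_bij (R : realType) (F : fieldType) (S : sized R F) (N : fieldExtType F)
  (K : fieldType) (f : {rmorphism N -> K}) : bijective f ->
  exists X : finext S K, forall a, fj X a = f (a%:A).
Proof.
move=> [g fK gK]; pose b := vbasis {:N}%VS.
have bB := vbasisP {:N}%VS.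
pose j : {rmorphism F -> K} := (f : N -> K) \o in_alg N.
have gB x y : g (x - y) = g x - g y by apply: (can_inj fK); rewrite rmorphB !gK.
have [||||X XE] := @finext_build R F S K j 'I_(\dim {:N}) (fun i => f b`_i) (fun x i => coord b i (g x)).
- move=> x; rewrite -{1}(gK x) {1}(coord_vbasis (memvf (g x))) rmorph_sum; apply: eq_bigr => i _ /=.
  by rewrite -rmorphM mulr_algl.
- by move=> x y i; rewrite gB linearB.
- move=> a x i; have -> : g (j a * x) = a *: g x.
  by apply: (can_inj fK); rewrite gK -mulr_algl rmorphM gK.
  by rewrite linearZ.
- by move=> i k; rewrite fK coord_free ?(basis_free bB).
by exists X => a; rewrite XE.
Qed.

Lemma finext_tower (R : realType) (F : fieldType) (S : sized R F) (K : fieldType)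
  (X : finext S K) (L : fieldExtType K) : exists Y : finext S L, forall a, fj Y a = (fj X a)%:A.
Proof.
pose b := vbasis {:L}%VS; have bB := vbasisP {:L}%VS.
pose j : {rmorphism F -> L} := in_alg L \o fj X.
have [||||Y YE] := @finext_build R F S L j ('I_(\dim {:L}) * 'I_(fd X))%type
  (fun t => (fw X t.2)%:A * b`_t.1) (fun x t => fco X (coord b t.1 x) t.2).
- move=> x; rewrite {1}(coord_vbasis (memvf x)).
  rewrite -(pair_bigA _ (fun i k => j (fco X (coord b i x) k) * ((fw X k)%:A * b`_i))) /=.
  apply: eq_bigr => i _; rewrite {1}(fcoK X (coord b i x)) scaler_suml; apply: eq_bigr => k _.
  by rewrite !mulr_algl scalerA.
- by move=> x y t; rewrite linearB fcoB.
- by move=> a x t; rewrite /= mulr_algl linearZ /= fcoZ.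
- move=> [i k] [i' k'] /=; rewrite mulr_algl linearZ /= coord_free ?(basis_free bB) // xpair_eqE.
  case: (i == i'); first by rewrite mulr1 fcow.
  by rewrite mulr0 fco0.
by exists Y => a; rewrite YE.
Qed.

(** * Number fields: the Chebyshev element and the primes of equal norm *)

Section ChebInt.
Variables (R : realType) (S : sized R rat) (K : fieldType) (X : finext S K).
Hypotheses (SA : sA S = qint) (Sabs : sabs S = @qabs R).

Lemma j_int (n : nat) : fj X n%:R = n%:R. Proof. exact: rmorph_nat. Qed.

(** Adding 1 permutes the residue field, so the sum of all its elements shows that its cardinality
    is 0 in it. *)
Lemma norm_in_max (P : set K) : is_prime P -> hasidx P (max_ideal P) (prime_norm P) ->
  max_ideal P (prime_norm P)%:R.
Proof.
move=> hP /(residue_ex hP)[k [c [hc <-]]].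
have Pn (n : nat) : P n%:R /\ c n%:R = n%:R.
  elim: n => [|n [IH1 IH2]]; first by rewrite (res0 hP hc); split=> //; apply: prime0.
  rewrite -addn1 !natrD; split; first by apply: primeD => //; apply: prime1.
  by rewrite (resD hc) ?IH2 ?(res1 hc) //; apply: prime1.
have [h1 h2] := Pn #|k|; apply/(res_max hc h1); rewrite h2.
have : \sum_(x : k) (x + 1) = \sum_(x : k) x.
  by rewrite [RHS](reindex_inj (addIr 1)).
rewrite big_split /= sumr_const => /eqP; rewrite -[X in _ == X]addr0 (inj_eq (addrI _)).
by move/eqP; rewrite cardE -cardT.
Qed.

Lemma prime_nat (P : set K) (n : nat) : is_prime P -> P n%:R.
Proof. by move=> hP; elim: n => [|n IH]; [apply: prime0 | rewrite -addn1 natrD; apply: primeD => //; apply: prime1]. Qed.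

Lemma prime_in_max (P : set K) (n : nat) : is_prime P -> (0 < n)%N -> max_ideal P n%:R ->
  exists l, [/\ prime l, (l <= n)%N & max_ideal P l%:R].
Proof.
move=> hP; have Pn (m : nat) : P m%:R by exact: prime_nat.
elim: n {-2}n (leqnn n) => [|m IH] n nm n0 mn; first by lia.
have n1 : (1 < n)%N.
  rewrite ltn_neqAle n0 andbT; apply/eqP => n1; case: (max_not1 hP); by rewrite -[1]/(1%:R) n1.
have [h|h] := pselect (max_ideal P (pdiv n)%:R).
  by exists (pdiv n); rewrite pdiv_prime // pdiv_leq.
have nE : n = (pdiv n * (n %/ pdiv n))%N by rewrite mulnC divnK ?pdiv_dvd.
have p1 := prime_gt1 (pdiv_prime n1).
have [|||l [l1 l2 l3]] := IH (n %/ pdiv n)%N.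
- by have := ltn_Pdiv p1 n0; lia.
- by rewrite divn_gt0 ?pdiv_leq // ltnW.
- by rewrite nE natrM in mn; exact: (max_mul hP (Pn _) h mn).
by exists l; split=> //; apply: leq_trans l2 (leq_div _ _).
Qed.

Lemma central_le m : (\prod_(k < m) 'C(2 ^ k.+1, 2 ^ k) <= 2 ^ (2 ^ m.+1))%N.
Proof.
have binle a b : ('C(a, b) <= 2 ^ a)%N.
  elim: a b => [|a IH] [|b]; rewrite ?bin0 ?expn_gt0 // binS expnS mul2n -addnn.
  exact: leq_add.
elim: m => [|m IH]; first by rewrite big_ord0 expn_gt0.
rewrite big_ord_recr /=; apply: leq_trans (leq_mul IH (binle _ _)) _.
by rewrite -expnD addnn -mul2n -expnS.
Qed.

(** For 2^k < l <= 2^(k+1) the prime l divides the factorial of 2^(k+1) but not that of 2^k. *)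
Lemma prime_dvd_central l T : prime l -> (l <= T)%N ->
  (l %| \prod_(k < (trunc_log 2 T).+1) 'C(2 ^ k.+1, 2 ^ k))%N.
Proof.
move=> pl lT; have l1 := prime_gt1 pl; pose k := trunc_log 2 l.-1.
have l10 : (0 < l.-1)%N by lia.
have k1 : (2 ^ k <= l.-1)%N := trunc_logP (ltnSn 1) l10.
have k2 : (l.-1 < 2 ^ k.+1)%N := trunc_log_ltn _ (ltnSn 1).
have kT : (k < (trunc_log 2 T).+1)%N by rewrite ltnS; apply: leq_trunc_log; lia.
rewrite (bigD1 (Ordinal kT)) //=; apply: dvdn_mulr.
have nf m : (m < l)%N -> ~~ (l %| m`!)%N.
  elim: m => [|m IH] ml; first by rewrite fact0 dvdn1; lia.
  by rewrite factS Euclid_dvdM // negb_or IH ?gtnNdvd // ltnW.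
have e : (2 ^ k.+1 - 2 ^ k = 2 ^ k)%N by rewrite expnS mul2n -addnn addnK.
have := bin_fact (leq_pexp2l (isT : (0 < 2)%N) (leqnSn k)); rewrite e => bf.
have : (l %| (2 ^ k.+1)`!)%N by apply: dvdn_fact; lia.
rewrite -bf !Euclid_dvdM // => /or3P[//| |]; rewrite (negPf (nf _ _)) //; lia.
Qed.

Lemma cheb_int : cheb_elem X.
Proof.
(* With l = trunc_log 2 T, the product of the l + 1 central binomials is at most 2^(2^(l+2)), hence
   at most 2^(4 T) = 16^T. *)
exists 16 => [|T]; first by lra.
have [T0|T0] := posnP T.
  exists 1; rewrite SA Sabs; split; rewrite ?oner_neq0 //.
  by rewrite /qabs normr1 rmorph1 T0 expr0.
  by move=> P /norm_above[_ h1] h2; lia.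
pose z := (\prod_(k < (trunc_log 2 T).+1) 'C(2 ^ k.+1, 2 ^ k))%N.
exists z%:R; rewrite SA Sabs; split.
- by rewrite /qint -[z%:R]/(z%:Z%:~R); apply: intr_int.
- rewrite pnatr_eq0 -lt0n prodn_gt0 // => k; rewrite bin_gt0; exact: leq_pexp2l.
- rewrite qabs_nat -[16]/(16%:R) -natrX ler_nat; apply: leq_trans (central_le _) _.
  rewrite -[16%N]/(2 ^ 4)%N -expnM leq_exp2l // !expnS mulnA leq_mul2l /=.
  exact: trunc_logP.
move=> P aP NT; have [hP _] := aP; have [hi N1] := norm_above aP.
have [l [pl lN ml]] := prime_in_max hP (ltnW N1) (norm_in_max hP hi).
rewrite j_int /z; have /dvdnP[q ->] := prime_dvd_central pl (leq_trans lN NT).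
rewrite natrM; apply: maxM => //; exact: prime_nat.
Qed.

Lemma above_int P : is_prime P -> above X P.
Proof.
move=> hP; split=> // a; rewrite SA => /intrP[z ->]; rewrite rmorph_int.
have Pn (m : nat) : P m%:R by exact: prime_nat.
by case: z => n; [exact: Pn | rewrite NegzE rmorphN; apply: primeN => //; exact: Pn].
Qed.

(* The primes of norm n divide n, and N (n) is about n ^ d. *)
Lemma few_same_norm : exists D : nat, forall n (t : seq (set K)), uniq t ->
  (forall P, P \in t -> is_prime P /\ prime_norm P = n) -> (size t <= D)%N.
Proof.
have [C C1 idx] := idx_scaledO X; have [r r1 br] := ex_box X 1.
have Cr1 : 1 <= C * r by rewrite mulr_ege1.
have [m hm] : exists m : nat, C * r <= (2 ^ m)%:R.
  exists (Num.bound (C * r)); apply/ltW; apply: lt_trans (archi_boundP _) _; first by lra.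
  by rewrite ltr_nat ltn_expl.
exists ((m.+1) * fd X)%N => n t ut ht.
case: t ut ht => // P0 t ut ht; set s := P0 :: t in ut ht *.
have [hP0 nP0] := ht P0 (mem_head _ _).
have [_ n1] := norm_above (above_int hP0); rewrite nP0 in n1.
have n0 : (n%:R : rat) != 0 by rewrite pnatr_eq0; lia.
have An : sA S n%:R by rewrite SA /qint -[n%:R]/(n%:Z%:~R); apply: intr_int.
have bn : box X (n%:R * r) (fj X n%:R).
  by have := proj1 (boxZ X r 1 n0) br; rewrite mulr1 Sabs qabs_nat.
have [|M Mle hM] := idx (fj X n%:R) (n%:R * r) (ointj X An) (j_neq0 X n0) _ bn.
  by rewrite mulr_ege1 // ler1n ltnW.
have hs : forall Q, Q \in s -> above X Q /\ max_ideal Q (fj X n%:R).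
  move=> Q /ht[hQ nQ]; have aQ := above_int hQ; split=> //.
  by have [hi _] := norm_above aQ; have := norm_in_max hQ hi; rewrite nQ j_int.
have := prod_norm_le (ointj X An) (j_neq0 X n0) ut hs hM.
have -> : (\prod_(Q <- s) prime_norm Q = n ^ size s)%N.
  by rewrite big_seq (eq_bigr (fun=> n)) => [|Q /ht[]//]; rewrite -big_seq big_const_seq count_predT iter_muln_1.
move=> h; have : ((n ^ size s)%:R : R) <= ((n * n ^ m) ^ fd X)%:R.
  apply: le_trans (_ : M%:R <= _); first by rewrite ler_nat.
  apply: le_trans Mle _; rewrite natrX; apply: lerXn2r; rewrite ?nnegrE ?mulr_ge0 //; try lra.
  rewrite mulrCA natrM; apply: ler_wpM2l => //; apply: le_trans hm _.
  by rewrite ler_nat; case: (m) => // k; rewrite leq_exp2r.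
by rewrite -expnS -expnM ler_nat leq_exp2l // mulnC.
Qed.

End ChebInt.

(** * Function fields: degrees of primes and the Chebyshev element *)

Section ChebPoly.
Variables (R : realType) (F : finFieldType).
Local Notation F0 := {fraction {poly F}}.
Local Notation q := #|F|.
Variables (S : sized R F0) (K : fieldType) (X : finext S K).
Hypotheses (SA : sA S = @fpoly F) (Sabs : sabs S = @fabs R F).

Let Apoly u : sA S (tf u). Proof. by rewrite SA; exists u. Qed.

Lemma const_rmorph (P : set K) (k : finFieldType) (c : K -> k) : above X P -> residue_map P c ->
  exists g : {rmorphism F -> k}, forall a, g a = c (fj X (tf a%:P)).
Proof.
move=> [hP AP] hc; pose g a := c (fj X (tf a%:P)).
have gB : zmod_morphism g.
  by move=> a b; rewrite /g polyCB 2!rmorphB (resB hP hc) //; apply: AP; apply: Apoly.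
have gM : monoid_morphism g.
  split; first by rewrite /g polyC1 tofrac1 rmorph1 (res1 hc).
  by move=> a b; rewrite /g polyCM 2!rmorphM (resM hc) //; apply: AP; apply: Apoly.
pose gA := GRing.isZmodMorphism.Build F k g gB.
pose gMm := GRing.isMonoidMorphism.Build F k g gM.
pose G : {rmorphism F -> k} := HB.pack g gA gMm.
by exists G.
Qed.

Lemma norm_power P : above X P -> exists2 f, (0 < f)%N & prime_norm P = (q ^ f)%N.
Proof.
move=> aP; have [hP _] := aP; have [hi _] := norm_above aP.
have [k [c [hc <-]]] := residue_ex hP hi.
by have [g _] := const_rmorph aP hc; exact: card_power g.
Qed.

Lemma frob_XnX P n : above X P -> prime_norm P = n -> max_ideal P (fj X (tf ('X^n - 'X))).
Proof.
move=> aP <-; have [hP AP] := aP; have [hi _] := norm_above aP.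
have [k [c [hc <-]]] := residue_ex hP hi.
by rewrite 2!rmorphB 2!rmorphXn; apply: (fermat hP hc); apply: AP; apply: Apoly.
Qed.

Lemma size_XnX n : (1 < n)%N -> size ('X^n - 'X : {poly F}) = n.+1.
Proof. by move=> n1; rewrite size_polyDl ?size_polyN ?size_polyXn ?size_polyX. Qed.
Lemma XnX_neq0 n : (1 < n)%N -> ('X^n - 'X : {poly F}) != 0.
Proof. by move=> n1; rewrite -size_poly_eq0 size_XnX. Qed.

Lemma cheb_poly : cheb_elem X.
Proof.
have q1 : (1 < q)%N := finNzRing_gt1 F; have q0 : (0 < q)%N := ltnW q1.
(* The product over f <= m of the X^(q^f) - X has degree at most 2 q^m, and q^m <= q T for m =
   trunc_log q T + 1. *)
exists (q ^ (2 * q))%:R => [|T]; first by rewrite ler1n expn_gt0 q0.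
have [T0|T0] := posnP T.
  exists 1; rewrite Sabs; split; rewrite ?oner_neq0 //.
  - by rewrite SA; exists 1; rewrite rmorph1.
  - by rewrite -(rmorph1 tf) fabs_poly /psz oner_eq0 size_poly1 T0 expr0.
  by move=> P /norm_above[_ h1] h2; lia.
have qf f : (1 < q ^ f.+1)%N by rewrite -(expn0 q) ltn_exp2l.
pose z m : {poly F} := \prod_(f < m) ('X^(q ^ f.+1) - 'X).
have zle m : z m != 0 /\ fabs R (tf (z m)) <= (q ^ (2 * q ^ m))%:R.
  elim: m => [|m [IH1 IH2]].
  rewrite /z big_ord0 oner_neq0 fabs_poly /psz oner_eq0 size_poly1; split=> //.
  by rewrite ler_nat leq_exp2l.
  rewrite /z big_ord_recr -/(z m) mulf_neq0 ?XnX_neq0 //; split=> //.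
  rewrite fabs_poly pszM; rewrite fabs_poly in IH2.
  apply: (@le_trans _ _ ((q ^ (2 * q ^ m))%:R * (q ^ (q ^ m.+1))%:R)).
  apply: ler_pM; rewrite ?psz_ge0 // /psz (negPf (XnX_neq0 (qf m))) size_XnX //.
  rewrite -natrM -expnD ler_nat leq_exp2l // expnS; move: (q ^ m)%N => a; nia.
exists (tf (z (trunc_log q T).+1)); rewrite Sabs; have [z0 zl] := zle (trunc_log q T).+1.
split; rewrite ?tofrac_eq0 //.
  apply: le_trans zl _; rewrite -natrX ler_nat -expnM leq_exp2l // -mulnA leq_mul2l /= expnS leq_mul2l.
  by rewrite trunc_logP ?orbT.
move=> P aP NT; have [[|f] f0 Nf] := norm_power aP; first by [].
have [hP AP] := aP.
have fT : (f < (trunc_log q T).+1)%N.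
  rewrite ltnS; apply: leq_trans (_ : f.+1 <= _)%N => //.
  by apply: trunc_log_max => //; rewrite -Nf.
rewrite /z (bigD1 (Ordinal fT)) //= rmorphM rmorphM mulrC; apply: maxM => //; first by apply: AP; apply: Apoly.
exact: frob_XnX.
Qed.

End ChebPoly.

(** * The automorphism of F(t) inverting t, which exchanges 0 and infinity *)

Section FractionLift.
Variables (F : finFieldType) (L : fieldType) (g : {rmorphism {poly F} -> L}).
Hypothesis gI : injective g.
Local Notation F0 := {fraction {poly F}}.

Let g0 u : u != 0 -> g u != 0.
Proof. by apply: contraNneq => h; apply/eqP/gI; rewrite h rmorph0. Qed.
Let h (x : F0) : L := g (fnum x) / g (fden x).

Let hE u v : v != 0 -> h (tf u / tf v) = g u / g v.
Proof.
move=> v0; have [d0 e] := fdenP (tf u / tf v); rewrite /h.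
move: (fnum _) (fden _) d0 e => n d d0 e.
have tv : tf v != 0 by rewrite tofrac_eq0.
have td : tf d != 0 by rewrite tofrac_eq0.
have : tf (u * d) = tf (n * v) by rewrite !tofracM -(divfK tv (tf u)) e mulrAC divfK // mulrAC.
move/eqP; rewrite tofrac_eq => /eqP /(congr1 g); rewrite !rmorphM => e'.
have pv := g0 v0; have pd := g0 d0.
by apply: (mulIf pd); apply: (mulIf pv); rewrite divfK // -e' mulrAC divfK.
Qed.

Lemma frac_lift : exists f : {rmorphism F0 -> L}, forall u, f (tf u) = g u.
Proof.
have htf u : h (tf u) = g u.
  by have := @hE u 1 (oner_neq0 _); rewrite !rmorph1 !divr1.
have hD x y : h (x - y) = h x - h y.
  have [u [v [v0 ->]]] := frac_rep x; have [u' [v' [v0' ->]]] := frac_rep y.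
  have tv : tf v != 0 by rewrite tofrac_eq0.
  have tv' : tf v' != 0 by rewrite tofrac_eq0.
  have -> : tf u / tf v - tf u' / tf v' = tf (u * v' - u' * v) / tf (v * v').
  have e1 := tofracB (u * v') (u' * v); have e2 := tofracM u v'; have e3 := tofracM u' v.
  have e4 := tofracM v v'; rewrite e1 e2 e3 e4 -mulNr.
  by have e := addf_div (tf u : F0) (- tf u' : F0) tv tv'; rewrite e mulNr.
  rewrite !hE ?mulf_neq0 // rmorphB !rmorphM.
  by have e := addf_div (g u) (- g u') (g0 v0) (g0 v0'); rewrite !mulNr in e; rewrite e.
have hM x y : h (x * y) = h x * h y.
  have [u [v [v0 ->]]] := frac_rep x; have [u' [v' [v0' ->]]] := frac_rep y.
  rewrite mulrACA -invfM -!tofracM !hE ?mulf_neq0 // !rmorphM invfM; exact: mulrACA.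
have h1 : h 1 = 1 by rewrite -tofrac1 htf rmorph1.
pose hA := GRing.isZmodMorphism.Build F0 L h hD.
have hMm : monoid_morphism h by split.
pose hMM := GRing.isMonoidMorphism.Build F0 L h hMm.
pose H : {rmorphism F0 -> L} := HB.pack h hA hMM.
by exists H.
Qed.

End FractionLift.

Lemma frac_morph_eq (F : finFieldType) (L : fieldType) (f g : {rmorphism {fraction {poly F}} -> L}) :
  (forall a, f (tf a%:P) = g (tf a%:P)) ->
  f (tf 'X) = g (tf 'X) -> f =1 g.
Proof.
move=> hC hX x; have [u [v [v0 ->]]] := frac_rep x.
have e w : f (tf w) = g (tf w).
  elim/poly_ind: w => [|w a IH]; first by rewrite !rmorph0.
  by rewrite !tofracD !tofracM !rmorphD !rmorphM IH hX hC.
by rewrite !fmorph_div !e.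
Qed.

Section Invert.
Variables (R : realType) (F : finFieldType).
Local Notation F0 := {fraction {poly F}}.

Lemma frac_invert : exists s : {rmorphism F0 -> F0},
  [/\ forall a, s (tf a%:P) = tf a%:P, s (tf 'X) = (tf 'X)^-1 & involutive s].
Proof.
pose c : {rmorphism F -> F0} := tf \o polyC.
have com (x : F0) : commr_rmorph c x by move=> a; apply: mulrC.
pose g : {rmorphism {poly F} -> F0} := horner_morph (com (tf 'X)^-1).
have X0 : tf ('X : {poly F}) != 0 by rewrite tofrac_eq0 polyX_eq0.
have gE u : g u = (map_poly c u).[(tf 'X)^-1] by [].
have gX : g 'X = (tf 'X)^-1 by rewrite gE map_polyX hornerX.
have gC a : g a%:P = tf a%:P by rewrite gE map_polyC hornerC.
have gI : injective g.
  apply: raddf_inj => u gu0; apply/eqP; apply: contraTT isT => u0.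
  pose n := (size u).-1.
  (* Multiplied by t^n, the value u(1/t) becomes the reversed polynomial, whose constant term is the
     leading coefficient of u; this gives injectivity. *)
  have e : g u * tf 'X ^+ n = tf (\sum_(i < size u) (u`_i)%:P * 'X^(n - i)).
  rewrite -{1}(coefK u) poly_def rmorph_sum mulr_suml rmorph_sum; apply: eq_bigr => i _.
  rewrite -mul_polyC 2!rmorphM gC !rmorphXn gX -mulrA; congr (_ * _).
  have le : (i <= n)%N by rewrite /n; have := ltn_ord i; lia.
  have eX : (tf 'X : F0) ^+ n = tf 'X ^+ (n - i) * tf 'X ^+ i by rewrite -exprD subnK.
  by rewrite eX mulrCA exprVn mulVf ?mulr1 ?expf_neq0.
  move: e; rewrite gu0 mul0r => /esym/eqP; rewrite tofrac_eq0 => /eqP /(congr1 (fun p : {poly F} => p`_0)).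
  rewrite coef0 coef_sum; have sz : (0 < size u)%N by rewrite size_poly_gt0.
  have ln : (n < size u)%N by rewrite /n; lia.
  rewrite (bigD1 (Ordinal ln)) //= subnn expr0 mulr1 coefC eqxx big1 ?addr0.
  by move/eqP; rewrite -lead_coefE lead_coef_eq0 (negPf u0).
  move=> i; rewrite -val_eqE /= => i_n; rewrite coefCM coefXn.
  have -> : (0 == n - i)%N = false.
  have h : (i < n)%N.
  rewrite ltn_neqAle; apply/andP; split; first exact: i_n.
  by have := ltn_ord i; rewrite -{2}(prednK sz) ltnS.
  by rewrite eq_sym subn_eq0 leqNgt h.
  by rewrite mulr0.
have [s sE] := frac_lift gI.
exists s; split=> [a||]; rewrite ?sE ?gC ?gX // => x.
apply: (frac_morph_eq (f := s \o s) (g := idfun) _ _ x) => [a|] /=; first by rewrite sE gC sE gC.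
by rewrite sE gX fmorphV sE gX invrK.
Qed.

Lemma finext_invert (S : sized R F0) (K : fieldType) (X : finext S K) :
  exists X' : finext S K, (forall a, fj X' (tf a%:P) = fj X (tf a%:P)) /\ fj X' (tf 'X) = (fj X (tf 'X))^-1.
Proof.
have [s [sC sX ss]] := frac_invert.
have [||||X' XE] := @finext_build R F0 S K (fj X \o s) 'I_(fd X) (fw X) (fun x i => s (fco X x i)).
- by move=> x; rewrite {1}(fcoK X x); apply: eq_bigr => i _; rewrite /= ss.
- by move=> x y i; rewrite fcoB rmorphB.
- by move=> a x i; rewrite /= fcoZ rmorphM ss.
- by move=> i k; rewrite fcow rmorph_nat.
by exists X'; rewrite XE /=; split=> [a|]; rewrite ?sC ?sX ?fmorphV.
Qed.

(** It suffices that P contains t, since a nonzero constant a satisfies a^q = a and so has valuation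
    0 at every prime. *)
Lemma above_poly (S : sized R F0) (K : fieldType) (X : finext S K) P : sA S = @fpoly F ->
  is_prime P -> P (fj X (tf 'X)) -> above X P.
Proof.
move=> SA hP PX; split=> // a; rewrite SA => -[u ->]; elim/poly_ind: u => [|u a' IH].
  by rewrite !rmorph0; apply: prime0.
rewrite tofracD tofracM rmorphD rmorphM; apply: primeD => //; first exact: primeM.
have [->|a0] := eqVneq a' 0; first by rewrite !rmorph0; apply: prime0.
have b0 : fj X (tf a'%:P) != 0 by rewrite fmorph_eq0 tofrac_eq0 polyC_eq0.
apply/(vl_prime hP) => //; have q1 := finNzRing_gt1 F.
have : fj X (tf a'%:P) ^+ #|F| = fj X (tf a'%:P).
  by rewrite -!rmorphXn expf_card.
move/(congr1 (vl P)); rewrite (vlX hP) // => /eqP.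
rewrite -subr_eq0 -{2}[vl _ _]mulr1 -mulrBr mulf_eq0 => /orP[/eqP->//|]; rewrite subr_eq0 -[1]/(Posz 1) eqz_nat => /eqP h; by rewrite h in q1.
Qed.

End Invert.

(** * All primes of a global field, and Mertens's first theorem for them *)

Section GlobalBase.
Variable R : realType.

Definition gint (K : fieldType) : Prop := exists (S : sized R rat) (X : finext S K),
  sA S = qint /\ sabs S = @qabs R.
Definition gpoly (F : finFieldType) (K : fieldType) : Prop :=
  exists (S : sized R {fraction {poly F}}) (X : finext S K), sA S = @fpoly F /\ sabs S = @fabs R F.
Definition gbase (K : fieldType) : Prop := gint K \/ exists F, gpoly F K.

Lemma global_gbase K : global_field K -> gbase K.
Proof.
move=> [[N [f bf]]|[F [N [f bf]]]]; [left|right].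
  have [S hS] := sized_int_ex R; have [X _] := finext_bij S bf; by exists S, X.
by have [S hS] := sized_poly_ex R F; have [X _] := finext_bij S bf; exists F, S, X.
Qed.

Section Facts.
Variable K : fieldType.
Hypothesis hK : gbase K.
Implicit Types P : set K.

(* All primes are above Z, respectively above F[t] or F[1/t]. *)
Lemma prime_above_cases P : is_prime P ->
  exists (F : fieldType) (S : sized R F) (X : finext S K), above X P.
Proof.
move=> hP; case: hK => [[S [X [h1 h2]]]|[F [S [X [h1 h2]]]]].
  by exists rat, S, X; apply: above_int.
have [PX|PX] := pselect (P (fj X (tf 'X))).
  by exists {fraction {poly F}}, S, X; apply: above_poly.
have [X' [_ hX']] := finext_invert X.
exists {fraction {poly F}}, S, X'; apply: above_poly => //; rewrite hX'; apply: max_prime.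
apply: prime_tot => //; by rewrite fmorph_eq0 tofrac_eq0 polyX_eq0.
Qed.

Lemma prime_normP (P : set K) : is_prime P -> hasidx P (max_ideal P) (prime_norm P) /\ (1 < prime_norm P)%N.
Proof. by move=> /prime_above_cases[F [S [X aP]]]; apply: norm_above aP. Qed.

(** A prime not above F[t] has t outside its ring; it is then above F[1/t] with 1/t in its maximal
    ideal, which happens for finitely many primes. *)
Lemma finite_nonabove (F : finFieldType) (S : sized R {fraction {poly F}}) (X : finext S K) :
  sA S = @fpoly F -> exists t : seq (set K), forall P, is_prime P -> ~ above X P -> P \in t.
Proof.
move=> SA; have [X' [_ hX']] := finext_invert X.
have X0 : tf 'X != 0 :> {fraction {poly F}} by rewrite tofrac_eq0 polyX_eq0.
have AX : sA S (tf 'X) by rewrite SA; exists 'X.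
have [t ut ht] := mem_finite (ointj X' AX) (j_neq0 X' X0).
exists t => P hP nP; apply/ht; rewrite hX'.
have PX : ~ P (fj X (tf 'X)) by move=> h; apply: nP; apply: above_poly.
have mX : max_ideal P (fj X (tf 'X))^-1.
  by apply: prime_tot => //; rewrite fmorph_eq0.
split=> //; apply: above_poly => //; rewrite hX'; exact: max_prime mX.
Qed.

Lemma bad_finite y : y != 0 -> exists t : seq (set K), forall P, is_prime P ->
  max_ideal P y \/ ~ P y -> P \in t.
Proof.
move=> y0; suff H (F : fieldType) (S : sized R F) (X : finext S K) : exists t : seq (set K),
  forall P, above X P -> max_ideal P y \/ ~ P y -> P \in t.
  case: hK => [[S [X [h1 h2]]]|[F [S [X [h1 h2]]]]].
  by have [t ht] := H _ S X; exists t => P hP; apply: ht; apply: above_int.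
  have [t ht] := H _ S X; have [t' ht'] := finite_nonabove X h1.
  exists (t ++ t') => P hP hy; rewrite mem_cat; apply/orP.
  by have [aP|aP] := pselect (above X P); [left; apply: ht | right; apply: ht'].
have [D [D0 AD OD]] := oint_frac X y; have Dn0 := j_neq0 X D0.
have [t ut ht] := mem_finite OD (mulf_neq0 Dn0 y0).
have [t' ut' ht'] := mem_finite (ointj X AD) Dn0.
exists (t ++ t') => P aP; have [hP AP] := aP; rewrite mem_cat => -[my|ny]; apply/orP.
  by left; apply/ht; split=> //; apply: maxM => //; apply: AP.
right; apply/ht'; split=> //; apply: contrapT => nD; apply: ny.
rewrite -(mulKf Dn0 y); apply: primeM => //; last exact: aboveO OD.
by apply: prime_inv => //; apply: AP.
Qed.

Lemma gbase_cheb : exists (F : fieldType) (S : sized R F) (X : finext S K), cheb_elem X /\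
  exists t : seq (set K), forall P, is_prime P -> ~ above X P -> P \in t.
Proof.
case: hK => [[S [X [h1 h2]]]|[F [S [X [h1 h2]]]]].
  by exists rat, S, X; split; [exact: cheb_int | exists [::] => P hP []; apply: above_int].
exists {fraction {poly F}}, S, X; split; first exact: cheb_poly.
exact: finite_nonabove.
Qed.

Lemma pl_ex T : exists t : seq (set K), uniq t /\
  forall P, P \in t <-> is_prime P /\ (prime_norm P <= T)%N.
Proof.
have [F [S [X [hc [t ht]]]]] := gbase_cheb.
have [s [us hs]] := ps_ex hc T.
exists [seq P <- undup (t ++ s) | `[< is_prime P /\ (prime_norm P <= T)%N >]].
split=> [|P]; first exact: filter_uniq (undup_uniq _).
rewrite mem_filter mem_undup mem_cat; split=> [/andP[/asboolP//]|h].
apply/andP; split; first exact/asboolP.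
apply/orP; have [aP|aP] := pselect (above X P); [right|left].
  by apply/hs; case: h.
by apply: ht => //; case: h.
Qed.

Definition pl T := projT1 (cid (pl_ex T)).
Lemma pl_uniq T : uniq (pl T). Proof. by rewrite /pl; case: cid => t []. Qed.
Lemma plP P T : P \in pl T <-> is_prime P /\ (prime_norm P <= T)%N.
Proof. by rewrite /pl; case: cid => t []. Qed.

Local Notation nm P := ((prime_norm P)%:R : R).

(** The finitely many primes not above A change the sum by at most B, and the values of T below the
    threshold of [mertens_scale] cost another constant. *)
Lemma mertens_first : exists2 C : R, 0 < C & forall T, (0 < T)%N ->
  `|\sum_(P <- pl T) ln (nm P) / nm P - ln T%:R| <= C.
Proof.
have [F [S [X [hc [t ht]]]]] := gbase_cheb.
have [C C0 [T0 hC]] := mertens_scale hc.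
pose B := \sum_(P <- undup t | `[< is_prime P >]) ln (nm P) / nm P.
have lnm (P : set K) : is_prime P -> 0 <= ln (nm P) / nm P.
  by move=> /prime_normP[_ h]; rewrite divr_ge0 // ln_ge0 // ler1n ltnW.
have cmp T : \sum_(P <- ps hc T) ln (nm P) / nm P <= \sum_(P <- pl T) ln (nm P) / nm P
  <= \sum_(P <- ps hc T) ln (nm P) / nm P + B.
  apply/andP; split.
  apply: (sum_subset (ps_uniq hc T) (pl_uniq T)) => [P /psP[[hP _] h]|P /plP[hP _]]; last exact: lnm.
  by apply/plP.
  rewrite (bigID (mem (ps hc T))) /=; apply: lerD.
  rewrite -big_filter; apply: sum_subset; rewrite ?filter_uniq ?pl_uniq ?ps_uniq // => P.
  by rewrite mem_filter => /andP[].
  by move=> /psP[[hP _] _]; apply: lnm.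
  rewrite -big_filter /B -[leRHS]big_filter; apply: sum_subset; rewrite ?filter_uniq ?pl_uniq ?undup_uniq //.
  move=> P; rewrite !mem_filter mem_undup => /andP[nP /plP[hP h]]; apply/andP; split; first exact/asboolP.
  apply: ht => // aP; move/negP: nP; apply; by apply/psP.
  by move=> P; rewrite mem_filter => /andP[/asboolP hP _]; apply: lnm.
pose B0 := \sum_(P <- pl T0) ln (nm P) / nm P.
have B_ge0 : 0 <= B by apply: sumr_ge0 => P /asboolP; apply: lnm.
have pl_ge0 T : 0 <= \sum_(P <- pl T) ln (nm P) / nm P.
  by rewrite big_seq; apply: sumr_ge0 => P /plP[/lnm].
exists (C + B + B0 + `|ln T0%:R|).
  by rewrite ltr_wpDr // ltr_wpDr ?pl_ge0 // ltr_wpDr.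
move=> T Tpos; have [TT0|TT0] := leqP T0 T.
  have := hC T TT0; have /andP[h1 h2] := cmp T; have := pl_ge0 T0; rewrite -/B0.
  by have := normr_ge0 (ln T0%:R : R); rewrite !ler_norml; lra.
have h1 : \sum_(P <- pl T) ln (nm P) / nm P <= B0.
  apply: (sum_subset (pl_uniq T) (pl_uniq T0)) => [P /plP[hP h]|P /plP[/lnm//]].
  by apply/plP; split=> //; apply: leq_trans h (ltnW TT0).
have h2 : 0 <= ln T%:R :> R by rewrite ln_ge0 // ler1n.
have h3 : ln T%:R <= ln T0%:R :> R by rewrite ler_ln ?posrE ?ltr0n ?ler_nat //; lia.
have := pl_ge0 T; have := ler_norm (ln T0%:R : R); rewrite ler_norml; lra.
Qed.

End Facts.
End GlobalBase.

(** * Integers and primes in a tower of extensions *)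

Section Tower.
Variables (R : realType) (F : fieldType) (S : sized R F) (Kb E : fieldType).
Variables (Y : finext S Kb) (X : finext S E) (iota : {rmorphism Kb -> E}).
Hypothesis iotaj : forall a, iota (fj Y a) = fj X a.
Local Notation A := (sA S).
Implicit Types (Q P : set E) (p : set Kb).

Lemma common_den (T : finType) (f : T -> F) : exists D, [/\ D != 0, A D & forall t, A (D * f t)].
Proof.
suff [D [D0 AD h]] : exists D, [/\ D != 0, A D & forall t, t \in enum T -> A (D * f t)].
  by exists D; split=> // t; apply: h; rewrite mem_enum.
elim: (enum T) => [|u s [D [D0 AD h]]]; first by exists 1; split; rewrite ?oner_neq0 //; apply: sA1.
have [b [b0 Ab Abf]] := sA_frac S (f u).
exists (b * D); split; [by rewrite mulf_neq0 | exact: sAM | move=> t].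
rewrite inE => /orP[/eqP->|ts]; first by rewrite mulrAC mulrC; apply: sAM.
by rewrite -mulrA; apply: sAM => //; apply: h.
Qed.

Let M : 'M[F]_(fd Y, fd X) := \matrix_(l, i) fco X (iota (fw Y l)) i.

Let fco_iota a i : fco X (iota a) i = \sum_l fco Y a l * M l i.
Proof.
rewrite {1}(fcoK Y a) rmorph_sum fco_sum; apply: eq_bigr => l _.
by rewrite rmorphM iotaj fcoZ mxE.
Qed.

Let ex_inv : exists B : 'M[F]_(fd X, fd Y), M *m B = 1%:M.
Proof.
apply/row_freeP; rewrite -kermx_eq0; apply/rowV0P => v /sub_kermxP vM.
pose a := \sum_l fj Y (v 0 l) * fw Y l.
have av l : fco Y a l = v 0 l by rewrite fco_comb.
have : iota a = 0.
  apply: (fco_inj (X := X)) => i; rewrite fco_iota fco0.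
  have := congr1 (fun u : 'rV_(fd X) => u 0 i) vM; rewrite [in LHS]mxE [in RHS]mxE => e.
  by rewrite -[RHS]e; apply: eq_bigr => l _; rewrite av.
move/eqP; rewrite fmorph_eq0 => /eqP a0; apply/rowP => l.
by rewrite -av a0 fco0 mxE.
Qed.

Lemma OK_OE a : oint Y a -> oint X (iota a).
Proof.
move=> [D D0 h]; have [D1 [D10 _ h1]] := common_den (fun li => M li.1 li.2).
exists (D1 * D) => [|k i]; first by rewrite mulf_neq0.
rewrite -iotaj -rmorphXn -rmorphM fco_iota; apply: sA_sum => l.
rewrite rmorphM -mulrA fcoZ mulrAC mulrC; apply: sAM (h k l) (h1 (l, i)).
Qed.

(** Injectivity of [iota] gives its matrix a right inverse, so the coordinates in the smaller field
    are combinations, with a common denominator, of those in E. *)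
Lemma OE_OK a : oint X (iota a) -> oint Y a.
Proof.
move=> [D D0 h]; have [B MB] := ex_inv.
have [D1 [D10 _ h1]] := common_den (fun il => B il.1 il.2).
have co b l : fco Y b l = \sum_i fco X (iota b) i * B i l.
  under eq_bigr => i _ do rewrite fco_iota mulr_suml.
  rewrite exchange_big /= (eq_bigr (fun k => fco Y b k * (k == l)%:R)) => [|k _].
  by rewrite (bigD1 l) //= eqxx mulr1 big1 ?addr0 // => k /negPf->; rewrite mulr0.
  have e := congr1 (fun u : 'M[F]_(fd Y) => u k l) MB; rewrite [in LHS]mxE [in RHS]mxE in e; rewrite -e.
  by rewrite mulr_sumr; apply: eq_bigr => i _; rewrite mulrA.
exists (D1 * D) => [|k l]; first by rewrite mulf_neq0.
rewrite co; apply: sA_sum => i.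
rewrite rmorphM rmorphXn iotaj rmorphM -mulrA fcoZ mulrAC mulrC; apply: sAM (h k i) (h1 (i, l)).
Qed.

End Tower.

(** The powers of an element of size greater than 1 are distinct, yet they fall into finitely many
    residue classes. *)
Lemma ex_small_A (R : realType) (F : fieldType) (S : sized R F) (E : fieldType) (X : finext S E)
  (Q : set E) : above X Q -> exists D, [/\ D != 0, sA S D & max_ideal Q (fj X D)].
Proof.
move=> aQ; have [hQ AQ] := aQ; have [hi _] := norm_above aQ.
have [C C1 hC] := sA_scale S; have [|a [Aa a2 _]] := hC 2; first by rewrite ler1n.
have AX k : sA S (a ^+ k) by elim: k => [|k IH]; [apply: sA1 | rewrite exprS; apply: sAM].
apply: contrapT => nD.
suff : (#|'I_(prime_norm Q).+1| <= prime_norm Q)%N by rewrite card_ord ltnn.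
apply: (idx_ge (u := fun t : 'I_(prime_norm Q).+1 => fj X (a ^+ t)) (max_sub hQ) hi) => [t|t s h].
  exact: AQ.
apply: val_inj => /=; apply: contrapT => ts; apply: nD.
exists (a ^+ t - a ^+ s); split; last by rewrite rmorphB.
- have a1 : 1 < sabs S a by apply: lt_le_trans a2; rewrite ltr1n.
  rewrite subr_eq0; apply/eqP => /(congr1 (sabs S)); rewrite !sabsX.
  by move/(ieexprIn (lt_trans ltr01 a1) (negbT (gt_eqF a1))).
- exact: sAB.
Qed.

(** * Contraction of primes along a field embedding *)

Section Contraction.
Variables (Kb E : fieldType) (iota : {rmorphism Kb -> E}).
Implicit Types (Q P : set E) (p : set Kb).

Definition contr Q : set Kb := fun a => Q (iota a).

Lemma contr_max Q a : max_ideal (contr Q) a <-> max_ideal Q (iota a).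
Proof.
rewrite /max_ideal /contr /= fmorphV; split=> -[h1 h2]; split=> //.
  by case: h2 => [->|h]; [left; rewrite rmorph0 | right].
case: h2 => [/eqP|h]; [rewrite fmorph_eq0 => /eqP h; by left | by right].
Qed.

(** The second hypothesis keeps the restricted valuation from being trivial. An element of least
    positive valuation is a uniformizer, by division with remainder of the valuations. *)
Lemma contr_prime Q : is_prime Q -> (exists2 a, a != 0 & max_ideal Q (iota a)) -> is_prime (contr Q).
Proof.
move=> hQ [a0 a00 ma0]; pose V a := vl Q (iota a).
have i0 a : a != 0 -> iota a != 0 by rewrite fmorph_eq0.
pose W n := `[< exists2 a, a != 0 & V a = n.+1%:Z >].
have exW : exists n, W n.
  exists `|V a0 - 1|%N; apply/asboolP; exists a0 => //.
  by have /(vl_max hQ (i0 _ a00)) := ma0; rewrite -/(V a0); lia.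
have [n /asboolP[t t0 Vt] nmin] := ex_minnP exW.
have VM a b : a != 0 -> b != 0 -> V (a * b) = V a + V b by move=> a_0 b_0; rewrite /V rmorphM vlM ?i0.
have VV a : a != 0 -> V a^-1 = - V a by move=> a_0; rewrite /V fmorphV vlV ?i0.
have VX a k : a != 0 -> V (a ^ k) = V a * k.
  move=> a_0; case: k => k; first by rewrite -exprnP /V rmorphXn vlX ?i0.
  by rewrite NegzE -exprnN VV ?expf_neq0 // /V rmorphXn vlX ?i0 // mulrN.
split=> [|x y|x y|].
- by rewrite /contr rmorph1; apply: prime1.
- by rewrite /contr rmorphB; apply: primeB.
- by rewrite /contr rmorphM; apply: primeM.
exists t; split=> // [|x x0].
  apply/contr_max/(vl_max hQ (i0 _ t0)); rewrite -/(V t); lia.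
pose k := (V x %/ V t)%Z; pose u := x / t ^ k.
have tk0 : t ^ k != 0 by rewrite expfz_neq0.
have u0 : u != 0 by rewrite mulf_neq0 ?invr_neq0.
have Vu : V u = (V x %% V t)%Z.
  by rewrite /u VM ?invr_neq0 // VV // VX // /k; have := divz_eq (V x) (V t); lia.
have Vu0 : V u = 0.
  apply: contrapT => nz; have := modz_ge0 (V x) (_ : V t != 0); have := ltz_pmod (V x) (_ : 0 < V t).
  rewrite -Vu Vt => /(_ isT) h1 /(_ isT) h2.
  have := nmin `|V u - 1|%N; have -> : W `|V u - 1|%N.
  by apply/asboolP; exists u => //; lia.
  move=> /(_ isT); lia.
exists u, k; split=> //.
- by apply/(vl_prime hQ (i0 _ u0)); rewrite -/(V u) Vu0.
- by rewrite /contr fmorphV; apply/(vl_prime hQ); rewrite ?invr_neq0 ?i0 // vlV ?i0 // -/(V u) Vu0.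
by rewrite /u divfK.
Qed.

Lemma residue_morph Q p (k k' : finFieldType) (c : Kb -> k) (c' : E -> k') :
  is_prime p -> is_prime Q -> (forall a, p a <-> Q (iota a)) -> residue_map p c -> residue_map Q c' ->
  exists g : {rmorphism k -> k'}, forall a, p a -> g (c a) = c' (iota a).
Proof.
move=> hp hQ pQ hc hc'.
have Hl x : exists a, p a /\ c a = x by have [a pa <-] := res_surj hc x; exists a.
have [f fP] := choice Hl.
have fE x : p (f x) by case: (fP x). have fc x : c (f x) = x by case: (fP x).
have Qi a : p a -> Q (iota a) by move/pQ.
have eqc a b : p a -> p b -> c a = c b -> c' (iota a) = c' (iota b).
  move=> pa pb /(res_eq hp hc pa pb) [_ h]; apply/(res_eq hQ hc') => //; try exact: Qi.
  rewrite -rmorphB; split; first by apply: Qi; apply: primeB.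
  case: h => [->|h]; [by left; rewrite rmorph0 | right => h'; apply: h; apply/pQ; by rewrite fmorphV].
pose g x := c' (iota (f x)).
have gE a : p a -> g (c a) = c' (iota a) by move=> pa; apply: eqc.
have gB : zmod_morphism g.
  move=> x y; rewrite -{1}(fc x) -{1}(fc y) -(resB hp hc) // gE; last exact: primeB.
  by rewrite rmorphB (resB hQ hc') //; apply: Qi.
have gM : monoid_morphism g.
  split; first by rewrite -(res1 hc) gE ?rmorph1 ?(res1 hc') //; exact: prime1.
  move=> x y; rewrite -{1}(fc x) -{1}(fc y) -(resM hc) // gE; last exact: primeM.
  by rewrite rmorphM (resM hc') //; apply: Qi.
pose hA := GRing.isZmodMorphism.Build k k' g gB.
pose hMM := GRing.isMonoidMorphism.Build k k' g gM.
pose H : {rmorphism k -> k'} := HB.pack g hA hMM.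
by exists H.
Qed.

Lemma norm_contr Q p : is_prime p -> is_prime Q -> (forall a, p a <-> Q (iota a)) ->
  hasidx p (max_ideal p) (prime_norm p) -> hasidx Q (max_ideal Q) (prime_norm Q) ->
  exists2 f, (0 < f)%N & prime_norm Q = (prime_norm p ^ f)%N.
Proof.
move=> hp hQ pQ /(residue_ex hp)[k [c [hc <-]]] /(residue_ex hQ)[k' [c' [hc' <-]]].
by have [g _] := residue_morph hp hQ pQ hc hc'; exact: card_power g.
Qed.

End Contraction.

(** * Lying over *)

Section LyingOver.
Variables (R : realType) (F : fieldType) (S : sized R F) (Kb E : fieldType).
Variables (Y : finext S Kb) (X : finext S E) (iota : {rmorphism Kb -> E}).
Hypothesis iotaj : forall a, iota (fj Y a) = fj X a.
Local Notation contr := (contr iota).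

Lemma contr_above Q : above X Q -> above Y (contr Q).
Proof.
move=> aQ; have [hQ AQ] := aQ; have [D [D0 AD mD]] := ex_small_A aQ; split.
  by apply: contr_prime => //; exists (fj Y D); [exact: j_neq0 | rewrite iotaj].
by move=> a Aa; rewrite /contr iotaj; exact: AQ.
Qed.

(** Take D in A inside the maximal ideal of p. If no prime contracted to p, some e congruent to 1
    modulo p would lie in the contractions of all primes of E containing D; then e ^ k / D would be
    integral and e ^ k would fall into the maximal ideal of p. *)
Lemma lying_over (p : set Kb) : above Y p -> exists2 Q, above X Q & contr Q = p.
Proof.
move=> ap; have [hp Ap] := ap; have [D [D0 AD mD]] := ex_small_A ap.
have s0 := j_neq0 X D0; have [t ut ht] := mem_finite (ointj X AD) s0.
apply: contrapT => nQ.
have ha Q : Q \in t -> above X Q by move=> /ht[].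
have [||e [Oe pe he]] := @crt_elem _ _ _ _ Y p (map contr t) 1 ap.
- by move=> q /mapP[Q /ha aQ ->]; apply: contr_above.
- by apply/mapP => -[Q /ha aQ e]; apply: nQ; exists Q.
pose k := (\sum_(Q <- t) `|vl Q (fj X D)|)%N.
have e0 : ~ max_ideal p e.
  move=> me; apply: (max_not1 hp); rewrite -(subrK e 1).
  by apply: subgD => //; [exact: max_sub | apply/(vge1 hp)].
have en0 : e != 0 by apply/eqP => h; apply: e0; rewrite h; case: (max_sub hp).
have ie0 : iota e != 0 by rewrite fmorph_eq0.
have ek m : ~ max_ideal p (e ^+ m).
  elim: m => [|m IH]; first exact: (max_not1 hp).
  by rewrite exprS => h; apply: IH; apply: (max_mul hp _ e0 h); exact: aboveO Oe.
have Oy : oint Y (e ^+ k / fj Y D).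
  apply: (OE_OK iotaj); apply: oint_inter => Q aQ; have [hQ AQ] := aQ.
  have Qe : Q (iota e) by apply: (aboveO aQ); apply: (OK_OE iotaj).
  rewrite rmorphM fmorphV rmorphXn iotaj.
  have [mQ|nmQ] := pselect (max_ideal Q (fj X D)).
  have Qt : Q \in t by apply/ht.
  apply/(vl_prime hQ); rewrite ?mulf_neq0 ?invr_neq0 ?expf_neq0 // vlM ?invr_neq0 ?expf_neq0 //.
  rewrite vlV // vlX //.
  have : 1 <= vl Q (iota e).
  by apply/(vl_max hQ ie0)/contr_max/vge1; [apply: (contr_above aQ).1 | apply: he; apply: map_f].
  have : (`|vl Q (fj X D)| <= k)%N.
  by rewrite /k (big_rem Q) //= leq_addr.
  move: (vl Q (fj X D)) (vl Q (iota e)) k => a b m; nia.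
  by apply: primeM => //; [exact: primeX | apply: prime_inv => //; exact: AQ].
apply: (ek k); rewrite -(divfK (j_neq0 Y D0) (e ^+ k)); apply: maxM => //.
exact: (aboveO ap).
Qed.

End LyingOver.

Lemma pow_eq_card (k : finFieldType) (a b : nat) : a != b -> (forall x : k, x ^+ a = x ^+ b) ->
  (#|k| <= maxn a b)%N.
Proof.
move=> ab h; wlog lt : a b ab h / (a < b)%N.
  move=> W; case: (ltngtP a b) => [l|l|e]; last by rewrite e eqxx in ab.
  by have := W a b ab h l; rewrite (maxn_idPr (ltnW l)).
  have := W b a _ (fun x => esym (h x)) l; rewrite (maxn_idPr (ltnW l)) eq_sym; exact.
pose u : {poly k} := 'X^b - 'X^a.
have su : size u = b.+1 by rewrite size_polyDl ?size_polyN !size_polyXn // ltnS.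
have u0 : u != 0 by rewrite -size_poly_eq0 su.
have := max_poly_roots u0 _ (enum_uniq k); rewrite su ltnS -cardE (maxn_idPr (ltnW lt)); apply.
by apply/allP => x _; rewrite rootE !hornerE h subrr.
Qed.

Lemma field_gen (k : finFieldType) : exists2 g : k, g != 0 & forall x, x != 0 -> exists i, x = g ^+ i.
Proof.
have /cyclicP[u hu] := (@field_unit_group_cyclic k) [set: {unit k}]%G.
exists (val u) => [|x x0]; first by have := valP u; rewrite unitfE.
have xu : x \is a GRing.unit by rewrite unitfE.
have : FinRing.Unit xu \in <[u]>%g by rewrite -hu inE.
by case/cycleP => i /(congr1 val); rewrite FinRing.val_unitX /= => ->; exists i.
Qed.

(** Source of the additivity of q-power maps: in this form the cardinality fits [exprDn_pchar]. *)
Lemma rmorph_card_nat (k k' : finFieldType) (g : {rmorphism k -> k'}) : [pchar k']%N.-nat #|k|.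
Proof.
have [p pp pc] := finPcharP k; have := fin_ring_pchar_abelem pc.
move=> /abelem_pgroup; rewrite /pgroup cardsT; apply: sub_in_pnat => l _; rewrite inE => /eqP ->.
exact: rmorph_pchar pc.
Qed.

(** * Galois action on primes, Frobenius elements and decomposition groups *)

Section NormalExtension.
Variables (R : realType) (F : fieldType) (S : sized R F) (Kb Bf : fieldType).
Variables (E : splittingFieldType Bf) (Y : finext S Kb) (X : finext S E) (iota : {rmorphism Kb -> E}).
Variable U : {subfield E}.
Hypothesis iotaj : forall a, iota (fj Y a) = fj X a.
Hypothesis iotaU : forall x, x \in U <-> exists a, x = iota a.
Local Notation H := ('Gal({:E} / U))%g.
Local Notation O := (oint X).
Implicit Types (Q P : set E) (p : set Kb) (s : gal_of {:E}).

(** The map s itself, typed as a ring morphism so that the [rmorph] lemmas apply to it. *)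
Definition ac s : {rmorphism E -> E} := s.
Lemma acM s r x : ac (s * r)%g x = ac r (ac s x). Proof. by rewrite /ac /= galM ?memvf. Qed.
Lemma ac1 x : ac 1%g x = x. Proof. by rewrite /ac /= gal_id. Qed.
(** The inverse image of Q under s. The order of the factors in [movedM] follows the composition
    rule of [galM]. *)
Definition moved s Q : set E := contr (ac s) Q.
Lemma gal_fix s a : s \in H -> ac s (iota a) = iota a.
Proof. by move=> sH; rewrite /ac /= (fixed_gal (subvf U) sH) //; apply/iotaU; exists a. Qed.
Lemma gal_fj s a : s \in H -> ac s (fj X a) = fj X a.
Proof. by move=> sH; rewrite -iotaj gal_fix. Qed.
Lemma gal_oint s x : s \in H -> O x -> O (ac s x).
Proof. by move=> sH; apply: (@OK_OE _ _ _ _ _ X X (ac s)) => a; apply: gal_fj. Qed.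
Lemma moved_max s Q x : max_ideal (moved s Q) x <-> max_ideal Q (ac s x).
Proof. exact: contr_max. Qed.
Lemma movedM s r Q : moved s (moved r Q) = moved (s * r)%g Q.
Proof. by apply/funext => x; rewrite /moved /contr acM. Qed.
Lemma moved1 Q : moved 1%g Q = Q.
Proof. by apply/funext => x; rewrite /moved /contr ac1. Qed.
Lemma moved_above s Q : s \in H -> above X Q -> above X (moved s Q).
Proof. by move=> sH; apply: (@contr_above _ _ _ _ _ X X (ac s)) => a; apply: gal_fj. Qed.
Lemma moved_contr s Q : s \in H -> contr iota (moved s Q) = contr iota Q.
Proof. by move=> sH; apply/funext => a; rewrite /contr /moved /contr gal_fix. Qed.

Lemma moved_norm s Q : s \in H -> above X Q -> prime_norm (moved s Q) = prime_norm Q.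
Proof.
move=> sH aQ.
have le r P : r \in H -> above X P -> (prime_norm (moved r P) <= prime_norm P)%N.
  move=> rH aP; have aP' := moved_above rH aP.
  have [hi h1] := norm_above aP; have [hi' h1'] := norm_above aP'.
  have [f f0 ->] := norm_contr (iota := (ac r)) aP'.1 aP.1 (fun a => iff_refl _) hi' hi.
  by rewrite -{1}[prime_norm _]expn1 leq_exp2l.
apply/eqP; rewrite eqn_leq le //=.
have := le (s^-1)%g (moved s Q); rewrite movedM mulVg moved1 groupV; apply=> //.
exact: moved_above.
Qed.

Lemma conj_poly x : exists (r : seq E) (g : {poly Kb}),
  [/\ map_poly iota g = \prod_(y <- r) ('X - y%:P), x \in r
  & forall y, y \in r -> exists2 s, s \in H & ac s x = y].
Proof.
have [r /eqP rE] := splitting_field_normal U x.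
have /polyOverP cU := minPolyOver U x.
have [f fP] := choice (fun i => (iotaU _).1 (cU i)).
exists r, (\poly_(i < size (minPoly U x)) f i); split.
- rewrite -rE; apply/polyP => i; rewrite coef_map coef_poly.
  case: ltnP => h; first by rewrite fP.
  by rewrite raddf0 nth_default.
- by rewrite -root_prod_XsubC -rE root_minPoly.
move=> y yr; apply: (normalField_root_minPoly (subvf U) (normalFieldf U) (memvf x)).
by rewrite rE root_prod_XsubC.
Qed.

(* The norm of an element lying in Q' but in no conjugate of Q would separate their contractions. *)
Lemma gal_trans Q Q' : above X Q -> above X Q' -> contr iota Q = contr iota Q' ->
  exists2 s, s \in H & Q' = moved s Q.
Proof.
move=> aQ aQ' eQ; have [hQ AQ] := aQ; have [hQ' AQ'] := aQ'; apply: contrapT => nQ.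
have [||e [Oe e1 et]] := @crt_elem _ _ _ _ X Q' [seq moved s Q | s <- enum H] 1 aQ'.
- by move=> P /mapP[s]; rewrite mem_enum => sH ->; apply: moved_above.
- by apply/mapP => -[s]; rewrite mem_enum => sH h; apply: nQ; exists s.
have [r [g [gE xr hr]]] := conj_poly (1 - e).
have Or y : y \in r -> O y.
  by move=> /hr[s sH <-]; apply: gal_oint => //; apply: (oint_sub X).2 => //; apply: oint1.
have gc : iota (g`_0) = \prod_(y <- r) (- y).
  rewrite -coef_map gE -horner_coef0 horner_prod; apply: eq_bigr => y _; by rewrite !hornerE.
have m' : max_ideal Q' (iota g`_0).
  rewrite gc (big_rem _ xr) /= mulrC; apply: maxM => //; last first.
  by apply: subgN; [apply: max_sub | apply/(vge1 hQ')].
  rewrite big_seq; elim/big_ind: _ => [||y /mem_rem /Or Oy]; first exact: prime1.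
  by move=> a b; apply: primeM.
  by apply: primeN => //; apply: aboveO Oy.
have m : ~ max_ideal Q (iota g`_0).
  rewrite gc big_seq; elim/big_ind: _ => [||y yr]; first exact: max_not1.
  move=> a b na nb; have [Pa|nPa] := pselect (Q a); last first.
  have a0 : a != 0 by apply/eqP => a0; apply: nPa; rewrite a0; apply: prime0.
  move=> mab; apply: nb; rewrite -(mulKf a0 b); apply: maxM => //.
  by apply: max_prime => //; apply: prime_tot.
  by move=> mab; apply: nb; apply: max_mul na mab.
  have [s sH ys] := hr y yr => my; apply: (max_not1 hQ).
  have -> : 1 = - - y + ac s e by rewrite opprK -ys rmorphB rmorph1 subrK.
  apply: subgD; [exact: max_sub | apply: subgN => //; exact: max_sub | ].
  have aM := moved_above sH aQ.
  by apply/moved_max/(vge1 aM.1); apply: et; apply/mapP; exists s; rewrite ?mem_enum.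
by apply: m; apply/contr_max; rewrite eQ; apply/contr_max.
Qed.

Section Residue.
Variables (Q : set E) (k : finFieldType) (c : E -> k).
Hypotheses (aQ : above X Q) (hc : residue_map Q c).
Let hQ := aQ.1.
Local Notation N := (prime_norm (contr iota Q)).

Lemma res_poly (r : seq E) : (forall y, y \in r -> Q y) -> forall i,
  Q (\prod_(y <- r) ('X - y%:P))`_i /\
  c (\prod_(y <- r) ('X - y%:P))`_i = (\prod_(y <- r) ('X - (c y)%:P))`_i.
Proof.
elim: r => [_ i|y r IH hr i].
  rewrite !big_nil !coef1; case: eqP => _; rewrite ?mulr1n ?mulr0n.
  by split; [apply: prime1 | apply: (res1 hc)].
  by split; [apply: prime0 | apply: (res0 hQ hc)].
have Qy : Q y by apply: hr; rewrite mem_head.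
have IH' m := IH (fun z zr => hr z (@mem_behead _ (y :: r) z zr)) m.
rewrite !big_cons !mulrBl !coefB !coefXM !coefCM; move: (\prod_(z <- r) ('X - z%:P)) IH' => u IH'.
have [Qi ci] := IH' i; have [Qi1 ci1] := IH' i.-1; have Qm := primeM hQ Qy Qi.
case: eqP => _; first by split; [apply: primeB => //; apply: prime0 | rewrite (resB hQ hc) ?(res0 hQ hc) ?(resM hc) ?ci //; apply: prime0].
by split; [apply: primeB | rewrite (resB hQ hc) // (resM hc) // ci ci1].
Qed.

Lemma contr_res a : contr iota Q a -> c (iota a) ^+ N = c (iota a).
Proof.
move=> pa; have ap := contr_above iotaj aQ; have hp := ap.1; have [hi _] := norm_above ap.
have [k0 [c0 [hc0 <-]]] := residue_ex hp hi.
have [g gE] := residue_morph hp hQ (fun a => iff_refl _) hc0 hc.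
by rewrite -gE // -rmorphXn expf_card.
Qed.

Lemma norm_pchar : [pchar k]%N.-nat N.
Proof.
have ap := contr_above iotaj aQ; have hp := ap.1; have [hi _] := norm_above ap.
have [k0 [c0 [hc0 <-]]] := residue_ex hp hi.
have [g _] := residue_morph hp hQ (fun a => iff_refl _) hc0 hc.
exact: rmorph_card_nat g.
Qed.

Lemma res_moved s : moved s Q = Q -> forall x, Q x -> Q (ac s x).
Proof. by move=> e x; rewrite -{1}e. Qed.

(* An automorphism realizing the Frobenius on a generator of the residue field,
  chosen in all the conjugates of Q other than Q, lies in the decomposition group. *)
Lemma frob_res : exists2 s, s \in H & moved s Q = Q /\ forall x, Q x -> c (ac s x) = c x ^+ N.
Proof.
have [g g0 hg] := field_gen k; have [x0 Qx0 cx0] := res_surj hc g.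
have [w0 Oo xo] := approx 1 aQ Qx0.
pose t := [seq P <- [seq moved s Q | s <- enum H] | P != Q].
have ht P : P \in t -> above X P.
  by rewrite mem_filter => /andP[_ /mapP[s]]; rewrite mem_enum => sH ->; apply: moved_above.
have [|e [Oe e1 et]] := @crt_elem _ _ _ _ X Q t 1 aQ ht; first by rewrite mem_filter eqxx.
have Qo := aboveO aQ Oo; have Qe := aboveO aQ Oe.
pose th := w0 * e; have Oth : O th by apply: ointM.
have Qth := aboveO aQ Oth.
have cth : c th = g.
  have ce : c e = 1.
  rewrite -(res1 hc); apply/(res_eq hQ hc) => //; first exact: prime1.
  by apply: subgC; [exact: max_sub | apply/(vge1 hQ)].
  rewrite (resM hc) // ce mulr1 -cx0; apply/(res_eq hQ hc) => //.
  by apply: subgC; [exact: max_sub | apply/(vge1 hQ)].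
have [r [u [uE xr hr]]] := conj_poly th.
have Qr y : y \in r -> Q y by move=> /hr[s sH <-]; apply: (aboveO aQ); apply: gal_oint.
pose v : {poly k} := \prod_(y <- r) ('X - (c y)%:P).
have vN i : v`_i ^+ N = v`_i.
  have [h1 h2] := res_poly Qr i; rewrite -/v in h2; rewrite -h2 -uE coef_map.
  by apply: contr_res; rewrite /contr -coef_map uE.
(* The coefficients of the reduced polynomial are fixed by the N-th power map, which is additive
   because N is a power of the characteristic; so g ^+ N is a root along with g. *)
have rt : poly.root v (g ^+ N).
  have : poly.root v g.
  have -> : v = \prod_(z <- [seq c y | y <- r]) ('X - z%:P) by rewrite big_map.
  by rewrite root_prod_XsubC -cth map_f.
  move=> /eqP rg; apply/eqP; rewrite horner_coef.
  have N0 : (0 < N)%N by have [_ /ltnW] := norm_above (contr_above iotaj aQ).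
  have <- : v.[g] ^+ N = \sum_(i < size v) v`_i * (g ^+ N) ^+ i.
  rewrite horner_coef; elim/big_ind2: _ => [|a b a' b' <- <-|i _]; first by rewrite expr0n gtn_eqF.
  by rewrite exprDn_pchar // norm_pchar.
  by rewrite exprMn vN -!exprM mulnC.
  by rewrite rg expr0n gtn_eqF.
have : g ^+ N \in [seq c y | y <- r] by rewrite -root_prod_XsubC big_map.
case/mapP => y yr gy; have [s sH sth] := hr y yr.
have cs : c (ac s th) = g ^+ N by rewrite sth.
have mQ : moved s Q = Q.
  apply: contrapT => ne; have : max_ideal (moved s Q) th.
  have st : moved s Q \in t by rewrite mem_filter; apply/andP; split; [apply/eqP | apply/mapP; exists s; rewrite ?mem_enum].
  have aM := ht _ st; rewrite /th; apply: (maxM aM.1); first exact: (aboveO aM).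
  by apply/(vge1 aM.1); apply: et.
  move/moved_max/(res_max hc) => h; have := h (aboveO aQ (gal_oint sH Oth)); rewrite cs => /eqP.
  by rewrite expf_eq0 (negPf g0) andbF.
exists s => //; split=> // x Qx; have [cx|cx] := eqVneq (c x) 0.
  have mx : max_ideal Q x by apply/(res_max hc).
  have N0 : (0 < N)%N by have [_ /ltnW] := norm_above (contr_above iotaj aQ).
  rewrite cx expr0n gtn_eqF //=; apply/(res_max hc); first exact: res_moved.
  by apply/moved_max; rewrite mQ.
have [i ci] := hg _ cx.
have Qi : Q (th ^+ i) by apply: primeX.
have : max_ideal Q (x - th ^+ i) by apply/(res_eq hQ hc) => //; rewrite (resX hQ hc) // cth.
rewrite -{1}mQ => /moved_max; rewrite rmorphB rmorphXn => mm.
have -> : c (ac s x) = c (ac s th ^+ i).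
  apply/(res_eq hQ hc) => //; first exact: res_moved.
  by apply: primeX => //; apply: res_moved.
by rewrite (resX hQ hc) ?cs ?ci -?exprM 1?mulnC //; apply: res_moved.
Qed.

End Residue.

Lemma frobenius_ex Q : above X Q -> exists2 s, s \in H &
  moved s Q = Q /\ forall x, Q x -> max_ideal Q (ac s x - x ^+ prime_norm (contr iota Q)).
Proof.
move=> aQ; have hQ := aQ.1; have [hi _] := norm_above aQ; have [k [c [hc _]]] := residue_ex hQ hi.
have [s sH [mQ h]] := frob_res aQ hc; exists s => //; split=> // x Qx.
apply/(res_eq hQ hc); [exact: res_moved | exact: primeX | by rewrite h // (resX hQ hc)].
Qed.

Definition decomp Q : {set gal_of {:E}} := [set s in H | `[< moved s Q = Q >]]%SET.

(** The inertia group of Q in H is trivial, that is, Q is unramified over U. *)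
Definition tame Q : Prop := forall s, s \in H -> moved s Q = Q ->
  (forall x, Q x -> max_ideal Q (ac s x - x)) -> s = 1%g.

(** If s is in the inertia group of Q, then s(b) - b lies in the maximal ideal for all integral b.
    Choosing for each nontrivial s one integral b that it moves, only the prime divisors of the
    product of these differences remain. *)
Lemma tame_almost : exists t : seq (set E), forall Q, above X Q -> ~ tame Q -> Q \in t.
Proof.
have Hb s : exists b, O b /\ (s <> 1%g -> s \in H -> ac s b != b).
  have [->|s1] := eqVneq s 1%g; first by exists 1; split=> //; apply: oint1.
  have [b sb] : exists b, ac s b != b.
  apply: contrapT => nb; move/negP: s1; apply; apply/gal_eqP => b _.
  by rewrite ac1; apply/eqP; apply: contraT => h; case: nb; exists b.
  have [D [D0 _ OD]] := oint_frac X b; exists (fj X D * b); split=> // _ sH.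
  by rewrite rmorphM gal_fj // (inj_eq (mulfI (j_neq0 X D0))).
have [b bP] := choice Hb.
pose y := \prod_(s in H | s != 1%g) (ac s (b s) - b s).
have Oy : O y.
  rewrite /y; elim/big_ind: _ => [||s /andP[sH _]]; [exact: oint1 | exact: ointM |].
  by have [Ob _] := bP s; apply: (oint_sub X).2 => //; apply: gal_oint.
have y0 : y != 0.
  apply/prodf_neq0 => s /andP[sH s1]; rewrite subr_eq0; have [_ h] := bP s; apply: h => //; exact/eqP.
have [t _ ht] := mem_finite Oy y0; exists t => Q aQ nQ; apply/ht; split=> //.
apply: contrapT => ny; apply: nQ => s sH mQ hs; apply/eqP; apply: contraT => s1; case: ny.
have hQ := aQ.1; rewrite /y (bigD1 s) /= ?sH // mulrC; apply: maxM => //.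
  elim/big_ind: _ => [||r /andP[/andP[rH _] _]]; [exact: prime1 | by move=> a b'; apply: primeM |].
  have [Ob _] := bP r; by apply: (aboveO aQ); apply: (oint_sub X).2 => //; apply: gal_oint.
by apply: hs; apply: (aboveO aQ); case: (bP s).
Qed.

Lemma tame_oint Q s : above X Q -> tame Q -> s \in H ->
  (forall x, O x -> max_ideal Q (ac s x - x)) -> s = 1%g.
Proof.
move=> aQ tQ sH hs; have hQ := aQ.1; have sm := max_sub hQ.
have mQ : moved s Q = Q.
  apply/esym; apply: (above_eq aQ (moved_above sH aQ)) => x [Ox mx]; split=> //.
  by apply/moved_max; rewrite -(subrK x (ac s x)); apply: subgD => //; apply: hs.
apply: tQ => // x Qx; have [w0 Oo /(vge1 hQ) xo] := approx 1 aQ Qx.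
have -> : ac s x - x = (ac s (x - w0) - (x - w0)) + (ac s w0 - w0) by rewrite rmorphB; ring.
apply: subgD => //; last exact: hs.
by apply: sm.2 => //; apply/moved_max; rewrite mQ.
Qed.

Lemma frob_uniq Q n s r : above X Q -> tame Q -> s \in H -> r \in H ->
  (forall x, O x -> max_ideal Q (ac s x - x ^+ n)) -> (forall x, O x -> max_ideal Q (ac r x - x ^+ n)) -> s = r.
Proof.
move=> aQ tQ sH rH hs hr; have sm := max_sub aQ.1.
suff : (r^-1 * s)%g = 1%g by move/(congr1 (fun w => r * w)%g); rewrite mulKVg mulg1.
apply: (tame_oint aQ tQ) => [|x Ox]; first by rewrite groupM ?groupV.
have rV : (r^-1)%g \in H by rewrite groupV.
have Oy := gal_oint rV Ox.
have e : x = ac r (ac (r^-1)%g x) by rewrite -acM mulVg ac1.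
rewrite acM {2}e; apply: (subg_trans sm (hs _ Oy)).
by apply: subgC => //; apply: hr.
Qed.

Lemma decompP Q s : reflect (s \in H /\ moved s Q = Q) (s \in decomp Q).
Proof. by rewrite inE; apply: (iffP andP) => -[h1 h2]; split=> //; apply/asboolP. Qed.

(** The first f powers of a Frobenius element act on the residue field as distinct power maps, their
    exponents N ^ i being below its cardinality. *)
Lemma decomp_ge Q f : above X Q -> prime_norm Q = (prime_norm (contr iota Q) ^ f)%N ->
  (f <= #|decomp Q|)%N.
Proof.
move=> aQ; set N := prime_norm (contr iota Q) => NQ; have hQ := aQ.1.
have [hi _] := norm_above aQ; have [_ N1] := norm_above (contr_above iotaj aQ).
have [k [c [hc ck]]] := residue_ex hQ hi; have [s sH [mQ hs]] := frob_res aQ hc.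
have si i : (s ^+ i)%g \in decomp Q /\ forall x, Q x -> c (ac (s ^+ i)%g x) = c x ^+ (N ^ i).
  elim: i => [|i [/decompP[h1 h2] h3]]; first by split=> [|x _]; [apply/decompP; rewrite group1 moved1 | rewrite ac1].
  rewrite expgSr; split=> [|x Qx]; first by apply/decompP; rewrite groupM // -movedM mQ.
  have Qs : Q (ac (s ^+ i)%g x) by rewrite -{1}h2 in Qx.
  by rewrite acM hs // h3 // -exprM -expnSr.
rewrite -[f]card_ord -cardsT -(card_imset [set: 'I_f] (f := fun i : 'I_f => (s ^+ i)%g)).
  by apply: subset_leq_card; apply/fintype.subsetP => r /imsetP[i _ ->]; case: (si i).
move=> i i' e; apply: val_inj; apply/eqP; apply: contraT => ne.
have : (#|k| <= maxn (N ^ i) (N ^ i'))%N.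
  apply: pow_eq_card; first by rewrite eqn_exp2l.
  move=> z; have [x Qx <-] := res_surj hc z.
  by rewrite -(si i).2 // -(si i').2 // e.
by rewrite ck NQ leqNgt gtn_max !ltn_exp2l // !ltn_ord.
Qed.

(* The residues of the conjugates of a generator are roots of a polynomial of degree at most f,
  found by the pigeonhole principle. *)
Lemma decomp_le Q f : above X Q -> tame Q -> prime_norm Q = (prime_norm (contr iota Q) ^ f)%N ->
  (#|decomp Q| <= f)%N.
Proof.
move=> aQ tQ; set N := prime_norm (contr iota Q) => NQ; have hQ := aQ.1.
have [hi _] := norm_above aQ; have ap := contr_above iotaj aQ; have [hip N1] := norm_above ap.
have [k [c [hc ck]]] := residue_ex hQ hi; have [k0 [c0 [hc0 ck0]]] := residue_ex ap.1 hip.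
have [G GE] := residue_morph ap.1 hQ (fun a => iff_refl _) hc0 hc.
have [g g0 hg] := field_gen k; have [x0 Qx0 cx0] := res_surj hc g.
pose ev (u : {ffun 'I_f.+1 -> k0}) := \sum_i G (u i) * g ^+ i.
have [u [v [uv euv]]] : exists u v, u <> v /\ ev u = ev v.
  apply: contrapT => nuv; have inj : injective ev.
  by move=> u v e; apply: contrapT => ne; apply: nuv; exists u, v.
  have := max_card (mem (codom ev)); rewrite card_codom // card_ffun card_ord ck ck0 NQ -/N.
  by rewrite leqNgt ltn_exp2l // ltnSn.
have Ha i : exists a, contr iota Q a /\ c0 a = u i - v i.
  by have [a pa <-] := res_surj hc0 (u i - v i); exists a.
have [a aP] := choice Ha.
pose h : {poly k} := \poly_(i < f.+1) G (c0 (a (inord i))).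
have hE z : h.[z] = \sum_(i < f.+1) G (c0 (a i)) * z ^+ i.
  by rewrite horner_poly; apply: eq_bigr => i _; rewrite inord_val.
have h0 : h != 0.
  apply/eqP => h0; apply: uv; apply/ffunP => i; apply/eqP; rewrite -subr_eq0 -(fmorph_eq0 G) -(aP i).2.
  by have := congr1 (fun w : {poly k} => w`_i) h0; rewrite coef0 coef_poly ltn_ord inord_val => ->.
have Qa s i : s \in H -> Q (ac s (iota (a i))) by move=> sH; rewrite gal_fix //; exact: (aP i).1.
have sum_res s : s \in decomp Q ->
  Q (ac s (\sum_(i < f.+1) iota (a i) * x0 ^+ i)) /\ c (ac s (\sum_(i < f.+1) iota (a i) * x0 ^+ i)) = h.[c (ac s x0)].
  move=> /decompP[sH mQ]; have Qs := res_moved mQ Qx0.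
  have Qi i : Q (ac s (iota (a i) * x0 ^+ i)) by rewrite rmorphM rmorphXn; apply: primeM => //; [exact: Qa | exact: primeX].
  rewrite rmorph_sum; split.
  elim/big_ind: _ => [|b b'|//]; [exact: prime0 | exact: primeD].
  rewrite (res_sum hQ hc) // hE; apply: eq_bigr => i _.
  rewrite rmorphM rmorphXn (resM hc) ?(resX hQ hc) //; [|exact: Qa|exact: primeX].
  by rewrite gal_fix // GE //; exact: (aP i).1.
have d1 : 1%g \in decomp Q by apply/decompP; rewrite group1 moved1.
have rt s : s \in decomp Q -> poly.root h (c (ac s x0)).
  move=> sd; have [Qs cs] := sum_res s sd; rewrite /poly.root -cs; apply/eqP/(res_max hc) => //.
  have /decompP[sH mQ] := sd; apply/moved_max; rewrite mQ.
  have [Q1 c1] := sum_res _ d1; rewrite !ac1 in Q1 c1.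
  apply/(res_max hc) => //; rewrite c1 cx0 hE.
  under eq_bigr => i _ do rewrite (aP i).2 rmorphB mulrBl.
  by rewrite sumrB -/(ev u) -/(ev v) euv subrr.
have inj : {in enum (decomp Q) &, injective (fun s : gal_of {:E} => c (ac s x0))}.
  move=> s r; rewrite !mem_enum => /decompP[sH ms] /decompP[rH mr] /= e.
  suff : (r^-1 * s)%g = 1%g by move/(congr1 (fun w => r * w)%g); rewrite mulKVg mulg1.
  have mV : moved (r^-1)%g Q = Q by rewrite -{1}mr movedM mulVg moved1.
  apply: tQ => [||x Qx]; first by rewrite groupM ?groupV.
  by rewrite -movedM ms mV.
  have Qy : Q (ac (r^-1)%g x) by apply: res_moved mV _ Qx.
  have {2}-> : x = ac r (ac (r^-1)%g x) by rewrite -acM mulVg ac1.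
  rewrite acM; move: (ac (r^-1)%g x) Qy => y Qy.
  have act w z : moved w Q = Q -> Q z -> c z = 0 -> c (ac w z) = 0.
  move=> mw Qz /(res_max hc Qz) mz; apply/(res_max hc); first exact: res_moved.
  by apply/moved_max; rewrite mw.
  apply/(res_eq hQ hc); [exact: res_moved | exact: res_moved |].
  have [cy|cy] := eqVneq (c y) 0; first by rewrite !act.
  have [i ci] := hg _ cy.
  have ww w : w \in H -> moved w Q = Q -> c (ac w y) = c (ac w x0) ^+ i.
  move=> wH mw; have Qi : Q (x0 ^+ i) by apply: primeX.
  have : c (ac w (y - x0 ^+ i)) = 0.
  by apply: act => //; [exact: primeB | rewrite (resB hQ hc) // (resX hQ hc) // cx0 ci subrr].
  rewrite rmorphB rmorphXn (resB hQ hc) ?(resX hQ hc) //; try exact: res_moved; last first.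
  by apply: primeX => //; apply: res_moved.
  by move/eqP; rewrite subr_eq0 => /eqP.
  by rewrite !ww // e.
rewrite cardE -(size_map (fun s : gal_of {:E} => c (ac s x0))).
have sz : (size h <= f.+1)%N by apply: size_poly.
rewrite -ltnS; apply: leq_trans sz; apply: max_poly_roots => //.
  by apply/allP => z /mapP[s]; rewrite mem_enum => sd ->; apply: rt.
by rewrite map_inj_in_uniq ?enum_uniq.
Qed.

(** Orbit counting for the transitive action of H on the primes over p: the number of these times
    the order of the decomposition group is the order of H, and that order is at least f, with
    equality in the unramified case. *)
Lemma fibre p : above Y p -> exists (t : seq (set E)) (f : nat),
  [/\ uniq t, forall P, P \in t <-> above X P /\ contr iota P = p,
  forall P, P \in t -> prime_norm P = (prime_norm p ^ f)%N, (0 < f)%N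
  & (0 < size t)%N /\ (size t * f <= #|H|)%N /\ ((forall P, P \in t -> tame P) -> (size t * f = #|H|)%N)].
Proof.
move=> ap; have [Q aQ eQ] := lying_over iotaj ap; have hQ := aQ.1.
have [hip _] := norm_above ap; have [hi _] := norm_above aQ.
have [f f0 Nf] : exists2 f, (0 < f)%N & prime_norm Q = (prime_norm p ^ f)%N.
  by apply: (norm_contr (iota := iota) ap.1 hQ) => // a; rewrite -eQ.
pose m s := moved s Q.
pose t := undup [seq m s | s <- enum H].
have tP P : P \in t <-> above X P /\ contr iota P = p.
  rewrite mem_undup; split=> [/mapP[s]|[aP eP]].
  by rewrite mem_enum => sH ->; rewrite /m moved_contr //; split=> //; apply: moved_above.
  have [|s sH ->] := gal_trans aQ aP; first by rewrite eP.
  by apply/mapP; exists s; rewrite ?mem_enum.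
have cnt s0 : s0 \in H -> (\sum_(s in H) (m s0 == m s) = #|decomp Q|)%N.
  move=> s0H; rewrite -big_mkcondr /= sum1_card -(card_lcoset (decomp Q) s0); apply: eq_card => s.
  rewrite unfold_in mem_lcoset inE; apply/andP/andP => -[h1 h2]; split.
  - by rewrite groupM ?groupV.
  - apply/asboolP; move/eqP: h2; rewrite /m => h2.
  by rewrite -movedM -h2 movedM mulVg moved1.
  - by rewrite -(mulKVg s0 s) groupM.
  - apply/eqP; move/asboolP: h2; rewrite -movedM /m => h2.
  by rewrite -[in LHS]h2 movedM mulgV movedM mul1g.
have tot : (size t * #|decomp Q| = #|H|)%N.
  rewrite -sum1_size big_distrl /=.
  rewrite -[RHS]sum1_card (eq_bigr (fun s => \sum_(P <- t) (P == m s))%N).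
  rewrite exchange_big /= big_seq [RHS]big_seq; apply: eq_bigr => P; rewrite mem_undup => /mapP[s0].
  by rewrite mem_enum mul1n => s0H ->; rewrite cnt.
  move=> s sH; rewrite -big_mkcond /= sum1_count (@eq_count _ _ (pred1 (m s))) ?count_uniq_mem ?undup_uniq //.
  by rewrite mem_undup map_f // mem_enum.
exists t, f; split=> // [|P|]; first exact: undup_uniq.
  by rewrite mem_undup => /mapP[s]; rewrite mem_enum => sH ->; rewrite /m moved_norm.
have NQ : prime_norm Q = (prime_norm (contr iota Q) ^ f)%N by rewrite eQ.
have Qt : Q \in t by apply/tP.
split; first by case: (t) Qt.
split; first by rewrite -tot leq_mul2l (decomp_ge aQ NQ) orbT.
by move=> tt; rewrite -tot; congr (_ * _)%N; apply/eqP; rewrite eqn_leq (decomp_ge aQ NQ) decomp_le //; apply: tt.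
Qed.

End NormalExtension.

Lemma max_exp (K : fieldType) (P : set K) x k : is_prime P -> P x -> max_ideal P (x ^+ k) -> max_ideal P x.
Proof.
move=> hP Px; elim: k => [|k IH]; first by move/(max_not1 hP).
by rewrite exprS => h; apply: contrapT => n; apply: (n); apply: IH; exact: (max_mul hP Px n h).
Qed.

Lemma pigeon (T : eqType) (k : finType) (g : T -> k) (y0 : T) (u : seq T) :
  exists a, (size u <= #|k| * size [seq y <- u | g y == a])%N.
Proof.
have e : size u = (\sum_a size [seq y <- u | g y == a])%N.
  rewrite -sum1_size (eq_bigr (fun a => \sum_(y <- u) (g y == a))%N) => [|a _]; last first.
  by rewrite size_filter -sum1_count big_mkcond.
  rewrite exchange_big /=; apply: eq_bigr => y _; rewrite (bigD1 (g y)) //= eqxx big1 // => a.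
  by rewrite eq_sym => /negPf->.
have [a _ ha] := @arg_maxnP k (g y0) predT (fun a => size [seq y <- u | g y == a]) isT.
exists a; rewrite [X in (X <= _)%N]e -sum_nat_const; apply: leq_sum => b _; exact: ha.
Qed.

(** * Many elements with distinct valuations *)

Section Valuations.
Variables (K : fieldType) (P : set K).
Hypothesis hP : is_prime P.

Lemma sum_distinct_vl (s : seq K) : s != [::] -> (forall x, x \in s -> x != 0) -> uniq (map (vl P) s) ->
  \sum_(x <- s) x != 0 /\ vl P (\sum_(x <- s) x) \in map (vl P) s.
Proof.
elim: s => // x s IH _ h /= /andP[nx us]; have x0 : x != 0 by apply: h; rewrite mem_head.
have [->|s0] := eqVneq s [::]; first by rewrite big_seq1 mem_head.
have [|y0 ym] := IH s0 _ us; first by move=> z zs; apply: h; rewrite inE zs orbT.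
rewrite big_cons; move: (\sum_(z <- s) z) y0 ym => y y0 ym.
have ne : vl P x != vl P y by apply: contraNneq nx => ->.
case/lt_total/orP: ne => lt.
  by have [h1 ->] := vl_ltD hP x0 y0 lt; rewrite mem_head.
by rewrite addrC; have [h1 ->] := vl_ltD hP y0 x0 lt; rewrite inE ym orbT.
Qed.

(* Split a set according to residues at the smallest valuation of a difference, and iterate in a largest class. *)
Lemma val_spread N : hasidx P (max_ideal P) N -> forall u : seq K, uniq u -> (forall y, y \in u -> P y) ->
  exists s : seq K, [/\ forall x, x \in s -> x != 0 /\ exists y z, [/\ y \in u, z \in u & x = y - z],
  uniq (map (vl P) s) & (size u <= N ^ size s)%N].
Proof.
move=> /(residue_ex hP)[k [c [hc <-]]] u; have [n] := ubnP (size u).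
elim: n u => // n IH u un uu hu.
have [small|] := leqP (size u) 1; first by exists [::].
case: u un uu hu => [//|x0 [//|x1 u']]; set u := x0 :: x1 :: u' => un uu hu _.
pose W m := `[< exists y z, [/\ y \in u, z \in u, y != z & vl P (y - z) = m%:Z] >].
have hW y z : y \in u -> z \in u -> y != z -> vl P (y - z) = `|vl P (y - z)|%N.
  move=> yu zu yz; have : 0 <= vl P (y - z).
  by apply/(vl_prime hP); [rewrite subr_eq0 | apply: primeB => //; apply: hu].
  by move/gez0_abs.
have exW : exists m, W m.
  exists `|vl P (x0 - x1)|%N; apply/asboolP; exists x0, x1.
  have ne : x0 != x1 by move: uu => /=; rewrite inE negb_or => /andP[/andP[]].
  by rewrite !inE !eqxx orbT; split=> //; apply: hW; rewrite // !inE eqxx ?orbT.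
have [m /asboolP[y0 [z0 [y0u z0u yz0 vm]]] mmin] := ex_minnP exW.
have ge y z : y \in u -> z \in u -> vge P m (y - z).
  move=> yu zu; have [->|yz] := eqVneq y z; first by rewrite subrr; exact: (vge_sub hP _).1.
  apply/(vlP hP); first by rewrite subr_eq0.
  rewrite hW // lez_nat; apply: mmin; apply/asboolP; exists y, z; split=> //; exact: hW.
pose g y := c ((y - y0) / unif P ^ m).
have [a ha] := pigeon g y0 u; set v := [seq y <- u | g y == a] in ha.
have Pg y : y \in u -> P ((y - y0) / unif P ^ m) by move=> yu; apply: ge.
have vg y z : y \in v -> z \in v -> vge P (m%:Z + 1) (y - z).
  rewrite !mem_filter => /andP[/eqP ga yu] /andP[/eqP gz zu].
  have : max_ideal P ((y - y0) / unif P ^ m - (z - y0) / unif P ^ m).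
  by apply/(res_eq hP hc); [exact: Pg | exact: Pg | rewrite -/(g y) ga -gz].
  rewrite -mulrBl (_ : y - y0 - (z - y0) = y - z); last by ring.
  move/(vge1 hP); rewrite /vge /= expfzDr ?unif_neq0 // invfM mulrA expr1z; exact.
have vu : {subset v <= u} by move=> y; rewrite mem_filter => /andP[].
have lt : (size v < size u)%N.
  rewrite size_filter ltn_neqAle count_size andbT; apply/negP; rewrite -all_count => /allP al.
  have yv y : y \in u -> y \in v by move=> yu; rewrite mem_filter al.
  have := vg _ _ (yv _ y0u) (yv _ z0u); move/(vlP hP) => h.
  by have := h (_ : y0 - z0 != 0); rewrite subr_eq0 vm => /(_ yz0); lia.
have [|||s [h1 h2 h3]] := IH v.
- by apply: leq_trans lt _.
- exact: filter_uniq.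
- by move=> y /vu/hu.
exists ((y0 - z0) :: s); split.
- move=> x; rewrite inE => /orP[/eqP->|/h1[x_0 [y [z [yv zv xE]]]]].
  by rewrite subr_eq0; split=> //; exists y0, z0.
  by split=> //; exists y, z; split; [exact: (vu _ yv) | exact: (vu _ zv) |].
- rewrite /= h2 andbT; apply/negP => /mapP[x xs e].
  have [x_0 [y [z [yv zv xE]]]] := h1 x xs.
  have := vg _ _ yv zv; rewrite -xE => /(vlP hP _ x_0); rewrite -e vm; lia.
rewrite /= expnS; apply: leq_trans ha _; rewrite leq_mul2l h3 orbT //.
Qed.

End Valuations.

(** * Stepanov's method: numerical part *)

Lemma step_parameter d r c mu KK m : (0 < d)%N -> m = (c + (r * mu + KK) %/ d + 1)%N ->
  [/\ r * mu + KK <= d * (m - c), m <= c + (r * mu + KK) + 1 & d * m <= d * c + r * mu + KK + d]%N.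
Proof.
move=> d0 mE; have e := divn_eq (r * mu + KK) d; have lt := ltn_pmod (r * mu + KK) d0.
have -> : (m - c = (r * mu + KK) %/ d + 1)%N by rewrite mE -addnA addKn.
have le := leq_div (r * mu + KK) d.
rewrite mE; clear mE; move: ((r * mu + KK) %/ d)%N ((r * mu + KK) %% d)%N e lt le => a b e lt le.
rewrite -addnA [(d * (c + _))%N]mulnDr mulnDr muln1 [(d * a)%N]mulnC -addnA !addnA.
split; lia.
Qed.

(** l bounds the pole orders of the coefficients to be found. It is about mu / (2 d), so that their
    valuations at P0 stay below nu. *)
Lemma step_degree d r c mu l : (0 < d)%N -> (8 * d * (c + r + 1) <= mu)%N -> l = (mu %/ (2 * d))%N ->
  (2 * d * l <= mu)%N /\ exists x, l = (x + (c + r))%N /\ (mu <= 4 * d * x)%N.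
Proof.
move=> d0 large lE; have d2 : (0 < 2 * d)%N by lia.
have e := divn_eq mu (2 * d); have lt := ltn_pmod mu d2; rewrite -lE in e.
move: (mu %% (2 * d))%N e lt => b e lt; clear lE.
have h : (c + r <= l)%N by nia.
split; first by nia.
exists (l - (c + r))%N; split; first by rewrite subnK.
have [x xE] : exists x, (l = x + (c + r))%N by exists (l - (c + r))%N; rewrite subnK.
rewrite xE addnK; subst l; nia.
Qed.

(** The last hypothesis is what injectivity of the map Phi would mean for exponents of q. The
    surplus 4 d W + 1 in the number k of summands is just what contradicts it. *)
Lemma step_count d r c mu W l x m k : (0 < d)%N -> (0 < mu)%N -> W = (2 * r * c + r * r + r * (4 * c + 1))%N ->
  l = (x + (c + r))%N -> (mu <= 4 * d * x)%N -> (r * mu + (4 * d * W + 1) <= r * k)%N ->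
  (m <= c + (r * mu + (4 * d * W + 1)) + 1)%N ->
  ((l - c) * k <= mu * (l + c) + (m + c) + c + c)%N -> False.
Proof.
move=> d0 mu0 WE lE mux rk mle le; have KE : exists KK, KK = (4 * d * W + 1)%N by eexists.
case: KE => KK KE; rewrite -KE in rk mle.
have lc : (l - c = x + r)%N by lia.
have a1 : (r * ((l - c) * k) <= r * (mu * (l + c) + (m + c) + c + c))%N by rewrite leq_mul2l le orbT.
have a2 : ((l - c) * (r * mu + KK) <= (l - c) * (r * k))%N by rewrite leq_mul2l rk orbT.
rewrite mulnCA in a1.
have a3 := leq_trans a2 a1.
have a4 : (r * m <= r * (c + (r * mu + KK) + 1))%N by rewrite leq_mul2l mle orbT.
have a5 : (KK * x <= mu * W)%N.
  rewrite lc lE in a3; rewrite WE; clear -mu0 a3 a4.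
  have h : (r * (4 * c + 1) <= mu * (r * (4 * c + 1)))%N by rewrite leq_pmull.
  move: h; move: a3 a4; nia.
have a6 : (4 * d * (KK * x) <= 4 * d * (mu * W))%N by rewrite leq_mul2l a5 orbT.
have a7 : (KK * mu <= KK * (4 * d * x))%N by rewrite leq_mul2l mux orbT.
have a8 : (KK * mu = 4 * d * (mu * W) + mu)%N by rewrite KE mulnDl mul1n -[(4 * d * W * mu)%N]mulnA (mulnC W).
have a9 : (KK * (4 * d * x) = 4 * d * (KK * x))%N by rewrite mulnCA.
lia.
Qed.

(** * Stepanov's upper bound *)

Section Stepanov.
Variables (R : realType) (F : finFieldType).
Local Notation F0 := {fraction {poly F}}.
Local Notation q := #|F|.
Variables (S : sized R F0) (E : fieldType) (X : finext S E).
Hypotheses (SA : sA S = @fpoly F) (Sabs : sabs S = @fabs R F).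
Local Notation O := (oint X).
Local Notation d := (fd X).

Let q1 : (1 < q)%N := finNzRing_gt1 F.
Let q0 : (0 < q)%N := ltnW q1.
(** Plays the part of a Riemann-Roch space: functions with poles only above infinity, of order
    bounded in terms of m. By [ball_pick] and [ball_count] it has q^(d m + O(1)) elements. *)
Definition ball (m : nat) : set E := fun x => O x /\ box X (q ^ m)%:R x.
Lemma ball0 m : ball m 0.
Proof. by split; [exact: (oint_sub X).1 | apply: box0; rewrite ltr0n expn_gt0 q0]. Qed.

Lemma ballD m x y : ball m x -> ball m y -> ball m (x + y).
Proof.
move=> [Ox bx] [Oy b_y]; split=> [|i]; first exact: ointD.
rewrite fcoD Sabs; apply: le_lt_trans (fabs_max _ _ _) _; rewrite -Sabs gt_max.
by rewrite bx b_y.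
Qed.

Lemma ballB m x y : ball m x -> ball m y -> ball m (x - y).
Proof. by move=> hx [Oy b_y]; apply: ballD => //; split; [exact: ointN | exact: boxN]. Qed.
Lemma ball_le m n x : (m <= n)%N -> ball m x -> ball n x.
Proof. by move=> mn [Ox bx]; split=> //; apply: box_le bx; rewrite ler_nat leq_pexp2l. Qed.
Lemma ball_sum (I : Type) (s : seq I) (f : I -> E) m : (forall i, ball m (f i)) -> ball m (\sum_(i <- s) f i).
Proof. by move=> h; elim/big_ind: _ => [|x y|//]; [exact: ball0 | exact: ballD]. Qed.

Lemma ex_qpow (B : R) : exists c : nat, B <= (q ^ c)%:R.
Proof.
exists (Num.bound `|B|); apply: le_trans (ler_norm _) _; apply/ltW/(lt_trans (archi_boundP (normr_ge0 B))).
by rewrite ltr_nat ltn_expl.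
Qed.

Let pow_le (C : R) e m : 1 <= C -> C <= (q ^ e)%:R -> (C * (q ^ m)%:R) ^+ d <= (q ^ (d * (m + e)))%:R.
Proof.
move=> C1 he; rewrite [(d * _)%N]mulnC expnM [leRHS]natrX; apply: lerXn2r; rewrite ?nnegrE ?mulr_ge0 //; first lra.
by rewrite addnC expnD natrM ler_wpM2r.
Qed.

Lemma ball_pick : exists c : nat, forall m, exists u : seq E,
  [/\ uniq u, forall x, x \in u -> ball m x & (q ^ (d * (m - c)) <= size u)%N].
Proof.
have [c c0 hc] := ball_many X; have [e he] := ex_qpow c^-1.
exists e.+1 => m; have [me|me] := leqP m e.+1.
  exists [:: 0]; split=> // [x|]; first by rewrite inE => /eqP->; exact: ball0.
  by move: me; rewrite -subn_eq0 => /eqP ->; rewrite muln0.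
have [|n [u [hu ui nb]]] := hc (q ^ m)%:R 0.
  rewrite ler_nat; apply: leq_trans (_ : q ^ 1 <= _)%N => //; rewrite leq_exp2l //; lia.
exists [seq u i | i <- enum 'I_n]; split.
- by rewrite map_inj_uniq ?enum_uniq.
- by move=> x /mapP[i _ ->]; have [Ou bu] := hu i; rewrite subr0 in bu.
rewrite size_map size_enum_ord -(ler_nat R); apply: le_trans nb.
rewrite mulnC expnM natrX; apply: lerXn2r; rewrite ?nnegrE ?mulr_ge0 //; first exact: ltW.
apply: (@le_trans _ _ (q ^ (m - e))%:R); first by rewrite ler_nat leq_exp2l //; lia.
have em : (e <= m)%N by lia.
rewrite -{2}(subnK em) expnD natrM mulrCA ler_peMr //.
by rewrite -ler_pdivrMl // mulr1.
Qed.

Lemma ball_count : exists c : nat, forall m (u : seq E), uniq u -> (forall x, x \in u -> ball m x) ->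
  (size u <= q ^ (d * (m + c)))%N.
Proof.
have [C C1 hC] := ball_finite X; have [e he] := ex_qpow C; exists e => m u uu hu.
have [|n nle hn] := hC (q ^ m)%:R 0; first by rewrite ler1n expn_gt0 q0.
have : (#|'I_(size u)| <= n)%N.
  apply: (idx_ge (u := fun i : 'I_(size u) => u`_i) (@zeros_sub E) hn) => [i|i k].
  by have [Ou bu] := hu _ (mem_nth 0 (ltn_ord i)); split=> //; rewrite subr0.
  move=> /eqP; rewrite subr_eq0 => /eqP e2; apply/val_inj/eqP.
  by rewrite -(nth_uniq 0 (ltn_ord i) (ltn_ord k) uu) e2.
rewrite card_ord => h; apply: leq_trans h _; rewrite -(ler_nat R); exact: le_trans nle (pow_le _ _ _).
Qed.

Lemma ballM : exists c : nat, (forall m n x y, ball m x -> ball n y -> ball (m + n + c) (x * y)) /\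
  forall k m x, (0 < k)%N -> ball m x -> ball (k * (m + c)) (x ^+ k).
Proof.
have [e he] := ex_qpow (bM X).
have M m n x y : ball m x -> ball n y -> ball (m + n + e) (x * y).
  move=> [Ox bx] [Oy b_y]; split; first exact: ointM.
  apply: box_le (boxM _ _ bx b_y); rewrite ?ltr0n ?expn_gt0 ?q0 //.
  by rewrite -natrM -expnD [(_ + e)%N]addnC [(q ^ (e + _))%N]expnD natrM ler_wpM2r.
exists e; split=> // k m x; case: k => // k _ bx; elim: k => [|k IH].
  by rewrite expr1 mul1n; apply: ball_le bx; apply: leq_addr.
rewrite exprS; apply: ball_le (M _ _ _ _ bx IH).
by rewrite mulSn addnAC.
Qed.

(** The degree of a function bounds the number of its zeros, weighted by residue degrees, and the
    order of each of them; here both come from the index of y O. *)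
Lemma ball_norm : exists c : nat, forall m y, ball m y -> y != 0 ->
  (forall t, uniq t -> (forall Q, Q \in t -> above X Q /\ max_ideal Q y) ->
  (\prod_(Q <- t) prime_norm Q <= q ^ (d * (m + c)))%N) /\
  forall P, above X P -> (`|vl P y| <= d * (m + c))%N.
Proof.
have [C C1 hC] := idx_scaledO X; have [e he] := ex_qpow C; exists e => m y [Oy b_y] y0.
have [|M Mle hM] := hC y (q ^ m)%:R Oy y0 _ b_y; first by rewrite ler1n expn_gt0 q0.
have ML : (M <= q ^ (d * (m + e)))%N.
  rewrite -(ler_nat R); exact: le_trans Mle (pow_le _ _ _).
split=> [t ut ht|P aP]; first exact: leq_trans (prod_norm_le Oy y0 ut ht hM) ML.
have [t ut ht] := mem_finite Oy y0.
have [Pt|Pt] := boolP (P \in t); last first.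
  have : ~ 1 <= vl P y by move=> /(vl_max aP.1 y0) my; move/negP: Pt; apply; apply/ht.
  by have := vge_oint aP y0 Oy; lia.
have hM2 := idx_scaled_prod Oy y0 ut (fun Q Qt => ((ht Q).1 Qt).1) (fun Q aQ mQ => (ht Q).2 (conj aQ mQ)).
have := ML; rewrite (idx_uniq (scaled_sub _ (oint_sub X)) hM hM2) (big_rem _ Pt) /= => le.
have [f f0 Nf] := norm_power SA aP.
rewrite -(leq_exp2l _ _ q1); apply: leq_trans le.
apply: leq_trans (_ : prime_norm P ^ `|vl P y| <= _)%N.
  by rewrite Nf -expnM leq_exp2l // leq_pmull.
rewrite leq_pmulr // big_seq prodn_cond_gt0 // => Q /mem_rem/ht[aQ _].
by rewrite expn_gt0; have [_ /ltnW->] := norm_above aQ.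
Qed.

Lemma pchar_q : [pchar E]%N.-nat q.
Proof.
pose c : {rmorphism F -> E} := fj X \o (tf \o polyC).
have [p pp pc] := finPcharP F; have := fin_ring_pchar_abelem pc.
move=> /abelem_pgroup; rewrite /pgroup cardsT; apply: sub_in_pnat => l _; rewrite inE => /eqP ->.
exact: (rmorph_pchar c) pc.
Qed.

Lemma powqD a (x y : E) : (x + y) ^+ (q ^ a) = x ^+ (q ^ a) + y ^+ (q ^ a).
Proof. by rewrite exprDn_pchar // pnatX pchar_q. Qed.

Lemma powq_sum a (I : Type) (s : seq I) (f : I -> E) :
  (\sum_(i <- s) f i) ^+ (q ^ a) = \sum_(i <- s) f i ^+ (q ^ a).
Proof.
elim/big_ind2: _ => [|x y x' y' <- <-|//]; last exact: powqD.
by rewrite expr0n gtn_eqF // expn_gt0 q0.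
Qed.

Lemma powqB a (x y : E) : (x - y) ^+ (q ^ a) = x ^+ (q ^ a) - y ^+ (q ^ a).
Proof. by rewrite -[in RHS](subrK y x) [in RHS]powqD addrK. Qed.

Variable tau : {rmorphism E -> E}.
Hypothesis tauj : forall a, tau (fj X a) = fj X a.

Lemma ball_tau : exists c : nat, forall m x, ball m x -> ball (m + c) (tau x).
Proof.
pose B : R := \sum_i \sum_k sabs S (fco X (tau (fw X i)) k).
have [e he] := ex_qpow (B + 1); exists e => m x [Ox bx].
split; first exact: (OK_OE (iota := tau) (Y := X) tauj Ox).
move=> k; rewrite [in tau x](fcoK X x) rmorph_sum fco_sum.
have H i : sabs S (fco X (tau (fj X (fco X x i) * fw X i)) k) < (q ^ (m + e))%:R.
  rewrite rmorphM tauj fcoZ sabsM expnD natrM.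
  apply: ltr_pM => //; rewrite ?sabs_ge0 //.
  apply: lt_le_trans he; rewrite ltr_pwDr //.
  have nn i' k' : 0 <= sabs S (fco X (tau (fw X i')) k') := sabs_ge0 S _.
  rewrite /B (bigD1 i) //= (bigD1 k) //= -addrA ler_wpDr // addr_ge0 ?sumr_ge0 // => *; exact: sumr_ge0.
elim/big_ind: _ => [|x1 x2|i _ //]; first by rewrite sabs0 ltr0n expn_gt0 q0.
by move=> h1 h2; rewrite Sabs; apply: le_lt_trans (fabs_max _ _ _) _; rewrite -Sabs gt_max h1 h2.
Qed.

(** Write q^n = mu nu with nearly equal powers of q. The pigeonhole principle gives a relation sum
    e_i^mu tau(s_i) = 0, and h = sum e_i s_i^nu then satisfies h^mu = sum e_i^mu (s_i^(q^n) -
    tau(s_i)). So h vanishes at every Q of the list, and its degree bounds the product of the norms.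
    The valuations of the s_i at P0 are distinct, which makes h nonzero. *)
Lemma stepanov (P0 : set E) (r : nat) : above X P0 -> (0 < r)%N -> (prime_norm P0 <= q ^ r)%N ->
  exists C : nat, forall n (t : seq (set E)), (0 < n)%N -> uniq t ->
  (forall Q, Q \in t -> above X Q /\ forall x, O x -> max_ideal Q (x ^+ (q ^ n) - tau x)) ->
  (\prod_(Q <- t) prime_norm Q <= q ^ (r * q ^ n + C * q ^ (uphalf n)))%N.
Proof.
move=> aP r0 N0; have hP := aP.1; have [hiP _] := norm_above aP.
have [c1 h1] := ball_pick; have [c2 h2] := ball_count; have [c3 [h3 h3']] := ballM.
have [c4 h4] := ball_norm; have [c5 h5] := ball_tau.
have [c [e1 e2 e3 e4 e5]] : exists c, [/\ (c1 <= c)%N, (c2 <= c)%N, (c3 <= c)%N, (c4 <= c)%N & (c5 <= c)%N].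
  by exists (c1 + c2 + c3 + c4 + c5)%N; split; lia.
have pick m : exists u : seq E, [/\ uniq u, forall x, x \in u -> ball m x & (q ^ (d * (m - c)) <= size u)%N].
  have [u [uu hu le]] := h1 m; exists u; split=> //; apply: leq_trans le; rewrite leq_exp2l //.
  by rewrite leq_mul2l leq_sub2l ?orbT.
have count m (u : seq E) : uniq u -> (forall x, x \in u -> ball m x) -> (size u <= q ^ (d * (m + c)))%N.
  move=> uu hu; apply: leq_trans (h2 _ _ uu hu) _; rewrite leq_exp2l // leq_mul2l leq_add2l e2 orbT //.
have mul m n x y : ball m x -> ball n y -> ball (m + n + c) (x * y).
  by move=> hx hy; apply: ball_le (h3 _ _ _ _ hx hy); rewrite leq_add2l.
have pow k m x : (0 < k)%N -> ball m x -> ball (k * (m + c)) (x ^+ k).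
  by move=> k0 hx; apply: ball_le (h3' _ _ _ k0 hx); rewrite leq_mul2l leq_add2l e3 orbT.
have norm m y t : ball m y -> y != 0 -> uniq t -> (forall Q, Q \in t -> above X Q /\ max_ideal Q y) ->
  (\prod_(Q <- t) prime_norm Q <= q ^ (d * (m + c)))%N.
  move=> b_y y0 ut ht; apply: leq_trans ((h4 _ _ b_y y0).1 t ut ht) _.
  by rewrite leq_exp2l // leq_mul2l leq_add2l e4 orbT.
have nval m y : ball m y -> y != 0 -> (`|vl P0 y| <= d * (m + c))%N.
  move=> b_y y0; apply: leq_trans ((h4 _ _ b_y y0).2 P0 aP) _.
  by rewrite leq_mul2l leq_add2l e4 orbT.
have btau m x : ball m x -> ball (m + c) (tau x) by move=> /h5; apply: ball_le; rewrite leq_add2l.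
have d0 := fd_gt0 X.
(* These constants are dictated by [step_count] and [step_degree] and are chosen before n. *)
have [W WE] : exists W, W = (2 * r * c + r * r + r * (4 * c + 1))%N by eexists.
have [KK KE] : exists KK, KK = (4 * d * W + 1)%N by eexists.
have [L LE] : exists L, L = (8 * d * (c + r + 1))%N by eexists.
have [m0 bt] : exists m0, ball m0 (fj X (tf 'X)).
  have [e _ be] := ex_box X (fj X (tf 'X)); have [m0 em] := ex_qpow e.
  by exists m0; split; [apply: ointj; rewrite SA; exists 'X | apply: box_le be].
have [B BE] : exists B, B = (d * (q ^ (L.*2 + 1) * (m0 + c) + c))%N by eexists.
exists (B + (1 + KK + d * (4 * c + 1)))%N => n t n0 ut ht.
have nE : (n./2 + uphalf n = n)%N by rewrite uphalf_half addnCA addnn odd_double_half.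
have muE : (q ^ n = q ^ n./2 * q ^ uphalf n)%N by rewrite -expnD nE.
(* Finitely many n are left out by the numerical lemmas. For these t^(q^n) - t is used: it is
   nonzero and vanishes at every Q of the list because tau fixes t. *)
have [small|large] := ltnP (q ^ n./2) L.
  have nL : (n <= L.*2 + 1)%N by have := ltn_expl n./2 q1; lia.
  pose y := fj X (tf 'X) ^+ (q ^ n) - fj X (tf 'X).
  have qn1 : (1 < q ^ n)%N by rewrite -(expn0 q) ltn_exp2l.
  have y0 : y != 0.
  rewrite /y -!rmorphXn -rmorphB -rmorphB fmorph_eq0 tofrac_eq0.
  exact: XnX_neq0.
  have b_y : ball (q ^ n * (m0 + c)) y.
  apply: ballB; first by apply: pow => //; rewrite expn_gt0 q0.
  by apply: ball_le bt; nia.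
  apply: leq_trans (norm _ _ t b_y y0 ut _) _.
  by move=> Q /ht[aQ hQ]; split=> //; rewrite /y -{2}tauj; apply: hQ; case: bt.
  rewrite leq_exp2l //; apply: leq_trans (_ : B <= _)%N.
  by rewrite BE leq_mul2l leq_add2r leq_mul2r leq_exp2l // nL !orbT.
  have : (0 < q ^ uphalf n)%N by rewrite expn_gt0 q0.
  by move: (q ^ uphalf n)%N (q ^ n)%N => b1 b2 h; nia.
have mu0 : (0 < q ^ n./2)%N by rewrite expn_gt0 q0.
have numu : (q ^ n./2 <= q ^ uphalf n)%N by rewrite leq_exp2l // uphalf_half leq_addl.
move: (q ^ n)%N muE => qn muE in ht *.
have [mu muD] : exists mu, mu = (q ^ n./2)%N by eexists.
have [nu nuD] : exists nu, nu = (q ^ uphalf n)%N by eexists.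
rewrite -muD -nuD in muE mu0 numu large *.
have [m mE] : exists m, m = (c + (r * mu + KK) %/ d + 1)%N by eexists.
have [l lE] : exists l, l = (mu %/ (2 * d))%N by eexists.
have [mle1 mle2 mle3] := step_parameter d0 mE.
rewrite LE in large; have [lle [w [wE mux]]] := step_degree d0 large lE.
have [u1 [uu1 hu1 s1]] := pick m.
have [|s [hs us ss]] := val_spread hP hiP uu1.
  by move=> y /hu1[Oy _]; apply: (aboveO aP).
have bs x : x \in s -> ball m x /\ x != 0.
  by move=> /hs[x0 [y [z [/hu1 hy /hu1 hz xE]]]]; split=> //; rewrite xE; apply: ballB.
(* A residue field with at most q^r elements yields at least d (m - c) / r distinct valuations; the
   surplus KK over r mu is what [step_count] uses. *)
have rs : (r * mu + KK <= r * size s)%N.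
  apply: leq_trans mle1 _; rewrite -(leq_exp2l _ _ q1); apply: leq_trans s1 _; apply: leq_trans ss _.
  rewrite expnM; case: (size s) => // k; by rewrite leq_exp2r.
have [u2 [uu2 hu2 s2]] := pick l.
have bs' (i : 'I_(size s)) : ball m s`_i /\ s`_i != 0 by apply: bs; exact: mem_nth.
have bu (i : 'I_(size u2)) : ball l u2`_i by apply: hu2; exact: mem_nth.
pose Phi (f : {ffun 'I_(size s) -> 'I_(size u2)}) := \sum_i u2`_(f i) ^+ mu * tau s`_i.
have [f [g [fg Phifg]]] : exists f g, f <> g /\ Phi f = Phi g.
  apply: contrapT => nfg; have inj : injective Phi.
  by move=> f g e; apply: contrapT => ne; apply: nfg; exists f, g.
  have bPhi f : ball (mu * (l + c) + (m + c) + c) (Phi f).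
  by apply: ball_sum => i; apply: mul; [apply: pow | apply: btau; case: (bs' i)].
  have := count _ [seq Phi f | f <- enum {: {ffun 'I_(size s) -> 'I_(size u2)}}].
  move=> /(_ (mu * (l + c) + (m + c) + c)%N); rewrite map_inj_uniq // enum_uniq => /(_ isT).
  have {}bPhi : forall x, x \in [seq Phi f | f <- enum {: {ffun 'I_(size s) -> 'I_(size u2)}}] ->
  ball (mu * (l + c) + (m + c) + c) x by move=> x /mapP[f _ ->].
  move=> /(_ bPhi); rewrite size_map -cardE card_ffun !card_ord => le.
  have : (d * (l - c) * size s <= d * (mu * (l + c) + (m + c) + c + c))%N.
  rewrite -(leq_exp2l _ _ q1); apply: leq_trans le; rewrite expnM.
  case: (size s) => // k; by rewrite leq_exp2r.
  rewrite -mulnA leq_pmul2l // => {}le.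
  rewrite KE in rs mle2; exact: (step_count d0 mu0 WE wE mux rs mle2 le).
pose e i := u2`_(f i) - u2`_(g i).
have be i : ball l (e i) by apply: ballB.
have emu : \sum_i e i ^+ mu * tau s`_i = 0.
  rewrite (eq_bigr (fun i => u2`_(f i) ^+ mu * tau s`_i - u2`_(g i) ^+ mu * tau s`_i)).
  by rewrite sumrB -/(Phi f) -/(Phi g) Phifg subrr.
  by move=> i _; rewrite -mulrBl /e muD powqB.
pose h := \sum_i e i * s`_i ^+ nu.
have nu0 : (0 < nu)%N by apply: leq_trans numu.
(* The valuations of the nonzero e_i lie in [0, nu), so the valuation of e_i s_i^nu determines that
   of s_i by division with remainder: the nonzero terms of h have distinct valuations. *)
have h0 : h != 0.
  pose I0 := [seq i <- enum 'I_(size s) | e i != 0].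
  have -> : h = \sum_(x <- [seq e i * s`_i ^+ nu | i <- I0]) x.
  rewrite big_map /I0 big_filter [RHS]big_enum_cond /h [LHS](bigID (fun i => e i != 0)) /=.
  by rewrite [X in _ + X]big1 ?addr0 // => i /negbNE/eqP->; rewrite mul0r.
  have [i0 fi] : exists i, f i <> g i.
  by apply: contrapT => n'; apply: fg; apply/ffunP => i; apply: contrapT => ne; apply: n'; exists i.
  have ei0 : i0 \in I0.
  rewrite mem_filter mem_enum andbT subr_eq0; apply/eqP => e'; apply: fi.
  by apply/val_inj/eqP; rewrite -(nth_uniq 0 (ltn_ord (f i0)) (ltn_ord (g i0)) uu2) e'.
  have ex i : i \in I0 -> e i != 0 by rewrite mem_filter => /andP[].
  have sx (i : 'I_(size s)) : s`_i ^+ nu != 0 by apply: expf_neq0; case: (bs' i).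
  have ev i : i \in I0 -> (0 <= vl P0 (e i) < nu%:Z).
  move=> /ex ei; have := nval _ _ (be i) ei; have := vge_oint aP ei (be i).1 => -> hv.
  rewrite ltz_nat /=; apply: leq_ltn_trans hv _; move: lle large numu; clear -d0 r0; nia.
  apply: (sum_distinct_vl hP _ _ _).1.
  - by case: (I0) ei0.
  - by move=> x /mapP[i iI ->]; rewrite mulf_neq0 ?ex.
  have uI : uniq I0 by apply: filter_uniq; exact: enum_uniq.
  rewrite -map_comp map_inj_in_uniq // => i k iI kI /=.
  rewrite !vlM ?ex ?vlX ?(bs' _).2 // => ee.
  have vs : vl P0 s`_i = vl P0 s`_k.
  have := ev i iI; have := ev k kI; move: ee nu0; move: (vl P0 (e i)) (vl P0 (e k)) (vl P0 s`_i) (vl P0 s`_k).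
  by clear => a b v w; nia.
  apply/val_inj/eqP; have := @nth_uniq _ (0 : int) (map (vl P0) s) i k.
  by rewrite size_map !(nth_map 0) // vs eqxx => <-.
have bh : ball (l + nu * (m + c) + c) h.
  by apply: ball_sum => i; apply: mul => //; apply: pow => //; case: (bs' i).
apply: leq_trans (norm _ _ t bh h0 ut _) _.
  move=> Q Qt; have [aQ hQ] := ht Q Qt; split=> //; have hQ' := aQ.1.
  have Qo x m' : ball m' x -> Q x by move=> [Ox _]; apply: (aboveO aQ).
  apply: (@max_exp _ Q h mu) => //; first exact: Qo bh.
  have -> : h ^+ mu = \sum_i e i ^+ mu * (s`_i ^+ qn - tau s`_i).
  rewrite -[LHS]subr0 -[X in _ - X]emu /h muD powq_sum -sumrB; apply: eq_bigr => i _.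
  by rewrite exprMn -exprM -mulrBr [(nu * _)%N]mulnC -muD -muE.
  elim/big_ind: _ => [|a b|i _]; [exact: (max_sub hQ').1 | exact: (subgD (max_sub hQ')) |].
  apply: maxM => //; first by apply: primeX => //; apply: Qo (be i).
  by apply: hQ; case: (bs' i) => -[].
rewrite leq_exp2l //.
have b1 : (nu * (d * m) <= nu * (d * c + r * mu + KK + d))%N by rewrite leq_mul2l mle3 orbT.
have b2 : (d * l <= nu)%N by move: lle numu; clear; nia.
have b3 : (d * c <= nu * (d * c))%N by rewrite leq_pmull.
by rewrite muE; move: b1 b2 b3; clear; nia.
Qed.

End Stepanov.

Lemma card_natr (F : finFieldType) : #|F|%:R = 0 :> F.
Proof. by rewrite -FinRing.zmodXgE -cardsT expg_cardG ?finset.inE. Qed.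

(** The exponent may be reduced to n mod e; if that were positive, a polynomial of degree below the
    cardinality would vanish on all of k. *)
Lemma frob_dvd (k : finFieldType) (q e n : nat) : (1 < q)%N -> (0 < e)%N -> #|k| = (q ^ e)%N ->
  (forall z : k, z ^+ (q ^ n) = z) -> (e %| n)%N.
Proof.
move=> q1 e0 ck h; have pe m (z : k) : z ^+ (q ^ (e * m)) = z.
  by elim: m => [|m IH]; [rewrite muln0 expr1 | rewrite mulnS expnD exprM -ck expf_card IH].
have hs (z : k) : z ^+ (q ^ (n %% e)) = z.
  by have := h z; rewrite {1}(divn_eq n e) expnD exprM [(_ %/ _ * _)%N]mulnC pe.
apply: contraT; rewrite /dvdn -lt0n => s0.
have := @pow_eq_card k (q ^ (n %% e)) 1 _ hs; rewrite ck.
have qs : (1 < q ^ (n %% e))%N by rewrite -(expn0 q) ltn_exp2l.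
rewrite gtn_eqF // => /(_ isT); rewrite (maxn_idPl (ltnW qs)) leq_exp2l // leqNgt ltn_pmod //.
Qed.

Lemma square_quotient (K : fieldType) (A B C D u p : K) : B != 0 -> D != 0 -> p != 0 ->
  u / p ^ 2 = C / D -> p = A / B -> u * (D * (B * B)) = A * A * C.
Proof.
move=> B0 D0 p0 e pE; have -> : u = C / D * (A / B * (A / B)).
  by rewrite -pE -e -[p * p]/(p ^ 2) divfK // expfz_neq0.
by field; rewrite B0 D0.
Qed.

(** * Primes of degree n of the rational function field *)

Section RationalFunctionField.
Variables (R : realType) (F : finFieldType).
Local Notation F0 := {fraction {poly F}}.
Local Notation q := #|F|.
Variables (S : sized R F0) (Y : finext S F0).
Hypotheses (SA : sA S = @fpoly F) (Sabs : sabs S = @fabs R F) (idj : forall a, fj Y a = a).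

Let q1 : (1 < q)%N := finNzRing_gt1 F.

Lemma finext_id : exists Y : finext S F0, forall a, fj Y a = a.
Proof.
have [||||Z ZE] := @finext_build R F0 S F0 idfun unit (fun=> 1) (fun x _ => x).
- by move=> x; rewrite big_const card_unit /= mulr1 addr0.
- by [].
- by [].
- by move=> [] [].
by exists Z => a; rewrite ZE.
Qed.

Lemma above_tf P u : above Y P -> P (tf u).
Proof. by move=> [_ AP]; rewrite -[tf u]idj; apply: AP; rewrite SA; exists u. Qed.

(** In a reduced fraction, a denominator in the maximal ideal would force the numerator into it,
    against Bezout. *)
Lemma prime_frac P x : above Y P -> P x -> exists a b, ~ max_ideal P (tf b) /\ x = tf a / tf b.
Proof.
move=> aP Px; have hP := aP.1; have [a [b [b0 xE]]] := frac_rep x.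
pose g := gcdp a b; have g0 : g != 0 by rewrite gcdp_eq0 negb_and b0 orbT.
have aE : a = (a %/ g) * g by rewrite divpK ?dvdp_gcdl.
have bE : b = (b %/ g) * g by rewrite divpK ?dvdp_gcdr.
have cop : coprimep (a %/ g) (b %/ g) by apply: coprimep_div_gcd; rewrite b0 orbT.
have b'0 : b %/ g != 0 by apply: contraNneq b0 => e; rewrite bE e mul0r.
have xE' : x = tf (a %/ g) / tf (b %/ g).
  have tg : tf g != 0 by rewrite tofrac_eq0.
  rewrite xE {1}aE {1}bE; have e1 := tofracM (a %/ g) g; have e2 := tofracM (b %/ g) g.
  by rewrite e1 e2 -mulf_div divff // mulr1.
exists (a %/ g), (b %/ g); split=> // mb.
have ma : max_ideal P (tf (a %/ g)).
  have -> : tf (a %/ g) = x * tf (b %/ g) by rewrite xE' divfK // tofrac_eq0.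
  exact: maxM.
have /Bezout_coprimepP[[u v] /= uv] := cop.
have /eqpP[[c1 c2] /= /andP[c10 c20] e] := uv.
have m1 : max_ideal P (tf (c1 *: (u * (a %/ g) + v * (b %/ g)))).
  have -> : c1 *: (u * (a %/ g) + v * (b %/ g)) = (c1%:P * u) * (a %/ g) + (c1%:P * v) * (b %/ g).
  by rewrite -mul_polyC mulrDr !mulrA.
  rewrite tofracD !tofracM; apply: subgD; [exact: max_sub | |]; apply: maxM => //; rewrite -tofracM; exact: above_tf.
apply: (max_not1 hP); have -> : 1 = tf (c2^-1)%:P * tf (c1 *: (u * (a %/ g) + v * (b %/ g))).
  by rewrite e -tofracM -mul_polyC mulr1 -polyCM mulVf // tofrac1.
by apply: maxM => //; apply: above_tf.
Qed.

Lemma max_nmul P x y : above Y P -> P x -> ~ max_ideal P x -> max_ideal P (x * y) -> max_ideal P y.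
Proof. by move=> [hP _]; apply: max_mul. Qed.

(** With a / b the uniformizer and b a unit at P, differentiate u d b^2 = a^2 c: all terms except u'
    d b^2 lie in the maximal ideal. *)
Lemma max_deriv P u : above Y P -> vge P 2 (tf u) -> max_ideal P (tf u^`()).
Proof.
move=> aP v2; have hP := aP.1; have sm := max_sub hP.
have munif : max_ideal P (unif P) by apply/(vl_max hP (unif_neq0 hP)); rewrite vl_unif.
have [a [b [nb uE]]] := prime_frac aP (max_prime munif).
have b0 : tf b != 0 by apply/eqP => e; apply: nb; rewrite e; exact: sm.1.
have ma : max_ideal P (tf a).
  have -> : tf a = tf b * unif P by rewrite uE mulrC divfK.
  by apply: maxM => //; apply: above_tf.
have [c [d [nd xE]]] := prime_frac aP v2.
have d0 : tf d != 0 by apply/eqP => e; apply: nd; rewrite e; exact: sm.1.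
have e : u * (d * b ^+ 2) = a ^+ 2 * c.
  apply/eqP; rewrite -tofrac_eq !tofracM; apply/eqP.
  exact: (square_quotient b0 d0 (unif_neq0 hP) xE uE).
have mu : max_ideal P (tf u).
  by apply/(vge1 hP); apply: (vge_le hP _ v2).
have mm v w : max_ideal P (tf v) -> max_ideal P (tf (w * v)).
  by move=> mv; rewrite tofracM; apply: maxM => //; apply: above_tf.
have md : max_ideal P (tf (u^`() * (d * b ^+ 2))).
  have -> : u^`() * (d * b ^+ 2) = (a * c^`() + 2%:R * a^`() * c) * a - (d * b ^+ 2)^`() * u.
  move: (d * b ^+ 2) e => w; rewrite expr2 => e.
  have := congr1 (fun p : {poly F} => p^`()) e; rewrite /= !derivM => e'.
  have -> : u^`() * w = (u^`() * w + u * w^`()) - w^`() * u by ring.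
  by rewrite e'; ring.
  by rewrite tofracB; apply: sm.2; apply: mm.
move: md; rewrite mulrC tofracM; apply: max_nmul => //; first exact: above_tf.
rewrite tofracM => h; apply: nb; apply: (@max_exp _ _ _ 2) => //; first exact: above_tf.
by rewrite -rmorphXn; apply: max_nmul h => //; apply: above_tf.
Qed.

Let XnX n : {poly F} := 'X^(q ^ n) - 'X.

(** Separability: the derivative of X^(q^n) - X is -1. *)
Lemma XnX_vl P n : (0 < n)%N -> above Y P -> max_ideal P (tf (XnX n)) -> vl P (tf (XnX n)) = 1.
Proof.
move=> n0 aP m1; have hP := aP.1; have qn : (1 < q ^ n)%N by rewrite -(expn0 q) ltn_exp2l.
have y0 : tf (XnX n) != 0 by rewrite tofrac_eq0 XnX_neq0.
apply/eqP; rewrite eq_le; apply/andP; split; last exact/(vl_max hP y0).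
rewrite leNgt; apply/negP => v2; have := max_deriv aP ((vlP hP 2 y0).2 v2).
rewrite /XnX derivB derivXn derivX.
have -> : ('X^((q ^ n).-1) : {poly F}) *+ (q ^ n)%N = 0.
  rewrite -mulr_natr natrX; have -> : (q%:R : {poly F}) = 0; last by rewrite expr0n gtn_eqF // mulr0.
  by rewrite -polyC_natr card_natr polyC0.
rewrite sub0r => h; apply: (max_not1 hP); rewrite -[1]opprK; apply: subgN; first exact: max_sub.
by rewrite -tofrac1 -tofracN.
Qed.

Lemma XnX_norm P n : (0 < n)%N -> above Y P -> max_ideal P (tf (XnX n)) ->
  exists e, [/\ (0 < e)%N, (e %| n)%N & prime_norm P = (q ^ e)%N].
Proof.
move=> n0 aP my; have hP := aP.1; have [e e0 Ne] := norm_power SA aP.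
exists e; split=> //; have [hi _] := norm_above aP.
have [k [c [hc ck]]] := residue_ex hP hi.
apply: (frob_dvd q1 e0 (_ : #|k| = _)); first by rewrite ck.
have cpol u : c (tf u) ^+ (q ^ n) = c (tf u).
  have Pu w := above_tf w aP.
  have cD v w : c (tf (v + w)) = c (tf v) + c (tf w) by rewrite tofracD (resD hc).
  have cM v w : c (tf (v * w)) = c (tf v) * c (tf w) by rewrite tofracM (resM hc).
  have ch : [pchar k]%N.-nat q.
  by have [g _] := const_rmorph SA aP hc; exact: rmorph_card_nat g.
  elim/poly_ind: u => [|u a IH]; first by rewrite tofrac0 (res0 hP hc) expr0n gtn_eqF // expn_gt0 ltnW.
  rewrite cD cM exprDn_pchar ?pnatX ?ch // exprMn IH; congr (_ * _ + _).
  rewrite -(resX hP hc) // -tofracXn; apply/(res_eq hP hc) => //.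
  by rewrite -tofracB.
  rewrite -(resX hP hc) // -tofracXn -polyC_exp; congr (c (tf _%:P)).
  by elim: (n) => [|m IHm]; rewrite ?expr1 // expnSr exprM IHm expf_card.
move=> z; have [x Px <-] := res_surj hc z; have [a [b [nb ->]]] := prime_frac aP Px.
have b0 : tf b != 0 by apply/eqP => e1; apply: nb; rewrite e1; exact: (max_sub hP).1.
have Pb : P (tf b)^-1 by apply: prime_inv => //; apply: above_tf.
have cb : c (tf b) != 0 by apply/eqP => /(res_max hc) h; apply: nb; apply: h; apply: above_tf.
have cV : c (tf b)^-1 = (c (tf b))^-1.
  by apply: (mulfI cb); rewrite divff // -(resM hc) ?divff ?(res1 hc) //; apply: above_tf.
by rewrite (resM hc) ?cV ?exprMn ?exprVn ?cpol //; apply: above_tf.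
Qed.

(** X^(q^n) - X has degree q^n, is squarefree, and its primes have degrees dividing n. The proper
    divisors are at most n / 2 and contribute O(q^(n/2)) by [theta_bound]. *)
Lemma count_degree : exists C : nat, forall n, (0 < n)%N -> exists t : seq (set F0),
  [/\ uniq t, forall P, P \in t -> above Y P /\ prime_norm P = (q ^ n)%N
  & (q ^ n <= n * size t + C * q ^ (n./2))%N].
Proof.
have [c [e [c0 e0 e1 hge]]] := idx_scaled_ge Y.
have [C C1 hC] := theta_bound (cheb_poly Y SA Sabs).
have lq : 0 < ln q%:R :> R by rewrite ln_gt0 // ltr1n.
have ex_nat (x : R) : exists m : nat, x <= (q ^ m)%:R /\ x <= m%:R.
  exists (Num.bound `|x|); have h := ltW (archi_boundP (normr_ge0 x)).
  have h' := le_trans (ler_norm _) h; split=> //; apply: le_trans h' _.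
  by rewrite ler_nat ltnW // ltn_expl.
have [c' [hc' _]] := ex_nat (c^-1 + e^-1); have [B [_ hB]] := ex_nat (C / ln q%:R).
have ci0 : 0 < c^-1 by rewrite invr_gt0. have ei0 : 0 < e^-1 by rewrite invr_gt0.
exists (c' + B + q ^ c')%N => n n0.
have qn : (1 < q ^ n)%N by rewrite -(expn0 q) ltn_exp2l.
have qh : (0 < q ^ n./2)%N by rewrite expn_gt0 ltnW.
have [small|large] := leqP (q ^ n) c'.
  exists [::]; split=> //; rewrite muln0 add0n; apply: leq_trans small _.
  by rewrite -addnA mulnDl (leq_trans (leq_pmulr _ qh)) ?leq_addr.
pose y := tf (XnX n); have y0 : y != 0 by rewrite tofrac_eq0 XnX_neq0.
have Ay : sA S y by rewrite SA; exists (XnX n).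
have Oy : oint Y y by rewrite -[y]idj; apply: ointj.
have [u uu hu] := mem_finite Oy y0.
have hidx := idx_scaled_prod Oy y0 uu (fun Q Qu => ((hu Q).1 Qu).1) (fun Q aQ mQ => (hu Q).2 (conj aQ mQ)).
have ay : sabs S y = (q ^ (q ^ n))%:R.
  by rewrite Sabs fabs_poly /psz (negPf (XnX_neq0 _ qn)) size_XnX.
have qqn : (q ^ c' <= q ^ (q ^ n))%N by rewrite leq_exp2l // ltnW.
have [|||_ hge'] := @hge y y (sabs S y) (\prod_(Q <- u) prime_norm Q ^ `|vl Q y|)%N Ay Oy.
- rewrite ay; apply: (@le_trans _ _ (q ^ c')%:R); last by rewrite ler_nat.
  by apply: le_trans hc'; rewrite ler_wpDl // ltW.
- exact: lexx.
- by rewrite idj subrr; apply: box0; rewrite mulr_gt0 // sabs_gt0.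
pose dg (P : set F0) := trunc_log q (prime_norm P).
have dgP (P : set F0) : P \in u -> [/\ (0 < dg P)%N, (dg P %| n)%N & prime_norm P = (q ^ dg P)%N].
  move=> /hu[aP mP]; have [m [m0 mn Nm]] := XnX_norm n0 aP mP.
  have -> : dg P = m by rewrite /dg Nm; apply: trunc_expnK.
  by split.
have pE : (\prod_(Q <- u) prime_norm Q ^ `|vl Q y| = q ^ (\sum_(Q <- u) dg Q))%N.
  rewrite (big_morph (fun i => q ^ i)%N (fun a b => expnD q a b) (expn0 q)) big_seq [RHS]big_seq.
  by apply: eq_bigr => Q Qu; have [aQ mQ] := (hu Q).1 Qu; rewrite XnX_vl // expn1; have [_ _] := dgP Q Qu.
have le1 : (q ^ n - c' <= \sum_(Q <- u) dg Q)%N.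
  rewrite -(leq_exp2l _ _ q1) -pE -(ler_nat R); apply: le_trans (hge' hidx).
  rewrite ay; apply: (@le_trans _ _ (c * (q ^ (q ^ n))%:R)); last first.
  rewrite -{1}[c * _]expr1; apply: ler_weXn2l; last exact: fd_gt0.
  rewrite -ler_pdivrMl // mulr1; apply: (@le_trans _ _ (q ^ c')%:R); last by rewrite ler_nat.
  by apply: le_trans hc'; rewrite ler_wpDr // ltW.
  rewrite -ler_pdivrMl // -{2}(subnK (ltnW large)) expnD natrM mulrC ler_wpM2l //.
  by apply: le_trans hc'; rewrite ler_wpDr // ltW.
exists [seq P <- u | dg P == n]; split; first exact: filter_uniq.
  move=> P; rewrite mem_filter => /andP[/eqP dP Pu]; have [aP _] := (hu P).1 Pu.
  by have [_ _ ->] := dgP P Pu; rewrite dP.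
have s1 : (\sum_(Q <- u | dg Q == n) dg Q = n * size [seq P <- u | dg P == n])%N.
  rewrite size_filter -sum1_count big_distrr /=; apply: eq_bigr => Q /eqP ->; exact: esym (muln1 n).
have s2 : (\sum_(Q <- u | dg Q != n) dg Q <= B * q ^ n./2)%N.
  rewrite -(ler_nat R) natrM; apply: (@le_trans _ _ (C / ln q%:R * (q ^ n./2)%:R)); last exact: ler_wpM2r.
  rewrite mulrAC ler_pdivlMr //; apply: le_trans (hC _); rewrite natr_sum mulr_suml.
  rewrite -big_filter (eq_big_seq (fun Q => ln (prime_norm Q)%:R)); last first.
  move=> Q; rewrite mem_filter => /andP[_ Qu]; have [_ _ ->] := dgP Q Qu.
  by have q0 : 0 < q%:R :> R by [rewrite ltr0n; exact: ltnW]; rewrite natrX lnXn // mulr_natl.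
  apply: sum_subset; rewrite ?ps_uniq ?filter_uniq //.
  move=> Q; rewrite mem_filter => /andP[dn Qu]; apply/psP; have [aQ _] := (hu Q).1 Qu; split=> //.
  have [d0 /dvdnP[m nE] ->] := dgP Q Qu; rewrite leq_exp2l //.
  case: m nE => [|[|m]] nE; [by rewrite nE in n0 | by rewrite nE mul1n eqxx in dn |].
  by rewrite -(doubleK (dg Q)) half_leq // nE -mul2n leq_mul2r orbT.
  by move=> Q; apply: ln_nm.
move: le1; rewrite (bigID (fun Q => dg Q == n)) /= s1 => le1.
have : (c' <= c' * q ^ n./2)%N by rewrite leq_pmulr.
move=> h3; rewrite leq_subLR in le1; apply: leq_trans le1 _.
by rewrite addnCA leq_add2l !mulnDl -addnA leq_add // (leq_trans s2) // leq_addr.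
Qed.

End RationalFunctionField.

(** * Splitting fields with coordinates over the base *)

Section FinextField.
Variables (R : realType) (F : fieldType) (S : sized R F) (K : fieldType) (X : finext S K).

(** A second name for K, depending on X, to carry the F-algebra structure given by [fj]. *)
Definition fext : Type := let _ := X in K.
Local Notation KX := fext.

HB.instance Definition _ := GRing.Field.on KX.

Definition fext_scale (a : F) (u : KX) : KX := fj X a * u.

Fact fext_scaleA a b u : fext_scale a (fext_scale b u) = fext_scale (a * b) u.
Proof. by rewrite /fext_scale rmorphM mulrA. Qed.
Fact fext_scale1 u : fext_scale 1 u = u.
Proof. by rewrite /fext_scale rmorph1 mul1r. Qed.
Fact fext_scaleDr : right_distributive fext_scale +%R.
Proof. by move=> a u v; apply: mulrDr. Qed.
Fact fext_scaleDl u : {morph fext_scale^~ u : a b / a + b}.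
Proof. by move=> a b; rewrite /fext_scale rmorphD mulrDl. Qed.

HB.instance Definition _ := GRing.Zmodule_isLmodule.Build F KX
  fext_scaleA fext_scale1 fext_scaleDr fext_scaleDl.

Fact fext_scaleAl (a : F) (u v : KX) : a *: (u * v) = a *: u * v.
Proof. exact: mulrA. Qed.

HB.instance Definition _ := GRing.Lmodule_isLalgebra.Build F KX fext_scaleAl.

Fact fext_scaleAr (a : F) (u v : KX) : a *: (u * v) = u * (a *: v).
Proof. exact: mulrCA. Qed.

HB.instance Definition _ := GRing.Lalgebra_isAlgebra.Build F KX fext_scaleAr.

Fact fext_vect : Vector.axiom (fd X) KX.
Proof.
exists (fun x : KX => \row_i fco X x i) => [a x y|].
  by apply/rowP => i; rewrite !mxE fcoD fcoZ.
exists (fun u : 'rV_(fd X) => \sum_i fj X (u 0 i) * fw X i) => [x|u].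
  by rewrite [RHS](fcoK X); apply: eq_bigr => i _; rewrite mxE.
by apply/rowP => i; rewrite mxE fco_comb.
Qed.

HB.instance Definition _ := Lmodule_hasFinDim.Build F KX fext_vect.

Lemma finext_alg (a : F) : a%:A = fj X a :> KX.
Proof. exact: mulr1. Qed.

Lemma finext_algebraic (x : K) : exists2 g : {poly F}, g != 0 & poly.root (map_poly (fj X) g) x.
Proof.
have /polyOver1P[g gE] := minPolyOver 1%AS (x : KX).
have rt := root_minPoly 1%AS (x : KX); rewrite gE in rt.
exists g; first by apply: contraTneq (monic_minPoly 1%AS (x : KX)) => g0; rewrite gE g0 map_poly0 monicE lead_coef0 eq_sym oner_neq0.
suff <- : map_poly (in_alg KX) g = map_poly (fj X) g by [].
by apply: eq_map_poly => a; rewrite /= finext_alg.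
Qed.

End FinextField.

Lemma irreducible_factor (K : fieldType) (p : {poly K}) : (1 < size p)%N ->
  exists2 r, r %| p & irreducible_poly r.
Proof.
move=> sp; pose W n := `[< exists r, [/\ r %| p, (1 < size r)%N & size r = n] >].
have exW : exists n, W n by exists (size p); apply/asboolP; exists p; rewrite dvdpp.
have [n /asboolP[r [rp r1 rn]] nmin] := ex_minnP exW.
exists r => //; split=> // s s1 sr.
have r0 : r != 0 by rewrite -size_poly_gt0 ltnW.
have s0 : s != 0 by apply: dvdpN0 sr r0.
rewrite -dvdp_size_eqp // eqn_leq dvdp_leq //= rn; apply: nmin; apply/asboolP; exists s; split=> //.
  exact: dvdp_trans rp.
by rewrite ltn_neqAle eq_sym s1 size_poly_gt0.
Qed.

(** The second clause says that E is generated by the image of K and by the roots. Ring operations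
    are enough because the roots are algebraic. *)
Definition splits_in (K E : fieldType) (f : {rmorphism K -> E}) (p : {poly K}) (rs : seq E) : Prop :=
  map_poly f p %= \prod_(z <- rs) ('X - z%:P) /\
  forall V : set E, (forall x y, V x -> V y -> V (x + y)) -> (forall x y, V x -> V y -> V (x * y)) ->
  (forall a, V (f a)) -> (forall z, z \in rs -> V z) -> forall x, V x.

(** One root of an irreducible factor is adjoined at a time, and [finext_tower] carries the
    coordinates along. *)
Lemma splitting_ex (R : realType) (F : fieldType) (S : sized R F) (K : fieldType) (X : finext S K)
  (p : {poly K}) : p != 0 -> exists (E : fieldType) (XE : finext S E) (f : {rmorphism K -> E}) (rs : seq E),
  (forall a, f (fj X a) = fj XE a) /\ splits_in f p rs.
Proof.
have [n] := ubnP (size p); elim: n K X p => // n IH K X p sp p0.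
have [p1|p1] := leqP (size p) 1.
  exists K, X, idfun, [::]; split=> //; split=> // .
  rewrite big_nil map_poly_id // -size_poly_eq1 eqn_leq p1 size_poly_gt0 //.
have [r rp ir] := irreducible_factor p1.
have [K1 _ [x rx gen]] := irredp_FAdjoin ir; have [X1 X1E] := finext_tower X K1.
have [q qE] : exists q, map_poly (in_alg K1) p = q * ('X - x%:P).
  by apply/factor_theorem; rewrite -(divpK rp) rmorphM poly.rootM rx orbT.
have sq : size p = size (q * ('X - x%:P)) by rewrite -qE size_map_poly.
have q0 : q != 0.
  by apply/eqP => e; move: sq; rewrite e mul0r size_poly0 => /eqP; rewrite size_poly_eq0 (negPf p0).
have [|E [XE [f [rs [fj1 [sp1 gen1]]]]]] := IH K1 X1 q _ q0.
  by move: sp; rewrite sq size_mul ?polyXsubC_eq0 // size_XsubC addn2 /=.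
exists E, XE, (f \o in_alg K1), (f x :: rs); split; first by move=> a /=; rewrite -fj1 X1E.
split.
  rewrite big_cons map_poly_comp qE rmorphM /= rmorphB /= map_polyX map_polyC mulrC.
  exact: eqp_mull.
move=> V VD VM Va Vr; apply: gen1 => // [b|z zr]; last by apply: Vr; rewrite inE zr orbT.
have : b \in <<1; x>>%VS by rewrite gen memvf.
move=> /Fadjoin_polyP[u /polyOver1P[v ->] ->].
rewrite horner_coef rmorph_sum; elim/big_ind: _ => [||i _]; [|exact: VD|].
  by rewrite -(rmorph0 (f \o in_alg K1)); apply: Va.
rewrite rmorphM rmorphXn coef_map; apply: (VM); first exact: Va.
elim: (nat_of_ord i) => [|k IHk]; first by rewrite expr0 -(rmorph1 (f \o in_alg K1)); apply: Va.
by rewrite exprS; apply: (VM) => //; apply: Vr; rewrite mem_head.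
Qed.

Lemma gal_iter (F : fieldType) (E : splittingFieldType F) (s : gal_of {:E}) k x :
  (s ^+ k)%g x = iter k s x.
Proof. by elim: k => [|k IH]; rewrite ?expg0 ?gal_id // expgSr galM ?memvf // IH. Qed.

(* The orbit of a root of g has fewer than size g elements. *)
Lemma root_orbit (F : fieldType) (E : splittingFieldType F) (s : gal_of {:E}) (g : {poly F}) (z : E) :
  g != 0 -> poly.root (map_poly (in_alg E) g) z -> (s ^+ (size g)`!)%g z = z.
Proof.
move=> g0 gz; set ge := map_poly _ g in gz.
have ge0 : ge != 0 by rewrite map_poly_eq0.
have rt k : poly.root ge (iter k s z).
  elim: k => //= k /eqP IH; rewrite /poly.root.
  have -> : ge.[s (iter k s z)] = s ge.[iter k s z].
  rewrite -horner_map /=; congr (_.[_]); rewrite -map_poly_comp; apply: eq_map_poly => a /=.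
  by rewrite rmorph_alg.
  by rewrite IH rmorph0.
have : ~~ uniq (mkseq (fun i => iter i s z) (size g)).
  apply/negP => u; have H := max_poly_roots ge0 _ u.
  suff : (size g < size g)%N by rewrite ltnn.
  by rewrite -{2}(size_map_poly (in_alg E) g) -{1}(size_mkseq (fun i => iter i s z) (size g)) H //; apply/allP => y /mapP[i _ ->].
move=> /(uniqPn 0)[i [k [ik]]]; rewrite size_mkseq => kg; rewrite !nth_mkseq ?(ltn_trans ik) // => e.
have e' : iter (k - i) s z = z.
  have inj : injective (iter i s) by elim: (i) => [|m IH] //= a b /fmorph_inj/IH.
  by apply: inj; rewrite -iterD subnKC // ltnW.
have /dvdnP[m ->] : (k - i %| (size g)`!)%N.
  by apply: dvdn_fact; rewrite subn_gt0 ik (leq_trans (leq_subr _ _)) // ltnW.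
by rewrite gal_iter; elim: m => [|m IH] //; rewrite mulSn addnC iterD e'.
Qed.

Lemma gal_trivial (F : fieldType) (E : splittingFieldType F) (s : gal_of {:E}) (rs : seq E) :
  (forall V : set E, (forall x y, V x -> V y -> V (x + y)) -> (forall x y, V x -> V y -> V (x * y)) ->
  (forall a : F, V a%:A) -> (forall z, z \in rs -> V z) -> forall x, V x) ->
  (forall z, z \in rs -> s z = z) -> s = 1%g.
Proof.
move=> gen hs; apply/eqP/gal_eqP => x _; rewrite gal_id.
apply: (gen (fun x => s x = x)) => // [y z hy hz|y z hy hz|a].
- by rewrite -[RHS](congr2 +%R hy hz); apply: rmorphD.
- by rewrite -[RHS](congr2 *%R hy hz); apply: rmorphM.
exact: rmorph_alg.
Qed.

Lemma gal_iter_pow (F : fieldType) (E : splittingFieldType F) (s : gal_of {:E}) z q i :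
  s z = z ^+ q -> (s ^+ i)%g z = z ^+ (q ^ i).
Proof.
move=> sz; rewrite gal_iter; elim: i => [|i IH] //=; rewrite IH.
by have -> : s (z ^+ (q ^ i)) = s z ^+ (q ^ i) by [exact: rmorphXn]; rewrite sz -exprM -expnS.
Qed.

(** * A normal closure over F(t) with enlarged constants *)

Section SplittingClosure.
Variables (R : realType) (F : finFieldType).
Local Notation F0 := {fraction {poly F}}.
Local Notation q := #|F|.
Variables (S : sized R F0) (L : fieldType) (XL : finext S L).

(* Adjoining all roots of X ^ (q ^ r) - X with r = (size g)! makes the Frobenius at a
  prime of degree one of F0 have order dividing r. *)
Lemma normal_closure : exists (E : splittingFieldType F0) (X : finext S E) (f : {rmorphism L -> E})
  (r : nat) (ks : seq E),
  [/\ forall a, fj X a = a%:A, forall a, f (fj XL a) = fj X a, (0 < r)%N,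
  uniq ks /\ size ks = (q ^ r)%N & (forall u, u \in ks <-> u ^+ (q ^ r) = u) /\
  forall s : gal_of {:E}, (forall u, u \in ks -> s u = u ^+ q) -> (s ^+ r = 1)%g].
Proof.
have q1 : (1 < q)%N := finNzRing_gt1 F.
have Hg i : exists g : {poly F0}, g != 0 /\ poly.root (map_poly (fj XL) g) (fw XL i).
  by have [g g0 h] := finext_algebraic XL (fw XL i); exists g.
(* g annihilates a basis of L over F0, so the splitting field of g times X^(q^r) - X over L is
   generated by roots over F0 itself, hence normal over F0. *)
have [gi giP] := choice Hg; pose g := \prod_i gi i.
have g0 : g != 0 by apply/prodf_neq0 => i _; case: (giP i).
have groot i : poly.root (map_poly (fj XL) g) (fw XL i).
  by rewrite /g (bigD1 i) //= rmorphM poly.rootM (giP i).2.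
pose r := (size g)`!; have r0 : (0 < r)%N := fact_gt0 _.
have qr : (1 < q ^ r)%N by rewrite -(expn0 q) ltn_exp2l.
pose k : {poly F0} := 'X^(q ^ r) - 'X.
have sk : size k = (q ^ r).+1 by rewrite size_polyDl ?size_polyN ?size_polyXn ?size_polyX.
have k0 : k != 0 by rewrite -size_poly_eq0 sk.
have p0 : map_poly (fj XL) (g * k) != 0 by rewrite map_poly_eq0 mulf_neq0.
have [E0 H] := splitting_ex XL p0.
(* In this form the field structures of E and of fext X are convertible. *)
move: H; destruct E0 as [T []]; move=> [X [f [rs [fjE [spl gen]]]]].
set E := GRing.Field.Pack _ in X f rs fjE spl gen.
have mE p : map_poly f (map_poly (fj XL) p) = map_poly (in_alg (fext X)) p.
  rewrite -map_poly_comp; apply: eq_map_poly => a /=; by rewrite fjE finext_alg.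
have gen' (V : set E) : (forall x y, V x -> V y -> V (x + y)) -> (forall x y, V x -> V y -> V (x * y)) ->
  (forall a, V (fj X a)) -> (forall z, z \in rs -> V z) -> forall x, V x.
  move=> VD VM Va Vr; apply: gen => // a; rewrite (fcoK XL a) rmorph_sum.
  elim/big_ind: _ => [||i _]; [|exact: VD|].
  by rewrite -(rmorph0 (fj X)); apply: Va.
  rewrite rmorphM fjE; apply: (VM); first exact: Va.
  apply: Vr; rewrite -root_prod_XsubC -(eqp_root spl) /poly.root horner_map.
  by have /rootP gr := groot i; rewrite rmorphM hornerM gr mul0r rmorph0.
have spl' := spl; rewrite mE in spl'.
have axE : SplittingField.axiom (fext X).
  exists (map_poly (in_alg (fext X)) (g * k)).
  by apply/polyOver1P; exists (g * k).
  exists rs; first exact: spl'.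
  apply/vspaceP => x; rewrite memvf.
  apply: (gen' (fun x : E => (x : fext X) \in <<1 & (rs : seq (fext X))>>%VS)).
  - by move=> y z; apply: rpredD.
  - by move=> y z; apply: rpredM.
  - by move=> a; rewrite -finext_alg; apply: rpredZ; apply: rpred1.
  - by move=> z zr; apply: seqv_sub_adjoin.
pose ES := FieldExt_isSplittingField.Build F0 (fext X) axE.
pose EE : splittingFieldType F0 := HB.pack (fext X) ES.
have kd : map_poly (in_alg (fext X)) k %| \prod_(z <- rs) ('X - z%:P).
  by rewrite -(eqp_dvdr _ spl') rmorphM dvdp_mull.
have [m km] := dvdp_prod_XsubC kd.
pose ks : seq E := mask m rs.
have kE : map_poly (in_alg (fext X)) k = 'X^(q ^ r) - 'X.
  by rewrite rmorphB /= map_polyXn map_polyX.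
have ksP u : u \in ks <-> u ^+ (q ^ r) = u.
  rewrite /ks -(@root_prod_XsubC (fext X)) -(eqp_root km) kE /poly.root !hornerE subr_eq0.
  by split=> [/eqP//|e]; apply/eqP.
have uks : uniq ks.
  rewrite -(@separable_prod_XsubC (fext X)) -(eqp_separable km) kE unlock.
  rewrite derivB derivXn derivX (_ : 'X^((q ^ r).-1) *+ (q ^ r)%N = 0).
  by rewrite sub0r -[- 1]scaleN1r coprimepZr ?coprimep1 // oppr_eq0 oner_eq0.
  rewrite -mulr_natr natrX; have -> : (q%:R : {poly fext X}) = 0; last by rewrite expr0n gtn_eqF ?mulr0.
  pose c : {rmorphism F -> E} := fj X \o (tf \o polyC).
  have qE : (q%:R : E) = 0 by rewrite -(rmorph_nat c) card_natr rmorph0.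
  by rewrite -polyC_natr (_ : q%:R = 0 :> fext X) ?polyC0.
have sks : size ks = (q ^ r)%N.
  have := eqp_size km; rewrite size_map_poly sk (@size_prod_XsubC (fext X)) => -[] //.
exists EE, X, f, r, ks; split; [by move=> a; exact: (esym (finext_alg X a)) | exact: fjE | exact: r0 | by split |].
split; [exact: ksP | move=> s hs].
apply: (@gal_trivial _ EE (s ^+ r)%g rs) => [V VD VM Va Vr|z zr].
  by apply: gen' => //; move=> a; have := Va a; rewrite -finext_alg.
have : poly.root (map_poly (in_alg (fext X)) (g * k)) z.
  by rewrite (eqp_root spl') (@root_prod_XsubC (fext X)).
rewrite rmorphM poly.rootM => /orP[gz|]; first exact: (@root_orbit _ EE).
rewrite (eqp_root km) (@root_prod_XsubC (fext X)) => zk.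
by rewrite (@gal_iter_pow _ EE s z q r (hs z zk)); apply/ksP.
Qed.

End SplittingClosure.

Lemma uniq_fibres (T U : eqType) (g : T -> U) (fb : U -> seq T) (t : seq U) : uniq t ->
  (forall P, P \in t -> uniq (fb P)) -> (forall P, P \in t -> forall Q, Q \in fb P -> g Q = P) ->
  uniq (flatten (map fb t)).
Proof.
elim: t => //= P t IH /andP[Pt ut] hu hg; rewrite cat_uniq hu ?mem_head //=; apply/andP; split; last first.
  by apply: IH => // P' P't; [apply: hu | apply: hg]; rewrite inE P't orbT.
apply/hasPn => Q /flattenP[l /mapP[P' P't ->] Ql]; apply/negP => QP.
by move/negP: Pt; apply; rewrite -(hg P (mem_head _ _) Q QP) (hg P' _ Q Ql) // inE P't orbT.
Qed.

(** Numerical part of [lower_count]: a0 and a count the primes of degree n before and after at most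
    B are discarded, h and k are the orders of H and of [Hn n], T1 is the sum over [Hn n] and T2 the
    term of the chosen element. *)
Lemma lower_arith (a a0 n h k r Q0 T1 T2 w w' C1 C2 B : nat) : (a * (n * h) <= T1)%N ->
  (T1 <= T2 + k * (C1 * w) + k.-1 * (r * Q0))%N -> (Q0 <= n * a0 + C2 * w')%N -> (a0 <= a + B)%N ->
  (r * k <= h)%N -> (0 < k)%N -> (n <= 2 * w)%N -> (w' <= w)%N -> (k <= h)%N ->
  (r * Q0 <= T2 + h * (C1 + C2 + 2 * B) * w)%N.
Proof.
move=> tot le1 le0 st cH c1 w2 hw HH; have [B2 B2E] : exists B2, B2 = (2 * B)%N by eexists.
rewrite -B2E; have e1 : (h * Q0 <= h * (n * a + n * B + C2 * w))%N.
  rewrite leq_mul2l; apply/orP; right; apply: leq_trans le0 _; apply: leq_add; last by rewrite leq_mul2l hw orbT.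
  by rewrite -mulnDr leq_mul2l st orbT.
have e2 : (r * k * Q0 <= h * Q0)%N by rewrite leq_mul2r cH orbT.
have e3 : (h * (n * B) <= h * (B2 * w))%N by rewrite B2E mulnAC leq_mul2l leq_mul2r w2 !orbT.
have e4 : (k * (C1 * w) <= h * (C1 * w))%N by rewrite leq_mul2r HH orbT.
case: k c1 le1 cH e2 HH e4 => // k _ le1 cH e2 HH e4; rewrite /= in le1.
have e5 : (r * k.+1 * Q0 = r * Q0 + k * (r * Q0))%N by rewrite mulnS mulnDl -[(r * k * Q0)%N]mulnA mulnCA.
have e6 : (h * (n * a) = a * (n * h))%N by rewrite mulnCA [RHS]mulnCA [(a * h)%N]mulnC.
move: e1; rewrite !mulnDr e6 !mulnDl => e1.
have -> : (h * C1 * w = h * (C1 * w))%N by rewrite mulnA.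
have -> : (h * C2 * w = h * (C2 * w))%N by rewrite mulnA.
have -> : (h * B2 * w = h * (B2 * w))%N by rewrite mulnA.
lia.
Qed.

(** * Counting primes of the normal closure by their Frobenius element *)

Section ClosureCount.
Variables (R : realType) (F : finFieldType).
Local Notation F0 := {fraction {poly F}}.
Local Notation q := #|F|.
Variables (S : sized R F0) (Y : finext S F0) (E : splittingFieldType F0) (X : finext S E).
Variables (r : nat) (ks : seq E).
Hypotheses (SA : sA S = @fpoly F) (Sabs : sabs S = @fabs R F) (idj : forall a, fj Y a = a).
Hypotheses (jE : forall a, fj X a = a%:A) (r0 : (0 < r)%N) (uks : uniq ks) (sks : size ks = (q ^ r)%N).
Hypothesis ksP : forall u, u \in ks <-> u ^+ (q ^ r) = u.
Hypothesis ksr : forall s : gal_of {:E}, (forall u, u \in ks -> s u = u ^+ q) -> (s ^+ r = 1)%g.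
Local Notation H := ('Gal({:E} / 1%AS))%g.
Implicit Types (Q : set E) (s : gal_of {:E}) (n : nat).

Let q1 : (1 < q)%N := finNzRing_gt1 F.
Let q0 : (0 < q)%N := ltnW q1.

Lemma fj_one x : x \in (1%AS : {subfield E}) <-> exists a, x = fj X a.
Proof.
split=> [/vlineP[a ->]|[a ->]]; first by exists a; rewrite jE.
by apply/vlineP; exists a; rewrite jE.
Qed.

Lemma fj_id a : fj X (fj Y a) = fj X a. Proof. by rewrite idj. Qed.

Lemma ks_vl Q w : is_prime Q -> w ^+ (q ^ r) = w -> w != 0 -> vl Q w = 0.
Proof.
move=> hQ ww w0; have := congr1 (vl Q) ww; rewrite vlX //.
have qr : (1 < q ^ r)%N by rewrite -(expn0 q) ltn_exp2l.
by move: (vl Q w) => v; nia.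
Qed.

Lemma ks_inj Q u v : is_prime Q -> u \in ks -> v \in ks -> max_ideal Q (u - v) -> u = v.
Proof.
move=> hQ /ksP uu /ksP vv; have [/eqP|w0 mw] := eqVneq (u - v) 0; first by rewrite subr_eq0 => /eqP.
have := (vl_max hQ w0).1 mw; rewrite ks_vl ?(powqB X) ?uu ?vv //.
Qed.

Lemma ks_oint u : u \in ks -> oint X u.
Proof.
move=> /ksP uu; apply: oint_inter => Q aQ; have hQ := aQ.1.
have [->|u0] := eqVneq u 0; first exact: prime0.
by apply/(vl_prime hQ u0); rewrite ks_vl.
Qed.

Lemma ks_pow u i : u \in ks -> u ^+ (q ^ i) \in ks.
Proof. by move=> /ksP uu; apply/ksP; rewrite -exprM mulnC exprM uu. Qed.
Lemma ks_gal s u : u \in ks -> s u \in ks.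
Proof. by move=> /ksP uu; apply/ksP; rewrite -[in RHS]uu; apply/esym; exact: rmorphXn. Qed.
Definition dg (K : fieldType) (P : set K) : nat := trunc_log q (prime_norm P).

Lemma dgP (K : fieldType) (Z : finext S K) P : above Z P -> prime_norm P = (q ^ dg P)%N /\ (0 < dg P)%N.
Proof.
move=> aP; have [f f0 Nf] := norm_power SA aP.
have -> : dg P = f by rewrite /dg Nf; apply: trunc_expnK.
by [].
Qed.

(** For large k the index of t^k exceeds 1, so some prime contains t; its residues are those of
    constant terms, so its residue field has q elements. *)
Lemma prime_degree1 : exists2 P, above Y P & prime_norm P = q.
Proof.
have [c [e [c0 e0 e1 hge]]] := idx_scaled_ge Y.
have [k hk] : exists k, c^-1 + e^-1 + 1 <= (q ^ k)%:R.
  exists (Num.bound `|c^-1 + e^-1 + 1|); apply: le_trans (ler_norm _) _.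
  by apply/ltW/(lt_trans (archi_boundP (normr_ge0 _))); rewrite ltr_nat ltn_expl.
have ci0 : 0 < c^-1 by rewrite invr_gt0. have ei0 : 0 < e^-1 by rewrite invr_gt0.
pose y := tf ('X^k : {poly F}); have y0 : y != 0 by rewrite tofrac_eq0 -size_poly_eq0 size_polyXn.
have Ay : sA S y by rewrite SA; exists 'X^k.
have Oy : oint Y y by rewrite -[y]idj; apply: ointj.
have ay : sabs S y = (q ^ k)%:R.
  by rewrite Sabs fabs_poly /psz -size_poly_eq0 size_polyXn.
have [u uu hu] := mem_finite Oy y0.
have hidx := idx_scaled_prod Oy y0 uu (fun Z Zu => ((hu Z).1 Zu).1) (fun Z aZ mZ => (hu Z).2 (conj aZ mZ)).
have [|||_ hge'] := @hge y y (sabs S y) (\prod_(Z <- u) prime_norm Z ^ `|vl Z y|)%N Ay Oy.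
- by rewrite ay; lra.
- exact: lexx.
- by rewrite idj subrr; apply: box0; rewrite mulr_gt0 // sabs_gt0.
have {}hge' := hge' hidx.
have [P Pu] : exists P, P \in u.
  case: (u) hge' => [|P u'] h; last by exists P; rewrite mem_head.
  have x1 : 1 < c * sabs S y by rewrite ay -ltr_pdivrMl // mulr1; lra.
  move: h; rewrite big_nil leNgt expr_gt1 ?x1 ?fd_gt0 //; exact: ltW (lt_trans ltr01 x1).
have [aP my] := (hu P).1 Pu; have hP := aP.1; exists P => //.
have mX : max_ideal P (tf 'X).
  by apply: (@max_exp _ P _ k) => //; [exact: (above_tf SA idj) | rewrite -rmorphXn].
have [hi _] := norm_above aP; have [k' [c' [hc ck]]] := residue_ex hP hi.
have [NP dP] := dgP aP.
suff : (dg P %| 1)%N by rewrite dvdn1 => /eqP d1; rewrite NP d1 expn1.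
apply: (@frob_dvd k' q) => //; first by rewrite ck.
have [g gE] := const_rmorph SA aP hc.
have cpol u' : c' (tf u') = g u'`_0.
  rewrite gE idj; apply/(res_eq hP hc); [exact: (above_tf SA idj) | exact: (above_tf SA idj) |].
  rewrite -tofracB; have /polyP e2 : u' - (u'`_0)%:P = (\poly_(i < size u') u'`_i.+1) * 'X.
  apply/polyP => i; rewrite coefMX coefB coefC coef_poly; case: i => [|i] /=; first by rewrite subrr.
  by rewrite subr0; case: ltnP => // h; rewrite nth_default // ltnW.
  move/polyP: e2 => ->; rewrite tofracM; apply: maxM => //; exact: (above_tf SA idj).
move=> z; have [x Px <-] := res_surj hc z; have [a [b [nb ->]]] := prime_frac SA idj aP Px.
have b0 : tf b != 0 by apply/eqP => e2; apply: nb; rewrite e2; exact: (max_sub hP).1.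
have Pt w : P (tf w) := above_tf SA idj w aP.
have Pb : P (tf b)^-1 by apply: prime_inv.
have cb : c' (tf b) != 0 by apply/eqP => /(res_max hc (Pt _)) h; apply: nb.
have cV : c' (tf b)^-1 = (c' (tf b))^-1.
  by apply: (mulfI cb); rewrite divff // -(resM hc) // divff // (res1 hc).
by rewrite expn1 (resM hc) // cV !cpol -fmorphV -rmorphM -rmorphXn expf_card.
Qed.

(** Taken at a prime P0 above one of degree 1. Since s^r = 1, every residue at P0 satisfies x^(q^r)
    = x, which bounds the norm of P0 as Stepanov's bound requires. *)
Lemma exists_frob : exists s, [/\ s \in H, forall u, u \in ks -> s u = u ^+ q &
  exists2 P0, above X P0 & (prime_norm P0 <= q ^ r)%N].
Proof.
have [P aP NP] := prime_degree1; have [P0 aP0 cP0] := lying_over fj_id aP.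
have [s sH [mP hs]] := frobenius_ex fj_id fj_one aP0; have hP := aP0.1.
rewrite cP0 NP in hs.
have sks' u : u \in ks -> s u = u ^+ q.
  move=> uk; apply: (ks_inj hP); [exact: ks_gal | by have := ks_pow 1 uk; rewrite expn1 |].
  by apply: hs; apply: (aboveO aP0); apply: ks_oint.
exists s; split=> //; exists P0 => //.
have [hi _] := norm_above aP0; have [k [c [hc <-]]] := residue_ex hP hi.
have si i x : P0 x -> P0 ((s ^+ i)%g x) /\ c ((s ^+ i)%g x) = c x ^+ (q ^ i).
  move=> Px; elim: i => [|i [IH1 IH2]]; first by rewrite expg0 gal_id expr1.
  rewrite expgSr galM ?memvf //; have Ps : P0 (s ((s ^+ i)%g x)) by exact: (res_moved mP IH1).
  split=> //; rewrite expnSr exprM -IH2 -(resX hP hc) //; apply/(res_eq hP hc) => //; first exact: primeX.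
  exact: hs.
have : (#|k| <= maxn (q ^ r) 1)%N; last by rewrite (maxn_idPl _) // expn_gt0 q0.
apply: pow_eq_card; first by rewrite -(expn0 q) eqn_exp2l // -lt0n.
by move=> z; have [x Px <-] := res_surj hc z; have [_ <-] := si r x Px; rewrite (ksr sks') gal_id expr1.
Qed.

Definition Tn (n : nat) s Q : Prop := above X Q /\ forall x, oint X x -> max_ideal Q (x ^+ (q ^ n) - ac s x).
(** The elements acting on the constants as the n-th power of the q-Frobenius; by [Tn_Hn] only these
    can agree with the q^n-th power map at some prime. *)
Definition Hn (n : nat) : {set gal_of {:E}} := [set s in H | all (fun u => s u == u ^+ (q ^ n)) ks]%SET.

Lemma HnP n s : reflect (s \in H /\ forall u, u \in ks -> s u = u ^+ (q ^ n)) (s \in Hn n).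
Proof.
rewrite inE; apply: (iffP andP) => -[h1 h2]; split=> //.
  by move=> u uk; apply/eqP; have /allP := h2; apply.
by apply/allP => u uk; apply/eqP; apply: h2.
Qed.

Lemma Tn_Hn n s Q : s \in H -> Tn n s Q -> s \in Hn n.
Proof.
move=> sH [aQ h]; apply/HnP; split=> // u uk; apply/esym.
by apply: (ks_inj aQ.1); [exact: ks_pow | exact: ks_gal | apply: h; apply: ks_oint].
Qed.

Lemma ks_faithful i : (forall u, u \in ks -> u ^+ (q ^ i) = u) -> (i < r)%N -> i = 0%N.
Proof.
move=> h ir; apply/eqP; rewrite -leqn0 leqNgt; apply/negP => i0.
have qi : (1 < q ^ i)%N by rewrite -(expn0 q) ltn_exp2l.
pose u : {poly E} := 'X^(q ^ i) - 'X.
have su : size u = (q ^ i).+1 by rewrite size_polyDl ?size_polyN ?size_polyXn ?size_polyX.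
have u0 : u != 0 by rewrite -size_poly_eq0 su.
have := max_poly_roots u0 _ uks; rewrite su sks ltnS leq_exp2l // leqNgt ir => H'.
suff : false by []; apply: H'; apply/allP => v vk.
by rewrite /poly.root /u !hornerE h // subrr.
Qed.

Lemma ks_faithful2 i j : (forall u, u \in ks -> u ^+ (q ^ i) = u ^+ (q ^ j)) -> (i <= j)%N -> (j < i + r)%N -> i = j.
Proof.
move=> h ij jr; suff : (j - i = 0)%N by move/eqP; rewrite subn_eq0 => ji; apply/eqP; rewrite eqn_leq ij.
apply: ks_faithful; last by rewrite ltn_subLR.
move=> u uk; apply/eqP; rewrite -subr_eq0.
have : (u ^+ (q ^ (j - i)) - u) ^+ (q ^ i) = 0.
  by rewrite (powqB X) -exprM -expnD subnK // h // subrr.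
by move/eqP; rewrite expf_eq0 => /andP[].
Qed.

(** The translates of [Hn n] by s^i for i < r are disjoint, because they act on the constants by
    different powers of Frobenius. *)
Lemma card_Hn n : (r * #|Hn n| <= #|H|)%N.
Proof.
have [s [sH sk _]] := exists_frob.
pose f (t : gal_of {:E} * 'I_r) := (t.1 * s ^+ t.2)%g.
have act t (i : nat) u : t \in Hn n -> u \in ks -> (t * s ^+ i)%g u = u ^+ (q ^ (n + i)).
  move=> /HnP[_ ht] uk; rewrite galM ?memvf // ht //; have vk := ks_pow n uk.
  by rewrite (@gal_iter_pow _ E s _ q i (sk _ vk)) -exprM -expnD.
have inj : {in finset.setX (Hn n) [set: 'I_r]%SET &, injective f}.
  move=> [t i] [t' j] /setXP[/= th _] /setXP[/= th' _] e.
  have ij : i = j.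
  wlog le : t t' i j th th' e / (i <= j)%N.
  by move=> W; case/orP: (leq_total i j) => h; [apply: W e h | apply/esym; apply: W (esym e) h].
  apply: val_inj; apply/eqP; rewrite -(eqn_add2l n); apply/eqP; apply: ks_faithful2.
  - by move=> u uk; rewrite -(act _ _ _ th uk) -(act _ _ _ th' uk); congr (gal_repr _ u).
  - by rewrite leq_add2l.
  - by rewrite -addnA ltn_add2l (leq_trans (ltn_ord j)) // leq_addl.
  by subst j; congr (_, _); apply: (mulIg (s ^+ i)%g); exact: e.
have := card_in_imset inj; rewrite cardsX cardsT card_ord mulnC => <-.
apply: subset_leq_card; apply/fintype.subsetP => t /imsetP[[t' i] /setXP[/HnP[h _] _] ->].
by rewrite groupM ?groupX.
Qed.

Lemma upper_count : exists C : nat, forall n s (t : seq (set E)), (0 < n)%N -> s \in H -> uniq t ->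
  (forall Q, Q \in t -> Tn n s Q) -> (\sum_(Q <- t) dg Q <= r * q ^ n + C * q ^ (uphalf n))%N.
Proof.
have [_ [_ _ [P0 aP0 N0]]] := exists_frob.
have Hs s : exists C : nat, s \in H -> forall n (t : seq (set E)), (0 < n)%N -> uniq t ->
  (forall Q, Q \in t -> Tn n s Q) -> (\sum_(Q <- t) dg Q <= r * q ^ n + C * q ^ (uphalf n))%N.
  have [sH|_] := boolP (s \in H); last by exists 0%N.
  have [C hC] := stepanov SA Sabs (fun a => gal_fj fj_id fj_one a sH) aP0 r0 N0.
  exists C => _ n t n0 ut ht; rewrite -(leq_exp2l _ _ q1); apply: leq_trans (hC n t n0 ut ht).
  rewrite (big_morph (fun i => q ^ i)%N (fun a b => expnD q a b) (expn0 q)) big_seq [leqRHS]big_seq.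
  by apply: eq_leq; apply: eq_bigr => Q /ht[aQ _]; have [-> _] := dgP aQ.
have [C hC] := choice Hs; exists (\sum_s C s)%N => n s t n0 sH ut ht.
apply: leq_trans (hC s sH n t n0 ut ht) _; rewrite leq_add2l leq_mul2r.
by rewrite (bigD1 s) //= leq_addr orbT.
Qed.

Lemma leq_2w n : (n <= 2 * q ^ uphalf n)%N.
Proof.
have h := ltn_expl (uphalf n) q1; have := uphalf_half n; have := odd_double_half n; move: h.
by case: (odd n); move: (q ^ uphalf n)%N (uphalf n) (n./2) => a b c; lia.
Qed.

Lemma half_w n : (q ^ n./2 <= q ^ uphalf n)%N.
Proof. by rewrite leq_exp2l // uphalf_half leq_addl. Qed.

(* The upper bounds for all elements of Hn n add up to the number of points, up to the error term. *)
Lemma lower_count : exists C : nat, forall n s, (0 < n)%N -> s \in Hn n -> exists u : seq (set E),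
  [/\ uniq u, forall Q, Q \in u -> Tn n s Q & (r * q ^ n <= \sum_(Q <- u) dg Q + C * q ^ (uphalf n))%N].
Proof.
have [C1 up] := upper_count; have [C2 cd] := count_degree SA Sabs idj.
have [bad hb] := tame_almost fj_id fj_one.
pose badF := [seq contr (fj X) Q | Q <- bad]; pose B := size badF.
exists (#|H| * (C1 + C2 + 2 * B))%N => n s0 n0 s0H.
have [t0 [ut0 ht0 le0]] := cd n n0.
pose t := [seq P <- t0 | P \notin badF].
have st : (size t0 <= size t + B)%N.
  rewrite /t size_filter -(count_predC (fun P => P \notin badF) t0) leq_add2l.
  rewrite -size_filter; apply: uniq_leq_size; first exact: filter_uniq.
  by move=> P; rewrite mem_filter /= => /andP[/negbNE].
have Hfb P : exists fb : seq (set E), P \in t -> [/\ uniq fb,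
  forall Q, Q \in fb -> above X Q /\ contr (fj X) Q = P & (\sum_(Q <- fb) dg Q = n * #|H|)%N].
  have [Pt|_] := boolP (P \in t); last by exists [::].
  move: Pt; rewrite mem_filter => /andP[nb Pt]; have [aP NP] := ht0 P Pt.
  have [fb [f [ufb hfb Nfb f0 [_ [_ card]]]]] := fibre fj_id fj_one aP.
  exists fb => _; split=> // [Q /hfb//|].
  have -> : #|H| = (size fb * f)%N.
  apply/esym; apply: card => Q Qf; have [aQ cQ] := (hfb Q).1 Qf.
  apply: contrapT => nt; move/negP: nb; apply; apply/mapP; exists Q => //; exact: hb.
  rewrite mulnCA big_seq (eq_bigr (fun=> (n * f)%N)).
  by rewrite -big_seq big_const_seq count_predT iter_addn_0 mulnC.
  move=> Q Qf; apply/eqP; rewrite -(eqn_exp2l _ _ q1); have [aQ _] := (hfb Q).1 Qf.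
  by have [<- _] := dgP aQ; rewrite Nfb // NP expnM.
have [fb fbP] := choice Hfb.
pose al := flatten (map fb t).
have ual : uniq al.
  apply: (@uniq_fibres _ _ (fun Q => contr (fj X) Q)); first exact: filter_uniq.
  by move=> P /fbP[].
  by move=> P /fbP[_ h _] Q /h[].
have hal Q : Q \in al -> above X Q /\ prime_norm (contr (fj X) Q) = (q ^ n)%N.
  move=> /flattenP[l /mapP[P Pt ->] Ql]; have [_ h _] := fbP P Pt; have [aQ cQ] := h Q Ql.
  by split=> //; rewrite cQ; move: Pt; rewrite mem_filter => /andP[_ /ht0[]].
have sal : (\sum_(Q <- al) dg Q = size t * (n * #|H|))%N.
  rewrite /al big_flatten big_map big_seq (eq_bigr (fun=> (n * #|H|)%N)) => [|P /fbP[]//].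
  by rewrite -big_seq big_const_seq count_predT iter_addn_0 mulnC.
pose u s := [seq Q <- al | `[< Tn n s Q >]].
have hu s Q : Q \in u s -> Tn n s Q by rewrite mem_filter => /andP[/asboolP].
have uu s : uniq (u s) by apply: filter_uniq.
have tot : (size t * (n * #|H|) <= \sum_(s in Hn n) \sum_(Q <- u s) dg Q)%N.
  rewrite -sal; rewrite (eq_bigr (fun s => \sum_(Q <- al) (if `[< Tn n s Q >] then dg Q else 0))%N); last first.
  by move=> s _; rewrite big_filter big_mkcond.
  rewrite exchange_big /= big_seq [leqRHS]big_seq; apply: leq_sum => Q /hal[aQ NQ].
  have [s sH [mQ hs]] := frobenius_ex fj_id fj_one aQ.
  have TQ : Tn n s Q.
  split=> // x Ox; apply: subgC; first exact: (max_sub aQ.1).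
  by rewrite -NQ; apply: hs; apply: (aboveO aQ).
  rewrite (bigD1 s) /=; last exact: Tn_Hn TQ.
  by rewrite asboolT // leq_addr.
exists (u s0); split=> //; first exact: hu.
have le1 : (\sum_(s in Hn n) \sum_(Q <- u s) dg Q <=
  \sum_(Q <- u s0) dg Q + #|Hn n| * (C1 * q ^ uphalf n) + #|Hn n|.-1 * (r * q ^ n))%N.
  rewrite (bigD1 s0) //= -addnA leq_add2l.
  apply: (@leq_trans (#|Hn n|.-1 * (r * q ^ n + C1 * q ^ uphalf n))); last first.
  by rewrite mulnDr addnC leq_add2r leq_mul2r leq_pred orbT.
  apply: (@leq_trans (\sum_(s in Hn n | s != s0) (r * q ^ n + C1 * q ^ uphalf n))%N).
  by apply: leq_sum => s /andP[/HnP[sH _] _]; apply: (up n s (u s) n0 sH (uu s) (hu s)).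
  rewrite sum_nat_const (cardsD1 s0 (Hn n)) s0H /= leq_mul2r; apply/orP; right.
  by rewrite add0n; apply: subset_leq_card; apply/fintype.subsetP => s h; rewrite in_setD1 andbC.
have cH : (r * #|Hn n| <= #|H|)%N := card_Hn n.
have c1 : (0 < #|Hn n|)%N by rewrite card_gt0; apply/set0Pn; exists s0.
have w2 := leq_2w n; have hw := half_w n.
have HH : (#|Hn n| <= #|H|)%N by apply: leq_trans cH; rewrite leq_pmull.
exact: (lower_arith tot le1 le0 st cH c1 w2 hw HH).
Qed.

End ClosureCount.

(** By normality of L over K, s sends f(x) to a root of the minimal polynomial of x, which lies
    again in f(L). *)
Lemma restrict_gal (K E : fieldType) (L : splittingFieldType K) (f : {rmorphism L -> E})
  (s : {rmorphism E -> E}) : (forall a : K, s (f a%:A) = f a%:A) ->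
  exists2 r : gal_of {:L}, r \in ('Gal({:L} / 1%AS))%g & forall x, s (f x) = f (ac r x).
Proof.
move=> sK.
have Hx x : exists y, s (f x) = f y.
  have [rs /eqP rE] := splitting_field_normal 1%AS x.
  have /polyOver1P[g gE] := minPolyOver 1%AS x.
  have fg : map_poly f (minPoly 1%AS x) = \prod_(z <- [seq f z | z <- rs]) ('X - z%:P).
  by rewrite rE rmorph_prod big_map; apply: eq_bigr => z _; rewrite rmorphB /= map_polyX map_polyC.
  have : poly.root (map_poly f (minPoly 1%AS x)) (s (f x)).
  have e : map_poly s (map_poly f (minPoly 1%AS x)) = map_poly f (minPoly 1%AS x).
  by rewrite gE -!map_poly_comp; apply: eq_map_poly => a /=; rewrite sK.
  rewrite /poly.root -e horner_map horner_map.
  by have /rootP -> := root_minPoly 1%AS x; rewrite !rmorph0.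
  by rewrite fg root_prod_XsubC => /mapP[y _ ->]; exists y.
have [h hE] := choice Hx; have fI : injective f := fmorph_inj f.
have hlin : linear h.
  move=> a x y; apply: fI; rewrite -hE -mulr_algl [f (a%:A * x + y)]rmorphD rmorphM.
  by rewrite -[a *: h x]mulr_algl [f (a%:A * h x + h y)]rmorphD !rmorphM rmorphD rmorphM sK !hE.
have hM x y : h (x * y) = h x * h y by apply: fI; rewrite -hE !rmorphM !hE.
pose hl := GRing.isLinear.Build K L L _ h hlin.
pose hL : {linear L -> L} := HB.pack h hl.
have kA : kAut 1 {:L} (linfun hL).
  rewrite kAutfE; apply/kHomP; split=> [x y _ _|x /vlineP[a ->]].
  by rewrite !lfunE; exact: hM.
  by rewrite lfunE /=; apply: fI; rewrite -hE sK.
have [r rG re] := kAut_to_gal kA; exists r => // x.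
by rewrite hE; congr (f _); rewrite /ac /= -re ?memvf // lfunE.
Qed.

(** * Fibres over lists of primes and sums of degrees *)

Section FibreList.
Variables (R : realType) (F : finFieldType).
Local Notation F0 := {fraction {poly F}}.
Local Notation q := #|F|.
Variables (S : sized R F0) (Kb Bf : fieldType) (E : splittingFieldType Bf).
Variables (Y : finext S Kb) (X : finext S E) (iota : {rmorphism Kb -> E}) (U : {subfield E}).
Hypotheses (SA : sA S = @fpoly F) (Sabs : sabs S = @fabs R F).
Hypothesis iotaj : forall a, iota (fj Y a) = fj X a.
Hypothesis iotaU : forall x, x \in U <-> exists a, x = iota a.
Local Notation HU := ('Gal({:E} / U))%g.
Local Notation dgp P := (@dg F _ P).

Lemma fibre_list (t : seq (set Kb)) : uniq t -> (forall P, P \in t -> above Y P) ->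
  exists al : seq (set E), [/\ uniq al, forall Q, Q \in al <-> above X Q /\ contr iota Q \in t,
  (\sum_(Q <- al) dgp Q <= (\sum_(P <- t) dgp P) * #|HU|)%N
  & (forall Q, Q \in al -> tame U Q) -> (\sum_(Q <- al) dgp Q = (\sum_(P <- t) dgp P) * #|HU|)%N].
Proof.
move=> ut ht; have q1 := finNzRing_gt1 F.
have Hfb P : exists fb : seq (set E), P \in t -> [/\ uniq fb,
  forall Q, Q \in fb <-> above X Q /\ contr iota Q = P, (\sum_(Q <- fb) dgp Q <= dgp P * #|HU|)%N
  & (forall Q, Q \in fb -> tame U Q) -> (\sum_(Q <- fb) dgp Q = dgp P * #|HU|)%N].
  have [Pt|_] := boolP (P \in t); last by exists [::].
  have aP := ht P Pt; have [NP _] := dgP SA aP.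
  have [fb [f [ufb hfb Nfb f0 [_ [le card]]]]] := fibre iotaj iotaU aP.
  have e : (\sum_(Q <- fb) dgp Q = dgp P * (size fb * f))%N.
  rewrite mulnCA big_seq (eq_bigr (fun=> (dgp P * f)%N)).
  by rewrite -big_seq big_const_seq count_predT iter_addn_0 mulnC.
  move=> Q Qf; apply/eqP; rewrite -(eqn_exp2l _ _ q1); have [aQ _] := (hfb Q).1 Qf.
  by have [<- _] := dgP SA aQ; rewrite Nfb // NP expnM.
  exists fb => _; split=> //; rewrite e; first by rewrite leq_mul2l le orbT.
  by move=> h; rewrite card.
have [fb fbP] := choice Hfb; pose al := flatten (map fb t).
have mal Q : Q \in al <-> above X Q /\ contr iota Q \in t.
  split=> [/flattenP[l /mapP[P Pt ->] Ql]|[aQ ct]].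
  by have [_ h _ _] := fbP P Pt; have [aQ cQ] := (h Q).1 Ql; split=> //; rewrite cQ.
  apply/flattenP; exists (fb (contr iota Q)); first exact: map_f.
  by have [_ h _ _] := fbP _ ct; apply/h.
exists al; split=> //.
- apply: (@uniq_fibres _ _ (fun Q => contr iota Q)) => // [P /fbP[]//|P /fbP[_ h _ _] Q /h[]//].
- rewrite /al big_flatten big_map big_distrl /= big_seq [leqRHS]big_seq.
  by apply: leq_sum => P /fbP[].
move=> tm; rewrite /al big_flatten big_map big_distrl /= big_seq [RHS]big_seq.
apply: eq_bigr => P Pt; have [_ h _ ->] := fbP P Pt => // Q Qf; apply: tm; apply/mal.
by have [aQ cQ] := (h Q).1 Qf; split=> //; rewrite cQ.
Qed.

Lemma sum_degree : exists B : nat, forall T, (\sum_(P <- ps (cheb_poly Y SA Sabs) T) dgp P <= B * T)%N.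
Proof.
have q1 := finNzRing_gt1 F; have q0 : 0 < q%:R :> R by rewrite ltr0n; apply: ltnW.
have lq : 0 < ln q%:R :> R by rewrite ln_gt0 // ltr1n.
have [C C1 hC] := theta_bound (cheb_poly Y SA Sabs).
exists (Num.bound `|C / ln q%:R|) => T; rewrite -(ler_nat R) natrM.
apply: (@le_trans _ _ (C / ln q%:R * T%:R)); last first.
  by apply: ler_wpM2r => //; apply: le_trans (ler_norm _) _; apply/ltW/archi_boundP.
rewrite mulrAC ler_pdivlMr //; apply: le_trans (hC _); rewrite natr_sum mulr_suml le_eqVlt; apply/orP; left.
apply/eqP/eq_big_seq => P /psP[aP _]; have [-> _] := dgP SA aP.
by rewrite natrX lnXn // mulr_natl.
Qed.

End FibreList.

(** * Descent of the counts to the field K *)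

Section IntermediateCount.
Variables (R : realType) (F : finFieldType).
Local Notation F0 := {fraction {poly F}}.
Local Notation q := #|F|.
Variables (S : sized R F0) (Y : finext S F0) (E : splittingFieldType F0) (X : finext S E).
Variables (r : nat) (ks : seq E).
Hypotheses (SA : sA S = @fpoly F) (Sabs : sabs S = @fabs R F) (idj : forall a, fj Y a = a).
Hypotheses (jE : forall a, fj X a = a%:A) (r0 : (0 < r)%N) (uks : uniq ks) (sks : size ks = (q ^ r)%N).
Hypothesis ksP : forall u, u \in ks <-> u ^+ (q ^ r) = u.
Hypothesis ksr : forall s : gal_of {:E}, (forall u, u \in ks -> s u = u ^+ q) -> (s ^+ r = 1)%g.
Variables (K : fieldType) (XK : finext S K) (iota : {rmorphism K -> E}).
Hypothesis iotaj : forall a, iota (fj XK a) = fj X a.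
Local Notation H := ('Gal({:E} / 1%AS))%g.
Local Notation w n := (q ^ uphalf n)%N.
Local Notation dgp P := (@dg F _ P).

Let q1 : (1 < q)%N := finNzRing_gt1 F.
Let q0 : (0 < q)%N := ltnW q1.

Lemma image_subfield : exists U : {subfield E}, forall x, x \in U <-> exists a, x = iota a.
Proof.
pose b := [tuple iota (fw XK i) | i < fd XK]; pose V := <<b>>%VS.
have VP x : x \in V <-> exists a, x = iota a.
  split=> [/coord_span ->|[a ->]].
  exists (\sum_i fj XK (coord b i x) * fw XK i); rewrite rmorph_sum; apply: eq_bigr => i _.
  by rewrite rmorphM iotaj jE mulr_algl -tnth_nth tnth_mktuple.
  rewrite (fcoK XK a) rmorph_sum; apply: rpred_sum => i _.
  rewrite rmorphM iotaj jE mulr_algl; apply: rpredZ; apply: memv_span.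
  by rewrite -(tnth_mktuple (fun i => iota (fw XK i))); apply: mem_tnth.
have Va : is_aspace V.
  apply/andP; split; first by apply: has_algid1; apply/VP; exists 1; rewrite rmorph1.
  by apply/prodvP => u v /VP[a ->] /VP[c ->]; apply/VP; exists (a * c); rewrite rmorphM.
by exists (ASpace Va).
Qed.

Variable U : {subfield E}.
Hypothesis iotaU : forall x, x \in U <-> exists a, x = iota a.
Local Notation HU := ('Gal({:E} / U))%g.
Local Notation Tn := (Tn X).
Definition Zn n := HU :&: Hn ks n.
Lemma HU_sub s : s \in HU -> s \in H.
Proof. by move: s; apply/fintype.subsetP; apply: galS; apply: sub1v. Qed.

(** The fibre over each P has total degree n times the order of HU, and each Q in it is a point of
    some element of Z, to which [upper_count] applies. *)
Lemma class_upper : exists C : nat, forall n (Z : {set gal_of {:E}}) (t : seq (set K)), (0 < n)%N -> uniq t ->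
  (forall P, P \in t -> above XK P /\ prime_norm P = (q ^ n)%N) ->
  (forall P Q, P \in t -> above X Q -> contr iota Q = P -> tame U Q) ->
  (forall P Q (s : gal_of {:E}), P \in t -> above X Q -> contr iota Q = P -> s \in HU -> Tn n s Q -> s \in Z) ->
  (n * #|HU| * size t <= #|Zn n :&: Z| * (r * q ^ n) + C * w n)%N.
Proof.
have [C1 up] := upper_count SA Sabs idj jE r0 uks sks ksP ksr.
exists (#|HU| * C1)%N => n Z t n0 ut ht tm hZ.
have [al [ual mal _ sal]] := fibre_list SA iotaj iotaU ut (fun P Pt => (ht P Pt).1).
have {}sal : (\sum_(Q <- al) dgp Q = n * #|HU| * size t)%N.
  rewrite sal => [|Q /mal[aQ ct]]; last exact: tm ct aQ erefl.
  rewrite big_seq (eq_bigr (fun=> n)) => [|P /ht[_ NP]]; last by rewrite /dg NP; apply: trunc_expnK.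
  by rewrite -big_seq big_const_seq count_predT iter_addn_0 mulnAC.
pose u s := [seq Q <- al | `[< Tn n s Q >]].
have le1 : (\sum_(Q <- al) dgp Q <= \sum_(s in Zn n :&: Z) \sum_(Q <- u s) dgp Q)%N.
  rewrite [leqRHS](eq_bigr (fun s => \sum_(Q <- al) (if `[< Tn n s Q >] then dgp Q else 0))%N); last first.
  by move=> s _; rewrite big_filter big_mkcond.
  rewrite exchange_big /= big_seq [leqRHS]big_seq; apply: leq_sum => Q /mal[aQ ct].
  have [s sH [mQ hs]] := frobenius_ex iotaj iotaU aQ.
  have TQ : Tn n s Q.
  split=> // x Ox; apply: subgC; first exact: (max_sub aQ.1).
  by have [_ <-] := ht _ ct; apply: hs; apply: (aboveO aQ).
  rewrite (bigD1 s) /=; first by rewrite asboolT // leq_addr.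
  rewrite inE; apply/andP; split; last exact: (hZ (contr iota Q) Q s ct aQ erefl sH TQ).
  by rewrite inE sH; exact: (Tn_Hn r0 uks sks ksP (HU_sub sH) TQ).
rewrite -sal; apply: leq_trans le1 _.
apply: (@leq_trans (\sum_(s in Zn n :&: Z) (r * q ^ n + C1 * w n))%N).
  apply: leq_sum => s; rewrite !inE => /andP[/andP[sH _] _]; apply: (up n s) => //.
  - exact: HU_sub.
  - exact: filter_uniq.
  by move=> Q; rewrite mem_filter => /andP[/asboolP].
rewrite sum_nat_const mulnDr leq_add2l mulnA leq_mul2r leq_mul2r; apply/orP; right.
by apply/orP; right; apply: subset_leq_card; apply/fintype.subsetP => s; rewrite !inE => /andP[/andP[]].
Qed.

(** s fixes the residues coming from U, so the q^n-th power map does too. *)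
Lemma Tn_degree n s Q : s \in HU -> Tn n s Q -> (dgp (contr iota Q) %| n)%N.
Proof.
move=> sH [aQ hQ]; have ap := contr_above iotaj aQ; have hp := ap.1.
have [hi _] := norm_above ap; have [k [c [hc ck]]] := residue_ex hp hi.
have [Np dp] := dgP SA ap.
apply: (@frob_dvd k q) => //; first by rewrite ck.
move=> z; have [x px <-] := res_surj hc z; have [y Oy /(vge1 hp) xy] := approx 1 ap px.
have py := aboveO ap Oy.
have -> : c x = c y by apply/(res_eq hp hc).
rewrite -(resX hp hc) //; apply/(res_eq hp hc) => //; first exact: primeX.
apply/contr_max; rewrite rmorphB rmorphXn -{2}(gal_fix iotaU y sH); apply: hQ.
exact: (OK_OE iotaj Oy).
Qed.

(** The points provided by [lower_count] for the various s in [Zn n] are disjoint away from ramified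
    primes. Those above primes of degree other than n have degree at most n / 2 below, since it
    divides n, and are absorbed by the error term. *)
Lemma total_lower : exists C : nat, forall n, (0 < n)%N -> exists t : seq (set K),
  [/\ uniq t, forall P, P \in t -> above XK P /\ prime_norm P = (q ^ n)%N
  & (#|Zn n| * (r * q ^ n) <= n * #|HU| * size t + C * w n)%N].
Proof.
have [C1 low] := lower_count SA Sabs idj jE r0 uks sks ksP ksr.
have [B hB] := sum_degree XK SA Sabs; have [bad hbad] := tame_almost iotaj iotaU.
pose D := (\sum_(Q <- bad) dgp Q)%N; pose cheb := cheb_poly XK SA Sabs.
exists (#|HU| * (C1 + B * #|HU| + D))%N => n n0.
pose t := [seq P <- ps cheb (q ^ n) | prime_norm P == (q ^ n)%N].
have ut : uniq t by apply: filter_uniq; apply: ps_uniq.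
have ht P : P \in t <-> above XK P /\ prime_norm P = (q ^ n)%N.
  rewrite mem_filter; split=> [/andP[/eqP NP /psP[aP _]]//|[aP NP]].
  by rewrite NP eqxx; apply/psP; rewrite NP.
exists t; split=> // [P /ht//|].
have [al [ual mal sal _]] := fibre_list SA iotaj iotaU ut (fun P Pt => ((ht P).1 Pt).1).
have {}sal : (\sum_(Q <- al) dgp Q <= n * #|HU| * size t)%N.
  apply: leq_trans sal _.
  rewrite big_seq (eq_bigr (fun=> n)) => [|P /ht[_ NP]]; last by rewrite /dg NP; apply: trunc_expnK.
  by rewrite -big_seq big_const_seq count_predT iter_addn_0 mulnAC.
have [sm [usm msm ssm _]] := fibre_list SA iotaj iotaU (ps_uniq cheb (q ^ n./2)) (fun P Pt => ((psP cheb P _).1 Pt).1).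
have Hu s : exists u : seq (set E), s \in Zn n -> [/\ uniq u, forall Q, Q \in u -> Tn n s Q
  & (r * q ^ n <= \sum_(Q <- u) dgp Q + C1 * w n)%N].
  have [|_] := boolP (s \in Zn n); last by exists [::].
  by rewrite inE => /andP[_ sn]; have [u hu] := low n s n0 sn; exists u.
have [u uP] := choice Hu.
pose good s Q := (Q \in u s) && (Q \in al) && (Q \notin bad).
have split s : s \in Zn n -> (\sum_(Q <- u s) dgp Q <=
  \sum_(Q <- al) (if good s Q then dgp Q else 0) + \sum_(Q <- sm) dgp Q + D)%N.
  move=> sZ; have [us hus _] := uP s sZ; have sH : s \in HU by move: sZ; rewrite inE => /andP[].
  have subs (l1 l2 : seq (set E)) : uniq l1 -> {subset l1 <= l2} -> (\sum_(Q <- l1) dgp Q <= \sum_(Q <- l2) dgp Q)%N.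
  move=> ul sub; apply: (@leq_trans (\sum_(Q <- undup l2) dgp Q)%N).
  rewrite -(ler_nat R) !natr_sum; apply: sum_subset; rewrite ?undup_uniq // => Q.
  by move/sub; rewrite mem_undup.
  elim: (l2) => //= a l IH; case: ifP => _; rewrite !big_cons ?leq_add2l //.
  exact: leq_trans IH (leq_addl _ _).
  rewrite (bigID (fun Q => Q \in bad)) /= addnC; apply: leq_add; last first.
  by rewrite -big_filter; apply: subs; [exact: filter_uniq | move=> Q; rewrite mem_filter => /andP[]].
  rewrite (bigID (fun Q => Q \in al)) /=; apply: leq_add.
  rewrite -big_mkcond -big_filter -[leqRHS]big_filter; apply: subs; first exact: filter_uniq.
  by move=> Q; rewrite !mem_filter /good; move=> /andP[/andP[nb ia] iu]; rewrite iu ia nb.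
  rewrite -big_filter; apply: subs; first exact: filter_uniq.
  move=> Q; rewrite mem_filter => /andP[/andP[_ nal] Qu]; apply/msm.
  have TQ := hus Q Qu; have aQ := TQ.1; split=> //; have ap := contr_above iotaj aQ; apply/psP; split=> //.
  have dn := Tn_degree sH TQ; have [Np dp] := dgP SA ap; rewrite Np leq_exp2l //.
  have /dvdnP[m nE] := dn; case: m nE => [|[|m]] nE; [by rewrite nE in n0 | | ].
  case/negP: nal; apply/mal; split=> //; apply/ht; split=> //; by rewrite Np nE mul1n.
  by rewrite -(doubleK (dgp _)) half_leq // [X in (_ <= X)%N]nE -mul2n leq_mul2r orbT.
have dis : (\sum_(s in Zn n) \sum_(Q <- al) (if good s Q then dgp Q else 0) <= \sum_(Q <- al) dgp Q)%N.
  rewrite exchange_big /= big_seq [leqRHS]big_seq; apply: leq_sum => Q Qal.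
  have [/existsP[s /andP[sZ gs]]|/existsPn no] := boolP [exists s, (s \in Zn n) && good s Q].
  rewrite (bigD1 s) //= gs big1 ?addn0 // => s' /andP[sZ' ne]; case: ifP => // gs'.
  case/negP: ne; apply/eqP; move: gs gs'; rewrite /good => /andP[/andP[Qu _] nb] /andP[/andP[Qu' _] _].
  have [_ hu _] := uP s sZ; have [_ hu' _] := uP s' sZ'.
  move: sZ sZ'; rewrite !inE => /andP[sH _] /andP[sH' _].
  have [aQ h1] := hu Q Qu; have [_ h2] := hu' Q Qu'; have sm' := max_sub aQ.1.
  have tm : tame U Q by apply: contrapT => nt; case/negP: nb; apply: hbad.
  by apply: (frob_uniq iotaj iotaU aQ tm sH' sH) => x Ox; apply: subgC => //; [exact: h2 | exact: h1].
  by rewrite big1 // => s sZ; case: ifP => // gs; have := no s; rewrite sZ gs.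
have bsm : (\sum_(Q <- sm) dgp Q <= B * #|HU| * w n)%N.
  apply: leq_trans ssm _; rewrite mulnAC leq_mul2r; apply/orP; right; apply: leq_trans (hB _) _.
  by rewrite leq_mul2l half_w ?orbT.
have wn0 : (0 < w n)%N by rewrite expn_gt0 q0.
apply: (@leq_trans (\sum_(s in Zn n) (\sum_(Q <- al) (if good s Q then dgp Q else 0) +
  (C1 + B * #|HU| + D) * w n))%N).
  rewrite -sum_nat_const; apply: leq_sum => s sZ; have [_ _ le] := uP s sZ.
  by apply: leq_trans le _; have := split s sZ; move: bsm wn0; clear; move: (\sum_(_ <- al) _)%N => a; nia.
rewrite big_split /= sum_nat_const; apply: leq_add; first exact: leq_trans dis sal.
rewrite mulnA leq_mul2r leq_mul2r; apply/orP; right; apply/orP; right.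
by apply: subset_leq_card; apply/fintype.subsetP => s; rewrite inE => /andP[].
Qed.

End IntermediateCount.

(** * Distribution of conjugacy classes on cosets of a subgroup *)

Section CosetCount.
Variables (gT rT : finGroupType) (H : {group gT}) (G : {group rT}) (rho : gT -> rT) (Z : nat -> {set gT}).
Hypotheses (rhoG : {in H, forall s, rho s \in G}) (rhoM : {in H &, {morph rho : s t / (s * t)%g}}).
Hypotheses (ZH : forall n, Z n \subset H) (Z1 : (1%g : gT) \in Z 0%N).
Hypotheses (ZV : forall n s t, s \in Z n -> t \in Z n -> (s^-1 * t)%g \in Z 0%N).
Hypotheses (ZM : forall n s t, s \in Z n -> t \in Z 0%N -> (s * t)%g \in Z n).
Local Notation N n s := #|[set t in Z n | rho t \in (s ^: G)%g]%SET|.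
Let inH n t : t \in Z n -> t \in H. Proof. by move: t; apply/fintype.subsetP/ZH. Qed.
Let rho1 : rho 1%g = 1%g.
Proof. by apply: (mulgI (rho 1%g)); rewrite -rhoM // !mulg1. Qed.
Let rhoV t : t \in H -> rho t^-1%g = (rho t)^-1%g.
Proof. by move=> tH; apply: (mulgI (rho t)); rewrite -rhoM ?groupV // !mulgV rho1. Qed.

Lemma count_inv s : s \in G -> N 0%N s^-1%g = N 0%N s.
Proof.
move=> sG; have V t : t \in Z 0%N -> t^-1%g \in Z 0%N by move=> tZ; rewrite -[t^-1%g]mulg1; exact: (ZV tZ Z1).
have sub : invg @: [set t in Z 0%N | rho t \in (s ^: G)%g]%SET = [set t in Z 0%N | rho t \in (s^-1 ^: G)%g]%SET.
  apply/finset.setP => t; apply/imsetP/idP => [[u] |]; rewrite !inE => /andP[tZ tc].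
  move=> ->; rewrite V //= rhoV ?(inH tZ) //; case/imsetP: tc => g gG ->.
  by rewrite -conjVg imset_f.
  exists t^-1%g; last by rewrite invgK.
  rewrite inE V //= rhoV ?(inH tZ) //; case/imsetP: tc => g gG ->.
  by rewrite -conjVg invgK imset_f.
by rewrite -sub card_imset //; apply: invg_inj.
Qed.

(* The hypothesis is summed over all s, weighted by the inverse class sizes; the total being
  |Z 0|, all inequalities are equalities. *)
Lemma kernel_card : (forall s, s \in G -> #|(s ^: G)%g| * #|Z 0%N| <= N 0%N s * #|G|)%N ->
  (#|[set t in Z 0%N | rho t == 1%g]%SET| * #|G| <= #|Z 0%N|)%N.
Proof.
move=> hyp; have G0 : 0 < #|G|%:R :> rat by rewrite ltr0n cardG_gt0.
have c0 s : 0 < #|(s ^: G)%g|%:R :> rat by rewrite ltr0n; apply/card_gt0P; exists s; apply: class_refl.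
pose g s : rat := (N 0%N s)%:R / #|(s ^: G)%g|%:R - #|Z 0%N|%:R / #|G|%:R.
have g0 s : s \in G -> 0 <= g s.
  by move=> sG; rewrite subr_ge0 ler_pdivrMr // mulrAC ler_pdivlMr // -!natrM ler_nat mulnC hyp.
have sg : \sum_(s in G) g s = 0.
  rewrite sumrB sumr_const -[X in _ - X]mulr_natr mulfVK ?gt_eqF //; apply/eqP; rewrite subr_eq0; apply/eqP.
  transitivity (\sum_(s in G) \sum_(t in Z 0%N) (if rho t \in (s ^: G)%g then #|(rho t ^: G)%g|%:R^-1 else 0 : rat)).
  apply: eq_bigr => s _; rewrite -big_mkcondr -sum1_card natr_sum mulr_suml.
  apply: eq_big => [t|t]; rewrite ?inE // => /andP[_ tc]; rewrite mul1r; congr (_%:R^-1).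
  by move/class_eqP: tc => ->.
  rewrite exchange_big /= -sum1_card natr_sum; apply: eq_bigr => t tZ.
  rewrite -big_mkcondr sumr_const -[LHS]mulr_natr.
  rewrite (_ : #|_| = #|(rho t ^: G)%g|) ?mulVf ?gt_eqF //.
  apply: eq_card => s; rewrite unfold_in /= class_sym andb_idl //.
  by case/imsetP => h hG ->; rewrite groupJ ?(rhoG (inH tZ)).
have := g0 1%g (group1 G); rewrite -(ler_nat rat) natrM => h1.
have : g 1%g <= 0.
  rewrite -sg (bigD1 1%g) //= lerDl; apply: sumr_ge0 => s /andP[sG _]; exact: g0.
rewrite /g subr_le0 class1G cards1 divr1 ler_pdivlMr //.
have -> : #|[set t in Z 0%N | rho t \in (1%g : {set rT})]%SET| = #|[set t in Z 0%N | rho t == 1%g]%SET|.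
  by apply: eq_card => t; rewrite !inE.
by [].
Qed.

(** On any nonempty Z n the fibres of rho are no larger than its kernel on Z 0, which [kernel_card]
    bounds by |Z 0| / |G|; and Z n has at least |Z 0| elements. *)
Lemma coset_count : (forall s, s \in G -> #|(s ^: G)%g| * #|Z 0%N| <= N 0%N s * #|G|)%N ->
  forall n s, (N n s * #|G| <= #|(s ^: G)%g| * #|Z n|)%N.
Proof.
move=> /kernel_card ker n s; set k := #|_| in ker.
have [[t0 t0Z]|no] := pselect (exists t, t \in Z n); last first.
  rewrite (_ : N n s = 0%N) //; apply: eq_card0 => t; rewrite inE; apply/negP => /andP[h _].
  by apply: no; exists t.
have le : (#|Z 0%N| <= #|Z n|)%N.
  rewrite -(card_imset _ (mulgI t0)); apply: subset_leq_card.
  by apply/fintype.subsetP => _ /imsetP[t tZ ->]; apply: ZM.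
have f1 g : (#|[set t in Z n | rho t == g]%SET| <= k)%N.
  have [->|[t1]] := set_0Vmem [set t in Z n | rho t == g]%SET; first by rewrite cards0.
  rewrite inE => /andP[t1Z /eqP e1]; rewrite -(card_imset _ (mulgI t1^-1%g)); apply: subset_leq_card.
  apply/fintype.subsetP => _ /imsetP[t tS ->]; move: tS; rewrite !inE => /andP[tZ /eqP e].
  by rewrite (ZV t1Z) //= rhoM ?groupV ?(inH tZ) ?(inH t1Z) // rhoV ?(inH t1Z) // e e1 mulVg.
have f2 : (N n s <= #|(s ^: G)%g| * k)%N.
  rewrite -sum_nat_const -sum1_card (eq_bigl (fun t => (t \in Z n) && (rho t \in (s ^: G)%g))); last first.
  by move=> t; rewrite inE.
  rewrite (partition_big rho (mem (s ^: G)%g)) => [|t /andP[]//]; apply: leq_sum => g gs.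
  apply: leq_trans (f1 g); rewrite sum1_card; apply: subset_leq_card.
  by apply/fintype.subsetP => t; rewrite !inE /in_mem /= => /andP[/andP[-> _] ->].
apply: leq_trans (leq_mul f2 (leqnn _)) _; rewrite -mulnA leq_mul2l; apply/orP; right; exact: leq_trans le.
Qed.

End CosetCount.

(** * Frobenius elements at unramified primes *)

Section FrobeniusAt.
Variables (K : fieldType) (L : splittingFieldType K).
Local Notation G := ('Gal({:L} / 1%AS))%g.

(** An unramified Q is recorded together with g, so that [frob_uniq] makes g the only candidate at
    Q. *)
Definition frob_at (P : set K) (g : gal_of {:L}) : Prop := g \in G /\ exists Q : set L,
  [/\ is_prime Q, forall a, Q a%:A <-> P a, tame 1%AS Q
  & forall x, Q x -> max_ideal Q (ac g x - x ^+ prime_norm P)].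

Lemma mem1P (x : L) : x \in 1%AS <-> exists a : K, x = in_alg L a.
Proof. by split=> [/vlineP|] [a ->]; [exists a | apply/vlineP; exists a]. Qed.

Variables (R : realType) (F : fieldType) (S : sized R F) (XK : finext S K) (XL : finext S L).
Hypothesis XLE : forall a, fj XL a = (fj XK a)%:A.

(** The primes above P are conjugate, and conjugating h to the unramified Q0 leaves no choice but
    g. *)
Lemma frob_at_conj P g Q h : above XK P -> frob_at P g -> above XL Q -> contr (in_alg L) Q = P ->
  h \in G -> (forall x, oint XL x -> max_ideal Q (x ^+ prime_norm P - ac h x)) -> h \in (g ^: G)%g.
Proof.
move=> aP [gG [Q0 [hQ0 Q0P tQ0 hg]]] aQ cQ hG hh.
have ej a : in_alg L (fj XK a) = fj XL a by rewrite XLE.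
have aQ0 : above XL Q0 by split=> // a Aa; rewrite XLE; apply/Q0P; exact: aP.2.
have cQ0 : contr (in_alg L) Q0 = P by apply/seteqP; split=> a /= h1; apply/Q0P.
have [s sG Qs] := gal_trans ej mem1P aQ aQ0 (etrans cQ (esym cQ0)).
have -> : h = (g ^ s)%g; last by apply: imset_f.
rewrite -{1}(conjgKV s h); congr (_ ^ _)%g; apply/esym.
have sVG : s^-1%g \in G by rewrite groupV.
apply: (frob_uniq ej mem1P aQ0 tQ0 gG _ (n := prime_norm P)); first by rewrite groupJ.
  by move=> x Ox; apply: hg; apply: (aboveO aQ0).
move=> x Ox; rewrite Qs; apply/moved_max; rewrite rmorphB rmorphXn -!acM conjgE invgK -!mulgA mulVg mulg1.
have Oy := gal_oint ej mem1P sG Ox.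
by rewrite [in X in X - _]acM; apply: subgC; [exact: (max_sub aQ.1) | exact: hh].
Qed.

End FrobeniusAt.

(** * The counting package for function fields *)

Section FunctionFieldCount.
Variables (R : realType) (F : finFieldType).
Local Notation F0 := {fraction {poly F}}.
Local Notation q := #|F|.
Variables (S : sized R F0) (K : fieldType) (XK : finext S K) (L : splittingFieldType K).
Hypotheses (SA : sA S = @fpoly F) (Sabs : sabs S = @fabs R F).
Variables (fr : set K -> gal_of {:L}) (bl0 : seq (set K)).
Hypothesis frP : forall P, is_prime P -> P \notin bl0 -> frob_at P (fr P).
Local Notation G := ('Gal({:L} / 1%AS))%g.
Local Notation w n := (q ^ uphalf n)%N.

(** Here [Zc n] is the order of [Zn n] and [N n s] counts its elements whose restriction to L is
    conjugate to s. At multiples of r both take their values at 0, where s and its inverse have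
    equal counts; the last clause is [coset_count]. *)
Lemma function_field_count : exists (hu r C : nat) (N : nat -> gal_of {:L} -> nat) (Zc : nat -> nat)
  (bl : seq (set K)), [/\ (0 < hu)%N && (0 < r)%N,
  forall P, is_prime P -> P \notin bl -> exists2 n, (0 < n)%N & prime_norm P = (q ^ n)%N,
  forall n s (t : seq (set K)), (0 < n)%N -> uniq t ->
  (forall P, P \in t -> [/\ is_prime P, prime_norm P = (q ^ n)%N, P \notin bl & fr P \in (s ^: G)%g]) ->
  (n * hu * size t <= N n s * (r * q ^ n) + C * w n)%N,
  forall n, (0 < n)%N -> exists t : seq (set K), [/\ uniq t,
  forall P, P \in t -> is_prime P /\ prime_norm P = (q ^ n)%N
  & (Zc n * (r * q ^ n) <= n * hu * size t + C * w n)%N]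
  & [/\ forall m s, N (r * m)%N s = N 0%N s, forall m, Zc (r * m)%N = Zc 0%N,
  forall s, s \in G -> N 0%N s^-1%g = N 0%N s
  & (forall s, s \in G -> #|(s ^: G)%g| * Zc 0 <= N 0 s * #|G|)%N ->
  forall n s, (N n s * #|G| <= #|(s ^: G)%g| * Zc n)%N]].
Proof.
have [XL XLE] := finext_tower XK L.
have [E [X [f [r [ks [jE fj_f r0 [uks sks] [ksP ksr]]]]]]] := normal_closure XL.
pose iota : {rmorphism K -> E} := f \o in_alg L.
have iotaj a : iota (fj XK a) = fj X a by rewrite /iota /= -XLE fj_f.
have [Y idj] := finext_id S; have [U iotaU] := image_subfield jE iotaj.
pose HU : {group gal_of {:E}} := ('Gal({:E} / U))%G.
have [C1 up] := class_upper SA Sabs idj jE r0 uks sks ksP ksr iotaj iotaU.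
have [C2 low] := total_lower SA Sabs idj jE r0 uks sks ksP ksr iotaj iotaU.
have Hrho (s : gal_of {:E}) : exists g : gal_of {:L}, s \in HU ->
  g \in G /\ forall x, f (ac g x) = ac s (f x).
  have [sH|_] := boolP (s \in HU); last by exists 1%g.
  have [|g gG hg] := @restrict_gal K E L f (ac s); first by move=> a; exact: (gal_fix iotaU a sH).
  by exists g => _; split=> // x; rewrite hg.
have [rho rhoP] := choice Hrho; have fI : injective f := fmorph_inj f.
have rhoG : {in HU, forall s, rho s \in G} by move=> s /rhoP[].
have rhoM : {in HU &, {morph rho : s t / (s * t)%g}}.
  move=> s t sH tH; apply/eqP/gal_eqP => x _; apply: fI; rewrite -[LHS]/(f (ac (rho (s * t)%g) x)).
  have [_ ->] := rhoP _ (groupM sH tH); rewrite acM.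
  have [_ h1] := rhoP _ sH; have [_ h2] := rhoP _ tH.
  by rewrite -h1 -h2 -acM.
pose Z := @Zn F E ks U.
have ZP n s : s \in Z n <-> s \in HU /\ forall u, u \in ks -> s u = u ^+ (q ^ n).
  rewrite /Z /Zn inE; split=> [/andP[sH /HnP[_]]//|[sH h]]; apply/andP; split=> //.
  by apply/HnP; split=> //; exact: (HU_sub sH).
have ksM (s : gal_of {:E}) u : u \in ks -> s u \in ks.
  by move/ksP => h; apply/ksP; rewrite -{2}h; apply/esym; exact: (rmorphXn (ac s)).
have ZH n : Z n \subset HU by apply/fintype.subsetP => s /ZP[].
have Z1 : (1%g : gal_of {:E}) \in Z 0%N by apply/ZP; split=> [|u _]; rewrite ?group1 // gal_id expr1.
have ZV n s t : s \in Z n -> t \in Z n -> (s^-1 * t)%g \in Z 0%N.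
  move=> /ZP[sH hs] /ZP[tH ht]; apply/ZP; split=> [|u uk]; first by rewrite groupM ?groupV.
  rewrite galM ?memvf // expr1 ht ?ksM // -hs ?ksM //.
  by rewrite -galM ?memvf // mulVg gal_id.
have ZM n s t : s \in Z n -> t \in Z 0%N -> (s * t)%g \in Z n.
  move=> /ZP[sH hs] /ZP[tH ht]; apply/ZP; split=> [|u uk]; first by rewrite groupM.
  by rewrite galM ?memvf // ht ?ksM // expr1 hs.
have Zr m : Z (r * m)%N = Z 0%N.
  have e u : u \in ks -> u ^+ (q ^ (r * m)) = u ^+ (q ^ 0).
  move/ksP => h; rewrite expr1; elim: m => [|m IH]; first by rewrite muln0 expr1.
  by rewrite mulnS expnD exprM h.
  by apply/finset.setP => s; apply/idP/idP => /ZP[sH h]; apply/ZP; split=> // u uk; rewrite h // e.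
pose N n s := #|[set t in Z n | rho t \in (s ^: G)%g]%SET|.
have [blT hT] := tame_almost iotaj iotaU; have [bln hn] := finite_nonabove XK SA.
exists #|HU|, r, (C1 + C2)%N, N, (fun n => #|Z n|), (bl0 ++ bln ++ [seq contr iota Q | Q <- blT]).
split; first by rewrite cardG_gt0.
- move=> P hP; rewrite !mem_cat !negb_or => /and3P[_ nb _].
  have aP : above XK P by apply: contrapT => na; case/negP: nb; apply: hn.
  by have [e e0 NP] := norm_power SA aP; exists e.
- move=> n s t n0 ut ht; have nb P : P \in t -> P \notin bl0 /\ above XK P.
  move=> Pt; have [hP _] := ht P Pt; rewrite !mem_cat !negb_or => /and3P[b0 b1 _] _; split=> //.
  by apply: contrapT => na; case/negP: b1; apply: hn.
  have := up n [set g | rho g \in (s ^: G)%g]%SET t n0 ut.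
  rewrite -setIdE.
  move=> h; apply: leq_trans (h _ _ _) _; last by rewrite leq_add2l leq_mul2r leq_addr orbT.
  + by move=> P Pt; have [_ aP] := nb P Pt; have [_ NP _ _] := ht P Pt.
  + move=> P Q Pt aQ cQ; apply: contrapT => nt; have [_ _] := ht P Pt; rewrite !mem_cat !negb_or.
  by move=> /and3P[_ _ nbT] _; case/negP: nbT; apply/mapP; exists Q => //; apply: hT.
  move=> P Q g Pt aQ cQ gH [_ Tg]; rewrite inE; have [b0 aP] := nb P Pt.
  have [hP NP _ fc] := ht P Pt; have aQL := contr_above fj_f aQ.
  have [gG hg] := rhoP g gH.
  move/class_eqP: fc => <-.
  apply: (@frob_at_conj K L R F0 S XK XL XLE P (fr P) (contr f Q)) => // [|x Ox]; first exact: frP.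
  apply/contr_max; rewrite rmorphB rmorphXn NP hg; apply: Tg; exact: (OK_OE fj_f Ox).
- move=> n n0; have [t [ut ht le]] := low n n0; exists t; split=> // [P /ht[[]]//|].
  by apply: leq_trans le _; rewrite leq_add2l leq_mul2r leq_addl orbT.
split=> [m s|m|s sG|].
- by rewrite /N Zr.
- by rewrite Zr.
- exact: (@count_inv _ _ HU _ rho Z rhoM ZH Z1 ZV).
exact: (@coset_count _ _ HU ('Gal({:L} / 1%AS))%G rho Z rhoG rhoM ZH ZV ZM).
Qed.

End FunctionFieldCount.

Lemma square_lt_pow2 D n : (16 * D + 16 <= n)%N -> ((n * D) ^ 2 < 2 ^ n)%N.
Proof.
move=> h; pose k := (n %/ 4)%N; have nk : (n < 4 * k.+1)%N by rewrite /k mulnC ltn_ceil.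
have kn : (4 * k <= n)%N by rewrite /k mulnC leq_trunc_div.
have k2 : (k.+1 <= 2 ^ k)%N by apply: ltn_expl.
apply: (@leq_trans ((2 ^ k) ^ 4)); last by rewrite -expnM mulnC leq_exp2l.
apply: (@leq_trans (k.+1 ^ 4)); last by rewrite leq_exp2r.
rewrite -[4%N]/(2 * 2)%N expnM ltn_exp2r //.
move: h nk; clear; rewrite expnS expn1; move: k.+1 => j; nia.
Qed.

Lemma jump_bound (R : realType) (k a p d : R) : 0 <= k <= 1 -> 0 <= a -> a <= p -> p <= d -> `|a - k * p| <= d.
Proof.
move=> /andP[k0 k1] a0 ap pd; have p0 : 0 <= p by exact: le_trans ap.
have h0 : 0 <= k * p by apply: mulr_ge0.
have h1 : k * p <= p by rewrite ler_piMl.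
by rewrite ler_norml; apply/andP; split; lra.
Qed.

(** Combines Stepanov's bound for one class, the coset inequality and the lower bound for the total
    number p of primes of degree n; B allows for exceptional primes. *)
Lemma upper_ineq (n hu at_ a B Ns r N C w g c Zc p p' : nat) :
  (n * hu * at_ <= Ns * (r * N) + C * w)%N -> (a <= at_ + B)%N -> (Ns * g <= c * Zc)%N ->
  (Zc * (r * N) <= n * hu * p' + C * w)%N -> (p' <= p)%N ->
  (n * hu * g * a <= n * hu * c * p + (c + g) * C * w + n * hu * g * B)%N.
Proof.
move=> h1 h2 h3 h4 h5.
have e1 : (n * hu * g * a <= g * (n * hu * at_) + n * hu * g * B)%N.
  by apply: leq_trans (leq_mul (leqnn _) h2) _; rewrite mulnDr mulnCA mulnA.
have e2 : (g * (n * hu * at_) <= g * (Ns * (r * N) + C * w))%N by rewrite leq_mul2l h1 orbT.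
have e3 : (Ns * g * (r * N) <= c * Zc * (r * N))%N by rewrite leq_mul2r h3 orbT.
have e4 : (c * (Zc * (r * N)) <= c * (n * hu * p + C * w))%N.
  by rewrite leq_mul2l (leq_trans h4) ?orbT // leq_add2r leq_mul2l h5 orbT.
move: e1 e2 e3 e4; clear; nia.
Qed.

Lemma upper_real (R : realType) (n hu a B C w g c p q : nat) (x e : R) : (0 < n)%N -> (0 < hu)%N -> (0 < g)%N ->
  (n * hu * g * a <= n * hu * c * p + (c + g) * C * w + n * hu * g * B)%N -> 0 <= x -> 0 <= e ->
  w%:R <= q%:R * x -> B%:R <= e / 2 * x -> ((c + g) * C * q)%:R <= e / 2 * n%:R ->
  a%:R <= c%:R / g%:R * p%:R + e * x.
Proof.
move=> n0 h0 g0; rewrite -(ler_nat R) !natrM !natrD !natrM.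
rewrite -(ltr_nat R) in n0; rewrite -(ler_nat R) in h0; rewrite -(ler_nat R) in g0.
have C0 : 0 <= C%:R :> R by []; have c0 : 0 <= c%:R :> R by [].
move: n0 h0 g0 C0 c0; rewrite natrD.
move: (n%:R : R) (hu%:R : R) (g%:R : R) (a%:R : R) (c%:R : R) (p%:R : R) (C%:R : R) (w%:R : R) (B%:R : R) (q%:R : R).
move=> {}n {}hu {}g {}a {}c {}p {}C {}w {}B {}q n0 h0 g0 C0 c0 H x0 e0 wq Bx Cq.
have g00 : 0 < g by lra.
rewrite mulrAC -lerBlDr -(ler_pM2r g00) mulfVK ?gt_eqF //.
have nh : 0 < n * hu by rewrite mulr_gt0 //; lra.
rewrite -(ler_pM2l nh).
have h1 : (c + g) * C * w <= n * (e / 2) * x.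
  apply: (@le_trans _ _ ((c + g) * C * (q * x))).
  by apply: ler_wpM2l wq; rewrite mulr_ge0 // addr_ge0 // ltW.
  by rewrite mulrA; apply: ler_wpM2r => //; rewrite [n * _]mulrC.
have hg : 1 <= hu * g by rewrite -[1]mulr1 ler_pM.
have h2 : n * (e / 2) * x <= (n * hu * g) * (e / 2) * x.
  apply: ler_wpM2r => //; apply: ler_wpM2r; first by rewrite divr_ge0.
  by rewrite -mulrA ler_peMr // ltW.
have h3 : n * hu * g * B <= n * hu * g * (e / 2 * x) by apply: ler_wpM2l Bx; rewrite mulr_ge0 // ltW.
move: H h1 h2 h3; clear; lra.
Qed.

(** Used for a contradiction: if the coset inequality failed by at least 1, then x = sqrt(q^n) would
    grow at most linearly in n. *)
Lemma lower_ineq (R : realType) (n hu r N C w g c Z p M B q x a1 a2 : R) :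
  1 <= n -> 1 <= r -> 0 < g -> 0 <= C -> 0 <= c -> 0 <= hu -> 0 <= q -> 0 <= B ->
  x ^+ 2 = N -> 1 <= x -> w <= q * x ->
  n * hu * a1 <= M * (r * N) + C * w + n * hu * B -> n * hu * a2 <= M * (r * N) + C * w + n * hu * B ->
  Z * (r * N) <= n * hu * p + C * w -> 2 * (c / g) * p - x <= a1 + a2 ->
  M * g + 1 <= c * Z -> x <= n * ((2 * g + 2 * c) * C * q + g * hu * (2 * B + 1)).
Proof.
move=> n1 r1 g0 C0 c0 h0 q0 B0 xN x1 wq h1 h2 h3 h4 h5.
have g2 : 2 * c * p - g * x <= g * (a1 + a2).
  have e : g * (2 * (c / g) * p - x) = 2 * c * p - g * x by field; rewrite gt_eqF.
  by rewrite -e ler_pM2l.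
have nh : 0 <= n * hu by rewrite mulr_ge0 //; lra.
have k1 : n * hu * (2 * c * p - g * x) <= g * (2 * (M * (r * N) + C * w + n * hu * B)).
  apply: (le_trans (ler_wpM2l nh g2)); rewrite mulrCA ler_pM2l //; lra.
have k2 : c * (Z * (r * N)) <= c * (n * hu * p + C * w) by apply: ler_wpM2l.
have N0 : 0 <= N by rewrite -xN sqr_ge0.
have rN : 0 <= r * N by rewrite mulr_ge0 //; lra.
have k3 : (M * g + 1) * (r * N) <= c * Z * (r * N) by apply: ler_wpM2r.
have k4 : 2 * (r * N) <= (2 * g + 2 * c) * C * w + g * n * hu * (2 * B + x).
  move: k1 k2 k3; clear; lra.
have k5 : (2 * g + 2 * c) * C * w <= n * ((2 * g + 2 * c) * C * q) * x.
  apply: (@le_trans _ _ ((2 * g + 2 * c) * C * (q * x))).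
  by apply: ler_wpM2l wq; rewrite mulr_ge0 //; lra.
  rewrite mulrA ler_wpM2r //; first lra.
  by rewrite ler_peMl // !mulr_ge0 //; lra.
have k6 : g * n * hu * (2 * B + x) <= n * (g * hu * (2 * B + 1)) * x.
  have z0 : 0 <= g * n * hu by rewrite !mulr_ge0 //; lra.
  have : 2 * B + x <= (2 * B + 1) * x by rewrite [leRHS]mulrDl mul1r; apply: lerD => //; rewrite ler_peMr // mulr_ge0.
  by move/(ler_wpM2l z0) => h; apply: le_trans h _; rewrite le_eqVlt; apply/orP; left; apply/eqP; ring.
have k7 : x * x <= 2 * (r * N).
  rewrite -expr2 xN; have : 0 <= (2 * r - 1) * N by rewrite mulr_ge0 //; lra.
  by move=> ?; lra.
have x0 : 0 < x by lra.
rewrite -(ler_pM2r x0); apply: (le_trans k7); apply: (le_trans k4).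
by rewrite [n * (_ + _)]mulrDr [leRHS]mulrDl; apply: lerD.
Qed.

(** * Equidistribution of Frobenius among the primes of one norm *)

Section Jumps.
Variables (R : realType) (K : fieldType) (hK : gbase R K) (L : splittingFieldType K).
Variable fr : set K -> gal_of {:L}.
Local Notation G := ('Gal({:L} / 1%AS))%g.
Hypothesis frP : exists bl : seq (set K), forall P, is_prime P -> P \notin bl -> frob_at P (fr P).

Definition pn (N : nat) := [seq P <- pl hK N | prime_norm P == N].
Definition cnt s (N : nat) := size [seq P <- pn N | fr P \in (s ^: G)%g].
Local Notation kap s := (#|(s ^: G)%g|%:R / #|G|%:R : R).
Local Notation sq N := (Num.sqrt N%:R : R).

Lemma pnP P N : P \in pn N <-> is_prime P /\ prime_norm P = N.
Proof.
rewrite mem_filter; split=> [/andP[/eqP e /plP[h _]]//|[h e]].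
by rewrite e eqxx; apply/plP; rewrite e.
Qed.

Lemma pn_uniq N : uniq (pn N). Proof. exact/filter_uniq/pl_uniq. Qed.
Let gG0 : (0 < #|G|)%N. Proof. exact: cardG_gt0. Qed.

Lemma kap_bound s : s \in G -> 0 <= kap s <= 1.
Proof.
move=> sG; rewrite divr_ge0 //= ler_pdivrMr ?ltr0n // mul1r ler_nat; apply: subset_leq_card.
exact: class_subG.
Qed.

Lemma cnt_le s N : (cnt s N <= size (pn N))%N. Proof. by rewrite /cnt; move: (pn N) => l; rewrite size_filter count_size. Qed.

Lemma small_jump s N D : s \in G -> (size (pn N) <= D)%N -> `|(cnt s N)%:R - kap s * (size (pn N))%:R| <= D%:R :> R.
Proof.
by move=> sG pD; apply: jump_bound; [exact: kap_bound | by [] | rewrite ler_nat cnt_le | rewrite ler_nat].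
Qed.

Lemma sqrt_big (M e : R) : 0 < e -> exists N0 : nat, forall N, (N0 <= N)%N -> M <= e * sq N.
Proof.
move=> e0; exists (Num.bound `|M / e| ^ 2)%N => N h; rewrite mulrC -ler_pdivrMr //.
apply: le_trans (ler_norm _) _; apply: (@le_trans _ _ (Num.bound `|M / e|)%:R); first exact/ltW/archi_boundP.
by rewrite -[leLHS]ger0_norm // -sqrtr_sqr; apply: ler_wsqrtr; rewrite -natrX ler_nat.
Qed.

Lemma cnt_split s N (bl : seq (set K)) :
  (cnt s N <= size [seq P <- [seq P <- pn N | fr P \in (s ^: G)%g] | P \notin bl] + size bl)%N.
Proof.
rewrite /cnt; set l := [seq P <- pn N | _]; rewrite [size (seq.filter _ _)]size_filter.
rewrite -(count_predC (fun P => P \notin bl) l) leq_add2l -size_filter; apply: uniq_leq_size.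
  by do 3!apply: filter_uniq; apply: pl_uniq.
by move=> P; rewrite mem_filter /= => /andP[/negbNE].
Qed.

(** All that the real parts of the logarithms provide: the counts for s and for its inverse are
    controlled only together. *)
Hypothesis pair : forall s, s \in G -> forall e : R, 0 < e -> exists N0 : nat, forall N, (N0 <= N)%N ->
  `|(cnt s N)%:R + (cnt s^-1%g N)%:R - 2 * kap s * (size (pn N))%:R| <= e * sq N.

Lemma class_inv_card s : #|(s^-1 ^: G)%g| = #|(s ^: G)%g|.
Proof. by rewrite classVg card_invg. Qed.

(** At exponents divisible by r the upper bounds for s and its inverse have the same main term, so
    the paired estimate forces the assumption of [coset_count]; its conclusion is then available at
    every exponent. *)
Lemma upper_jump : (exists F, gpoly R F K) -> forall s, s \in G -> forall e : R, 0 < e ->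
  exists N0 : nat, forall N, (N0 <= N)%N -> (cnt s N)%:R <= kap s * (size (pn N))%:R + e * sq N.
Proof.
move=> [F [S [X [SA Sabs]]]] s sG e e0; have [bl0 fr0] := frP; have q1 := finNzRing_gt1 F; set q := #|F| in q1.
have [hu [r [C [Nn [Zc [bl [/andP[hu0 r0] bn up low [Nr Zr Ni co]]]]]]]] := function_field_count X SA Sabs fr0.
set B := size bl.
have upN n s' : (0 < n)%N -> exists2 at_, (n * hu * at_ <= Nn n s' * (r * q ^ n) + C * q ^ uphalf n)%N &
  (cnt s' (q ^ n) <= at_ + B)%N.
  move=> n0; pose t := [seq P <- [seq P <- pn (q ^ n)%N | fr P \in (s' ^: G)%g] | P \notin bl].
  exists (size t); last exact: cnt_split.
  apply: up => // [|P]; first by do 3!apply: filter_uniq; apply: pl_uniq.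
  by rewrite !mem_filter => /and3P[nb fc /andP[/eqP NP /plP[hP _]]].
have lowN n : (0 < n)%N -> exists2 p', (Zc n * (r * q ^ n) <= n * hu * p' + C * q ^ uphalf n)%N &
  (p' <= size (pn (q ^ n)))%N.
  move=> n0; have [t [ut ht le]] := low n n0; exists (size t) => //; apply: uniq_leq_size => // P Pt.
  by apply/pnP; exact: ht.
have wq n : (q ^ uphalf n)%:R <= q%:R * sq (q ^ n)%N.
  rewrite -[leLHS]ger0_norm // -sqrtr_sqr -[X in X * _]ger0_norm // -[X in X * _]sqrtr_sqr -sqrtrM ?sqr_ge0 //.
  apply: ler_wsqrtr; rewrite -!natrX -natrM ler_nat -expnM -expnD leq_exp2l //.
  by rewrite uphalf_half; have := odd_double_half n; case: (odd n); lia.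
have sq1 n : 1 <= sq (q ^ n)%N.
  by rewrite -[leLHS]sqrtr1; apply: ler_wsqrtr; rewrite ler1n expn_gt0 ltnW.
have hyp s' : s' \in G -> (#|(s' ^: G)%g| * Zc 0%N <= Nn 0%N s' * #|G|)%N.
  move=> sG'; rewrite leqNgt; apply/negP => gap; have [N0 hN0] := pair sG' ltr01.
  pose D := ((2 * #|G| + 2 * #|(s' ^: G)%g|) * C * q + #|G| * hu * (2 * B + 1))%N.
  (* A multiple of r, so large that q^n >= N0 and, by [square_lt_pow2], that sqrt(q^n) exceeds n
     D. *)
  pose n := (r * (16 * D + 16 + N0))%N.
  have nD : (16 * D + 16 <= n)%N by rewrite /n; move: r0 => {}; nia.
  have nN : (N0 <= q ^ n)%N by apply: (@leq_trans n); [rewrite /n; nia | exact/ltnW/ltn_expl].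
  have n0 : (0 < n)%N by lia.
  have [a1 h1 l1] := upN n s' n0; have [a2 h2 l2] := upN n s'^-1%g n0.
  have [p' h3 l3] := lowN n n0; move: h1 h2 h3; rewrite !Nr Ni // !Zr => h1 h2 h3.
  have /ler_normlP[h4 _] := hN0 _ nN.
  have h1' : n%:R * hu%:R * (cnt s' (q ^ n))%:R <=
  (Nn 0%N s')%:R * (r%:R * (q ^ n)%:R) + C%:R * (q ^ uphalf n)%:R + n%:R * hu%:R * B%:R :> R.
  rewrite -!natrM -!natrD ler_nat; apply: leq_trans (leq_mul (leqnn _) l1) _.
  by rewrite mulnDr leq_add2r.
  have h2' : n%:R * hu%:R * (cnt s'^-1%g (q ^ n))%:R <=
  (Nn 0%N s')%:R * (r%:R * (q ^ n)%:R) + C%:R * (q ^ uphalf n)%:R + n%:R * hu%:R * B%:R :> R.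
  rewrite -!natrM -!natrD ler_nat; apply: leq_trans (leq_mul (leqnn _) l2) _.
  by rewrite mulnDr leq_add2r.
  have h3' : (Zc 0%N)%:R * (r%:R * (q ^ n)%:R) <= n%:R * hu%:R * (size (pn (q ^ n)))%:R + C%:R * (q ^ uphalf n)%:R :> R.
  rewrite -!natrM -!natrD ler_nat; apply: leq_trans h3 _.
  by rewrite leq_add2r leq_mul2l l3 orbT.
  have h4' : 2 * (#|(s' ^: G)%g|%:R / #|G|%:R) * (size (pn (q ^ n)))%:R - sq (q ^ n)%N <=
  (cnt s' (q ^ n))%:R + (cnt s'^-1%g (q ^ n))%:R.
  by move: h4; rewrite mul1r; clear; lra.
  have h5 : (Nn 0%N s')%:R * #|G|%:R + 1 <= #|(s' ^: G)%g|%:R * (Zc 0%N)%:R :> R.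
  by rewrite -!natrM -(natrD _ _ 1) ler_nat addn1.
  have xN : sq (q ^ n)%N ^+ 2 = (q ^ n)%:R by rewrite sqr_sqrtr.
  have n1 : 1 <= n%:R :> R by rewrite ler1n.
  have r1 : 1 <= r%:R :> R by rewrite ler1n.
  have g0 : 0 < #|G|%:R :> R by rewrite ltr0n.
  have := lower_ineq n1 r1 g0 (ler0n _ C) (ler0n _ _) (ler0n _ hu) (ler0n _ q) (ler0n _ B) xN (sq1 n) (wq n) h1' h2' h3' h4' h5.
  have -> : n%:R * ((2 * #|G|%:R + 2 * #|(s' ^: G)%g|%:R) * C%:R * q%:R + #|G|%:R * hu%:R * (2 * B%:R + 1)) = (n * D)%:R :> R.
  by rewrite /D !(natrM, natrD).
  rewrite leNgt => /negP[]; rewrite -[ltLHS]ger0_norm // -sqrtr_sqr ltr_sqrt; last by rewrite ltr0n expn_gt0 ltnW.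
  by rewrite -natrX ltr_nat (leq_trans (square_lt_pow2 nD)) // leq_exp2r.
have co' := co hyp.
have [N1 hN1] := sqrt_big B%:R (divr_gt0 e0 (ltr0n _ 2)).
pose n0 := Num.bound `|((#|(s ^: G)%g| + #|G|) * C * q)%:R / (e / 2)|.
exists (N1 + q ^ n0.+1)%N => N hN.
have hB : B%:R <= e / 2 * sq N by apply: hN1; apply: leq_trans hN; exact: leq_addr.
(* One unexceptional prime of norm N shows that N is a power of q; otherwise at most B primes have
   norm N. *)
have [/hasP[P PN nb]|/hasPn no] := boolP (has (fun P => P \notin bl) (pn N)).
  have [hP NP] := (pnP P N).1 PN; have [n npos NPn] := bn P hP nb.
  have NE : N = (q ^ n)%N by rewrite -NP.
  have nn0 : (n0 < n)%N.
  rewrite -(leq_exp2l _ _ q1) -NE; apply: leq_trans hN; exact: leq_addl.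
  have [a1 h1 l1] := upN n s npos; have [p' h3 l3] := lowN n npos.
  have := upper_ineq h1 l1 (co' n s) h3 l3; rewrite -NE => main.
  have wqN : (q ^ uphalf n)%:R <= q%:R * sq N by rewrite NE; exact: wq.
  apply: (upper_real npos hu0 gG0 main (sqrtr_ge0 _) (ltW e0) wqN hB).
  have e2 : 0 < e / 2 by rewrite divr_gt0.
  rewrite mulrC -ler_pdivrMr //; apply: le_trans (ler_norm _) _.
  apply: le_trans (ltW (archi_boundP _)) _ => //; rewrite ler_nat; exact: ltnW.
have pB : (size (pn N) <= B)%N.
  apply: uniq_leq_size (pn_uniq N) _ => P PN; have := no P PN; exact: negbNE.
have /ler_normlP[_ h] := small_jump sG pB; have B0 : 0 <= B%:R :> R by [].
have -> : e * sq N = 2 * (e / 2 * sq N) by field.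
by move: h hB B0; clear; lra.
Qed.

(** In a number field boundedly many primes have norm N. In a function field the upper bound for the
    inverse of s, subtracted from the paired estimate, is the lower bound for s. *)
Lemma global_jump s (e : R) : s \in G -> 0 < e ->
  exists N0 : nat, forall N, (N0 <= N)%N -> `|(cnt s N)%:R - kap s * (size (pn N))%:R| <= e * sq N.
Proof.
move=> sG e0; case: (hK) => [[S [X [SA Sabs]]]|gp].
  have [D hD] := few_same_norm X SA Sabs; have [N0 hN0] := sqrt_big D%:R e0.
  exists N0 => N /hN0 h; apply: le_trans h; apply: small_jump => //.
  by apply: (hD N); [exact: pn_uniq | move=> P /pnP].
have e2 : 0 < e / 2 by rewrite divr_gt0.
have [N1 h1] := upper_jump gp sG e0; have [N2 h2] := pair sG e2.
have [|N3 h3] := upper_jump gp (s := s^-1%g) _ e2; first by rewrite groupV.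
exists (N1 + N2 + N3)%N => N hN.
have /h1 u1 : (N1 <= N)%N by lia.
have /h2/ler_normlP[u2 _] : (N2 <= N)%N by lia.
have /h3 : (N3 <= N)%N by lia.
rewrite class_inv_card => u3; have ee : e * sq N = 2 * (e / 2 * sq N) by field.
rewrite -mulrA in u2; rewrite ee in u1 *; rewrite ler_norml; move: u1 u2 u3; clear.
by move: (e / 2 * sq N) (kap s * _) => x y u1 u2 u3; apply/andP; split; lra.
Qed.

End Jumps.

(** * The discriminant, and almost all primes being good *)

Section Discriminant.
Variables (K : fieldType) (L : splittingFieldType K).
Hypothesis hLK : galois 1%AS {:L}%AS.
Local Notation Tr := (galTrace 1%AS {:L}%AS).
Lemma trace_scale (a : K) (x : L) : Tr (a *: x) = a *: Tr x.
Proof. by rewrite /galTrace scaler_sumr; apply: eq_bigr => s _; rewrite linearZ. Qed.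

(** A vanishing determinant gives x != 0 orthogonal to a basis for the trace form; the trace would
    then vanish identically, against the independence of automorphisms. *)
Lemma disc_basis : exists2 d : K, d != 0 & disc (fun i => (vbasis {:L})`_i) = d%:A.
Proof.
pose b : 'I_(\dim {:L}) -> L := fun i => (vbasis {:L})`_i.
have ht x : exists a : K, Tr x = a%:A by apply/vlineP; apply: (mem_galTrace hLK); apply: memvf.
have [t tE] := choice ht; pose M : 'M[K]_(\dim {:L}) := \matrix_(i, j) t (b i * b j).
have dE : disc b = (\det M)%:A.
  rewrite -[RHS](det_map_mx (in_alg L)) /disc; congr (\det _); apply/matrixP => i j.
  by rewrite !mxE tE.
exists (\det M) => //; apply/negP => /eqP/eqP/det0P[v v0 vM].
pose x := \sum_i v 0 i *: b i.
have x0 : x != 0.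
  apply: contraNneq v0 => x0; apply/eqP/rowP => i; rewrite mxE.
  by have /freeP := basis_free (vbasisP {:L}); apply.
have Txb j : Tr (x * b j) = 0.
  rewrite mulr_suml raddf_sum; have /rowP/(_ j) := vM; rewrite !mxE => h.
  transitivity ((\sum_i v 0 i * M i j)%:A : L); last by rewrite h scale0r.
  rewrite scaler_suml; apply: eq_bigr => i _.
  by rewrite -scalerAl -[LHS]/(Tr _) trace_scale tE mxE scalerA.
have T0 y : Tr y = 0.
  have -> : y = x * (x^-1 * y) by rewrite mulrA mulfV ?mul1r.
  rewrite (coord_vbasis (memvf (x^-1 * y))) mulr_sumr raddf_sum big1 // => i _.
  by rewrite -scalerAr -[LHS]/(Tr _) trace_scale Txb scaler0.
have [||y _] := @gal_independent_contra _ _ {:L}%AS [in 'Gal({:L} / 1%AS)%g] (fun=> 1) 1%g.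
- exact: group1.
- exact: oner_neq0.
by under eq_bigr do rewrite mul1r; rewrite -[X in X != _]/(Tr y) T0 eqxx.
Qed.

End Discriminant.

(** Discarded are the primes not above A, those below a ramified prime, those dividing the
    discriminant of one fixed basis, and those at which the minimal polynomials of this basis are
    not integral. *)
Lemma good_almost (R : realType) (K : fieldType) (hK : gbase R K) (L : splittingFieldType K) :
  galois 1%AS {:L}%AS -> exists bl : seq (set K), forall p, is_prime p -> p \notin bl ->
  [/\ inertia (Defs.prime_above L p) = [set 1%g]%SET, ~ divides_discriminant L p & frob_at p (Frob L p)].
Proof.
move=> hLK; have [F [S [X [_ [t0 ht0]]]]] := gbase_cheb hK.
have [XL XLE] := finext_tower X L; have ej a : in_alg L (fj X a) = fj XL a by rewrite XLE.
have [bT hT] := tame_almost ej (@mem1P K L).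
have [d d0 dE] := disc_basis hLK; have [td htd] := bad_finite hK d0.
pose b i := (vbasis {:L})`_i.
have hg (i : nat) : exists2 g : {poly K}, map_poly (in_alg L) g = minPoly 1%AS (b i) & g \is monic.
  have /polyOver1P[g gE] := minPolyOver 1%AS (b i); exists g; first by rewrite gE.
  by have := monic_minPoly 1%AS (b i); rewrite gE map_monic.
have [g gE gm] : exists2 g : nat -> {poly K}, forall i, map_poly (in_alg L) (g i) = minPoly 1%AS (b i)
  & forall i, g i \is monic.
  have hg' i : exists g : {poly K}, map_poly (in_alg L) g = minPoly 1%AS (b i) /\ g \is monic.
  by have [h h1 h2] := hg i; exists h.
  by have [g gP] := choice hg'; exists g => i; case: (gP i).
have hc c : exists l : seq (set K), forall P, is_prime P -> ~ P c -> P \in l.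
  have [->|c0] := eqVneq c 0; first by exists [::] => P hP []; apply: prime0.
  by have [l hl] := bad_finite hK c0; exists l => P hP nP; apply: hl => //; right.
have [cl clP] := choice hc.
pose coefs := flatten [seq (g i : seq K) | i <- iota 0 (\dim {:L})].
exists (t0 ++ td ++ [seq contr (in_alg L) Q | Q <- bT] ++ flatten [seq cl c | c <- coefs]) => p hp.
rewrite !mem_cat !negb_or => /and4P[n0 nd nT nc].
have ap : above X p by apply: contrapT => na; case/negP: n0; apply: ht0.
have [Q1 aQ1 cQ1] := lying_over ej ap.
have : lies_above (Defs.prime_above L p) p.
  apply: (@xgetPex _ setT [set P | lies_above P p]); exists Q1; split; first exact: aQ1.1.
  by move=> a; rewrite -cQ1.
set Q := Defs.prime_above L p => -[hQ Qp].
have aQ : above XL Q by split=> // a Aa; rewrite XLE; apply/Qp; exact: ap.2.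
have cQ : contr (in_alg L) Q = p by apply/seteqP; split=> a /= h1; apply/Qp.
have tQ : tame 1%AS Q.
  by apply: contrapT => nt; case/negP: nT; apply/mapP; exists Q => //; apply: hT.
have mv s : s \in decomposition Q <-> s \in ('Gal({:L} / 1%AS))%g /\ moved s Q = Q.
  rewrite inE; split=> [/andP[sG /asboolP h]|[sG h]].
  by split=> //; apply/seteqP; split=> x h1; [exact: (h x).2 h1 | exact: (h x).1 h1].
  by rewrite sG; apply/asboolP => x; rewrite -[in X in X <-> _]h.
split.
- apply/finset.setP => s; rewrite finset.in_set1 finset.in_set; apply/andP/eqP => [[/mv[sG ms] /asboolP h]|->].
  exact: tQ.
  split; first by apply/mv; split; rewrite ?group1 ?moved1.
  by apply/asboolP => x Qx; rewrite gal_id subrr; split; [exact: prime0 | left].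
- move=> dd; case/negP: nd; apply: htd => //; left; apply: (dd _ _ _ dE) => i.
  exists (g i); split; [exact: gm | move=> k | by rewrite gE; apply: root_minPoly].
  have [kl|kl] := ltnP k (size (g i)); last by rewrite nth_default //; apply: prime0.
  apply: contrapT => nP; case/negP: nc; apply/flattenP; exists (cl (g i)`_k); last exact: clP.
  apply: map_f; apply/flattenP; exists (g i : seq K); last exact: mem_nth.
  by apply: map_f; rewrite mem_iota /= add0n.
have : is_frobenius p Q (Frob L p).
  rewrite /Frob -/Q; apply: (@xgetPex _ 1%g [set sg | is_frobenius p Q sg]).
  have [s sH [ms hs]] := frobenius_ex ej (@mem1P K L) aQ; exists s; split; first exact/mv.
  by rewrite cQ in hs.
move=> [/mv[fG _] hf]; split=> //; exists Q; split=> // x Qx; exact: hf.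
Qed.

Lemma idem_trace (F : fieldType) n (P : 'M[F]_n) : P *m P = P -> \tr P = (\rank P)%:R.
Proof.
move=> PP; rewrite -{1}(mulmx_base P) mxtrace_mulC.
suff -> : row_base P *m col_base P = 1%:M by rewrite mxtrace1.
apply: (row_full_inj (col_base_full P)); apply: (row_free_inj (row_base_free P)).
by rewrite mulmx1 mulmxA mulmx_base -mulmxA mulmx_base.
Qed.

Lemma delta_sandwich (F : fieldType) m n (A : 'M[F]_m) (B : 'M[F]_n) k l p q :
  (A *m delta_mx k l *m B) p q = A p k * B l q.
Proof.
by rewrite -(mul_delta_mx (0 : 'I_1)) mulmxA -mulmxA -colE -rowE mxE big_ord1 !mxE.
Qed.

(** * Orthogonality of characters over an algebraically closed field *)

Section Characters.
Variables (C : numClosedFieldType) (gT : finGroupType) (G : {group gT}).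
Local Notation g1 := (#|G|%:R : C).
Lemma pchar_group : (([pchar C]^')%N.-group G)%g.
Proof. by apply/pgroupP => p _; rewrite inE /= pchar_num. Qed.
Lemma card_neq0 : g1 != 0. Proof. by rewrite pnatr_eq0 -lt0n cardG_gt0. Qed.
Lemma splitting : group_splitting_field C G. Proof. exact: group_closure_closed_field. Qed.

Section Irreducible.
Variable sG : irrType C G.
Local Notation r i := (irr_repr (i : sG)).
Local Notation chi i g := (\tr (r i g)).
Lemma repr_xK i x g : x \in G -> g \in G -> r i (x * g)^-1%g *m r i x = r i g^-1%g.
Proof. by move=> xG gG; rewrite -repr_mxM ?groupV ?groupM // invMg mulgKV. Qed.

(** Schur's lemma; the scalar is found by comparing traces. *)
Lemma avg_scalar i (M : 'M[C]_(irr_degree i)) :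
  \sum_(g in G) r i g *m M *m r i g^-1%g = (g1 * \tr M / (irr_degree i)%:R)%:M.
Proof.
set S := LHS; have cS : centgmx (r i) S.
  apply/centgmxP => x xG; rewrite /S mulmx_suml mulmx_sumr (reindex_inj (mulgI x)).
  apply: eq_big => [g|g]; rewrite groupMl // => gG.
  by rewrite -(mulmxA _ (r i (x * g)^-1%g)) repr_xK // repr_mxM // !mulmxA.
have /is_scalar_mxP[a Sa] := mx_abs_irr_cent_scalar (splitting (socle_irr i)) cS.
have tS : \tr S = g1 * \tr M.
  rewrite /S raddf_sum -sumr_const mulr_suml; apply: eq_bigr => g gG /=.
  by rewrite mxtrace_mulC mulmxA -repr_mxM ?groupV // mulVg repr_mx1 mul1mx mul1r.
rewrite Sa -tS Sa mxtrace_scalar -[a *+ _]mulr_natr mulfK //.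
by rewrite pnatr_eq0 -lt0n irr_degree_gt0.
Qed.

(** The average S intertwines the two representations, so the Wedderburn idempotent of i, acting as
    1 on i and as 0 on j, kills it. *)
Lemma intertwine0 i j (M : 'M[C]_(irr_degree i, irr_degree j)) : i != j ->
  \sum_(g in G) r i g *m M *m r j g^-1%g = 0.
Proof.
move=> ij; set S := LHS; have hS x : x \in G -> r i x *m S = S *m r j x.
  move=> xG; rewrite /S mulmx_suml mulmx_sumr [RHS](reindex_inj (mulgI x)).
  apply: eq_big => [g|g gG]; rewrite ?groupMl //.
  by rewrite -(mulmxA _ (r j (x * g)^-1%g)) repr_xK // repr_mxM // !mulmxA.
have eG : (Wedderburn_id i \in group_ring C G)%MS.
  by apply: submx_trans (Wedderburn_id_mem i) _; rewrite genmxE submxMl.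
have /envelop_mxP[a aE] := eG.
have op k : gring_op (r k) (Wedderburn_id i) = \sum_(x in G) a x *: r k x.
  by rewrite aE linear_sum; apply: eq_bigr => x xG; rewrite linearZ /= gring_opG.
have e1 := op_Wedderburn_id_pchar pchar_group i; rewrite op in e1.
have e0 := irr_repr'_op0_pchar pchar_group ij (Wedderburn_id_mem i); rewrite op in e0.
rewrite -[S]mul1mx -e1 mulmx_suml (eq_bigr (fun x => S *m (a x *: r j x))); last first.
  by move=> x xG; rewrite -scalemxAl hS // scalemxAr.
by rewrite -mulmx_sumr e0 mulmx0.
Qed.

Lemma row_orth i j : \sum_(g in G) chi i g * chi j g^-1%g = if i == j then g1 else 0.
Proof.
transitivity (\sum_k \sum_l (\sum_(g in G) r i g *m delta_mx k l *m r j g^-1%g) k l).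
  under [RHS]eq_bigr do under eq_bigr do rewrite summxE.
  under [RHS]eq_bigr do rewrite exchange_big /=.
  rewrite [RHS]exchange_big /=; apply: eq_bigr => g _; rewrite mulr_suml; apply: eq_bigr => k _.
  by rewrite mulr_sumr; apply: eq_bigr => l _; rewrite delta_sandwich.
case: eqVneq => [e|ij]; last first.
  by apply: big1 => k _; apply: big1 => l _; rewrite intertwine0 // mxE.
subst j; have d0 : (irr_degree i)%:R != 0 :> C by rewrite pnatr_eq0 -lt0n irr_degree_gt0.
under eq_bigr => k _.
  under eq_bigr do rewrite avg_scalar mxE.
  rewrite (bigD1 k) //= big1 ?addr0; last by move=> l lk; rewrite eq_sym (negPf lk).
  rewrite eqxx mulr1n (_ : \tr (delta_mx k k) = 1) ?mulr1; last first.
  rewrite /mxtrace (bigD1 k) //= big1 ?addr0 ?mxE ?eqxx // => l lk; by rewrite mxE (negPf lk).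
  over.
by rewrite sumr_const card_ord -[LHS]mulr_natr mulfVK.
Qed.

Lemma regular_trace x : x \in G -> \tr (regular_repr C G x) = if x == 1%g then g1 else 0.
Proof.
move=> xG; case: eqVneq => [->|x1]; first by rewrite repr_mx1 mxtrace1.
apply: big1 => k _; rewrite !mxE /= -/(gring_index G _); case: eqP => //= e; case/eqP: x1.
have kG : enum_val k \in G by exact: enum_valP.
by apply: (mulgI (enum_val k)); rewrite mulg1 -[LHS](@gring_indexK _ G) ?groupM // -e.
Qed.

(** The regular character of a conjugate of s^-1 times g detects the h with g = s^h. Averaging over
    h turns the matrix of s^-1 into its character value divided by the degree, by [avg_scalar]. *)
Lemma col_orth s g : s \in G -> g \in G -> \sum_i chi i s^-1%g * chi i g = \sum_(h in G) (g == (s ^ h)%g)%:R.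
Proof.
move=> hs gG; apply: (mulfI card_neq0).
transitivity (\sum_(h in G) \sum_i chi i (h * s^-1 * h^-1 * g)%g *+ irr_degree i).
  rewrite exchange_big mulr_sumr; apply: eq_bigr => i _.
  have d0 : (irr_degree i)%:R != 0 :> C by rewrite pnatr_eq0 -lt0n irr_degree_gt0.
  rewrite sumrMnl -[RHS]mulr_natr; have -> : \sum_(h in G) chi i (h * s^-1 * h^-1 * g)%g =
  \tr ((\sum_(h in G) r i h *m r i s^-1%g *m r i h^-1%g) *m r i g).
  rewrite mulmx_suml raddf_sum; apply: eq_bigr => h hG /=.
  by rewrite !repr_mxM ?groupM ?groupV.
  by rewrite avg_scalar mul_scalar_mx mxtraceZ; move: (\tr _) (\tr _) g1 d0 => a b c d0; field.
rewrite mulr_sumr (reindex_inj invg_inj) /=; apply: eq_big => h; rewrite groupV // => hG.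
rewrite -(mxtrace_regular_pchar sG pchar_group splitting) ?regular_trace ?groupM ?groupV //.
have -> : (h^-1 * s^-1 * h^-1^-1 * g)%g = ((s ^ h)^-1 * g)%g by rewrite conjgE !invMg.
rewrite -eq_mulVg1 (eq_sym g).
by case: ifP => _; rewrite ?mulr1 ?mulr0.
Qed.

Lemma sum_irr0 i : i != principal_comp sG -> \sum_(g in G) chi i g = 0.
Proof.
move=> i1; have h := row_orth i (principal_comp sG); rewrite (negPf i1) in h; rewrite -[RHS]h.
apply: eq_bigr => g gG; rewrite (irr1_repr sG) ?groupV // mxtrace1 degree_irr1.
by rewrite mulr1.
Qed.

Lemma class_expand (f : gT -> C) g : (forall x h, x \in G -> h \in G -> f (x ^ h)%g = f x) -> g \in G ->
  f g = \sum_i (g1^-1 * \sum_(s in G) f s * chi i s^-1%g) * chi i g.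
Proof.
move=> hf gG; transitivity (g1^-1 * \sum_(s in G) f s * \sum_i chi i s^-1%g * chi i g).
  transitivity (g1^-1 * \sum_(s in G) \sum_(h in G) f g * (g == (s ^ h)%g)%:R).
  rewrite exchange_big /= (eq_bigr (fun=> f g)) => [|h hG].
  by rewrite sumr_const -[f g *+ _]mulr_natr mulrCA mulVf ?mulr1 ?card_neq0.
  rewrite (bigD1 (g ^ h^-1)%g) ?groupJ ?groupV //= conjgKV eqxx mulr1 big1 ?addr0 // => s /andP[_ sg].
  case: eqP => [e|]; rewrite ?mulr0 //; case/eqP: sg; by rewrite e conjgK.
  congr (_ * _); apply: eq_bigr => s sG'; rewrite col_orth // mulr_sumr; apply: eq_bigr => h hG.
  by case: eqP => [->|]; rewrite ?mulr0 // hf.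
rewrite mulr_sumr [RHS](eq_bigr (fun i => \sum_(s in G) g1^-1 * (f s * (chi i s^-1%g * chi i g)))); last first.
  by move=> i _; rewrite -mulrA mulr_suml mulr_sumr; apply: eq_bigr => s _; rewrite !mulrA.
by rewrite exchange_big; apply: eq_bigr => s _; rewrite -mulr_sumr -mulr_sumr.
Qed.

End Irreducible.

(** * Multiplicity of the trivial representation and the Frobenius-Schur indicator *)

Section OneRepr.
Variables (n : nat) (rG : mx_representation C G n).

(** P times the average over G is the projection onto the fixed vectors in U, and the rank of an
    idempotent is its trace. *)
Lemma rank_fix_sub (U P : 'M[C]_n) (modU : mxmodule rG U) : P *m P = P -> (P :=: U)%MS ->
  (forall g, g \in G -> P *m rG g = rG g *m P) ->
  (mult_trivial (submod_repr modU))%:R = g1^-1 * \sum_(g in G) \tr (P *m rG g) :> C.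
Proof.
move=> PP PU Pc; pose A := g1^-1 *: \sum_(g in G) rG g.
have AG x : x \in G -> A *m rG x = A.
  move=> xG; rewrite /A -scalemxAl mulmx_suml; congr (_ *: _).
  rewrite [RHS](reindex_inj (mulIg x)); apply: eq_big => [g|g gG]; first by rewrite groupMr.
  by rewrite repr_mxM.
have fA (m : nat) (v : 'M[C]_(m, n)) : (forall g, g \in G -> v *m rG g = v) -> v *m A = v.
  move=> h; rewrite /A -scalemxAr mulmx_sumr (eq_bigr (fun=> v)) // sumr_const -[v *+ _]scaler_nat scalerA.
  by rewrite mulVf ?scale1r ?card_neq0.
have PA : P *m A = A *m P.
  rewrite /A -scalemxAr -scalemxAl mulmx_sumr mulmx_suml; congr (_ *: _).
  by apply: eq_bigr => g gG; exact: Pc.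
have idem : (P *m A) *m (P *m A) = P *m A by rewrite {1}PA !mulmxA -[A *m P *m P]mulmxA PP -PA -mulmxA fA.
have fix_eq : (P *m A :=: U :&: rfix_mx rG G)%MS.
  apply/eqmxP/andP; split.
  rewrite sub_capmx -PU; apply/andP; split; first by rewrite PA submxMl.
  by apply/rfix_mxP => x xG; rewrite -mulmxA AG.
  set W := (U :&: _)%MS; have WU : (W <= P)%MS by rewrite PU capmxSl.
  have WP : W *m P = W by have /submxP[D ->] := WU; rewrite -mulmxA PP.
  have Wf : W *m A = W by apply: fA => g gG; move/rfix_mxP: (capmxSr U (rfix_mx rG G)); apply.
  by rewrite -[X in (X <= _)%MS]Wf -{1}WP -mulmxA submxMl.
rewrite /mult_trivial (rfix_submod modU) // mxrank_in_submod ?capmxSl // -fix_eq -(idem_trace idem).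
by rewrite /A -scalemxAr mxtraceZ mulmx_sumr raddf_sum.
Qed.

End OneRepr.

Section SquareTrace.
Variables (n : nat) (rG : mx_representation C G n).

Lemma tensor_swap_trace g : \tr (swap_mx C n *m tensor_square_mx rG g) = \tr (rG g *m rG g).
Proof.
have E (f : {linear 'M[C]_n -> 'M[C]_n}) : \tr (lin_mx f) = \sum_i \sum_j f (delta_mx i j) i j.
  rewrite /mxtrace (reindex _ (curry_mxvec_bij n n)) pair_bigA /=; apply: eq_bigr => -[i j] _ /=.
  by rewrite -(mxvecE (f _)) -mul_vec_lin mxvec_delta -rowE [RHS]mxE.
have -> : swap_mx C n *m tensor_square_mx rG g =
  lin_mx ((mulmxr (rG g) \o mulmx (rG g)^T) \o trmx : 'M[C]_n -> 'M[C]_n).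
  apply/row_matrixP => i; rewrite !rowE mulmxA -[delta_mx 0 i]vec_mxK !mul_vec_lin.
  by rewrite mul_tensor_square_mx.
rewrite E exchange_big; apply: eq_bigr => j _ /=; rewrite mxE; apply: eq_bigr => i _ /=.
by rewrite trmx_delta delta_sandwich mxE.
Qed.

(** The Frobenius-Schur formula. The projections (1 + swap)/2 and (1 - swap)/2 onto symmetric and
    alternating tensors differ by the swap, whose trace against g tensor g is tr(g^2). *)
Lemma nuE : (nu rG)%:~R = g1^-1 * \sum_(g in G) \tr (rG (g ^+ 2)%g) :> C.
Proof.
pose T := tensor_square rG; pose s := swap_mx C n; have two : (2 : C) != 0 by rewrite pnatr_eq0.
have ss : s *m s = 1%:M.
  apply/row_matrixP => i; rewrite !rowE mulmxA -[delta_mx 0 i]vec_mxK !mul_vec_lin /=.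
  by rewrite trmxK mulmx1.
have sT g : g \in G -> s *m T g = T g *m s.
  move=> _; apply/row_matrixP => i; rewrite !rowE !mulmxA -[delta_mx 0 i]vec_mxK.
  rewrite [in LHS]/s /swap_mx mul_vec_lin !mul_tensor_square_mx mul_vec_lin /=.
  by rewrite !trmx_mul trmxK mulmxA.
pose P (a : C) := 2^-1 *: (1%:M + a *: s).
have key a (aa : a * a = 1) (modU : mxmodule T (eigenspace s a)) : (mult_trivial (submod_repr modU))%:R =
  g1^-1 * \sum_(g in G) \tr (P a *m T g).
  apply: rank_fix_sub.
  - rewrite /P -scalemxAl -scalemxAr mulmxDl !mulmxDr !mul1mx mulmx1 -!scalemxAl -!scalemxAr ss.
  congr (_ *: _); rewrite [a *: (a *: _)]scalerA aa scale1r [a *: s + 1%:M]addrC; set Z := _ + _ *: s.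
  by rewrite -[Z + Z]mulr2n -[Z *+ 2]scaler_nat scalerA mulVf ?scale1r.
  - apply/eqmxP/andP; split.
  apply/eigenspaceP; rewrite /P -scalemxAl mulmxDl mul1mx -scalemxAl ss scalerA mulrC -scalerA.
  by congr (_ *: _); rewrite scalerDr scalerA aa scale1r addrC.
  set W := eigenspace s a; have /eigenspaceP h := submx_refl W.
  have -> : W = W *m P a; last exact: submxMl.
  rewrite /P -scalemxAr mulmxDr mulmx1 -scalemxAr h scalerA aa scale1r -mulr2n -[W *+ 2]scaler_nat scalerA.
  by rewrite mulVf ?scale1r.
  move=> g gG; rewrite /P -scalemxAl -scalemxAr mulmxDl mulmxDr mul1mx mulmx1 -scalemxAl -scalemxAr.
  by rewrite sT.
have -> : (nu rG)%:~R = (mult_trivial (sym2_repr rG))%:R - (mult_trivial (alt2_repr rG))%:R :> C.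
  by rewrite /nu rmorphB.
have -> := key 1 (mulr1 1) (swap_mx_stable rG 1).
have -> := key (-1) (etrans (mulrNN 1 1) (mulr1 1)) (swap_mx_stable rG (-1)).
rewrite -mulrBr -sumrB; congr (_ * _); apply: eq_bigr => g gG.
rewrite -raddfB /= -mulmxBl expgS expg1 repr_mxM // -tensor_swap_trace; congr (\tr (_ *m _)).
rewrite /P -scalerBr scale1r scaleN1r opprD addrACA subrr add0r opprK -mulr2n -[s *+ 2]scaler_nat scalerA.
by rewrite mulVf ?scale1r.
Qed.

End SquareTrace.

(** * Eigenvalues and local determinants *)

Section Spectrum.
Variables (n : nat) (rG : mx_representation C G n).

(** The matrix of g is killed by the separable polynomial X^|G| - 1, hence diagonalizable with roots
    of unity on the diagonal. *)
Lemma spectral g : g \in G -> exists l : 'I_n -> C, [/\ forall k, l k ^+ #|G| = 1,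
  forall m, \tr (rG (g ^+ m)%g) = \sum_k l k ^+ m
  & forall t, \det (1%:M - t *: rG g) = \prod_k (1 - t * l k)].
Proof.
move=> gG; case: n rG => [|n' r'].
  move=> r'; exists (fun=> 0); split=> [[]//|m|t]; first by rewrite big_ord0 /mxtrace big_ord0.
  by rewrite big_ord0 det_mx00.
have [rs Ers] := closed_field_poly_normal ('X^#|G| - 1 : {poly C}).
have mon : ('X^#|G| - 1 : {poly C}) \is monic by exact: monicXnsubC (cardG_gt0 G).
rewrite (monicP mon) scale1r in Ers.
have urs : uniq rs by rewrite -separable_prod_XsubC -Ers separable_Xn_sub_1 // card_neq0.
have A1 : (r' g) ^+ #|G| = 1 by rewrite -repr_mxX // expg_cardG // repr_mx1.
have [P Pu /(diagonalizable_forLR Pu)[D AE]] : exists2 P, P \in unitmx & diagonalizable_for P (r' g).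
  apply/diagonalizableP; exists rs => //; rewrite -Ers; apply: mxminpoly_min.
  by rewrite rmorphB rmorphXn /= horner_mx_X rmorph1 A1 subrr.
have Vu : invmx P \in unitmx by rewrite unitmx_inv.
rewrite (mxpoly.conjumx _ Vu) invmxK in AE; set l := fun k => D 0 k.
have Xm m : (r' g) ^+ m = invmx P *m diag_mx (\row_k l k ^+ m) *m P.
  elim: m => [|m IH].
  by rewrite (_ : diag_mx _ = 1%:M) ?mulmx1 ?mulVmx // ; apply/matrixP => a b; rewrite !mxE expr0.
  rewrite exprSr IH -[LHS]/(_ *m r' g) AE !mulmxA mulmxK // -[_ *m diag_mx _ *m diag_mx D]mulmxA mulmx_diag.
  by congr (_ *m diag_mx _ *m _); apply/rowP => k; rewrite !mxE exprSr.
have trm m : \tr (r' g ^+ m) = \sum_k l k ^+ m.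
  rewrite Xm mxtrace_mulC mulmxA mulmxV // mul1mx mxtrace_diag.
  by apply: eq_bigr => k _; rewrite mxE.
exists l; split=> [k|m|t].
- have : diag_mx (\row_k l k ^+ #|G|) = 1%:M.
  have := Xm #|G|; rewrite A1 => e.
  have /(congr1 (fun M => P *m M *m invmx P)) := e; rewrite !mulmxA mulmxV // mul1mx mulmxK //.
  by rewrite mulmx1 mulmxV.
  by move=> /matrixP/(_ k k); rewrite !mxE eqxx !mulr1n.
- by rewrite repr_mxX // trm.
have -> : 1%:M - t *: r' g = invmx P *m (1%:M - t *: diag_mx D) *m P.
  by rewrite mulmxBr mulmxBl mulmx1 mulVmx // -scalemxAr -scalemxAl AE.
rewrite !det_mulmx mulrAC -det_mulmx mulVmx // det1 mul1r.
have -> : 1%:M - t *: diag_mx D = diag_mx (\row_k (1 - t * l k)).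
  by apply/matrixP => a b; rewrite !mxE; case: eqP => _; rewrite ?mulr1n ?mulr0n ?mulr0 ?subr0.
by rewrite det_diag; apply: eq_bigr => k _; rewrite mxE.
Qed.

Lemma root_unity_norm (x : C) : x ^+ #|G| = 1 -> `|x| = 1.
Proof.
move=> h; apply/eqP; rewrite -(pexpr_eq1 (n := #|G|)) ?normr_ge0 ?cardG_gt0 //.
by rewrite -normrX h normr1.
Qed.

Lemma tr_inv g : g \in G -> \tr (rG g^-1%g) = (\tr (rG g))^*.
Proof.
move=> gG; have [l [l1 lt _]] := spectral gG; have -> : (g^-1 = g ^+ #|G|.-1)%g.
  by apply: (mulgI g); rewrite mulgV -expgS prednK ?cardG_gt0 // expg_cardG.
have lt1 := lt 1%N; rewrite expg1 in lt1; rewrite lt1 lt rmorph_sum; apply: eq_bigr => k _; rewrite expr1.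
have nl := root_unity_norm (l1 k); have l0 : l k != 0 by rewrite -normr_eq0 nl oner_neq0.
apply: (mulfI l0); rewrite -exprS prednK ?cardG_gt0 // l1.
by rewrite -normCK nl expr1n.
Qed.

Lemma tr_bound g : g \in G -> `|\tr (rG g)| <= n%:R.
Proof.
move=> gG; have [l [l1 lt _]] := spectral gG; rewrite -[g]expg1 lt; apply: le_trans (ler_norm_sum _ _ _) _.
rewrite (eq_bigr (fun=> 1)) ?sumr_const ?card_ord // => k _.
by rewrite expr1 root_unity_norm.
Qed.

(* An eigenvector for the eigenvalue 1/t would be fixed by t ^ #|G|. *)
Lemma det_restr_neq0 (U : 'M[C]_n) g t : g \in G -> (U *m rG g <= U)%MS -> 0 < t -> t < 1 ->
  \det (1%:M - t *: in_submod U (val_submod (1%:M : 'M[C]_(\rank U)) *m rG g)) != 0.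
Proof.
move=> gG Ug t0 t1; apply/det0P => -[v v0].
rewrite mulmxBr mulmx1 -scalemxAr => /eqP; rewrite subr_eq0 => /eqP vE.
pose u := val_submod v; have u0 : u != 0 by rewrite val_submod_eq0.
have uE : u = t *: (u *m rG g).
  rewrite {1}/u {1}vE linearZ /= in_submodE mulmxA -in_submodE mulmxA -val_submodE in_submodK //.
  apply: submx_trans Ug; apply: submxMr; exact: val_submodP.
have um m : u = t ^+ m *: (u *m rG (g ^+ m)%g).
  elim: m => [|m IH]; first by rewrite expg0 repr_mx1 mulmx1 scale1r.
  by rewrite expgSr repr_mxM ?groupX // mulmxA exprSr {1}uE {1}IH -!scalemxAl scalerA mulrC.
have := um #|G|; rewrite expg_cardG // repr_mx1 mulmx1 => /eqP.
rewrite -subr_eq0 -{1}[u]scale1r -scalerBl scaler_eq0 (negPf u0) orbF subr_eq0 => /eqP e.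
by have := exprn_ilt1 #|G| (ltW t0) t1; rewrite -e ltxx -lt0n cardG_gt0.
Qed.

Lemma det_restr_full (U : 'M[C]_n) g t : (U :=: 1%:M)%MS -> g \in G ->
  \det (1%:M - t *: in_submod U (val_submod (1%:M : 'M[C]_(\rank U)) *m rG g)) = \det (1%:M - t *: rG g).
Proof.
move=> U1 gG; have rU : \rank U = n by rewrite U1 mxrank1.
pose B := val_submod (1%:M : 'M[C]_(\rank U)); pose B' := in_submod U (1%:M : 'M[C]_n).
have BB' : B *m B' = 1%:M by rewrite /B' -in_submodE val_submodK.
have B'B : B' *m B = 1%:M by rewrite /B -val_submodE in_submodK // U1 submx1.
rewrite in_submodE -/B -/B'; move: B B' BB' B'B; rewrite rU => B B' BB' B'B.
have -> : 1%:M - t *: (B *m rG g *m B') = B *m (1%:M - t *: rG g) *m B'.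
  by rewrite mulmxBr mulmxBl mulmx1 BB' -scalemxAr -scalemxAl.
by rewrite !det_mulmx mulrAC -det_mulmx BB' det1 mul1r.
Qed.

End Spectrum.
End Characters.

Local Open Scope classical_set_scope.
Local Open Scope ring_scope.

(** * Complex sequences, exponentials and branches of the logarithm *)

Section ComplexSequences.
Variable R : realType.
Local Notation C := R[i].
Local Notation re := (@complex.Re R).
Local Notation im := (@complex.Im R).
Local Notation fl x := (Num.truncn (x : R)).
Local Notation rt n := (((Num.sqrt n%:R)^-1 : R)%:C).
Implicit Types (S U : nat -> C) (z w l : C).

Lemma reD z w : re (z + w) = re z + re w. Proof. by case: z w => [a b] [c d]. Qed.
Lemma imD z w : im (z + w) = im z + im w. Proof. by case: z w => [a b] [c d]. Qed.
Lemma reN z : re (- z) = - re z. Proof. by case: z. Qed.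
Lemma imN z : im (- z) = - im z. Proof. by case: z. Qed.
Lemma reM z w : re (z * w) = re z * re w - im z * im w. Proof. by case: z w => [a b] [c d]. Qed.
Lemma imM z w : im (z * w) = re z * im w + im z * re w. Proof. by case: z w => [a b] [c d]. Qed.
Lemma cplxE z w : re z = re w -> im z = im w -> z = w.
Proof. by case: z w => [a b] [c d] /= -> ->. Qed.
(** A norm equivalent to the modulus but with values in R; the norm of R[i] itself has values in
    R[i]. *)
Definition cn z : R := `|re z| + `|im z|.
Lemma cn_ge0 z : 0 <= cn z. Proof. by rewrite addr_ge0. Qed.
Lemma cnD z w : cn (z + w) <= cn z + cn w.
Proof. by rewrite /cn reD imD addrACA; apply: lerD; apply: ler_normD. Qed.
Lemma cnN z : cn (- z) = cn z. Proof. by rewrite /cn reN imN !normrN. Qed.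
Lemma cnM z w : cn (z * w) <= cn z * cn w.
Proof.
rewrite /cn reM imM mulrDl !mulrDr -!normrM.
apply: (le_trans (lerD (ler_normB _ _) (ler_normD _ _))).
by rewrite le_eqVlt; apply/orP; left; apply/eqP; ring.
Qed.
Lemma cnR (a : R) : cn a%:C = `|a|. Proof. by rewrite /cn /= normr0 addr0. Qed.
Lemma cn_sum (T : Type) (s : seq T) (F : T -> C) : cn (\sum_(t <- s) F t) <= \sum_(t <- s) cn (F t).
Proof.
elim/big_rec2: _ => [|t a b _ h]; first by rewrite /cn /= normr0 addr0.
by apply: le_trans (cnD _ _) _; rewrite lerD2l.
Qed.
Lemma cn_norm z (M : R) : `|z| <= M%:C -> cn z <= 2 * M.
Proof.
move=> h; have hr : `|re z| <= M /\ `|im z| <= M.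
  move: h; rewrite normc_def lecE /= => /andP[_ h]; have M0 : 0 <= M by apply: le_trans h; exact: sqrtr_ge0.
  by split; rewrite -sqrtr_sqr; apply: le_trans h; apply: ler_wsqrtr; rewrite ?lerDl ?lerDr sqr_ge0.
by case: hr => h1 h2; rewrite /cn; lra.
Qed.

(** Convergence of both coordinates, so that theorems on real sequences apply. *)
Definition cnv S l := (re \o S) @ \oo --> re l /\ (im \o S) @ \oo --> im l.
Definition conv S := exists l, cnv S l.
Lemma cnv_eq S U l : S =1 U -> cnv S l -> cnv U l.
Proof. by move=> /funext ->. Qed.
Lemma cnv_cst z : cnv (fun=> z) z. Proof. by split; apply: cvg_cst. Qed.

Lemma cnvD S U l m : cnv S l -> cnv U m -> cnv (fun n => S n + U n) (l + m).
Proof.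
move=> [a b] [c d]; split; rewrite ?reD ?imD.
  by rewrite (_ : _ \o _ = (re \o S) \+ (re \o U)); [apply: cvgD | apply/funext => n /=; rewrite reD].
by rewrite (_ : _ \o _ = (im \o S) \+ (im \o U)); [apply: cvgD | apply/funext => n /=; rewrite imD].
Qed.

Lemma cnvZ a S l : cnv S l -> cnv (fun n => a * S n) (a * l).
Proof.
move=> [h1 h2]; split; rewrite ?reM ?imM.
  rewrite (_ : _ \o _ = fun n => re a * (re \o S) n - im a * (im \o S) n); last by apply/funext => n /=; rewrite reM.
  by apply: cvgB; apply: cvgMr.
rewrite (_ : _ \o _ = fun n => re a * (im \o S) n + im a * (re \o S) n); last by apply/funext => n /=; rewrite imM.
by apply: cvgD; apply: cvgMr.
Qed.

Lemma cnvB S U l m : cnv S l -> cnv U m -> cnv (fun n => S n - U n) (l - m).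
Proof.
move=> hS hU; rewrite -mulN1r; apply: cnv_eq (cnvD hS (cnvZ (-1) hU)) => n.
by rewrite mulN1r.
Qed.

Lemma cnv_sum (I : finType) (P : pred I) (F : I -> nat -> C) (l : I -> C) :
  (forall i, P i -> cnv (F i) (l i)) -> cnv (fun n => \sum_(i | P i) F i n) (\sum_(i | P i) l i).
Proof.
move=> h; rewrite -big_filter.
have -> : (fun n => \sum_(i | P i) F i n) = (fun n => \sum_(i <- [seq i <- index_enum I | P i]) F i n).
  by apply/funext => n; rewrite big_filter.
have : all P [seq i <- index_enum I | P i] by exact: filter_all.
elim: [seq _ <- _ | _] => [_|i s IH /= /andP[Pi Ps]].
  by rewrite big_nil; apply: cnv_eq (cnv_cst 0) => n; rewrite big_nil.
by rewrite big_cons; apply: cnv_eq (cnvD (h i Pi) (IH Ps)) => n; rewrite big_cons.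
Qed.

Lemma cnv0 S : (forall e : R, 0 < e -> exists N0, forall n, (N0 <= n)%N -> cn (S n) <= e) <-> cnv S 0.
Proof.
split=> [h|[h1 h2] e e0].
  split; apply/cvgrPdist_le => e e0; have [N0 hN] := h e e0; exists N0 => // n /= nN; rewrite sub0r normrN;
  by apply: le_trans (hN n nN); rewrite /cn ?lerDl ?lerDr.
have e2 : 0 < e / 2 by rewrite divr_gt0.
move/cvgrPdist_le: h1 => /(_ _ e2)[N1 _ h1]; move/cvgrPdist_le: h2 => /(_ _ e2)[N2 _ h2].
exists (maxn N1 N2) => n; rewrite geq_max => /andP[/h1 {}h1 /h2 {}h2].
by move: h1 h2; rewrite !sub0r !normrN /cn /=; lra.
Qed.

Lemma cnv_shift S l k : cnv (fun n => S (n + k)%N) l <-> cnv S l.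
Proof.
have E (f : nat -> R) (a : R) : (fun n => f (n + k)%N) @ \oo --> a <-> f @ \oo --> a.
  by rewrite cvg_shiftn.
by split=> -[h1 h2]; split; [exact: (E (re \o S) _).1 | exact: (E (im \o S) _).1 | exact: (E (re \o S) _).2 | exact: (E (im \o S) _).2].
Qed.

(** Both b and u + b are nondecreasing and bounded above. *)
Lemma real_dom (u b : nat -> R) (M : R) : (forall n, `|u n.+1 - u n| <= b n.+1 - b n) -> (forall n, b n <= M) ->
  exists l : R, u @ \oo --> l.
Proof.
move=> ub bM; have mb : {homo b : m n / (m <= n)%N >-> m <= n}.
  by apply: homo_leq => // n; [exact: le_trans | rewrite -subr_ge0; apply: le_trans (ub n)].
have cb : cvgn b by apply: nondecreasing_is_cvgn => //; exists M => _ [n _ <-].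
pose v := fun n => u n + b n.
have mv : {homo v : m n / (m <= n)%N >-> m <= n}.
  apply: homo_leq => // n; [exact: le_trans | rewrite /v -subr_ge0].
  by have := ub n; rewrite ler_norml => /andP[h _]; lra.
have cv : cvgn v.
  apply: nondecreasing_is_cvgn => //; exists (u 0%N - b 0%N + M + M) => _ [n _ <-].
  have h : u n - b n <= u 0%N - b 0%N.
  elim: n => // n IH; apply: le_trans IH.
  by have := ub n; rewrite ler_norml => /andP[_ h]; lra.
  by rewrite /v; have := bM n; move: h; lra.
exists (limn v - limn b); rewrite (_ : u = fun n => v n - b n); last by apply/funext => n; rewrite /v; ring.
exact: cvgB.
Qed.

Lemma conv_dom S (b : nat -> R) (M : R) N0 : (forall n, (N0 <= n)%N -> cn (S n.+1 - S n) <= b n.+1 - b n) ->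
  (forall n, (N0 <= n)%N -> b n <= M) -> conv S.
Proof.
move=> h bM; have H f : (forall z, `|f z| <= cn z) -> {morph f : z w / z - w >-> z - w : R} ->
  exists a : R, (fun n => f (S (n + N0)%N)) @ \oo --> a.
  move=> f1 fB; apply: (@real_dom _ (fun n => b (n + N0)%N) M) => n; last by apply: bM; apply: leq_addl.
  by rewrite addSn -fB; apply: le_trans (f1 _) _; apply: h; apply: leq_addl.
have [||a ha] := H re; [by move=> z; rewrite lerDl | by move=> z w; rewrite reD reN |].
have [||c hc] := H im; [by move=> z; rewrite lerDr | by move=> z w; rewrite imD imN |].
by exists (a +i* c); apply/(cnv_shift _ _ N0).
Qed.

Definition cexp z : C := (expR (re z) * cos (im z)) +i* (expR (re z) * sin (im z)).

Lemma cexpD z w : cexp (z + w) = cexp z * cexp w.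
Proof.
by apply: cplxE; rewrite ?reM ?imM /= !reD !imD expRD ?cosD ?sinD; ring.
Qed.

Lemma cexp0 : cexp 0 = 1. Proof. by apply: cplxE; rewrite /= expR0 ?cos0 ?sin0 mul1r. Qed.

Lemma cexp_neq0 z : cexp z != 0.
Proof.
apply/eqP => h; have := cexpD z (- z); rewrite subrr h mul0r cexp0 => /eqP.
by rewrite oner_eq0.
Qed.

Lemma cexp_sum (T : Type) (s : seq T) (F : T -> C) : cexp (\sum_(t <- s) F t) = \prod_(t <- s) cexp (F t).
Proof. exact: (big_morph _ cexpD cexp0). Qed.

Lemma cnv_cexp S l : cnv S l -> cnv (cexp \o S) (cexp l).
Proof.
move=> [h1 h2]; have h3 : (fun n => expR (re (S n))) @ \oo --> expR (re l).
  by apply: (cvg_comp _ _ h1); exact: continuous_expR.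
split; apply: cvgM => //; first by apply: (cvg_comp _ _ h2); exact: continuous_cos.
by apply: (cvg_comp _ _ h2); exact: continuous_sin.
Qed.

Lemma cexp_surj z : z != 0 -> exists w, cexp w = z.
Proof.
move=> z0; pose d := re z ^+ 2 + im z ^+ 2; have d0 : 0 < d.
  rewrite lt_neqAle addr_ge0 ?sqr_ge0 // andbT eq_sym paddr_eq0 ?sqr_ge0 // !sqrf_eq0.
  by apply: contra z0 => /andP[/eqP a /eqP b]; apply/eqP/cplxE.
pose r := Num.sqrt d; have r0 : 0 < r by rewrite sqrtr_gt0.
have rd : r ^+ 2 = d by rewrite sqr_sqrtr // ltW.
pose c := re z / r; have c2 : 1 - c ^+ 2 = (im z / r) ^+ 2.
  by rewrite /c !expr_div_n rd; rewrite /d in d0 *; field; rewrite gt_eqF.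
have c1 : -1 <= c <= 1.
  by rewrite -ler_norml -(ler_pXn2r (n := 2)) ?nnegrE // expr1n -normrX ger0_norm ?sqr_ge0 // -subr_ge0 c2 sqr_ge0.
have cI : c \in `[-1, 1] by rewrite in_itv.
have sE : sin (acos c) = `|im z| / r by rewrite sin_acos // c2 sqrtr_sqr normrM normfV (gtr0_norm r0).
exists (ln r +i* (if 0 <= im z then acos c else - acos c)); apply: cplxE => /=; rewrite lnK ?posrE //.
  by case: ifP => _; rewrite ?cosN acosK // /c mulrC mulfVK ?gt_eqF.
case: ifP => [i0|/negbT]; rewrite ?sinN sE; first by rewrite ger0_norm // mulrC mulfVK ?gt_eqF.
by rewrite -ltNge => i0; rewrite ltr0_norm // mulNr opprK mulrC mulfVK ?gt_eqF.
Qed.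

Lemma cos_shift (x : R) : exists c : R, (forall y, cos (y - c) = cos y) /\ `|x - c| <= pi.
Proof.
have p0 : 0 < pi *+ 2 :> R by rewrite pmulrn_lgt0 // pi_gt0.
pose m := Num.floor ((x + pi) / (pi *+ 2)); exists (m%:~R * (pi *+ 2)); split=> [y|].
  case: m => n; rewrite ?NegzE ?mulrNz ?mulNr ?opprK -!pmulrn mulr_natl.
  by have e := periodicn (@cosD2pi R) n (y - (pi *+ 2) *+ n); rewrite subrK in e.
  by rewrite periodicn //; exact: cosD2pi.
have := floor_itv ((x + pi) / (pi *+ 2)); rewrite -/m ler_pdivlMr // ltr_pdivrMr // intrD mulrDl mul1r.
move: (m%:~R * _) => z /andP[h1 h2]; rewrite ler_norml mulr2n in h2 *; apply/andP; split; lra.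
Qed.

Lemma cos_small (x e : R) : `|x| <= pi -> 0 <= e -> e <= pi -> cos e < cos x -> `|x| < e.
Proof.
move=> xp e0 ep; rewrite -(cos_norm x) ltr_cos // in_itv /= ?normr_ge0 //; exact/andP.
Qed.

(** Once cos(v) is close to 1, v is close to a multiple of 2 pi, and increments tending to 0 prevent
    it from passing to another multiple. *)
Lemma angle_conv (v : nat -> R) : (fun n => cos (v n)) @ \oo --> (1 : R) ->
  (fun n => v n.+1 - v n) @ \oo --> (0 : R) -> exists l : R, v @ \oo --> l.
Proof.
move=> hc hj; have p2 := pi_ge2 R.
have near e : 0 < e -> e <= 1 -> exists N, forall n, (N <= n)%N -> cos e < cos (v n) /\ `|v n.+1 - v n| < 1.
  move=> e0 e1; have ce : cos e < 1.
  by rewrite -[ltRHS]cos0 ltr_cos // in_itv /= ?lexx ?pi_ge0 // (ltW e0) (le_trans e1) //; lra.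
  move/cvgrPdist_lt: hc => /(_ (1 - cos e)); rewrite subr_gt0 => /(_ ce)[N1 _ h1].
  move/cvgrPdist_lt: hj => /(_ 1 ltr01)[N2 _ h2].
  exists (maxn N1 N2) => n; rewrite geq_max => /andP[/h1 /= {}h1 /h2 /= {}h2]; split.
  by move: h1; rewrite ltr_norml => /andP[_]; lra.
  by move: h2; rewrite sub0r normrN.
have [N hN] := near 1 ltr01 (lexx 1); have [c [hcc hcN]] := cos_shift (v N).
have w1 k : `|v (k + N)%N - c| < 1.
  elim: k => [|k IH].
  apply: cos_small => //; [lra|]; rewrite hcc; by case: (hN N (leqnn N)).
  have [_ hj1] := hN (k + N)%N (leq_addl _ _); have [h2 _] := hN (k.+1 + N)%N (leq_addl _ _).
  apply: cos_small => //; rewrite ?hcc //; last lra.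
  have -> : v (k.+1 + N)%N - c = (v (k + N)%N - c) + (v (k + N).+1 - v (k + N)%N) by rewrite addSn; ring.
  by apply: le_trans (ler_normD _ _) _; move: IH hj1 p2; lra.
exists c; apply/cvgrPdist_lt => e e0; pose d := Num.min e 1.
have d0 : 0 < d by rewrite lt_min e0 ltr01.
have [|M hM] := near d d0; first by rewrite ge_min lexx orbT.
exists (maxn N M) => // n; rewrite /= geq_max => /andP[Nn Mn]; rewrite distrC.
apply: (@lt_le_trans _ _ d); last by rewrite ge_min lexx.
apply: cos_small; rewrite ?hcc ?(ltW d0) //; last by case: (hM n Mn).
  by rewrite -(subnK Nn); move: (w1 (n - N)%N) p2; lra.
by apply: (@le_trans _ _ 1); [rewrite ge_min lexx orbT | lra].
Qed.

(** The squared modulus exp(2 re Z) tends to 1. This is the part of a logarithm that its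
    exponentials determine by themselves. *)
Lemma cexp_re (Z : nat -> C) : cnv (cexp \o Z) 1 -> (re \o Z) @ \oo --> (0 : R).
Proof.
move=> [h1 h2]; have hs : (fun n => expR (re (Z n) *+ 2)) @ \oo --> (1 : R).
  rewrite (_ : (fun n => _) = fun n => re (cexp (Z n)) ^+ 2 + im (cexp (Z n)) ^+ 2); last first.
  apply/funext => n /=; rewrite !exprMn -mulrDr cos2Dsin2 mulr1 mulr2n expRD expr2 //.
  have -> : (1 : R) = 1 ^+ 2 + 0 ^+ 2 by rewrite expr1n expr0n addr0.
  by rewrite !expr2; apply: cvgD; apply: cvgM.
have hr2 : (fun n => re (Z n) *+ 2) @ \oo --> (0 : R).
  have -> : (fun n => re (Z n) *+ 2) = @ln R \o (fun n => expR (re (Z n) *+ 2)) by apply/funext => n /=; rewrite expRK.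
  rewrite -(ln1 R); apply: (cvg_comp _ _ hs); exact: continuous_ln.
rewrite (_ : _ \o _ = fun n => 2^-1 * (re (Z n) *+ 2)); last by apply/funext => n /=; field.
by rewrite -(mulr0 2^-1); apply: cvgMr.
Qed.

Lemma cexp_normalize (Y : nat -> C) l : l != 0 -> cnv (cexp \o Y) l ->
  exists y0, cnv (cexp \o (fun n => Y n - y0)) 1.
Proof.
move=> l0 hY; have [y0 y0E] := cexp_surj l0; exists y0; rewrite -cexp0 -(addNr y0) cexpD y0E.
by apply: cnv_eq (cnvZ (cexp (- y0)) hY) => n /=; rewrite mulrC -cexpD.
Qed.

(** After normalization the real part converges by [cexp_re], and increments tending to 0 keep the
    imaginary part on one branch. *)
Lemma cexp_lift (Y : nat -> C) l : l != 0 -> cnv (cexp \o Y) l -> cnv (fun n => Y n.+1 - Y n) 0 -> conv Y.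
Proof.
move=> l0 hY hj; have [y0 hZ] := cexp_normalize l0 hY; pose Z n := Y n - y0.
have [h1 _] : cnv (cexp \o Z) 1 := hZ; have hr := cexp_re hZ.
have hcos : (fun n => cos (im (Z n))) @ \oo --> (1 : R).
  rewrite (_ : (fun n => _) = fun n => expR (- re (Z n)) * re (cexp (Z n))); last first.
  by apply/funext => n /=; rewrite mulrA -expRD addNr expR0 mul1r.
  have -> : (1 : R) = expR (- 0) * 1 by rewrite oppr0 expR0 mulr1.
  apply: cvgM h1; apply: (cvg_comp _ _ (cvgN hr)); exact: continuous_expR.
have [|a ha] := angle_conv hcos.
  by case: hj => _; apply: cvg_trans; rewrite (_ : (fun n => _) = im \o (fun n => Y n.+1 - Y n)) //;
  apply/funext => n /=; rewrite /Z !imD !imN; ring.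
exists (y0 + (0 +i* a)); apply: (@cnv_eq (fun n => y0 + Z n)) => [n|]; first by rewrite /Z addrC subrK.
by apply: cnvD; [exact: cnv_cst | split].
Qed.

Lemma cubic_bound (f df : R -> R) (c r K x : R) : 0 <= K ->
  (forall y, `|y - c| <= r -> is_derive y 1 f (df y)) -> (forall y, `|y - c| <= r -> `|df y| <= K * (y - c) ^+ 2) ->
  f c = 0 -> `|x - c| <= r -> `|f x| <= K * `|x - c| ^+ 3.
Proof.
move=> K0 hd hb fc xr; pose a := Num.min x c; pose b := Num.max x c.
have ab : a <= b by rewrite ge_min !le_max lexx.
have rng y : y \in `[a, b]%R -> `|y - c| <= `|x - c|.
  rewrite in_itv /= /a /b; case: (lerP x c) => h /andP[h1 h2].
  by rewrite !ler0_norm ?subr_le0 //; lra.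
  by rewrite !ger0_norm ?subr_ge0 // ?(ltW h) //; lra.
have [||y yI fE] := @MVT_segment R f df a b ab.
- by move=> y yI; apply: hd; apply: le_trans xr; apply: rng; apply: subset_itv_oo_cc.
- apply: derivable_within_continuous => y yI; by case: (hd y (le_trans (rng y yI) xr)).
have yr := rng y yI; have : `|f x| = `|df y| * `|x - c|.
  rewrite -normrM; move: fE; rewrite /a /b; case: (lerP x c) => _; rewrite fc ?subr0 ?sub0r => e.
  by rewrite -normrN e !normrM distrC.
  by rewrite e.
move=> ->; rewrite exprSr mulrA; apply: ler_wpM2r => //.
apply: le_trans (hb y (le_trans yr xr)) _; apply: ler_wpM2l => //.
by rewrite -[leLHS]ger0_norm ?sqr_ge0 // normrX ler_pXn2r ?nnegrE.
Qed.

Lemma ln_cubic (u : R) : `|u - 1| <= 3 / 4 -> `|ln u - (u - 1) + (u - 1) ^+ 2 / 2| <= 4 * `|u - 1| ^+ 3.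
Proof.
(* f is twice the quantity to be bounded, written as a combination of functions to which the rules
   of differentiation apply directly. *)
move=> hu; pose d : R -> R := id - cst 1; pose f : R -> R := @ln R + @ln R - (d + d) + d * d.
have fE (y : R) : f y = 2 * (ln y - (y - 1) + (y - 1) ^+ 2 / 2).
  by rewrite /f /d !fctE /=; field.
have : `|f u| <= 8 * `|u - 1| ^+ 3; last first.
  by rewrite fE normrM (ger0_norm (ler0n _ 2)); move: (`|_ + _ / 2|) (`|u - 1| ^+ 3) => p q; lra.
have f1 : f 1 = 0 by rewrite fE ln1 subrr expr0n mul0r subr0 addr0 mulr0.
have y0 (y : R) : `|y - 1| <= 3 / 4 -> 0 < y by rewrite ler_norml => /andP[h1 h2]; lra.
apply: (@cubic_bound f (fun u => (u^-1 + u^-1) - 2 + 2 * (u - 1)) 1 (3 / 4) 8 u _ _ _ f1 hu); first exact: ler0n.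
  move=> y /y0 hy; have hl := is_derive1_ln hy; have d1 : is_derive y 1 d (1 - 0) by exact: is_deriveB.
  apply: (is_derive_eq (is_deriveD (is_deriveB (is_deriveD hl hl) (is_deriveD d1 d1)) (is_deriveM d1 d1))).
  by rewrite /d !fctE /= /GRing.scale /=; ring.
move=> y yb; have hy := y0 y yb; move: yb; rewrite ler_norml => /andP[h1 h2].
have -> : y^-1 + y^-1 - 2 + 2 * (y - 1) = (y - 1) ^+ 2 * (2 / y) by field; rewrite gt_eqF.
rewrite normrM [X in _ * X]ger0_norm ?divr_ge0 ?(ltW hy) // ger0_norm ?sqr_ge0 // mulrC.
by apply: ler_wpM2r; [exact: sqr_ge0 | rewrite ler_pdivrMr //; lra].
Qed.

Lemma atan_cubic (z : R) : `|atan z - z| <= `|z| ^+ 3.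
Proof.
rewrite -[X in X <= _]/`|(fun z : R => atan z - z) z| -{2}[z]subr0 -[X in _ <= X]mul1r.
apply: (@cubic_bound (fun z : R => atan z - z) (fun z : R => (1 + z ^+ 2)^-1 - 1) 0 `|z - 0|) => // [y _|].
  have h0 : 0 < 1 + y ^+ 2 by have := sqr_ge0 y; lra.
  rewrite subr0 mul1r (_ : _ - 1 = - (y ^+ 2 / (1 + y ^+ 2))); last by field; rewrite gt_eqF.
  rewrite normrN ger0_norm ?divr_ge0 ?sqr_ge0 ?(ltW h0) // ler_pdivrMr // ler_peMr ?sqr_ge0 //.
  by rewrite lerDl sqr_ge0.
by rewrite atan0 subrr.
Qed.

(** With w = a + i b the logarithm is - ln|1 - w| + i atan(b / (1 - a)); for t <= 1/4 the point 1 -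
    w stays in the right half-plane, where this is the principal branch. *)
Lemma log_factor (w : C) (t : R) : 0 <= t -> t <= 1 / 4 -> re w ^+ 2 + im w ^+ 2 = t ^+ 2 ->
  exists z, cexp z = (1 - w)^-1 /\ cn (z - w - w ^+ 2 / 2) <= 30 * t ^+ 3.
Proof.
case: w => a b /= t0 t4 ht; have a2 := sqr_ge0 a; have b2 := sqr_ge0 b.
have at_ : `|a| <= t by rewrite -(ler_pXn2r (n := 2)) ?nnegrE // -normrX ger0_norm //; lra.
have bt : `|b| <= t by rewrite -(ler_pXn2r (n := 2)) ?nnegrE // -normrX ger0_norm //; lra.
have [a1 a1'] : - t <= a /\ a <= t by move: at_; rewrite ler_norml => /andP.
pose u := 1 - 2 * a + t ^+ 2; pose z := b / (1 - a).
have t2 : t ^+ 2 <= t / 4 by rewrite expr2 -[leRHS]mulrC; nra.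
have uE : u = (1 - a) ^+ 2 + b ^+ 2 by rewrite /u -ht; ring.
have d0 : 0 < 1 - a by lra.
have u0 : 0 < u by rewrite uE; have : 0 < (1 - a) ^+ 2 by [rewrite exprn_gt0 //]; lra.
have t2' := sqr_ge0 t.
have u1 : `|u - 1| <= 9 / 4 * t by rewrite /u ler_norml; apply/andP; split; lra.
have t3 : 0 <= t ^+ 3 by rewrite exprn_ge0.
(* The 30 of the statement is 46/2 + 2 for the real part, from L1 and L4, plus 3 + 2 for the
   imaginary part, from L2 and L3. *)
have L1 : `|ln u - (u - 1) + (u - 1) ^+ 2 / 2| <= 46 * t ^+ 3.
  have h : `|u - 1| <= 3 / 4 by apply: le_trans u1 _; lra.
  apply: le_trans (ln_cubic h) _; have : `|u - 1| ^+ 3 <= (9 / 4 * t) ^+ 3 by rewrite ler_pXn2r ?nnegrE //; lra.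
  by rewrite exprMn; lra.
have z1 : `|z| <= 4 / 3 * t.
  rewrite normrM normfV (gtr0_norm d0) ler_pdivrMr //; apply: le_trans bt _.
  have : 0 <= t * (1 - a - 3 / 4) by apply: mulr_ge0 => //; lra.
  by lra.
have L2 : `|atan z - z| <= 3 * t ^+ 3.
  apply: le_trans (atan_cubic z) _; have : `|z| ^+ 3 <= (4 / 3 * t) ^+ 3 by rewrite ler_pXn2r ?nnegrE //; lra.
  by rewrite exprMn; lra.
have L3 : `|z - b - a * b| <= 2 * t ^+ 3.
  have -> : z - b - a * b = (b * a ^+ 2) / (1 - a) by rewrite /z; field; rewrite gt_eqF.
  rewrite !normrM normfV (gtr0_norm d0) ler_pdivrMr //.
  apply: (@le_trans _ _ (t ^+ 3)).
  by rewrite !exprS expr0 mulr1; apply: ler_pM => //; apply: ler_pM.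
  have : 0 <= t ^+ 3 * (1 - a - 1 / 2) by apply: mulr_ge0 => //; lra.
  by lra.
have L4 : `|a * t ^+ 2 - t ^+ 4 / 4| <= 2 * t ^+ 3.
  rewrite exprS [t ^+ 4]exprS (_ : a * t ^+ 2 = a * t ^+ 2) //.
  have -> : a * (t * t ^+ 1) - t * t ^+ 3 / 4 = a * t ^+ 2 - t / 4 * t ^+ 3 by ring.
  have q0 : 0 <= t / 4 by rewrite divr_ge0.
  have n1 : `|a * t ^+ 2| <= t ^+ 3 by rewrite normrM (ger0_norm t2') [leRHS]exprS; apply: ler_wpM2r.
  have n2 : `|t / 4 * t ^+ 3| <= t ^+ 3 by rewrite ger0_norm ?mulr_ge0 // ler_piMl //; lra.
  by apply: le_trans (ler_normB _ _) _; move: n1 n2; clear; lra.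
exists ((- (ln u / 2)) +i* atan z); split.
  pose r := Num.sqrt u; have r0 : 0 < r by rewrite sqrtr_gt0.
  have ru : r ^+ 2 = u by rewrite sqr_sqrtr // ltW.
  have sz : Num.sqrt (1 + z ^+ 2) = r / (1 - a).
  have -> : 1 + z ^+ 2 = (r / (1 - a)) ^+ 2 by rewrite [RHS]expr_div_n ru uE /z; field; rewrite gt_eqF.
  by rewrite sqrtr_sqr ger0_norm // divr_ge0 // ltW.
  have ex : expR (- (ln u / 2)) = r^-1.
  rewrite expRN; congr (_^-1); apply/eqP; rewrite -(eqrXn2 (n := 2)) ?expR_ge0 ?(ltW r0) //.
  by rewrite ru expr2 -expRD -splitr lnK ?posrE.
  have cz : cos (atan z) = (1 - a) / r by rewrite cos_atan sz invf_div.
  have sn : sin (atan z) = b / r.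
  have cn0 : cos (atan z) != 0 by rewrite cz mulf_neq0 ?invr_eq0 ?gt_eqF.
  have := atanK z; rewrite /tan => /(canRL (divfK cn0)) ->.
  by rewrite cz /z; field; rewrite !gt_eqF.
  rewrite /cexp /= ex cz sn; apply: (@mulIf _ (1 - (a +i* b))).
  apply/eqP => /(congr1 re) /=; lra.
  rewrite mulVf; last by apply/eqP => /(congr1 re) /=; lra.
  apply: cplxE; rewrite ?reM ?imM /=; last by field; rewrite gt_eqF.
  have : (1 - a) ^+ 2 + b ^+ 2 = r ^+ 2 by rewrite ru uE.
  move=> h; apply: (@mulIf _ (r ^+ 2)); first by rewrite expf_neq0 // gt_eqF.
  by rewrite -{2}h; field; rewrite gt_eqF.
rewrite /cn expr2 reD imD reD imD !reN !imN.
have two : (2^-1 : C) = (2^-1 : R)%:C by rewrite rmorphV ?unitfE ?pnatr_eq0 // rmorph_nat.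
rewrite two !reM !imM /= !mulr0 subr0 add0r.
have e1 : - (ln u / 2) - a - (a * a - b * b) / 2 = - ((ln u - (u - 1) + (u - 1) ^+ 2 / 2) / 2) - (a * t ^+ 2 - t ^+ 4 / 4).
  have -> : t ^+ 4 = t ^+ 2 * t ^+ 2 by ring.
  by rewrite /u -ht; field.
have e2 : atan z - b - (a * b + b * a) / 2 = (atan z - z) + (z - b - a * b) by field.
rewrite e1 e2; move: L1 L2 L3 L4; clear.
rewrite !ler_norml => /andP[p1 p2] /andP[q1 q2] /andP[r1 r2] /andP[s1 s2].
set X := _ + _ / 2 in p1 p2 *; set Y := _ - z in q1 q2 *; set Z := _ - a * b in r1 r2 *.
have hX : `|- (X / 2) - (a * t ^+ 2 - t ^+ 4 / 4)| <= 25 * t ^+ 3 by rewrite ler_norml; apply/andP; split; lra.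
have hY : `|Y + Z| <= 5 * t ^+ 3 by rewrite ler_norml; apply/andP; split; lra.
by move: hX hY; lra.
Qed.

Lemma norm_cn (z : C) : `|z| <= (cn z)%:C.
Proof.
case: z => a b; rewrite normc_def lecE /= eqxx /cn /=.
rewrite -(ler_pXn2r (n := 2)) ?nnegrE ?sqrtr_ge0 ?addr_ge0 // sqr_sqrtr ?addr_ge0 ?sqr_ge0 //.
by rewrite sqrrD !real_normK ?num_real // -addrA lerD2l lerDr mulrn_wge0 // mulr_ge0.
Qed.

Lemma tendsP (f : R -> C) (l : C) : ((f x : (R[i])^o) @[x --> +oo] --> (l : (R[i])^o)) <->
  forall e : R, 0 < e -> exists A, forall x, A <= x -> cn (f x - l) <= e.
Proof.
split=> [/cvgrPdist_le h e e0|h].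
  have e2 : (0 : C) < (e / 2)%:C by rewrite ltcR divr_gt0.
  have [A [_ hA]] := h _ e2; exists (A + 1) => x Ax.
  have := hA x; rewrite (lt_le_trans _ Ax) ?ltrDl // distrC => /(_ isT)/cn_norm; lra.
apply/cvgrPdist_le => e; case: e => a b; rewrite ltcE /= => /andP[/eqP -> a0].
have [A hA] := h a a0; exists A; split; first exact: num_real.
move=> x Ax; rewrite distrC; apply: le_trans (norm_cn _) _.
by rewrite -[_ +i* _]/(a%:C) lecR; apply: hA; exact: ltW.
Qed.

Lemma cnvP (S : nat -> C) l : cnv S l <-> forall e : R, 0 < e -> exists N0, forall n, (N0 <= n)%N -> cn (S n - l) <= e.
Proof.
rewrite (cnv0 (fun n => S n - l)); split=> [h|h].
  by rewrite -(subrr l); apply: cnvB h (cnv_cst l).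
by rewrite -[l]add0r; apply: cnv_eq (cnvD h (cnv_cst l)) => n; rewrite subrK.
Qed.

Definition LL n : R := ln (ln n%:R).
(** Sums over primes only see the integer part of x; this is the resulting change of loglog, which
    tends to 0 by [dl_small]. *)
Definition dl (x : R) := ln (ln x) - LL (fl x).
Lemma fl_bounds x : 0 <= x -> (fl x)%:R <= x < (fl x)%:R + 1.
Proof. by move=> x0; have := truncn_itv x0; rewrite -addn1 natrD. Qed.
Lemma le_bound (A : R) n : (Num.bound `|A| <= n)%N -> A <= n%:R.
Proof.
move=> h; apply: le_trans (ler_norm A) _; apply: (le_trans (ltW (archi_boundP (normr_ge0 A)))).
by rewrite ler_nat.
Qed.

Lemma fl_big (N : nat) : forall x : R, N%:R <= x -> (N <= fl x)%N.
Proof. by move=> x h; rewrite truncn_ge_nat // (le_trans _ h). Qed.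

Lemma LL_near (e : R) : 0 < e -> exists N, forall n, (N <= n)%N -> forall x : R,
  n%:R <= x -> x <= n%:R + 1 -> `|ln (ln x) - LL n| <= e.
Proof.
move=> e0; exists (3 + Num.bound (1 / e) + Num.bound (expR 1 : R))%N => n NF x n1 n2.
have n3 : (3 <= n)%N by apply: leq_trans NF; rewrite -addnA leq_addr.
have en : e^-1 <= n%:R.
  apply: (@le_trans _ _ (Num.bound (1 / e))%:R); last by rewrite ler_nat (leq_trans _ NF) // addnAC leq_addl.
  by rewrite div1r; apply/ltW/archi_boundP; rewrite invr_ge0 ltW.
have n3' : 3 <= n%:R :> R by rewrite ler_nat.
have n0 : 0 < n%:R :> R by lra.
have e1 : expR 1 <= n%:R :> R.
  apply: (le_trans (ltW (archi_boundP (expR_ge0 1)))); rewrite ler_nat; apply: leq_trans NF; exact: leq_addl.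
have lnn : 1 <= ln n%:R :> R by rewrite -[leLHS]expRK ler_ln ?posrE ?expR_gt0.
have lnx : ln n%:R <= ln x by rewrite ler_ln ?posrE //; lra.
rewrite /LL ger0_norm; last by rewrite subr_ge0 ler_ln ?posrE //; lra.
have h (a b : R) : 0 < a -> a <= b -> ln b - ln a <= (b - a) / a.
  move=> a0 ab; rewrite -ln_div ?posrE // ?(lt_le_trans a0) //.
  have -> : b / a = 1 + (b - a) / a by field; rewrite gt_eqF.
  by apply: le_ln1Dx; apply: (@lt_le_trans _ _ 0); rewrite ?ltrN10 // divr_ge0 ?subr_ge0 // ltW.
apply: (le_trans (h _ _ _ lnx)); first by lra.
apply: (@le_trans _ _ (ln x - ln n%:R)).
  by rewrite ler_pdivrMr; [rewrite ler_peMr // subr_ge0 | lra].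
apply: (le_trans (h _ _ n0 n1)); rewrite ler_pdivrMr //.
have : 1 <= e * n%:R by rewrite -[leLHS](mulfV (lt0r_neq0 e0)) ler_pM2l.
by lra.
Qed.

Lemma dl_small (e : R) : 0 < e -> exists A : R, forall x, A <= x -> `|dl x| <= e.
Proof.
move=> e0; have [N hN] := LL_near e0; exists N%:R => x hx.
have /andP[n1 n2] := fl_bounds (le_trans (ler0n _ N) hx).
by apply: (hN _ (fl_big hx)) => //; exact: ltW.
Qed.

Lemma LL_step : cnv (fun n => (LL n.+1 - LL n)%:C) 0.
Proof.
apply/cnv0 => e e0; have [N hN] := LL_near e0; exists N => n nN; rewrite cnR.
by apply: hN => //; rewrite -natr1 ?lerDl.
Qed.

(* Abel summation; the powers n ^ (-1/4) telescope. *)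
Definition qr (n : nat) : R := Num.sqrt (Num.sqrt n%:R).

Lemma abel_sqrt (S U : nat -> C) (K : R) :
  (forall n, U n.+1 - U n = (S n.+1 - S n) * ((Num.sqrt n.+1%:R)^-1)%:C) ->
  (forall n, (0 < n)%N -> cn (S n) <= K * qr n) -> conv U.
Proof.
move=> hU hS; pose a n : R := (qr n)^-1; pose T n := S n * ((Num.sqrt n%:R)^-1)%:C.
have q0 n : (0 < n)%N -> 0 < qr n by move=> n0; rewrite !sqrtr_gt0 ltr0n.
have a2 n : (Num.sqrt n%:R)^-1 = a n ^+ 2 :> R by rewrite exprVn sqr_sqrtr // sqrtr_ge0.
have K0 : 0 <= K.
  by have := le_trans (cn_ge0 _) (hS 1%N isT); rewrite /qr !sqrtr1 mulr1.
have ale n : (0 < n)%N -> a n.+1 <= a n.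
  by move=> n0; rewrite lef_pV2 ?posrE ?q0 //; apply: ler_wsqrtr; apply: ler_wsqrtr; rewrite ler_nat.
(* Summation by parts: the increments of U - T are S n times the difference of a n ^ 2 and a n.+1 ^
   2, in absolute value at most 2 K (a n - a n.+1). *)
have [l hl] : conv (fun n => U n - T n).
  apply: (@conv_dom _ (fun n => - (2 * K * a n)) 0 1) => [n n0|n n0]; last first.
  by rewrite oppr_le0 mulr_ge0 ?invr_ge0 ?(ltW (q0 _ n0)) // mulr_ge0.
  have -> : U n.+1 - T n.+1 - (U n - T n) = S n * (a n ^+ 2 - a n.+1 ^+ 2)%:C.
  rewrite rmorphB /= -!a2; have -> : U n.+1 - T n.+1 - (U n - T n) = (U n.+1 - U n) - T n.+1 + T n by ring.
  by rewrite hU /T; ring.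
  apply: le_trans (cnM _ _) _; rewrite cnR.
  have d0 : 0 <= a n - a n.+1 by rewrite subr_ge0 ale.
  have a0 : 0 < a n by rewrite invr_gt0 q0.
  have a1 : 0 < a n.+1 by rewrite invr_gt0 q0.
  have -> : a n ^+ 2 - a n.+1 ^+ 2 = (a n - a n.+1) * (a n + a n.+1) by ring.
  rewrite ger0_norm; last by rewrite mulr_ge0 // addr_ge0 // ltW.
  apply: (@le_trans _ _ (K * qr n * ((a n - a n.+1) * (2 * a n)))).
  apply: ler_pM; rewrite ?cn_ge0 ?hS //; first by rewrite mulr_ge0 // addr_ge0 // ltW.
  by apply: ler_wpM2l => //; have := ale n n0; lra.
  have e : qr n * a n = 1 by rewrite mulfV // gt_eqF ?q0.
  have -> : K * qr n * ((a n - a n.+1) * (2 * a n)) = 2 * K * (a n - a n.+1) * (qr n * a n) by ring.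
  by rewrite e; lra.
have hT : cnv T 0.
  apply/cnv0 => e e0; exists (Num.bound (K / e) ^ 4).+1%N => n hn.
  have n0 : (0 < n)%N by apply: leq_ltn_trans hn.
  apply: le_trans (cnM _ _) _; rewrite cnR a2 ger0_norm ?sqr_ge0 //.
  apply: (@le_trans _ _ (K * qr n * a n ^+ 2)); first by apply: ler_wpM2r; rewrite ?sqr_ge0 ?hS.
  have ee : qr n * a n = 1 by rewrite mulfV // gt_eqF ?q0.
  rewrite expr2 mulrA -[K * _ * _]mulrA ee mulr1 ler_pdivrMr ?q0 // mulrC -ler_pdivrMr //.
  apply: (le_trans (ltW (archi_boundP _))); first by rewrite divr_ge0 // ltW.
  rewrite -(ler_pXn2r (n := 4)) ?nnegrE ?sqrtr_ge0 // -[4%N]/(2 * 2)%N [leRHS]exprM.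
  by rewrite !sqr_sqrtr ?sqrtr_ge0 // -natrX ler_nat ltnW.
exists (l + 0); apply: cnv_eq (cnvD hl hT) => n; by rewrite subrK.
Qed.

Lemma qr_ge1 n : (0 < n)%N -> 1 <= qr n.
Proof. by move=> n0; do 2![rewrite -[leLHS]sqrtr1; apply: ler_wsqrtr]; rewrite ler1n. Qed.

Lemma LL_qr n : (1 < n)%N -> `|LL n| <= (`|LL 2| + 4) * qr n.
Proof.
move=> n1; have n0 : 0 < n%:R :> R by rewrite ltr0n ltnW.
have l0 : 0 < ln n%:R :> R by rewrite ln_gt0 // ltr1n.
have q1 := qr_ge1 (ltnW n1).
have q4 : qr n ^+ 4 = n%:R by rewrite -[4%N]/(2 * 2)%N exprM !sqr_sqrtr ?sqrtr_ge0 // ltW.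
have qp : 0 < qr n by lra.
have up : LL n <= 4 * qr n.
  apply: (le_trans (ltW (ln_sublinear l0))); rewrite -q4 lnXn // -[leLHS]mulr_natl; apply: ler_wpM2l => //.
  exact/ltW/ln_sublinear.
have lo : LL 2 <= LL n.
  by rewrite ler_ln ?posrE ?ln_gt0 ?ltr1n // ler_ln ?posrE ?ltr0n ?ler_nat // (ltnW n1).
have h0 : - `|LL 2| <= LL 2 by rewrite lerNl -normrN ler_norm.
have h1 : `|LL 2| <= `|LL 2| * qr n by rewrite ler_peMr.
by have h2 := normr_ge0 (LL 2); rewrite ler_norml; apply/andP; split; lra.
Qed.

(** The form along the integers of [eq_const_o1] with main term a loglog; [eq_const_o1P] passes
    between the two. *)
Definition asy (S : nat -> C) (a : C) := exists c, cnv (fun N => S N - a * (LL N)%:C) c.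
Lemma asyD S U a b : asy S a -> asy U b -> asy (fun N => S N + U N) (a + b).
Proof. by move=> [c hc] [d hd]; exists (c + d); apply: cnv_eq (cnvD hc hd) => n; ring. Qed.
Lemma asyZ z S a : asy S a -> asy (fun N => z * S N) (z * a).
Proof. by move=> [c hc]; exists (z * c); apply: cnv_eq (cnvZ z hc) => n; ring. Qed.
Lemma asyN S a : asy S a -> asy (fun N => - S N) (- a).
Proof. by move=> [c hc]; exists (-1 * c); apply: cnv_eq (cnvZ (-1) hc) => n; ring. Qed.
Lemma asy_eq S U a b : S =1 U -> a = b -> asy S a -> asy U b.
Proof. by move=> /funext -> ->. Qed.
Lemma asy_conv S : conv S -> asy S 0.
Proof. by move=> [c hc]; exists c; apply: cnv_eq hc => n; rewrite mul0r subr0. Qed.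

Lemma asy_sum (I : finType) (P : pred I) (F : I -> nat -> C) (a : I -> C) :
  (forall i, P i -> asy (F i) (a i)) -> asy (fun n => \sum_(i | P i) F i n) (\sum_(i | P i) a i).
Proof.
move=> h; have H i : exists d, P i -> cnv (fun N => F i N - a i * (LL N)%:C) d.
  by case: (boolP (P i)) => [/h[d hd]|_]; [exists d | exists 0].
have [d hd] := choice H; exists (\sum_(i | P i) d i); apply: cnv_eq (cnv_sum hd) => n.
by rewrite sumrB mulr_suml.
Qed.

Lemma asy_conj S a : asy S a -> asy (fun N => (S N)^*) a^*.
Proof.
move=> [[x y] /cnvP h]; exists (x -i* y); apply/cnvP => e /h[N hN]; exists N => n /hN; move: (LL n) => l.
suff E (z b : C) : cn (z^* - b^* * l%:C - (x -i* y)) = cn (z - b * l%:C - (x +i* y)) by rewrite E.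
by case: z b => [p q] [u v]; rewrite /cn /= -[X in _ = _ + X]normrN; apply: congr2; apply: congr1; ring.
Qed.

Lemma eq_const_o1P (F : R -> C) (S : nat -> C) a : (forall x, 0 <= x -> F x = S (fl x)) ->
  eq_const_o1 (F : R -> (R[i])^o) (fun x => a * (ln (ln x))%:C) <-> asy S a.
Proof.
move=> FE; split=> [[c /tendsP h]|[c /cnvP h]]; exists c.
  apply/cnvP => e /h[A hA]; exists (Num.bound `|A|) => n hn.
  have An : A <= n%:R by exact: le_bound.
  have := hA _ An; rewrite FE // natrK subr0 /LL; congr (cn _ <= _); ring.
apply/tendsP => e e0; have e2 : 0 < e / 2 by rewrite divr_gt0.
have [N hN] := h _ e2; have d0 : 0 < e / 2 / (cn a + 1) by rewrite divr_gt0 // ltr_wpDl ?cn_ge0.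
have [A hA] := dl_small d0; exists (`|A| + N%:R) => x hx.
have xA : A <= x by apply: le_trans hx; apply: le_trans (ler_norm A) _; rewrite lerDl.
have xN : N%:R <= x by apply: le_trans hx; rewrite lerDr.
rewrite subr0 FE ?(le_trans _ xN) //; set n := fl x.
have -> : S n - (a * (ln (ln x))%:C + c) = (S n - a * (LL n)%:C - c) - a * (dl x)%:C.
  by rewrite /dl rmorphB /=; ring.
apply: le_trans (cnD _ _) _; rewrite cnN [leRHS](splitr e); apply: lerD; first exact: hN (fl_big xN).
apply: le_trans (cnM _ _) _; rewrite cnR; have := hA x xA; rewrite ler_pdivlMr ?ltr_wpDl ?cn_ge0 // => h2.
by apply: le_trans h2; rewrite mulrC; apply: ler_wpM2l; rewrite ?lerDl.
Qed.

Lemma cexp_int z (m : int) : cexp (m%:~R * z) = cexp z ^ m :> C.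
Proof.
have N (n : nat) : cexp (n%:R * z) = cexp z ^+ n.
  elim: n => [|n IH]; first by rewrite mul0r cexp0.
  by rewrite -natr1 mulrDl mul1r cexpD IH exprSr.
case: m => n; first exact: N.
apply: (mulIf (cexp_neq0 (n.+1%:R * z))); rewrite -cexpD NegzE mulrNz mulNr addNr cexp0.
by rewrite -exprnN N mulVf // expf_neq0 // cexp_neq0.
Qed.

Lemma cexp_ln (y : R) : 0 < y -> cexp (ln y)%:C = y%:C.
Proof. by move=> y0; apply: cplxE; rewrite /= lnK ?posrE // ?cos0 ?sin0 ?mulr1 ?mulr0. Qed.

(* Continuity of cexp is only known along sequences. *)
Lemma cexp_floor (Y : nat -> C) (m : R) : conv Y ->
  exists2 l, l != 0 & ((cexp (Y (fl x) + (m * dl x)%:C) : (R[i])^o) @[x --> +oo] --> (l : (R[i])^o))%classic.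
Proof.
move=> [y /cnvP hy]; exists (cexp y); first exact: cexp_neq0.
apply/tendsP => e e0; apply: contrapT => no.
have H (n : nat) : exists x : R, n%:R <= x /\ e < cn (cexp (Y (fl x) + (m * dl x)%:C) - cexp y).
  apply: contrapT => nx; apply: no; exists n%:R => x nx'; rewrite leNgt; apply/negP => h.
  by apply: nx; exists x.
have [x hx] := choice H; suff /cnv_cexp : cnv (fun n => Y (fl (x n)) + (m * dl (x n))%:C) y.
  by move/cnvP => /(_ e e0)[N /(_ N (leqnn N))]; have [_] := hx N; move=> /lt_le_trans h /h; rewrite ltxx.
apply/cnvP => d d0; have d2 : 0 < d / 2 by rewrite divr_gt0.
have [N hN] := hy _ d2; have d3 : 0 < d / 2 / (`|m| + 1) by rewrite divr_gt0 // ltr_wpDl.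
have [A hA] := dl_small d3; exists (N + Num.bound `|A|)%N => n hn.
have [xn _] := hx n; have nN : (N <= n)%N by apply: leq_trans hn; apply: leq_addr.
have Ax : A <= x n by apply: le_trans xn; apply: le_bound; apply: leq_trans hn; apply: leq_addl.
rewrite addrAC; apply: le_trans (cnD _ _) _; rewrite [leRHS](splitr d); apply: lerD.
  by apply: hN; apply: fl_big; apply: le_trans xn; rewrite ler_nat.
rewrite cnR normrM; have := hA _ Ax; rewrite ler_pdivlMr ?ltr_wpDl // => h2.
by apply: le_trans h2; rewrite mulrC; apply: ler_wpM2l; rewrite ?lerDl.
Qed.

Lemma cnv_re (S : nat -> C) l : cnv S l -> cnv (fun n => (re (S n))%:C) (re l)%:C.
Proof. by move=> [h _]; split; [exact: h | exact: cvg_cst]. Qed.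

Lemma cnv_dom (S U : nat -> C) (c : R) : 0 <= c -> (forall n, cn (S n) <= c * cn (U n)) -> cnv U 0 -> cnv S 0.
Proof.
move=> c0 h /cnv0 hU; apply/cnv0 => e e0; have c1 : 0 < c + 1 by lra.
have [N hN] := hU _ (divr_gt0 e0 c1); exists N => n /hN; rewrite ler_pdivlMr // => h2.
by apply: le_trans (h n) _; have := cn_ge0 (U n); lra.
Qed.

Lemma conv_diff (S : nat -> C) : conv S -> cnv (fun n => S n.+1 - S n) 0.
Proof.
move=> [l hl]; have h1 : cnv (fun n => S (n + 1)%N) l by apply/cnv_shift.
by rewrite -(subrr l); apply: cnv_eq (cnvB h1 hl) => n; rewrite addn1.
Qed.

Lemma so_cnv (S : nat -> C) : (forall e : R, 0 < e -> exists N0, forall n, (N0 <= n)%N -> cn (S n) <= e * Num.sqrt n%:R) <->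
  cnv (fun n => S n * rt n) 0.
Proof.
have E n : (0 < n)%N -> cn (S n * rt n) = cn (S n) / Num.sqrt n%:R.
  move=> n0; rewrite /cn; case: (S n) => a b /=; rewrite !mulr0 subr0 add0r !normrM normfV (ger0_norm (sqrtr_ge0 _)).
  by rewrite mulrDl.
split=> [h|/cnv0 h]; [apply/cnv0|] => e e0; have [N hN] := h e e0; exists N.+1 => n nN;
  have n0 : (0 < n)%N by [exact: leq_trans nN | exact: leq_trans nN];
  have s0 : 0 < Num.sqrt n%:R :> R by [rewrite sqrtr_gt0 ltr0n | rewrite sqrtr_gt0 ltr0n].
  by rewrite E // ler_pdivrMr //; apply: hN; exact: ltnW.
by have := hN n (ltnW nN); rewrite E // ler_pdivrMr.
Qed.

Lemma re_sum (I : Type) (s : seq I) (P : pred I) (F : I -> C) : re (\sum_(i <- s | P i) F i) = \sum_(i <- s | P i) re (F i).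
Proof. exact: (big_morph re reD erefl). Qed.

End ComplexSequences.

(** * Sums over primes and Mertens's second theorem *)

Section PrimeSums.
Variables (R : realType) (K : fieldType) (hK : gbase R K).
Local Notation C := R[i].
Local Notation nm P := ((prime_norm P)%:R : R).
Local Notation LN n := (LL R n).
Implicit Types (P : set K) (phi : set K -> C).

Definition pw P : R := (Num.sqrt (nm P))^-1.
Definition PS phi N := \sum_(P <- pl hK N) phi P.
Lemma nm2 P : is_prime P -> 2 <= nm P.
Proof. by case/(prime_normP hK) => _ h; rewrite ler_nat. Qed.

Lemma pl_step (V : nmodType) (F : set K -> V) N :
  \sum_(P <- pl hK N.+1) F P = \sum_(P <- pl hK N) F P + \sum_(P <- pn hK N.+1) F P.
Proof.
rewrite -big_cat; apply: perm_big; apply: uniq_perm; first exact: pl_uniq.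
  rewrite cat_uniq pl_uniq pn_uniq andbT /=; apply/hasPn => P /pnP[_ e]; apply/negP => /plP[_].
  by rewrite e ltnn.
move=> P; rewrite mem_cat; apply/idP/orP => [/plP[hP]|[/plP[hP h]|/pnP[hP e]]].
- by rewrite leq_eqVlt => /orP[/eqP e|h]; [right; apply/pnP | left; apply/plP].
- by apply/plP; split=> //; apply: leq_trans h _.
by apply/plP; rewrite e.
Qed.

Lemma PS_step phi N : PS phi N.+1 - PS phi N = \sum_(P <- pn hK N.+1) phi P.
Proof. by rewrite /PS pl_step addrC addKr. Qed.

Lemma PS_abel phi (M : R) : (forall n, (0 < n)%N -> cn (PS phi n) <= M * qr R n) ->
  conv (PS (fun P => phi P * (pw P)%:C)).
Proof.
move=> h; apply: (abel_sqrt (S := PS phi) (K := M)) => // n; rewrite !PS_step mulr_suml big_seq [RHS]big_seq.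
by apply: eq_bigr => P /pnP[_ e]; rewrite /pw e.
Qed.

Let A N : R := \sum_(P <- pl hK N) ln (nm P) / nm P.
Let W N : R := \sum_(P <- pl hK N) (nm P)^-1.

Let AW n : (0 < n)%N -> W n.+1 - W n = (A n.+1 - A n) / ln n.+1%:R.
Proof.
move=> n0; rewrite /A /W !pl_step ![_ + _ - _]addrC !addKr mulr_suml big_seq [RHS]big_seq; apply: eq_bigr => P /pnP[_ ->].
by rewrite mulrC mulrA mulVf ?mul1r // gt_eqF // ln_gt0 // ltr1n.
Qed.

(** Discrete partial summation from [mertens_first]. The corrected sum V has increments dominated by
    those of a multiple of -1 / ln n, hence converges, and the correction E / ln tends to 0. *)
Lemma mertens_second : exists c, cnv (fun N => PS (fun P => ((nm P)^-1)%:C) N - (LN N)%:C) c.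
Proof.
have [C0 C00 hA] := mertens_first hK; pose E N : R := A N - ln N%:R.
pose V N : R := W N - LN N - E N / ln N%:R.
have l0 n : (1 < n)%N -> 0 < ln n%:R :> R by move=> n1; rewrite ln_gt0 // ltr1n.
have hE n : (0 < n)%N -> `|E n| <= C0 by move=> n0; exact: hA.
have [c hc] : conv (fun N => (V N)%:C).
  apply: (@conv_dom _ _ (fun n => - ((C0 + 1) * (ln n%:R)^-1)) 0 2) => n n2; last first.
  by rewrite oppr_le0 mulr_ge0 ?invr_ge0 ?(ltW (l0 n n2)) // addr_ge0 // ltW.
  have n0 : (0 < n)%N by apply: leq_trans n2.
  have L0 := l0 n n2; have L1 := l0 n.+1 (leqW n2); have n0' : 0 < n%:R :> R by rewrite ltr0n.
  rewrite -rmorphB cnR; set a := ln n%:R in L0 *; set b := ln n.+1%:R in L1 *.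
  have ab : a <= b by rewrite ler_ln ?posrE ?ltr0n // ler_nat.
  have d1 : b - a <= 1.
  rewrite -ln_div ?posrE ?ltr0n // -natr1 mulrDl mulfV ?gt_eqF // mul1r.
  apply: (le_trans (le_ln1Dx _)); first by apply: (@lt_le_trans _ _ 0); rewrite ?ltrN10 // invr_ge0 ltW.
  by rewrite invf_le1 // ler1n.
  have iv : b^-1 <= a^-1 by rewrite lef_pV2 ?posrE.
  have ln_dif (x y : R) : 0 < x -> 0 < y -> ln x - ln y <= (x - y) / y.
  move=> x0 y0; rewrite -ln_div ?posrE //; have -> : x / y = 1 + (x - y) / y by field; rewrite gt_eqF.
  by apply: le_ln1Dx; rewrite -subr_gt0 opprK addrC (_ : _ + _ = x / y) ?divr_gt0 //; field; rewrite gt_eqF.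
  have u1 : ln b - ln a <= (b - a) / a by apply: ln_dif.
  have u2 : (b - a) / b <= ln b - ln a.
  by have := ln_dif a b L0 L1; rewrite -(opprB b a) mulNr; lra.
  have -> : V n.+1 - V n = ((b - a) / b - (ln b - ln a)) + E n * (a^-1 - b^-1).
  have -> : V n.+1 - V n = (W n.+1 - W n) - (ln b - ln a) - E n.+1 / b + E n / a by rewrite /V /LL -/a -/b; ring.
  by rewrite AW // /E -/a -/b; field; rewrite !gt_eqF.
  have e0 : 0 <= a^-1 - b^-1 by rewrite subr_ge0.
  have h1 : `|E n * (a^-1 - b^-1)| <= C0 * (a^-1 - b^-1).
  by rewrite normrM (ger0_norm e0); apply: ler_wpM2r => //; exact: hE.
  have h2 : `|(b - a) / b - (ln b - ln a)| <= a^-1 - b^-1.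
  have h3 : (b - a) * (a^-1 - b^-1) <= a^-1 - b^-1 by apply: ler_piMl.
  rewrite mulrBr in h3; rewrite ler_norml; apply/andP; split; lra.
  by apply: le_trans (ler_normD _ _) _; lra.
have h0 : cnv (fun N => (E N / ln N%:R)%:C) 0.
  apply/cnv0 => e e0; exists (Num.bound (expR (C0 / e))).+2 => n hn.
  have n2 : (1 < n)%N by apply: leq_trans hn.
  rewrite cnR normrM normfV (gtr0_norm (l0 n n2)) ler_pdivrMr ?l0 // mulrC -ler_pdivrMr //.
  apply: le_trans (_ : C0 / e <= _); first by apply: ler_wpM2r; rewrite ?invr_ge0 ?(ltW e0) ?hE // ltnW.
  rewrite -[leLHS]expRK ler_ln ?posrE ?expR_gt0 ?ltr0n ?(ltnW n2) //.
  by apply: (le_trans (ltW (archi_boundP (expR_ge0 _)))); rewrite ler_nat; apply: leq_trans hn; rewrite leqW.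
exists (c + 0); apply: cnv_eq (cnvD hc h0) => n.
rewrite -rmorphD /V subrK rmorphB /=; congr (_ - _).
by rewrite /PS /W rmorph_sum.
Qed.

Lemma cnv_bounded (S : nat -> C) l : cnv S l -> exists M, forall n, cn (S n) <= M.
Proof.
move=> /cnvP/(_ 1 ltr01)[N hN]; exists (cn l + 1 + \sum_(n < N) cn (S n)) => n.
have s0 : 0 <= \sum_(n < N) cn (S n) by apply: sumr_ge0 => i _; exact: cn_ge0.
have [nN|nN] := ltnP n N.
  rewrite (bigD1 (Ordinal nN)) //=; have : 0 <= \sum_(i < N | i != Ordinal nN) cn (S i) by apply: sumr_ge0 => i _; exact: cn_ge0.
  by have := cn_ge0 l; move: (\sum_(_ < _ | _) _) => y; lra.
have -> : S n = l + (S n - l) by rewrite addrC subrK.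
by apply: le_trans (cnD _ _) _; have := hN n nN; lra.
Qed.

End PrimeSums.

Lemma tr_conj (F : fieldType) (gT : finGroupType) (G : {group gT}) n (rG : mx_representation F G n) x h :
  x \in G -> h \in G -> \tr (rG (x ^ h)%g) = \tr (rG x).
Proof.
move=> xG hG; rewrite conjgE !repr_mxM ?groupM ?groupV // mxtrace_mulC -mulmxA -repr_mxM ?groupV //.
by rewrite mulgV repr_mx1 mulmx1.
Qed.

Lemma sum_minus_one (F : comNzRingType) (I : finType) (o : I) (c d : I -> F) p : c o = 1 -> d o = 1 ->
  (1 - \sum_i c i * d i) * p = - \sum_(i | i != o) c i * (d i * p).
Proof.
move=> c1 d1; rewrite (bigD1 o) //= c1 d1 mul1r opprD addrA subrr add0r mulNr mulr_suml.
by congr (- _); apply: eq_bigr => i _; rewrite mulrA.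
Qed.

Lemma conj_sumM (R : realType) (I : finType) (P : pred I) (c m : I -> R[i]) : (forall i, (m i)^* = m i) ->
  (\sum_(i | P i) c i * m i)^* = \sum_(i | P i) (c i)^* * m i.
Proof. by move=> h; rewrite rmorph_sum; apply: eq_bigr => i _; rewrite -[in RHS](h i); exact: rmorphM. Qed.

Lemma class_sum (F : fieldType) (gT : finGroupType) (G : {group gT}) (f : gT -> F) g :
  (forall x h, x \in G -> h \in G -> f (x ^ h)%g = f x) -> g \in G ->
  \sum_(s in G) f s * (\sum_(h in G) (g == (s ^ h)%g)%:R) = #|G|%:R * f g.
Proof.
move=> fJ gG; under eq_bigr do rewrite mulr_sumr.
have -> : #|G|%:R * f g = \sum_(h in G) f g by rewrite sumr_const mulr_natl.
rewrite exchange_big; apply: eq_bigr => h hG /=; have hV : (g ^ h^-1)%g \in G by rewrite groupJ ?groupV.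
rewrite (bigD1 (g ^ h^-1)%g hV) conjgKV eqxx mulr1 fJ ?groupV //.
rewrite big1 => [|s /andP[_ ne]]; first exact: addr0.
by case: eqP => [e|_]; rewrite ?mulr0 //; case/eqP: ne; rewrite e conjgK.
Qed.

Lemma sum_deviation (F : fieldType) (I : finType) (A : {pred I}) (f : I -> F) x : #|A|%:R != 0 :> F ->
  \sum_(t in A) f t = 0 -> \sum_(t in A) #|A|%:R^-1 * (x - f t) = x.
Proof. by move=> A0 h; rewrite -mulr_sumr sumrB sumr_const h subr0 -(mulr_natl x) mulKf. Qed.

(** * Euler products and prime sums twisted by characters *)

Section Frobenius.
Variables (R : realType) (K : fieldType) (hK : gbase R K) (L : splittingFieldType K).
Hypothesis hLK : galois 1%AS {:L}%AS.
Local Notation C := R[i].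
Local Notation nm P := ((prime_norm P)%:R : R).
Local Notation LN n := (LL R n).
Local Notation G := ('Gal({:L} / 1%AS))%G.
Local Notation fr := (Frob L).
Local Notation g1 := (#|G|%:R : C).
Local Notation pw P := (pw R P).
Local Notation PS := (PS hK).
Local Notation sG := (irreps R L).
Local Notation one := (principal_comp sG).
Local Notation chi i g := (\tr (irr_repr (i : sG) g) : C).
Local Notation re := (@complex.Re R).
Local Notation fl x := (Num.truncn (x : R)).
Local Notation cnt := (cnt hK fr).
Local Notation csz s := (#|(s ^: G)%g|%:R : C).
Local Notation kap s := (#|(s ^: G)%g|%:R / #|G|%:R : R).
Local Notation rt n := (((Num.sqrt n%:R)^-1 : R)%:C).
Implicit Types (P : set K) (phi : set K -> C) (i j : sG) (g s t : gal_of {:L}).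

Lemma galT g : g \in G.
Proof.
rewrite gal_kAut ?sub1v //; apply/andP; split; last by rewrite limg_gal.
apply/kHomP; split=> [x y _ _|x /vlineP[a ->]]; first by rewrite rmorphM.
by rewrite linearZ /= rmorph1.
Qed.

Lemma chi_bound i g : cn (chi i g) <= 2 * (irr_degree i)%:R.
Proof. by apply: cn_norm; rewrite rmorph_nat; exact: (tr_bound _ (galT g)). Qed.
Lemma pw_gt0 P : is_prime P -> 0 < pw P.
Proof. by move=> hP; rewrite invr_gt0 sqrtr_gt0; have := nm2 hK hP; lra. Qed.
Lemma pw2 P : pw P ^+ 2 = (nm P)^-1.
Proof. by rewrite exprVn sqr_sqrtr. Qed.

(** By Mertens the sums of ln N / N are O(n^(1/4)), so Abel summation makes the sum of ln N times
    N^(-3/2) converge, and ln N >= ln 2. *)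
Lemma pw3_bounded : exists M : R, forall n, \sum_(P <- pl hK n) pw P ^+ 3 <= M.
Proof.
have [C0 C00 hA] := mertens_first hK; pose phi P : C := (ln (nm P) / nm P)%:C.
have [|l hl] := @PS_abel _ _ hK phi (4 + C0).
  move=> n n0; rewrite /PS -rmorph_sum cnR.
  have q1 := qr_ge1 R n0.
  have lq : `|ln n%:R| <= 4 * qr R n.
  rewrite ger0_norm ?ln_ge0 ?ler1n //; have -> : n%:R = qr R n ^+ 4 by rewrite -[4%N]/(2 * 2)%N exprM !sqr_sqrtr ?sqrtr_ge0.
  by rewrite lnXn -?[leLHS]mulr_natl; [apply: ler_wpM2l => //; apply/ltW/ln_sublinear |]; lra.
  have -> : \sum_(P <- pl hK n) ln (nm P) / nm P = ln n%:R + (\sum_(P <- pl hK n) ln (nm P) / nm P - ln n%:R) by ring.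
  apply: le_trans (ler_normD _ _) _; rewrite mulrDl; apply: lerD => //; apply: (le_trans (hA n n0)).
  by rewrite ler_peMr // ltW.
have [M hM] := cnv_bounded hl; have l2 : 0 < ln 2 :> R by rewrite ln_gt0 // ltr1n.
exists (M / ln 2) => n; rewrite ler_pdivlMr //; apply: le_trans (hM n); rewrite /PS.
rewrite (eq_bigr (fun P => (ln (nm P) / nm P * pw P)%:C)) => [|P _]; last by rewrite rmorphM.
rewrite -rmorph_sum cnR mulr_suml; apply: le_trans (ler_norm _).
rewrite big_seq [leRHS]big_seq; apply: ler_sum => P /plP[hP _]; have p0 := pw_gt0 hP; have n2 := nm2 hK hP.
rewrite exprSr pw2 mulrAC; apply: ler_wpM2r; first exact: ltW.
by rewrite mulrC; apply: ler_wpM2r; [rewrite invr_ge0 | rewrite ler_ln ?posrE]; lra.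
Qed.

(** The sum of the norms of the exceptional primes is beyond each of these norms; past it every term
    obeys the bound. *)
Lemma conv_bl phi (bl : seq (set K)) (c : R) : 0 <= c ->
  (forall P, is_prime P -> P \notin bl -> cn (phi P) <= c * pw P ^+ 3) -> conv (PS phi).
Proof.
move=> c0 h; have [M hM] := pw3_bounded.
apply: (@conv_dom _ _ (fun n => c * \sum_(P <- pl hK n) pw P ^+ 3) (c * M) (\sum_(P <- bl) prime_norm P)) => n hn.
  rewrite PS_step -mulrBr pl_step addrC addKr mulr_sumr; apply: le_trans (cn_sum _ _) _.
  rewrite big_seq [leRHS]big_seq; apply: ler_sum => P /pnP[hP e]; apply: h => //; apply/negP => Pb.
  suff : (prime_norm P <= \sum_(P <- bl) prime_norm P)%N by rewrite e => h'; have := leq_trans h' hn; rewrite ltnn.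
  by rewrite (big_rem P) //= leq_addr.
by apply: ler_wpM2l.
Qed.

Lemma asy_le_qr (S : nat -> C) a c : cnv (fun N => S N - a * (LN N)%:C) c ->
  exists M, forall n, (0 < n)%N -> cn (S n) <= M * qr R n.
Proof.
move=> /cnv_bounded[M hM]; exists (M + cn a * (`|LN 2| + 4)) => n n0.
have q1 := qr_ge1 R n0.
have Lq : `|LN n| <= (`|LN 2| + 4) * qr R n.
  have [n1|n1] := ltnP 1 n; first exact: LL_qr.
  have -> : n = 1%N by apply/eqP; rewrite eqn_leq n1.
  by rewrite /LL ln1 ln0 // normr0 mulr_ge0 ?sqrtr_ge0 // addr_ge0.
have -> : S n = (S n - a * (LN n)%:C) + a * (LN n)%:C by rewrite subrK.
apply: le_trans (cnD _ _) _; rewrite mulrDl; apply: lerD.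
  by apply: (le_trans (hM n)); rewrite ler_peMr //; apply: le_trans (hM 0%N); exact: cn_ge0.
by apply: (le_trans (cnM _ _)); rewrite cnR -mulrA; apply: ler_wpM2l; rewrite ?cn_ge0.
Qed.

Definition T i := PS (fun P => chi i (fr P) * (pw P)%:C).
Definition Q i := PS (fun P => chi i (fr P ^+ 2)%g * (pw P ^+ 2)%:C).
Definition nuC i : C := (nu (irr_repr i))%:~R.

(** The class function chi_i(g^2) is expanded in irreducible characters. The trivial one has
    coefficient nu, by [nuE], and meets [mertens_second]; for the others the bound on T_j lets Abel
    summation prove convergence at exponent 1. *)
Lemma Q_asy i : (forall j, j != one -> exists M, forall n, (0 < n)%N -> cn (T j n) <= M * qr R n) ->
  exists c, cnv (fun N => Q i N - nuC i * (LN N)%:C) c.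
Proof.
move=> hT; pose a j := g1^-1 * \sum_(s in G) chi i (s ^+ 2)%g * chi j s^-1%g.
have QE N : Q i N = \sum_j a j * PS (fun P => chi j (fr P) * (pw P ^+ 2)%:C) N.
  rewrite /Q /PS; under [RHS]eq_bigr do rewrite mulr_sumr.
  rewrite exchange_big; apply: eq_bigr => P _ /=.
  rewrite (class_expand sG (f := fun g => chi i (g ^+ 2)%g) _ (galT (fr P))); last first.
  by move=> x h xG hG; rewrite -conjXg tr_conj ?groupX.
  by rewrite mulr_suml; apply: eq_bigr => j _; rewrite mulrA.
have a1 : a one = nuC i.
  rewrite /a /nuC nuE; congr (_ * _); apply: eq_bigr => s _.
  by rewrite (irr1_repr sG) ?galT // mxtrace1 degree_irr1 mulr1.
have cj j : j != one -> conv (PS (fun P => chi j (fr P) * (pw P ^+ 2)%:C)).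
  move=> /hT[M hM]; have [l hl] := PS_abel hM; exists l; apply: cnv_eq hl => n.
  by apply: eq_bigr => P _; rewrite -mulrA -rmorphM expr2.
have [d hd] : exists d : sG -> C, forall j, j != one -> cnv (PS (fun P => chi j (fr P) * (pw P ^+ 2)%:C)) (d j).
  have H j : exists d, j != one -> cnv (PS (fun P => chi j (fr P) * (pw P ^+ 2)%:C)) d.
  by case: (eqVneq j one) => [->|/cj[d hd]]; [exists 0 | exists d].
  by have [d hd] := choice H; exists d.
have [c hc] := mertens_second hK.
exists (nuC i * c + \sum_(j | j != one) a j * d j).
apply: cnv_eq (cnvD (cnvZ (nuC i) hc) (cnv_sum (fun j hj => cnvZ (a j) (hd j hj)))) => N.
have -> : Q i N = a one * PS (fun P => chi one (fr P) * (pw P ^+ 2)%:C) N +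
  \sum_(j | j != one) a j * PS (fun P => chi j (fr P) * (pw P ^+ 2)%:C) N by rewrite QE (bigD1 one).
rewrite a1 mulrBr addrAC; congr (_ * _ + _ - _).
apply: eq_bigr => P _; rewrite (irr1_repr sG) ?galT // mxtrace1 degree_irr1 mul1r.
by rewrite pw2.
Qed.

(** A Frobenius element normalizes the inertia group. The default value 1 of [Frob] is covered too,
    so the statement holds at every P. *)
Lemma frob_stable n (rho : mx_representation R[i] G n) P :
  (inertia_fixed rho P *m rho (fr P) <= inertia_fixed rho P)%MS.
Proof.
set Q := Defs.prime_above L P; have DP s : s \in decomposition Q -> forall x, Q x <-> Q (s x).
  by rewrite finset.in_set => /andP[_ /asboolP].
have [fD|f1] : fr P \in decomposition Q \/ fr P = 1%g.
- by rewrite /Frob; case: xgetP => [s _ [h _]|]; [left|right].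
- apply/rfix_mxP => s sI; have [fG sG'] := (galT (fr P), galT s).
  have cI : (fr P * s * (fr P)^-1)%g \in inertia Q.
  have := sI; rewrite finset.in_set => /andP[/DP h1 /asboolP h2]; rewrite finset.in_set.
  set f := fr P in fD fG *; have V x : f (f^-1%g x) = x by rewrite -galM ?memvf // mulVg gal_id.
  have VI x : (f * s * f^-1)%g x = f^-1%g (s (f x)) by rewrite !galM ?memvf.
  have h3 x : Q (f^-1%g x) <-> Q x by rewrite (DP f fD) V.
  apply/andP; split; first by rewrite finset.in_set galT; apply/asboolP => x; rewrite VI h3 -h1 -(DP f fD).
  apply/asboolP => x Qx; rewrite VI; have [m1 m2] := h2 (f x) ((DP f fD x).1 Qx).
  have e : f (f^-1%g (s (f x)) - x) = s (f x) - f x.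
  by rewrite -[LHS]/(ac f _) (rmorphB (ac f)); congr (_ - _); exact: V.
  split; first by apply/(DP f fD); rewrite e.
  case: m2 => [z|nz]; [left|right]; first by apply: (fmorph_inj (ac f)); rewrite [LHS]e z rmorph0.
  have e' : f ((f^-1%g (s (f x)) - x)^-1) = (s (f x) - f x)^-1.
  by rewrite -[LHS]/(ac f _) fmorphV; congr (_^-1); exact: e.
  by move=> h; apply: nz; rewrite -e'; exact: (DP f fD _).1.
  have e : rho (fr P) *m rho s = rho (fr P * s * (fr P)^-1)%g *m rho (fr P) by rewrite -!repr_mxM ?galT // mulgKV.
  by rewrite -mulmxA e mulmxA; congr (_ *m _); exact: rfix_mx_id.
by rewrite f1 repr_mx1 mulmx1.
Qed.

Lemma nat_cpow_half P : is_prime P -> nat_cpow (prime_norm P) (- Defs.half R) = (pw P)%:C.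
Proof.
move=> hP; rewrite /nat_cpow /Defs.half /= oppr0 mul0r cos0 sin0 mulr0 mulr1; apply: cplxE => //=.
rewrite powRN -[2^-1]/(2^-1%R) powR12_sqrt //.
Qed.

(** At almost all P the logarithm is the sum of those from [log_factor] over the eigenvalues; at the
    remaining primes any logarithm of the nonzero factor is taken. *)
Lemma euler_ex i : exists ell : set K -> C, (forall P, is_prime P -> cexp (ell P) = euler_factor (irr_repr i) P (Defs.half R)) /\
  exists bl : seq (set K), forall P, is_prime P -> P \notin bl ->
  cn (ell P - chi i (fr P) * (pw P)%:C - chi i (fr P ^+ 2)%g * (pw P ^+ 2)%:C / 2)
  <= (irr_degree i)%:R * 30 * pw P ^+ 3.
Proof.
(* Norms up to 16 are put aside so that N^(-1/2) <= 1/4, as [log_factor] requires. *)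
have [bl0 good] := good_almost hK hLK; pose bl := bl0 ++ pl hK 16; set n := irr_degree i.
have H P : exists z : C, is_prime P -> cexp z = euler_factor (irr_repr i) P (Defs.half R) /\ (P \notin bl ->
  cn (z - chi i (fr P) * (pw P)%:C - chi i (fr P ^+ 2)%g * (pw P ^+ 2)%:C / 2) <= n%:R * 30 * pw P ^+ 3).
  have [hP|nP] := pselect (is_prime P); last by exists 0.
  have p0 := pw_gt0 hP; have n2 := nm2 hK hP.
  have p1 : pw P < 1 by rewrite invf_lt1 ?sqrtr_gt0 //; [rewrite -[ltLHS]sqrtr1 ltr_sqrt|]; lra.
  have t0 : (0 : C) < (pw P)%:C by rewrite ltcR.
  have t1 : (pw P)%:C < 1 :> C by rewrite ltcR.
  have [Pb|] := boolP (P \in bl).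
  have [|z hz] := @cexp_surj R (euler_factor (irr_repr i) P (Defs.half R)); last by exists z.
  by rewrite /euler_factor nat_cpow_half // invr_eq0; exact: (det_restr_neq0 (galT (fr P)) (frob_stable (irr_repr i) P) t0 t1).
  rewrite mem_cat negb_or => /andP[/(good P hP)[I1 _ _] nb].
  have p4 : pw P <= 1 / 4.
  have : (16 < prime_norm P)%N by rewrite ltnNge; apply/negP => h; case/negP: nb; apply/plP.
  rewrite -(ltr_nat R) => h; rewrite -[pw P]/((Num.sqrt (nm P))^-1) div1r lef_pV2 ?posrE ?sqrtr_gt0 //; [|lra].
  have -> : 4 = Num.sqrt (4 ^+ 2) :> R by rewrite sqrtr_sqr ger0_norm.
  by apply: ler_wsqrtr; apply: le_trans (ltW h); rewrite -natrX.
  have fE : euler_factor (irr_repr i) P (Defs.half R) = (\det (1%:M - (pw P)%:C *: irr_repr i (fr P)))^-1.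
  rewrite /euler_factor nat_cpow_half // /frob_mx det_restr_full ?galT //.
  rewrite /inertia_fixed I1; apply/eqmxP; rewrite submx1; apply/rfix_mxP => x; rewrite finset.in_set1 => /eqP ->.
  by rewrite repr_mx1 mulmx1.
  have [l [l1 lt ld]] := spectral (irr_repr i) (galT (fr P)).
  have Hz k : exists z, cexp z = (1 - (pw P)%:C * l k)^-1 /\
  cn (z - (pw P)%:C * l k - ((pw P)%:C * l k) ^+ 2 / 2) <= 30 * pw P ^+ 3.
  apply: log_factor; rewrite ?(ltW p0) //.
  have := root_unity_norm (l1 k); rewrite normc_def => /(congr1 (@complex.Re R)) /= e.
  have e2 : complex.Re (l k) ^+ 2 + complex.Im (l k) ^+ 2 = 1.
  by have := congr1 (fun x => x ^+ 2) e; rewrite sqr_sqrtr ?expr1n // addr_ge0 ?sqr_ge0.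
  by rewrite reM imM /= !mul0r subr0 addr0 !exprMn -mulrDr e2 mulr1.
  have [z hz] := choice Hz; exists (\sum_k z k) => _; split=> [|_].
  by rewrite fE ld cexp_sum -prodfV; apply: eq_bigr => k _; case: (hz k).
  rewrite -{1}[fr P]expg1 !lt !mulr_suml -!sumrB.
  apply: le_trans (cn_sum _ _) _.
  have -> : n%:R * 30 * pw P ^+ 3 = \sum_(k < n) 30 * pw P ^+ 3 by rewrite sumr_const card_ord -mulrA mulr_natl.
  apply: ler_sum => k _; have [_] := hz k; rewrite expr1 mulrC exprMn -rmorphXn.
  by rewrite [l k ^+ 2 * _]mulrC.
have [ell hell] := choice H; exists ell; split=> [P hP|]; first by case: (hell P hP).
by exists bl => P hP nb; case: (hell P hP) => _; apply.
Qed.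

(** Minus the coefficient of loglog that DRH(A) predicts for T_i. *)
Definition mu i : C := (central_order (irr_repr i))%:~R + nuC i / 2.

(** * Passage between irreducible characters and conjugacy classes *)

Lemma hcount s g : \sum_(h in G) (g == (s ^ h)%g)%:R = (if g \in (s ^: G)%g then g1 / csz s else 0) :> C.
Proof.
case: ifP => [gc|/negbT ngc]; last first.
  by rewrite big1 // => h hG; case: eqP => // e; case/negP: ngc; rewrite e; apply: imset_f.
have f_eq x : x \in (s ^: G)%g -> \sum_(h in G) (x == (s ^ h)%g)%:R = \sum_(h in G) (g == (s ^ h)%g)%:R :> C.
  move=> /imsetP[a aG ->]; case/imsetP: gc => b bG ->.
  rewrite (reindex_inj (mulIg (b^-1 * a)%g)); apply: eq_big => h; first by rewrite groupMr ?groupM ?groupV.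
  move=> _; rewrite -(inj_eq (conjg_inj (a^-1 * b)%g)) -!conjgM mulKVg.
  by rewrite -!mulgA mulKVg mulVg mulg1.
have c0 : csz s != 0 by rewrite pnatr_eq0 -lt0n; apply/card_gt0P; exists s; apply: class_refl.
apply: (mulIf c0); rewrite mulfVK // mulr_natr -sumr_const.
rewrite (eq_bigr (fun x => \sum_(h in G) (x == (s ^ h)%g)%:R)) => [|x xc]; last by rewrite f_eq.
rewrite exchange_big /=; have -> : g1 = \sum_(h in G) 1 by rewrite sumr_const.
apply: eq_bigr => h hG.
rewrite (bigD1 (s ^ h)%g) ?imset_f //= eqxx big1 ?addr0 // => x /andP[_ /negPf ->].
by [].
Qed.

Lemma chi_class i g : \sum_(s in G) chi i s * (\sum_(h in G) (g == (s ^ h)%g)%:R) = g1 * chi i g.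
Proof. by apply: class_sum => [x h|]; [exact: tr_conj | exact: galT]. Qed.
Lemma chi_conj i g : chi i g^-1%g = (chi i g)^*.
Proof. exact: (tr_inv _ (galT g)). Qed.
Lemma chi1 g : chi one g = 1.
Proof. by rewrite (irr1_repr sG) ?galT // mxtrace1 degree_irr1. Qed.
(** The difference in (ii) with the class condition read off the chosen [Frob] at all primes. The
    primes dividing the discriminant are finitely many and only change the constant, as [Sf_D]
    shows. *)
Definition D s := PS (fun P => (1 - (if fr P \in (s ^: G)%g then g1 / csz s else 0)) * (pw P)%:C).

Lemma D_T s N : D s N = - \sum_(i | i != one) chi i s^-1%g * T i N.
Proof.
rewrite /D /T /PS; under [in RHS]eq_bigr do rewrite mulr_sumr.
rewrite exchange_big -sumrN; apply: eq_bigr => P _; rewrite -hcount -(col_orth sG); try exact: galT.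
exact: sum_minus_one (chi1 _) (chi1 _).
Qed.

Lemma T_D i N : i != one -> T i N = - (g1^-1 * \sum_(s in G) chi i s * D s N).
Proof.
move=> i1; rewrite /D /PS; under [in RHS]eq_bigr do rewrite mulr_sumr.
rewrite exchange_big /= mulr_sumr -sumrN; apply: eq_bigr => P _.
transitivity (- (g1^-1 * ((\sum_(s in G) chi i s - g1 * chi i (fr P)) * (pw P)%:C))).
  by rewrite sum_irr0 // sub0r mulNr mulrN opprK !mulrA mulVf ?mul1r // card_neq0.
rewrite -chi_class -sumrB mulr_suml; congr (- (_ * _)); apply: eq_bigr => s _.
by rewrite hcount mulrA mulrBr mulr1.
Qed.

Lemma D_real s N : (D s N)^* = D s N.
Proof.
have -> : D s N = (\sum_(P <- pl hK N) (1 - (if fr P \in (s ^: G)%g then #|G|%:R / #|(s ^: G)%g|%:R else 0)) * pw P)%:C.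
  rewrite rmorph_sum; apply: eq_bigr => P _; rewrite rmorphM rmorphB rmorph1; congr ((1 - _) * _).
  by case: ifP => _; rewrite ?rmorph0 // fmorph_div !rmorph_nat.
by apply: cplxE; rewrite //= oppr0.
Qed.

Lemma mu_conj i : (mu i)^* = mu i.
Proof. by rewrite rmorphD /= rmorph_int fmorph_div /= rmorph_int rmorph_nat. Qed.

Lemma M_sumE s : M_sum R s + m_sum R s = \sum_(i | i != one) chi i s * mu i.
Proof.
rewrite /M_sum /m_sum mulr_sumr -big_split; apply: eq_bigr => i _ /=; rewrite /mu /irr_char /nuC; ring.
Qed.

(** Character orthogonality inverts the relation between T and D. [D_T] involves chi(s^-1) whereas M
    and m involve chi(s); since D and mu are real, complex conjugation exchanges the two. *)
Lemma T_asy_D : (forall i, i != one -> asy (T i) (- mu i)) <->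
  forall s, s \in G -> asy (D s) (M_sum R s + m_sum R s).
Proof.
have MC s : (M_sum R s + m_sum R s)^* = \sum_(i | i != one) chi i s^-1%g * mu i.
  by rewrite M_sumE (conj_sumM _ _ mu_conj); apply: eq_bigr => i _; rewrite chi_conj.
split=> [h s sG'|h i i1].
  have : asy (D s) (\sum_(i | i != one) chi i s^-1%g * mu i).
  apply: asy_eq (asyN (asy_sum (fun i hi => asyZ (chi i s^-1%g) (h i hi)))) => [N|]; first by rewrite D_T.
  by rewrite -sumrN; apply: eq_bigr => i _; rewrite mulrN opprK.
  rewrite -MC => /asy_conj; apply: asy_eq => [N|]; first exact: D_real.
  exact: conjCK.
have h' s : s \in G -> asy (D s) (\sum_(i | i != one) chi i s^-1%g * mu i).
  by move=> /h/asy_conj; apply: asy_eq => [N|]; [exact: D_real | exact: MC].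
apply: asy_eq (asyN (asyZ g1^-1 (asy_sum (fun s hs => asyZ (chi i s) (h' s hs))))) => [N|].
  by rewrite T_D.
congr (- _); transitivity (g1^-1 * \sum_(j | j != one) mu j * \sum_(s in G) chi i s * chi j s^-1%g).
  congr (_ * _); under eq_bigr do rewrite mulr_sumr; rewrite exchange_big; apply: eq_bigr => j _ /=.
  by rewrite mulr_sumr; apply: eq_bigr => s _; ring.
rewrite (bigD1 i) //= row_orth eqxx big1 ?addr0 => [|j /andP[_ ji]].
  by rewrite mulrC -mulrA mulfV ?mulr1 ?card_neq0.
by rewrite row_orth eq_sym (negPf ji) mulr0.
Qed.

(** * The prime sums of (ii) and (iii) in terms of D *)

Lemma primes_leE (x : R) : 0 <= x -> primes_le K x = [set` pl hK (fl x)].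
Proof.
move=> x0; apply/seteqP; split=> P /=; rewrite /primes_le /=.
  by move=> [hP h]; apply/plP; rewrite truncn_ge_nat.
by move=> /plP[hP h]; split=> //; rewrite -truncn_ge_nat.
Qed.

Lemma prime_sumE (x : R) : 0 <= x -> prime_sum K 2^-1 x = \sum_(P <- pl hK (fl x)) pw P.
Proof.
move=> x0; rewrite /prime_sum primes_leE // -fsbig_seq ?pl_uniq //.
by apply: eq_bigr => P _; rewrite powR12_sqrt.
Qed.

Local Notation av s := (M_sum R s + m_sum R s).
Definition unram_frob s P := `[< ~ divides_discriminant L P /\ fr P \in (s ^: G)%g >].

Lemma prime_sum_frobE s (x : R) : 0 <= x ->
  prime_sum_frob 2^-1 x s = \sum_(P <- pl hK (fl x) | unram_frob s P) pw P.
Proof.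
move=> x0; rewrite /prime_sum_frob primes_leE //.
have -> : [set` pl hK (fl x)] `&` frob_primes s = [set` [seq P <- pl hK (fl x) | unram_frob s P]].
  apply/seteqP; split=> P /=; rewrite mem_filter.
  by move=> [h [_ h1 h2]]; rewrite h andbT; apply/asboolP.
  by move=> /andP[/asboolP[h1 h2] h]; split=> //; case/plP: (h).
rewrite -fsbig_seq ?filter_uniq ?pl_uniq // big_filter.
by apply: eq_bigr => P _; rewrite powR12_sqrt.
Qed.

Lemma unram_D s : conv (fun N => \sum_(P <- pl hK N | unram_frob s P) (g1 / csz s * (pw P)%:C)
  - PS (fun P => (if fr P \in (s ^: G)%g then g1 / csz s else 0) * (pw P)%:C) N).
Proof.
have [bl hbl] := good_almost hK hLK.
have [|l hl] := @conv_bl (fun P => (if unram_frob s P then g1 / csz s * (pw P)%:C else 0)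
  - (if fr P \in (s ^: G)%g then g1 / csz s else 0) * (pw P)%:C) bl 0 (lexx _).
  move=> P hP nb; have [_ nd _] := hbl P hP nb; rewrite mul0r.
  have -> : unram_frob s P = (fr P \in (s ^: G)%g).
  by apply/asboolP/idP => [[]|].
  by case: ifP => _; rewrite ?mul0r subrr /cn /= normr0 addr0.
exists l; apply: cnv_eq hl => N; rewrite /PS sumrB; congr (_ - _).
by rewrite [RHS]big_mkcond.
Qed.

Definition Sf s N : C := \sum_(P <- pl hK N) (pw P)%:C - \sum_(P <- pl hK N | unram_frob s P) (g1 / csz s * (pw P)%:C).

Lemma Sf_D s : conv (fun N => Sf s N - D s N).
Proof.
have [l hl] := unram_D s; exists (-1 * l); apply: cnv_eq (cnvZ (-1) hl) => N.
rewrite /Sf /D /PS mulN1r opprB; under [X in _ = _ - _ - X]eq_bigr do rewrite mulrBl mul1r.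
by rewrite sumrB; ring.
Qed.

Lemma Sf_asy s a : asy (Sf s) a <-> asy (D s) a.
Proof.
have h := asy_conv (Sf_D s); split=> h'.
  by apply: asy_eq (asyD h' (asyN h)) => [N|]; rewrite ?oppr0 ?addr0 //; ring.
by apply: asy_eq (asyD h' h) => [N|]; rewrite ?addr0 //; ring.
Qed.

Lemma dimG : (\dim {:L})%:R = #|G|%:R :> R.
Proof. by have := galois_dim hLK; rewrite dimv1 divn1 => ->. Qed.

Lemma SfE s (x : R) : 0 <= x -> (prime_sum K 2^-1 x
  - (\dim {:L})%:R / #|(s ^: G)%g|%:R * prime_sum_frob 2^-1 x s)%:C = Sf s (fl x).
Proof.
move=> x0; rewrite prime_sumE // prime_sum_frobE // dimG rmorphB rmorph_sum; congr (_ - _).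
rewrite rmorphM rmorph_sum mulr_sumr; apply: eq_bigr => P _; congr (_ * _).
by rewrite fmorph_div !rmorph_nat.
Qed.

Lemma ii_asy s a : eq_const_o1 (fun x : R => (prime_sum K 2^-1 x
  - (\dim {:L})%:R / #|(s ^: G)%g|%:R * prime_sum_frob 2^-1 x s)%:C)
  (fun x : R => a * (ln (ln x))%:C) <-> asy (D s) a.
Proof. rewrite -Sf_asy; exact: eq_const_o1P (@SfE s). Qed.

Lemma iii_asy s t a : eq_const_o1 (fun x : R => (#|(t ^: G)%g|%:R^-1 * prime_sum_frob 2^-1 x t
  - #|(s ^: G)%g|%:R^-1 * prime_sum_frob 2^-1 x s)%:C)
  (fun x : R => a * (ln (ln x))%:C) <-> asy (fun N => g1^-1 * (D s N - D t N)) a.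
Proof.
have g0 : g1 != 0 := card_neq0 _ _.
have -> : asy (fun N => g1^-1 * (D s N - D t N)) a <-> asy (fun N => g1^-1 * (Sf s N - Sf t N)) a.
  have hE u : asy (fun N => Sf u N - D u N) 0 := asy_conv (Sf_D u).
  have h := asyZ g1^-1 (asyD (hE s) (asyN (hE t))).
  split=> h'; [apply: asy_eq (asyD h' h) => [N|] | apply: asy_eq (asyD h' (asyN h)) => [N|]]; rewrite ?oppr0 ?addr0 ?mulr0 ?oppr0 ?addr0 //; ring.
apply: eq_const_o1P => x x0; rewrite -!SfE //; apply: (mulfI g0); rewrite mulVKf //.
rewrite -rmorphB -[g1](rmorph_nat (real_complex R)) -rmorphM dimG; congr (_%:C).
ring.
Qed.

Lemma sum_D N : \sum_(t in G) D t N = 0.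
Proof.
rewrite /D /PS exchange_big big1 // => P _; rewrite -mulr_suml.
have -> : \sum_(t in G) (1 - (if fr P \in (t ^: G)%g then g1 / csz t else 0)) = 0.
  rewrite sumrB sumr_const; apply/eqP; rewrite subr_eq0 eq_sym; apply/eqP.
  rewrite (eq_bigr (fun t => 1 * \sum_(h in G) (fr P == (t ^ h)%g)%:R)) => [|t _]; last by rewrite mul1r hcount.
  by rewrite (@class_sum C _ G (fun=> 1)) ?galT ?mulr1.
by rewrite mul0r.
Qed.

Lemma sum_av : \sum_(t in G) av t = 0.
Proof.
under eq_bigr do rewrite M_sumE.
rewrite exchange_big big1 // => i i1; rewrite -mulr_suml sum_irr0 //; exact: mul0r.
Qed.

(** Both the D t and the predicted coefficients sum to 0 over G, so averaging the differences over t
    recovers each D s. *)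
Lemma differences_asy : (forall s t, s \in G -> t \in G ->
  asy (fun N => g1^-1 * (D s N - D t N)) (g1^-1 * (av s - av t))) <->
  (forall s, s \in G -> asy (D s) (av s)).
Proof.
split=> h s; last by move=> t sG' tG; exact: asyZ (asyD (h s sG') (asyN (h t tG))).
move=> sG'; have g0 : g1 != 0 := card_neq0 _ _.
apply: asy_eq (asy_sum (fun t tG => h s t sG' tG)) => [N|].
  by apply: sum_deviation g0 _; exact: sum_D.
by apply: sum_deviation g0 _; exact: sum_av.
Qed.

(** The jump of T_i at the norm n, without the factor n^(-1/2). *)
Definition J i n : C := \sum_(P <- pn hK n) chi i (fr P).

Lemma T_step i n : T i n.+1 - T i n = J i n.+1 * rt n.+1.
Proof.
rewrite PS_step mulr_suml big_seq [RHS]big_seq; apply: eq_bigr => P /pnP[_ e].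
by rewrite -[pw P]/((Num.sqrt (nm P))^-1) e.
Qed.

Lemma W_qr : exists M, forall n, (0 < n)%N -> \sum_(P <- pl hK n) pw P ^+ 2 <= M * qr R n.
Proof.
have [c hc] := mertens_second hK.
have hc' : cnv (fun N => PS (fun P => ((nm P)^-1)%:C) N - 1 * (LN N)%:C) c by apply: cnv_eq hc => n; rewrite mul1r.
have [M hM] := asy_le_qr hc'; exists M => n n0; apply: le_trans (hM n n0).
rewrite -[PS _ _]/(\sum_(P <- pl hK n) ((nm P)^-1)%:C) -rmorph_sum cnR; apply: le_trans (ler_norm _).
by apply: ler_sum => P _; rewrite pw2.
Qed.

Lemma cn_Q (s : seq (set K)) i : cn (\sum_(P <- s) chi i (fr P ^+ 2)%g * (pw P ^+ 2)%:C) <=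
  2 * (irr_degree i)%:R * \sum_(P <- s) pw P ^+ 2.
Proof.
apply: le_trans (cn_sum _ _) _; rewrite mulr_sumr; apply: ler_sum => P _.
apply: le_trans (cnM _ _) _; rewrite cnR ger0_norm ?sqr_ge0 //.
by apply: ler_wpM2r; [exact: sqr_ge0 | exact: chi_bound].
Qed.

(** The primes of exact norm n contribute o(1) to the sum of 1/N, because this sum differs from
    loglog by a convergent sequence. *)
Lemma Q_step i : cnv (fun n => Q i n.+1 - Q i n) 0.
Proof.
have [c hc] := mertens_second hK; pose W := PS (fun P => ((nm P)^-1)%:C).
have hW : cnv (fun n => W n.+1 - W n) 0.
  have h := conv_diff (ex_intro _ c hc); rewrite -[0](addr0 0).
  by apply: cnv_eq (cnvD h (LL_step R)) => n; rewrite rmorphB /W; ring.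
apply: cnv_dom hW => [|n]; first by apply: mulr_ge0 (ler0n _ 2) (ler0n _ (irr_degree i)).
rewrite !PS_step; apply: le_trans (cn_Q _ _) _; apply: ler_wpM2l; first by apply: mulr_ge0; exact: ler0n.
rewrite -rmorph_sum cnR; apply: le_trans (ler_norm _).
by apply: ler_sum => P _; rewrite pw2.
Qed.

(** * The logarithm of one Euler product *)

Section OneRepr.
Variables (i : sG) (ell : set K -> C).
Hypothesis ellE : forall P, is_prime P -> cexp (ell P) = euler_factor (irr_repr i) P (Defs.half R).
Hypothesis ell_bound : exists bl : seq (set K), forall P, is_prime P -> P \notin bl ->
  cn (ell P - chi i (fr P) * (pw P)%:C - chi i (fr P ^+ 2)%g * (pw P ^+ 2)%:C / 2) <= (irr_degree i)%:R * 30 * pw P ^+ 3.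

Local Notation m := (central_order (irr_repr i)).
(** A logarithm of the quantity in DRH(A) at the integer N; [DRH_term] makes the correction for real
    x explicit. *)
Definition Y N : C := PS ell N + m%:~R * (LN N)%:C.

Lemma rest_conv : conv (fun N => PS ell N - T i N - Q i N / 2).
Proof.
have [bl hbl] := ell_bound.
have [|l hl] := @conv_bl _ bl ((irr_degree i)%:R * 30) _ hbl; first by apply: mulr_ge0; exact: ler0n.
by exists l; apply: cnv_eq hl => N; rewrite /T /Q /PS mulr_suml !sumrB.
Qed.

Lemma Y_T_step : cnv (fun n => (Y n.+1 - Y n) - (T i n.+1 - T i n)) 0.
Proof.
have h1 := conv_diff rest_conv; have h2 := cnvZ 2^-1 (Q_step i); have h3 := cnvZ m%:~R (LL_step R).
have -> : 0 = 0 + 2^-1 * 0 + m%:~R * 0 :> C by rewrite !mulr0 !addr0.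
by apply: cnv_eq (cnvD (cnvD h1 h2) h3) => n; rewrite /Y rmorphB; ring.
Qed.

Lemma DRH_term (x : R) : 3 <= x ->
  ((ln x)%:C : (R[i])^o) ^ m * euler_product (irr_repr i) (Defs.half R) x = cexp (Y (fl x) + (m%:~R * dl x)%:C).
Proof.
move=> x3; have x0 : 0 <= x by lra.
have lx : 0 < ln x by rewrite ln_gt0; lra.
have -> : euler_product (irr_repr i) (Defs.half R) x = cexp (PS ell (fl x)).
  rewrite /euler_product primes_leE // -fsbig_seq ?pl_uniq // cexp_sum big_seq [RHS]big_seq.
  by apply: eq_bigr => P /plP[hP _]; rewrite ellE.
have -> : Y (fl x) + (m%:~R * dl x)%:C = m%:~R * (ln (ln x))%:C + PS ell (fl x).
  by rewrite /Y /dl rmorphM rmorph_int rmorphB; ring.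
by rewrite cexpD cexp_int cexp_ln.
Qed.

Lemma DRH_seq : DRH_A (irr_repr i) -> exists2 l, l != 0 & cnv (@cexp R \o Y) l.
Proof.
move=> [l l0 /tendsP h]; exists l => //; apply/cnvP => e /h[A hA].
exists (3 + Num.bound `|A|)%N => n hn.
have n3 : 3 <= n%:R :> R by rewrite ler_nat; apply: leq_trans hn; exact: leq_addr.
have An : A <= n%:R by apply: le_bound; apply: leq_trans hn; exact: leq_addl.
by have := hA _ An; rewrite DRH_term // /dl natrK subrr mulr0 addr0.
Qed.

Lemma conv_DRH : conv Y -> DRH_A (irr_repr i).
Proof.
move=> /(cexp_floor (m%:~R : R))[l l0 /tendsP h]; exists l => //; apply/tendsP => e /h[A hA].
exists (`|A| + 3) => x hx; have A0 := normr_ge0 A; have AA := ler_norm A.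
by rewrite DRH_term; [apply: hA|]; lra.
Qed.

Lemma ell_asy : conv Y <-> asy (PS ell) (- m%:~R).
Proof. by split=> -[c hc]; exists c; apply: cnv_eq hc => n; rewrite /Y; ring. Qed.

Lemma T_qr : conv Y -> exists M, forall n, (0 < n)%N -> cn (T i n) <= M * qr R n.
Proof.
move=> /ell_asy[c hc]; have [M hM] := asy_le_qr hc; have [d hd] := asy_conv rest_conv.
have [M1 hM1] := asy_le_qr hd; have [M2 hM2] := W_qr.
exists (M + M1 + (irr_degree i)%:R * M2) => n n0.
have -> : T i n = PS ell n - (PS ell n - T i n - Q i n / 2) - 2^-1 * Q i n by ring.
rewrite !mulrDl; apply: le_trans (cnD _ _) _; rewrite cnN; apply: lerD.
  by apply: le_trans (cnD _ _) _; rewrite cnN; apply: lerD; [exact: hM | exact: hM1].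
apply: le_trans (cnM _ _) _; have -> : 2^-1 = (2^-1 : R)%:C by rewrite fmorphV rmorph_nat.
rewrite cnR ger0_norm ?invr_ge0 // ler_pdivrMl // -mulrA.
apply: le_trans (cn_Q _ _) _; rewrite -mulrA; apply: ler_wpM2l => //; apply: ler_wpM2l; first exact: ler0n.
exact: hM2.
Qed.

Lemma Y_T_asy : asy (Q i) (nuC i) -> conv Y <-> asy (T i) (- mu i).
Proof.
move=> hQ; rewrite ell_asy; have hr := asy_conv rest_conv; have h2 := asyZ 2^-1 hQ; rewrite /mu; split=> h.
  apply: asy_eq (asyD h (asyN (asyD hr h2))) => [N|]; ring.
apply: asy_eq (asyD h (asyD hr h2)) => [N|]; ring.
Qed.

End OneRepr.
Lemma J_one N : J one N = (size (pn hK N))%:R.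
Proof. by rewrite /J (eq_bigr (fun=> 1)) => [|P _]; rewrite ?chi1 // big_const_seq count_predT iter_addr_0. Qed.
Lemma csz_neq0 s : csz s != 0.
Proof. by rewrite pnatr_eq0 -lt0n; apply/card_gt0P; exists s; apply: class_refl. Qed.
Lemma cntE s N : (cnt s N)%:R = \sum_(P <- pn hK N) (fr P \in (s ^: G)%g)%:R :> C.
Proof. by rewrite /cnt -sum1_size big_filter natr_sum big_mkcond; apply: eq_bigr => P _; case: ifP. Qed.

Lemma cnt_irr s N : (cnt s N)%:R = csz s / g1 * \sum_i chi i s^-1%g * J i N.
Proof.
rewrite cntE; under [X in _ = _ * X]eq_bigr do rewrite mulr_sumr.
rewrite exchange_big mulr_sumr; apply: eq_bigr => P _; rewrite (col_orth sG); try exact: galT.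
rewrite hcount; case: ifP => _; last by rewrite mulr0.
have g0 : g1 != 0 := card_neq0 _ _; have c0 := csz_neq0 s.
by rewrite mulrA mulfVK // mulfV.
Qed.

Lemma J_cnt i N : J i N = \sum_(s in G) chi i s / csz s * (cnt s N)%:R.
Proof.
under eq_bigr do rewrite cntE mulr_sumr.
rewrite exchange_big; apply: eq_bigr => P _; have g0 : g1 != 0 := card_neq0 _ _.
apply: (mulfI g0); rewrite -chi_class mulr_sumr; apply: eq_bigr => s _; rewrite hcount.
by case: ifP => _; rewrite ?mulr0 // mulr1 mulrCA.
Qed.

(** chi_i sums to 0 over G, so the expected counts may be subtracted from the actual ones. *)
Lemma J_dev i N : i != one ->
  J i N = \sum_(s in G) chi i s / csz s * ((cnt s N)%:R - kap s * (size (pn hK N))%:R)%:C.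
Proof.
move=> i1; have g0 : g1 != 0 := card_neq0 _ _.
have -> : J i N = J i N - (size (pn hK N))%:R / g1 * \sum_(s in G) chi i s.
  by rewrite sum_irr0 // mulr0 subr0.
rewrite J_cnt mulr_sumr -sumrB; apply: eq_bigr => s _; have c0 := csz_neq0 s.
rewrite rmorphB rmorphM fmorph_div !rmorph_nat.
move: (chi i s) c0 g0 => x; move: (csz s) g1 ((cnt s N)%:R) => c g k c0 g0.
by field; rewrite c0 g0.
Qed.

Lemma cnt_dev s N : (cnt s N)%:R - kap s * (size (pn hK N))%:R =
  kap s * \sum_(i | i != one) re (chi i s^-1%g * J i N).
Proof.
have kE : csz s / g1 = (kap s)%:C by rewrite fmorph_div !rmorph_nat.
have := cnt_irr s N; rewrite (bigD1 one isT) chi1 mul1r J_one kE mulrDr => E.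
have re_nat n : re n%:R = n%:R by rewrite -(rmorph_nat (real_complex R)).
rewrite -[X in X - _]re_nat E reD !reM /= !mul0r !subr0 re_nat re_sum.
by rewrite addrAC subrr add0r.
Qed.

Lemma re_conjM (x w : C) : re (x^* * w) + re (x * w) = (re x + re x) * re w.
Proof. case: x w => a b [c d] /=; ring. Qed.

(** Adding the terms of t and of its inverse pairs conjugate coefficients, so that only the real
    part of w survives. *)
Lemma chi_pair k t (w : C) :
  re (chi k t^-1%g * w) + re (chi k t^-1^-1%g * w) = (re (chi k t) + re (chi k t)) * re w.
Proof.
apply: etrans (re_conjM (chi k t) w).
by apply: (congr2 (fun a b => re (a * w) + re (b * w))); [exact: chi_conj | rewrite invgK].
Qed.

Lemma cnt_pair t n : (cnt t n)%:R - kap t * (size (pn hK n))%:R + ((cnt t^-1%g n)%:R - kap t^-1%g * (size (pn hK n))%:R)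
  = \sum_(k | k != one) (kap t * (re (chi k t) + re (chi k t))) * re (J k n).
Proof.
rewrite !cnt_dev class_inv_card -mulrDr -big_split mulr_sumr; apply: eq_bigr => k _.
rewrite -mulrA; congr (_ * _); exact: chi_pair.
Qed.

(** The real parts of the J_k give the deviations for t and its inverse together, by [cnt_pair];
    [global_jump] separates the two, and [J_dev] returns from class counts to J. *)
Lemma J_small : (forall i, i != one -> cnv (fun n => (re (J i n))%:C * rt n) 0) ->
  forall i, i != one -> cnv (fun n => J i n * rt n) 0.
Proof.
move=> hre i i1.
have hs (I : finType) (A : pred I) (F : I -> nat -> C) (v : I -> C) :
  (forall k : I, A k -> cnv (fun n => F k n * rt n) 0) -> cnv (fun n => (\sum_(k : I | A k) v k * F k n) * rt n) 0.
  move=> h; have := cnv_sum (fun k hk => cnvZ (v k) (h k hk)).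
  rewrite [X in cnv _ X]big1 => [|k _]; last by rewrite mulr0.
  apply: cnv_eq => n.
  by rewrite mulr_suml; apply: eq_bigr => k _; rewrite mulrA.
pose dev s n : R := (cnt s n)%:R - kap s * (size (pn hK n))%:R.
suff hd s : s \in G -> cnv (fun n => (dev s n)%:C * rt n) 0.
  apply: cnv_eq (hs _ _ _ (fun s => chi i s / csz s) hd) => n.
  by rewrite (J_dev _ i1).
move=> sG0; apply/so_cnv => e e0.
have [bl good] := good_almost hK hLK.
have [||N0 hN0] := @global_jump _ _ hK L fr _ _ s e sG0 e0.
- by exists bl => P hP nb; case: (good P hP nb).
- move=> t tG; have : cnv (fun n => (dev t n + dev t^-1%g n)%:C * rt n) 0.
  apply: cnv_eq (hs _ (fun k => k != one) (fun k n => (re (J k n))%:C)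
  (fun k => (kap t * (re (chi k t) + re (chi k t)))%:C) hre) => n.
  rewrite cnt_pair rmorph_sum; congr (_ * _).
  by apply: eq_bigr => k _; symmetry; exact: rmorphM.
  move=> /so_cnv h e' /h[N hN]; exists N => n /hN; rewrite cnR /dev class_inv_card.
  by apply: le_trans; rewrite le_eqVlt; apply/orP; left; apply/eqP; congr (`|_|); ring.
by exists N0 => n /hN0; rewrite cnR.
Qed.

(** All representations are treated at once: the smallness of each J_i and the asymptotics of each
    Q_i draw on every nontrivial character. *)
Lemma DRH_T : (forall i, i != one -> DRH_A (irr_repr i)) <-> (forall i, i != one -> asy (T i) (- mu i)).
Proof.
have [ell hell] := choice euler_ex.
have [hE hB] : (forall i, _) /\ (forall i, _) := conj (fun i => proj1 (hell i)) (fun i => proj2 (hell i)).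
split=> h i i1.
  have hl j : j != one -> exists2 l, l != 0 & cnv (@cexp R \o Y j (ell j)) l.
  move=> /h; apply: DRH_seq; exact: hE.
  (* [cexp_re] makes the real parts of the increments of Y tend to 0, and by [Y_T_step] those of T
     as well; this is the hypothesis of [J_small]. *)
  have hJ : forall j, j != one -> cnv (fun n => J j n * rt n) 0.
  apply: J_small => j j1; have [l l0 hY] := hl j j1.
  have [y0 /cexp_re hre] := cexp_normalize l0 hY; pose Y0 n : C := (re (Y j (ell j) n - y0))%:C.
  have hY0 : cnv Y0 0 by split; [exact: hre | exact: cvg_cst].
  have h1 := conv_diff (ex_intro _ _ hY0); have h2 := cnv_re (Y_T_step (hB j)).
  apply/(cnv_shift _ _ 1); rewrite -[0](subrr 0).
  apply: cnv_eq (cnvB h1 h2) => n; rewrite T_step addn1 /Y0.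
  apply: cplxE; last by rewrite !(imM, imD, imN) /=; ring.
  by rewrite !(reM, reD, reN) /=; ring.
  (* The increments of Y now tend to 0 in both coordinates, so [cexp_lift] applies. *)
  have hc j : j != one -> conv (Y j (ell j)).
  move=> j1; have [l l0 hY] := hl j j1; apply: cexp_lift l0 hY _.
  have h1 : cnv (fun n => J j (n + 1)%N * rt (n + 1)%N) 0 by apply/(cnv_shift (fun n => J j n * rt n)); exact: hJ.
  rewrite -[0](addr0 0); apply: cnv_eq (cnvD (Y_T_step (hB j)) h1) => n.
  by rewrite addn1 -T_step subrK.
  have hQ : asy (Q i) (nuC i) by apply: Q_asy => j /hc; apply: T_qr; exact: hB.
  by apply/(Y_T_asy (hB i) hQ); exact: hc.
apply: (conv_DRH (hE i)); apply/(Y_T_asy (hB i)); last exact: h.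
by apply: Q_asy => j /h[c /asy_le_qr].
Qed.

End Frobenius.

Theorem theorem2p2 (R : realType) (K : fieldType) (L : splittingFieldType K)
    (hK : global_field K) (hLK : galois 1%AS {:L}%AS) :
  let G := 'Gal({:L} / 1%AS)%g in
  [<->
    (forall i : irreps R L, i != principal_comp (irreps R L) ->
      DRH_A (irr_repr i));
    (forall sg, sg \in G ->
      eq_const_o1
        (fun x : R =>
          (prime_sum K 2^-1 x
           - (\dim {:L})%:R / #|(sg ^: G)%g|%:R * prime_sum_frob 2^-1 x sg)%:C)
        (fun x : R => (M_sum R sg + m_sum R sg) * (ln (ln x))%:C));
    (forall sg tau, sg \in G -> tau \in G ->
      eq_const_o1
        (fun x : R =>
          (#|(tau ^: G)%g|%:R^-1 * prime_sum_frob 2^-1 x tau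
           - #|(sg ^: G)%g|%:R^-1 * prime_sum_frob 2^-1 x sg)%:C)
        (fun x : R =>
          (\dim {:L})%:R^-1
          * (M_sum R sg - M_sum R tau + m_sum R sg - m_sum R tau)
          * (ln (ln x))%:C))].
Proof.
move=> G; have hB := global_gbase R hK.
have aE (s t : gal_of {:L}) : #|G|%:R^-1 * (M_sum R s + m_sum R s - (M_sum R t + m_sum R t)) =
    (\dim {:L})%:R^-1 * (M_sum R s - M_sum R t + m_sum R s - m_sum R t).
  have dE : #|G|%:R = (\dim {:L})%:R :> R[i] by have := galois_dim hLK; rewrite dimv1 divn1 => ->.
  have sE (u v w x : R[i]) : u + w - (v + x) = u - v + w - x by ring.
  apply: (congr2 (fun d z : R[i] => d^-1 * z)); [exact: dE | exact: sE].
(* (i) and (iii) are both compared with the asymptotics of the D s, which express (ii). *)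
have DE : (forall i : irreps R L, i != principal_comp (irreps R L) -> DRH_A (irr_repr i)) <->
    (forall s, s \in G -> asy (D hB s) (M_sum R s + m_sum R s)).
  by rewrite (DRH_T hB hLK); exact: T_asy_D.
tfae.
- by move=> /DE h s sG; apply/(ii_asy hB hLK); exact: h.
- move=> h s t sG tG; apply/(iii_asy hB hLK).
  have /asyZ : asy (fun N => D hB s N - D hB t N) (M_sum R s + m_sum R s - (M_sum R t + m_sum R t)).
    by apply: asyD (asyN _); apply/(ii_asy hB hLK); apply: h.
  move=> /(_ #|G|%:R^-1); apply: asy_eq; [by [] | exact: aE].
move=> h; apply/DE/(differences_asy hB) => s t sG tG; move: (h s t sG tG) => /(iii_asy hB hLK).
apply: asy_eq; [by [] | exact: esym (aE s t)].
Qed.
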